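(* Let $m\ge 3$, let $k$ be a non-zero real constant, and let $M$ be a Hopf hypersurface in the complex two-plane Grassmannian $G_2(\mathbb{C}^{m+2})$ with $\alpha=g(A\xi,\xi)=2k$ and with GTW-Reeb parallel Ricci tensor, i.e. $(\widehat\nabla^{(k)}_\xi S)Y=0$ for all tangent vector fields $Y$ on $M$. If $\xi$ belongs to the distribution $\mathcal{Q}$, then $M$ is locally congruent to an open part of a tube around a totally geodesic $\mathbb{H}P^n$, $m=2n$, in $G_2(\mathbb{C}^{m+2})$ with radius $r$ such that $r=\frac12\tan^{-1}\sqrt{2n-1}$.
   Context: $G_2(\mathbb{C}^{m+2})$ is the set of complex two-dimensional linear subspaces of $\mathbb{C}^{m+2}$ with its $SU(m+2)$-invariant Riemannian metric $g$, normalized so that the maximal sectional curvature is $8$ (so that $G_2(\mathbb{C}^3)$ is $\mathbb{C}P^2$ with constant holomorphic sectional curvature $8$). It carries a Kähler structure $J$ and a quaternionic Kähler structure $\mathfrak{J}$ (not containing $J$); for a local orthonormal basis $J_1,J_2,J_3$ of $\mathfrak J$ one has $JJ_\nu=J_\nu J$. Let $M$ be a real hypersurface (real codimension one) with induced metric $g$, local unit normal $N$, shape operator $A$, and Levi-Civita connection $\nabla$. The Reeb vector field is $\xi=-JN$, $\eta(X)=g(X,\xi)$, and the structure tensor $\phi$ is defined by letting $\phi X$ be the tangential part of $JX$. Put $\xi_\nu=-J_\nu N$ ($\nu=1,2,3$), $\mathcal{Q}^\perp=\mathrm{Span}\{\xi_1,\xi_2,\xi_3\}$, and let $\mathcal{Q}$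 be the orthogonal complement of $\mathcal{Q}^\perp$ in $TM$. $M$ is a Hopf hypersurface if $\xi$ is principal: $A\xi=\alpha\xi$ with $\alpha=g(A\xi,\xi)$. The Ricci tensor is the $(1,1)$-tensor $SX=\sum_{i=1}^{4m-1}R(X,e_i)e_i$ for a local orthonormal frame $\{e_i\}$ of $M$. For a non-zero real constant $k$, the generalized Tanaka-Webster (GTW) connection on $M$ is $$\widehat\nabla^{(k)}_XY=\nabla_XY+g(\phi AX,Y)\xi-\eta(Y)\phi AX-k\eta(X)\phi Y,$$ and $(\widehat\nabla^{(k)}_XS)Y=\widehat\nabla^{(k)}_X(SY)-S(\widehat\nabla^{(k)}_XY)$. *)

(* Defs.v *)
From mathcomp Require Import all_boot all_order all_algebra.
From mathcomp Require Import complex.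
From mathcomp Require Import all_classical all_reals all_analysis.

Set Implicit Arguments.
Unset Strict Implicit.
Unset Printing Implicit Defensive.

Import Order.TTheory GRing.Theory Num.Theory numFieldNormedType.Exports.

Local Open Scope classical_set_scope.
Local Open Scope complex_scope.
Local Open Scope sesquilinear_scope.
Local Open Scope ring_scope.

Notation cmat R m := ('M[R[i]]_(m.+2)).

(** * Smooth maps into complex matrices *)

Fixpoint Ck {R : realType} {V : normedModType R} (n : nat) (U : set V)
    (f : V -> R^o) : Prop :=
  match n with
  | 0 => forall u, U u -> {for u, continuous f}
  | k.+1 => (forall u, U u -> differentiable f u) /\
            (forall v : V, Ck k U (fun u => 'D_v f u))
  end.

Definition smooth {R : realType} {V : normedModType R} (U : set V)
    (f : V -> R^o) : Prop := forall n, Ck n U f.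

(* R[i] is not a normed module over R in the library, so derivatives of
   matrix-valued maps are taken on the real and imaginary parts of entries. *)
Definition smooth_mx {R : realType} {V : normedModType R} {m : nat} (U : set V)
    (F : V -> cmat R m) : Prop :=
  forall i j, smooth U (fun u => complex.Re (F u i j)) /\
              smooth U (fun u => complex.Im (F u i j)).

Definition derive_mx {R : realType} {V : normedModType R} {m : nat}
    (F : V -> cmat R m) (u v : V) : cmat R m :=
  \matrix_(i, j) ('D_v (fun w => complex.Re (F w i j) : R^o) u +i*
                  'D_v (fun w => complex.Im (F w i j) : R^o) u).

Definition velocity {R : realType} {m : nat} (c : R^o -> cmat R m) (t : R^o) :
    cmat R m := derive_mx c t (1 : R^o).

(** * The Grassmannian G_2(C^(m+2)) *)

(* A complex 2-plane is identified with the orthogonal projection onto it. *)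
Definition G2 (R : realType) (m : nat) : set (cmat R m) :=
  [set P | [/\ P ^t* = P, P *m P = P & \rank P = 2%N]].
Arguments G2 : clear implicits.

Definition G2_tangent {R : realType} {m : nat} (P : cmat R m) :
    set (cmat R m) :=
  [set X | X ^t* = X /\ P *m X + X *m P = X].

(* tr (XY) / 4 is the SU(m+2)-invariant metric of maximal sectional curvature
   8: on the projections of rank 1, tr (XY) / 2 is the Fubini-Study metric of
   holomorphic sectional curvature 4. *)
Definition gmet {R : realType} {m : nat} (X Y : cmat R m) : R :=
  complex.Re (\tr (X *m Y)) / 4.

(* The gmet-orthogonal projection of Hermitian matrices onto the tangent space
   at P.  As the metric is induced from a flat one, the Levi-Civita connection
   of the Grassmannian is the tangential part of the flat derivative. *)
Definition G2_proj {R : realType} {m : nat} (P X : cmat R m) : cmat R m :=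
  P *m X *m (1%:M - P) + (1%:M - P) *m X *m P.

(* A tangent vector at P is X = B + B^*, with B : im P -> (im P)^perp, and J
   maps B to 'i B. *)
Definition kahlerJ {R : realType} {m : nat} (P X : cmat R m) : cmat R m :=
  'i%C *: (X *m P - P *m X).

(* The fibre at P of the quaternionic Kaehler structure is su(im P), acting by
   B |-> B q; q 0, q 1, q 2 give an orthonormal basis J_1, J_2, J_3 of it. *)
Definition quat_basis {R : realType} {m : nat} (P : cmat R m)
    (q : 'I_3 -> cmat R m) : Prop :=
  (forall a, [/\ (q a) ^t* = - q a, P *m q a = q a, q a *m P = q a
               & \tr (q a) = 0]) /\
  (forall a b, q a *m q b + q b *m q a = - (((a == b)%:R *+ 2) *: P)).

Definition quatJ {R : realType} {m : nat} (q X : cmat R m) : cmat R m :=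
  X *m q - q *m X.

(* Isometries of the Riemannian manifold G_2(C^(m+2)); a map is smooth iff it
   sends smooth curves to smooth curves. *)
Definition G2_isometry {R : realType} {m : nat} (F : cmat R m -> cmat R m) :
    Prop :=
  set_bij (G2 R m) (G2 R m) F /\
  forall c : R^o -> cmat R m,
    (forall t, G2 R m (c t)) -> smooth_mx setT c ->
    smooth_mx setT (F \o c) /\
    forall t, gmet (velocity (F \o c) t) (velocity (F \o c) t) =
              gmet (velocity c t) (velocity c t).

Definition G2_geodesic {R : realType} {m : nat} (c : R^o -> cmat R m) : Prop :=
  [/\ forall t, G2 R m (c t), smooth_mx setT c &
      forall t, G2_proj (c t) (velocity (velocity c) t) = 0].

Definition unit_normal_to {R : realType} {m : nat} (S : set (cmat R m))
    (P v : cmat R m) : Prop :=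
  [/\ G2_tangent P v, gmet v v = 1 &
      forall b : R^o -> cmat R m, smooth_mx setT b -> (forall t, S (b t)) ->
        b 0 = P -> gmet v (velocity b 0) = 0].

Definition tube {R : realType} {m : nat} (r : R) (S : set (cmat R m)) :
    set (cmat R m) :=
  [set Q | exists c : R^o -> cmat R m,
     [/\ G2_geodesic c, S (c 0), unit_normal_to S (c 0) (velocity c 0)
       & Q = c r]].

(* For m = 2n, right multiplication by the quaternion j on
   C^(2n+2) = H^(n+1) is v |-> Omega (conj v), where Omega is block diagonal
   with 2 x 2 blocks (0 -1 ; 1 0). *)
Definition quat_Omega (R : realType) (m : nat) : cmat R m :=
  \matrix_(i, j)
    (if ~~ odd i && (j == i.+1 :> nat) then - 1
     else if ~~ odd j && (i == j.+1 :> nat) then 1 else 0).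
Arguments quat_Omega : clear implicits.

(* For m = 2n: the complex 2-planes that are quaternionic lines of H^(n+1),
   i.e. the standard totally geodesic HP^n. *)
Definition HPn (R : realType) (m : nat) : set (cmat R m) :=
  [set P | G2 R m P /\
     P *m quat_Omega R m = quat_Omega R m *m map_mx conjc P].
Arguments HPn : clear implicits.

(* B is open in T for the topology induced from the space of matrices. *)
Definition open_part {R : realType} {m : nat} (B T : set (cmat R m)) : Prop :=
  B `<=` T /\
  forall Q, B Q -> exists2 e : R, 0 < e &
    forall Q', T Q' -> gmet (Q' - Q) (Q' - Q) < e -> B Q'.

(** * Real hypersurfaces *)

(* A hypersurface immersed in G_2(C^(m+2)), whose real dimension is 4m; the
   map chart p is a local parametrization centred at p.  The changes of
   parametrization are smooth because immersions are local embeddings. *)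
Record hypersurface (R : realType) (m : nat) := Hypersurface {
  hs_carrier :> topologicalType;
  hs_nonempty : [set: hs_carrier] !=set0;
  hs_hausdorff : hausdorff_space hs_carrier;
  hs_second_countable : @second_countable hs_carrier;
  imm : hs_carrier -> cmat R m;
  dom : hs_carrier -> set 'rV[R]_((4 * m).-1);
  chart : hs_carrier -> 'rV[R]_((4 * m).-1) -> hs_carrier;
  imm_G2 : forall p, G2 R m (imm p);
  dom_open : forall p, open (dom p);
  dom_center : forall p, dom p 0 /\ chart p 0 = p;
  chart_inj : forall p, {in dom p &, injective (chart p)};
  chart_cont : forall p u, dom p u -> {for u, continuous (chart p)};
  chart_open : forall p (O : set 'rV[R]_((4 * m).-1)),
    open O -> O `<=` dom p -> open (chart p @` O);
  imm_smooth : forall p, smooth_mx (dom p) (imm \o chart p);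
  imm_immersion : forall p u v, dom p u ->
    derive_mx (imm \o chart p) u v = 0 -> v = 0
}.

Arguments imm {R m M} p : rename.
Arguments dom {R m M} p : rename.
Arguments chart {R m M} p u : rename.

Section Hypersurface_fields.

Context {R : realType} {m : nat} (M : hypersurface R m).

Implicit Types (p : M) (W : set M) (X Y Z N : M -> cmat R m).
Implicit Types (V : cmat R m) (f : M -> R).

(* Tangent vectors of M are identified with their images under d imm, and
   vector fields with matrix-valued maps on M. *)
Definition tangent p : set (cmat R m) :=
  [set V | exists v, V = derive_mx (imm \o chart p) 0 v].

Definition tcoord p V : 'rV[R]_((4 * m).-1) :=
  xget 0 [set v | V = derive_mx (imm \o chart p) 0 v].

(* Derivative at p, along V in tangent p, of a map defined near p. *)
Definition dirM p V f : R :=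
  'D_(tcoord p V) (fun u => f (chart p u) : R^o) 0.

Definition dirM_mx p V Y : cmat R m :=
  derive_mx (Y \o chart p) 0 (tcoord p V).

Definition smooth_fun W f : Prop :=
  forall p, smooth (dom p `&` chart p @^-1` W) (fun u => f (chart p u)).

Definition smooth_field W Y : Prop :=
  forall p, smooth_mx (dom p `&` chart p @^-1` W) (Y \o chart p).

Definition vfield W Y : Prop :=
  (forall p, W p -> tangent p (Y p)) /\ smooth_field W Y.

Definition bracket X Y : M -> cmat R m :=
  fun p => dirM_mx p (X p) Y - dirM_mx p (Y p) X.

(* The connection acts on vector fields defined on open subsets W of M; their
   values outside W are irrelevant. *)
Record levi_civita
    (nabla : (M -> cmat R m) -> (M -> cmat R m) -> M -> cmat R m) : Prop := {
  lc_field : forall W X Y, open W -> vfield W X -> vfield W Y ->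
    vfield W (nabla X Y);
  lc_linear : forall W X X' Y f p, open W -> vfield W X -> vfield W X' ->
    vfield W Y -> smooth_fun W f -> W p ->
    nabla (fun q => (f q)%:C *: X q + X' q) Y p =
      (f p)%:C *: nabla X Y p + nabla X' Y p;
  lc_leibniz : forall W X Y Y' f p, open W -> vfield W X -> vfield W Y ->
    vfield W Y' -> smooth_fun W f -> W p ->
    nabla X (fun q => (f q)%:C *: Y q + Y' q) p =
      (dirM p (X p) f)%:C *: Y p + (f p)%:C *: nabla X Y p + nabla X Y' p;
  lc_metric : forall W X Y Z p, open W -> vfield W X -> vfield W Y ->
    vfield W Z -> W p ->
    dirM p (X p) (fun q => gmet (Y q) (Z q)) =
      gmet (nabla X Y p) (Z p) + gmet (Y p) (nabla X Z p);
  lc_torsion : forall W X Y p, open W -> vfield W X -> vfield W Y -> W p ->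
    nabla X Y p - nabla Y X p = bracket X Y p
}.

Definition curvature
    (nabla : (M -> cmat R m) -> (M -> cmat R m) -> M -> cmat R m)
    X Y Z : M -> cmat R m :=
  fun p => nabla X (nabla Y Z) p - nabla Y (nabla X Z) p
           - nabla (bracket X Y) Z p.

Definition orthonormal_frame W (e : 'I_((4 * m).-1) -> M -> cmat R m) : Prop :=
  (forall i, vfield W (e i)) /\
  (forall p i j, W p -> gmet (e i p) (e j p) = (i == j)%:R).

Definition ricci_tensor
    (nabla : (M -> cmat R m) -> (M -> cmat R m) -> M -> cmat R m)
    (S : M -> cmat R m -> cmat R m) : Prop :=
  forall W e X p, open W -> orthonormal_frame W e -> vfield W X -> W p ->
    S p (X p) = \sum_i curvature nabla X (e i) (e i) p.

Definition unit_normal N : Prop :=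
  smooth_field setT N /\
  forall p, [/\ G2_tangent (imm p) (N p), gmet (N p) (N p) = 1 &
                forall V, tangent p V -> gmet (N p) V = 0].

Definition shape_op N p V : cmat R m := - G2_proj (imm p) (dirM_mx p V N).

Definition reeb N : M -> cmat R m := fun p => - kahlerJ (imm p) (N p).

Definition eta N p V : R := gmet V (reeb N p).

Definition phi N p V : cmat R m :=
  kahlerJ (imm p) V - (gmet (kahlerJ (imm p) V) (N p))%:C *: N p.

Definition alpha N p : R := gmet (shape_op N p (reeb N p)) (reeb N p).

Definition hopf N : Prop :=
  forall p, shape_op N p (reeb N p) = (alpha N p)%:C *: reeb N p.

(* Orthogonal complement in T_p M of the span of the xi_nu = - J_nu N. *)
Definition distQ N p : set (cmat R m) :=
  [set V | tangent p V /\
     forall q, quat_basis (imm p) q ->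
       forall a, gmet V (- quatJ (q a) (N p)) = 0].

Definition gtw
    (nabla : (M -> cmat R m) -> (M -> cmat R m) -> M -> cmat R m)
    N (k : R) X Y : M -> cmat R m :=
  fun p => nabla X Y p
    + (gmet (phi N p (shape_op N p (X p))) (Y p))%:C *: reeb N p
    - (eta N p (Y p))%:C *: phi N p (shape_op N p (X p))
    - (k * eta N p (X p))%:C *: phi N p (Y p).

Definition gtw_reeb_parallel
    (nabla : (M -> cmat R m) -> (M -> cmat R m) -> M -> cmat R m)
    N (k : R) (S : M -> cmat R m -> cmat R m) : Prop :=
  forall Y, vfield setT Y -> forall p,
    gtw nabla N k (reeb N) (fun q => S q (Y q)) p
    - S p (gtw nabla N k (reeb N) Y p) = 0.

Definition locally_congruent_to_open_part (T : set (cmat R m)) : Prop :=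
  forall p, exists W (F : cmat R m -> cmat R m),
    [/\ open W, W p, G2_isometry F & open_part ((F \o imm) @` W) T].

End Hypersurface_fields.

(* Main.v *)
(* Let P be the projection onto the plane at a point of M and n the unit normal
   there.  As xi lies in Q, P n^2 = P, and the Codazzi equation determines the
   shape operator on the span of xi, the xi_nu and the phi xi_nu and constrains it
   elsewhere.  Reeb parallelism of the Ricci tensor then turns alpha = 2k into
   k^2 = m - 1, whence the radius.

   Following the normal geodesic over the length 2r maps P to the projection
   focal P = (c^2 - s^2) P + c s n + s^2 n^2, where c = cos 2r and s = - k c.  The
   structure equations of M say that focal P = X (conj P) X^-1 for a unitary
   antisymmetric matrix X that is locally constant on M.  Such an X is a
   quaternionic structure on C^(m+2); it exists only for even m and is
   unitarily congruent to Omega.  Thus M lies in a level set of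
   tr (P X (conj P) X^-1), and this level set is the tube of radius r around
   HP^n: the shortest geodesic between P and X (conj P) X^-1 has length 2r, and its
   midpoint is fixed by the quaternionic structure.  Finally M is open in the
   tube: a point of the level set near M is joined by a normal vector to the
   nearest point of M, and to first order the level function grows along n. *)

Require Import Defs.
From HB Require Import structures.
From mathcomp Require Import all_boot all_order all_algebra.
From mathcomp Require Import complex.
From mathcomp Require Import all_classical all_reals all_analysis.
From mathcomp Require Import ring lra.
Import Order.TTheory GRing.Theory Num.Theory numFieldNormedType.Exports.
Local Open Scope ring_scope.
Set Implicit Arguments.
Unset Strict Implicit.
Unset Printing Implicit Defensive.

(** * Reflexive normalization of noncommutative matrix expressions *)

(** Along [xi] the GTW derivative turns [xi_nu] into [(alpha - k) phi xi_nu], so parallelism forces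
    the Ricci eigenvalues [4m + 4 + h beta - beta^2] of [xi_nu] and [4m + 8] of [phi xi_nu] to
    agree. Here [beta = -4 / alpha] is the principal curvature of [xi_nu] and
    [h = alpha + (2m - 1) beta] the trace of [A]; for [alpha = 2k] this reads [k^2 = m - 1]. The
    origin of X: orthogonally to [xi], [xi_nu], [phi xi_nu], the Jacobi operator [c - s A] of the
    normal geodesics is an involution commuting with the [J_nu] and anticommuting with [J]. Such a
    map is given by a matrix acting on conjugates, and X extends this matrix. The extension uses an
    alternating form on the plane, fixed only up to a phase, so it is conjugation by X that is
    constant; [X^-1 dX] is shown to be scalar by the argument that makes the Levi-Civita connection
    unique. A further obstacle: derivatives at a point are taken in the chart centred there, and no
    smooth dependence of this chart on the point is given. Smoothness of the shape operator is
    extracted from that of [nabla]. *)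

(* The relations known between the generators rewrite a product of two letters
   to 0, to 1 or to one letter; [ncr_nf] turns an expression into a linear
   combination of reduced words. *)
Inductive ncres := NRzero | NRone | NRlet of nat.
Definition ncrules := seq (nat * nat * ncres).

Inductive ncexp (K : Type) :=
  | NCvar of nat | NCzero | NCone | NCadd of ncexp K & ncexp K | NCopp of ncexp K
  | NCmul of ncexp K & ncexp K | NCscale of K & ncexp K.
Arguments NCvar {K}. Arguments NCzero {K}. Arguments NCone {K}.

(** Private copies of the comparisons: [nc_compute] unfolds exactly the functions that it lists, so
    the ring operations in the coefficients stay folded for [ring]. *)
Fixpoint nc_eqn (m n : nat) : bool :=
  match m, n with 0, 0 => true | m'.+1, n'.+1 => nc_eqn m' n' | _, _ => false end.
Fixpoint nc_leqn (m n : nat) : bool :=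
  match m, n with 0, _ => true | m'.+1, n'.+1 => nc_leqn m' n' | _, _ => false end.
Fixpoint nc_eqw (v w : seq nat) : bool :=
  match v, w with
  | [::], [::] => true
  | x :: v', y :: w' => if nc_eqn x y then nc_eqw v' w' else false
  | _, _ => false
  end.
Fixpoint nc_lew (v w : seq nat) : bool :=
  match v, w with
  | [::], _ => true
  | x :: v', y :: w' => if nc_eqn x y then nc_lew v' w' else nc_leqn x y
  | _, _ => false
  end.

Fixpoint nc_lookup (rs : ncrules) (x y : nat) : option ncres :=
  match rs with
  | [::] => None
  | (i, j, k) :: rs' =>
      if nc_eqn i x then if nc_eqn j y then Some k else nc_lookup rs' x y
      else nc_lookup rs' x y
  end.

Fixpoint nc_push (rs : ncrules) (x : nat) (w : seq nat) : option (seq nat) :=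
  match w with
  | [::] => Some [:: x]
  | y :: w' => match nc_lookup rs x y with
               | None => Some (x :: w)
               | Some NRzero => None
               | Some NRone => Some w'
               | Some (NRlet z) => nc_push rs z w'
               end
  end.

Fixpoint nc_red (rs : ncrules) (w : seq nat) : option (seq nat) :=
  match w with
  | [::] => Some [::]
  | x :: w' => match nc_red rs w' with None => None | Some u => nc_push rs x u end
  end.

Fixpoint nc_app (v w : seq nat) : seq nat :=
  match v with [::] => w | x :: v' => x :: nc_app v' w end.

Definition nc_rot (w : seq nat) : seq nat :=
  match w with [::] => [::] | x :: w' => nc_app w' [:: x] end.

(** Under a trace a word is cyclic. Rotating it through its whole length lets the letters at its two
    ends react with each other; the least rotation of the result then represents the cyclic word. *)
Fixpoint nc_cyc (rs : ncrules) (n : nat) (w : seq nat) : option (seq nat) :=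
  match n with
  | 0 => Some w
  | n'.+1 => match nc_red rs (nc_rot w) with None => None | Some u => nc_cyc rs n' u end
  end.

Fixpoint nc_minrot (n : nat) (best w : seq nat) : seq nat :=
  match n with
  | 0 => best
  | n'.+1 => let w' := nc_rot w in
             nc_minrot n' (if nc_lew best w' then best else w') w'
  end.

Fixpoint nc_len (w : seq nat) : nat := match w with [::] => 0 | _ :: w' => (nc_len w').+1 end.

Definition nc_canon (rs : ncrules) (w : seq nat) : option (seq nat) :=
  match nc_cyc rs (nc_len w) w with
  | None => None
  | Some u => Some (nc_minrot (nc_len u) u u)
  end.

Section NC.
Context (K : comNzRingType) (n : nat).
Implicit Types (e : ncexp K) (env : seq 'M[K]_n) (rs : ncrules).
Local Notation lincomb := (seq (K * seq nat)).

Fixpoint nc_get env (i : nat) : 'M[K]_n :=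
  match env, i with
  | [::], _ => 0
  | x :: _, 0 => x
  | _ :: env', i'.+1 => nc_get env' i'
  end.

Fixpoint nc_den env e : 'M[K]_n :=
  match e with
  | NCvar i => nc_get env i
  | NCzero => 0
  | NCone => 1%:M
  | NCadd a b => nc_den env a + nc_den env b
  | NCopp a => - nc_den env a
  | NCmul a b => nc_den env a *m nc_den env b
  | NCscale c a => c *: nc_den env a
  end.

Definition nc_res env (r : ncres) : 'M[K]_n :=
  match r with NRzero => 0 | NRone => 1%:M | NRlet z => nc_get env z end.

Fixpoint nc_ok env rs : Prop :=
  match rs with
  | [::] => True
  | (i, j, k) :: rs' => nc_get env i *m nc_get env j = nc_res env k /\ nc_ok env rs'
  end.

Fixpoint nc_word env (w : seq nat) : 'M[K]_n :=
  match w with [::] => 1%:M | x :: w' => nc_get env x *m nc_word env w' end.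

Definition nc_oword env (w : option (seq nat)) : 'M[K]_n :=
  if w is Some u then nc_word env u else 0.

Fixpoint nc_lin env (l : lincomb) : 'M[K]_n :=
  match l with [::] => 0 | (c, w) :: l' => c *: nc_word env w + nc_lin env l' end.

Fixpoint lc_app (l l' : lincomb) : lincomb :=
  match l with [::] => l' | x :: r => x :: lc_app r l' end.
Fixpoint lc_opp (l : lincomb) : lincomb :=
  match l with [::] => [::] | (c, w) :: r => (- c, w) :: lc_opp r end.
Fixpoint lc_scale (a : K) (l : lincomb) : lincomb :=
  match l with [::] => [::] | (c, w) :: r => (a * c, w) :: lc_scale a r end.
Fixpoint lc_mul1 rs (a : K) (v : seq nat) (l : lincomb) : lincomb :=
  match l with
  | [::] => [::]
  | (c, w) :: r => match nc_red rs (nc_app v w) with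
                   | None => lc_mul1 rs a v r
                   | Some u => (a * c, u) :: lc_mul1 rs a v r
                   end
  end.
Fixpoint lc_mul rs (l l' : lincomb) : lincomb :=
  match l with [::] => [::] | (c, w) :: r => lc_app (lc_mul1 rs c w l') (lc_mul rs r l') end.
Fixpoint lc_insert (c : K) (w : seq nat) (l : lincomb) : lincomb :=
  match l with
  | [::] => [:: (c, w)]
  | (d, v) :: r => if nc_eqw v w then (d + c, v) :: r else (d, v) :: lc_insert c w r
  end.
Fixpoint lc_collect (l : lincomb) : lincomb :=
  match l with [::] => [::] | (c, w) :: r => lc_insert c w (lc_collect r) end.

Fixpoint nc_nf rs e : lincomb :=
  match e with
  | NCvar i => [:: (1, [:: i])]
  | NCzero => [::]
  | NCone => [:: (1, [::])]
  | NCadd a b => lc_app (nc_nf rs a) (nc_nf rs b)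
  | NCopp a => lc_opp (nc_nf rs a)
  | NCmul a b => lc_mul rs (nc_nf rs a) (nc_nf rs b)
  | NCscale c a => lc_scale c (nc_nf rs a)
  end.

Fixpoint lc_cyc rs (l : lincomb) : lincomb :=
  match l with
  | [::] => [::]
  | (c, w) :: r => match nc_canon rs w with
                   | None => lc_cyc rs r
                   | Some u => (c, u) :: lc_cyc rs r
                   end
  end.

(** The last coefficient is not followed by [True], so that [repeat split] leaves one goal per
    reduced word. *)
Fixpoint lc_zero (l : lincomb) : Prop :=
  match l with
  | [::] => True
  | [:: (c, w)] => c = 0
  | (c, w) :: r => c = 0 /\ lc_zero r
  end.

Lemma nc_eqnP i j : nc_eqn i j -> i = j.
Proof. by elim: i j => [|i IH] [|j]//= /IH ->. Qed.
Lemma nc_eqwP v w : nc_eqw v w -> v = w.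
Proof.
elim: v w => [|x v IH] [|y w]//=; case: ifP => // /nc_eqnP ->.
by move=> /IH ->.
Qed.

Lemma nc_lookupP env rs x y k : nc_ok env rs -> nc_lookup rs x y = Some k ->
  nc_get env x *m nc_get env y = nc_res env k.
Proof.
elim: rs => [|[[i j] r] rs IH]//= [E ok].
case: ifP => [/nc_eqnP Ei|_]; last exact: IH.
by case: ifP => [/nc_eqnP Ej [<-]|_]; [rewrite -Ei -Ej | exact: IH].
Qed.

Lemma nc_pushP env rs x w : nc_ok env rs ->
  nc_oword env (nc_push rs x w) = nc_get env x *m nc_word env w.
Proof.
move=> ok; elim: w x => [|y w IH] x //=.
case E: (nc_lookup rs x y) => [[||z]|] //=; have := nc_lookupP ok E => //= E'.
- by rewrite mulmxA E' mul0mx.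
- by rewrite mulmxA E' mul1mx.
- by rewrite IH mulmxA E'.
Qed.

Lemma nc_redP env rs w : nc_ok env rs -> nc_oword env (nc_red rs w) = nc_word env w.
Proof.
move=> ok; elim: w => //= x w IH.
by case: (nc_red rs w) IH => [u|] /= <-; rewrite ?mulmx0 ?nc_pushP.
Qed.

Lemma nc_appP env v w : nc_word env (nc_app v w) = nc_word env v *m nc_word env w.
Proof. by elim: v => [|x v IH] /=; rewrite ?mul1mx ?IH ?mulmxA. Qed.

Lemma nc_rotP env w : \tr (nc_word env (nc_rot w)) = \tr (nc_word env w).
Proof. by case: w => //= x w; rewrite nc_appP /= mulmx1 mxtrace_mulC. Qed.

Lemma nc_canonP env rs w : nc_ok env rs ->
  \tr (nc_oword env (nc_canon rs w)) = \tr (nc_word env w).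
Proof.
move=> ok; rewrite /nc_canon.
have cycP k u : \tr (nc_oword env (nc_cyc rs k u)) = \tr (nc_word env u).
  elim: k u => //= k IH u; rewrite -(nc_rotP env u) -(nc_redP (nc_rot u) ok).
  by case: (nc_red rs (nc_rot u)) => //= v; exact: IH.
have minP k b u : \tr (nc_word env b) = \tr (nc_word env u) ->
    \tr (nc_word env (nc_minrot k b u)) = \tr (nc_word env u).
  elim: k b u => //= k IH b u E; rewrite IH ?nc_rotP//.
  by case: ifP => _; rewrite ?nc_rotP.
by rewrite -(cycP (nc_len w)); case: (nc_cyc _ _ _) => //= u; exact: minP.
Qed.

Lemma lc_appP env l l' : nc_lin env (lc_app l l') = nc_lin env l + nc_lin env l'.
Proof. by elim: l => [|[c w] l IH] /=; rewrite ?add0r ?IH ?addrA. Qed.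

Lemma nc_nfP env rs e : nc_ok env rs -> nc_lin env (nc_nf rs e) = nc_den env e.
Proof.
move=> ok; elim: e => /=.
- by move=> i; rewrite mulmx1 scale1r addr0.
- by [].
- by rewrite scale1r addr0.
- by move=> a IHa b IHb; rewrite lc_appP IHa IHb.
- move=> a <-; elim: (nc_nf rs a) => [|[c w] l IH] /=; rewrite ?oppr0// IH.
  by rewrite scaleNr opprD.
- move=> a <- b <-; elim: (nc_nf rs a) => [|[c w] l IH] /=; first by rewrite mul0mx.
  rewrite lc_appP IH mulmxDl; congr (_ + _); elim: (nc_nf rs b) => [|[d v] l' IH'] /=.
    by rewrite mulmx0.
  rewrite mulmxDr -IH' -scalemxAl -scalemxAr scalerA.
  have := nc_redP (nc_app w v) ok; rewrite nc_appP.
  by case: (nc_red _ _) => [u|] /= <- //; rewrite scaler0 add0r.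
- move=> c a <-; elim: (nc_nf rs a) => [|[d w] l IH] /=; first by rewrite scaler0.
  by rewrite scalerDr scalerA IH.
Qed.

Lemma lc_collectP env l : nc_lin env (lc_collect l) = nc_lin env l.
Proof.
elim: l => [|[c w] l IH] //=; rewrite -IH; elim: (lc_collect l) => [|[d v] r IHr] //=.
case: ifP => [/nc_eqwP ->|_] /=; first by rewrite scalerDl addrCA addrA.
by rewrite IHr addrCA.
Qed.

Lemma lc_zeroP env l : lc_zero l -> nc_lin env l = 0.
Proof.
elim: l => [|[c w] [|x r] IH] //=; first by move=> ->; rewrite scale0r addr0.
by move=> [-> /IH /= ->]; rewrite scale0r addr0.
Qed.

(** Soundness only: the rules are true equations, and nothing is claimed about confluence or about
    independence of the reduced words. *)
Lemma nc_eq env rs e1 e2 : nc_ok env rs ->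
  lc_zero (lc_collect (nc_nf rs (NCadd e1 (NCopp e2)))) -> nc_den env e1 = nc_den env e2.
Proof.
move=> ok /(lc_zeroP env); rewrite lc_collectP nc_nfP//= => /eqP.
by rewrite subr_eq0 => /eqP.
Qed.

Lemma nc_tr_eq env rs e1 e2 : nc_ok env rs ->
  lc_zero (lc_collect (lc_cyc rs (nc_nf rs (NCadd e1 (NCopp e2))))) ->
  \tr (nc_den env e1) = \tr (nc_den env e2).
Proof.
move=> ok /(lc_zeroP env); rewrite lc_collectP => E; apply/eqP.
rewrite -subr_eq0 -linearB /= -[_ - _]/(nc_den env (NCadd e1 (NCopp e2))).
rewrite -(nc_nfP _ ok); move: E; set l := nc_nf _ _ => E.
suff -> : \tr (nc_lin env l) = \tr (nc_lin env (lc_cyc rs l)) by rewrite E linear0.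
elim: l {E} => [|[c w] l IH] //=; rewrite linearD linearZ /= -(nc_canonP w ok) IH.
case: (nc_canon rs w) => [u|] /=; first by rewrite linearD linearZ.
by rewrite linear0 mulr0 add0r.
Qed.

End NC.

(* Letters [a] with [E t *m a = a = a *m E s] for pairwise orthogonal [E] multiply
   to 0 unless their types match; [units] lists the letters that are equal to
   the idempotent of their type. *)
Fixpoint nc_mem (i : nat) (l : seq nat) : bool :=
  match l with [::] => false | j :: l' => if nc_eqn i j then true else nc_mem i l' end.

Fixpoint nc_row (units : seq nat) (tys : seq (nat * nat)) (i si j : nat) : ncrules :=
  match tys with
  | [::] => [::]
  | (tj, _) :: tys' =>
      if nc_eqn si tj then
        if nc_mem j units then (i, j, NRlet i) :: nc_row units tys' i si j.+1
        else if nc_mem i units then (i, j, NRlet j) :: nc_row units tys' i si j.+1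
        else nc_row units tys' i si j.+1
      else (i, j, NRzero) :: nc_row units tys' i si j.+1
  end.

Fixpoint nc_gen (units : seq nat) (all tys : seq (nat * nat)) (i : nat) : ncrules :=
  match tys with
  | [::] => [::]
  | (_, si) :: tys' => cat (nc_row units all i si 0) (nc_gen units all tys' i.+1)
  end.

Section NC_typed.
Context (K : comNzRingType) (n : nat).
Implicit Types (E env : seq 'M[K]_n) (tys : seq (nat * nat)).

Fixpoint nc_typed E env tys : Prop :=
  match env, tys with
  | x :: env', (t, s) :: tys' =>
      [/\ nc_get E t *m x = x, x *m nc_get E s = x & nc_typed E env' tys']
  | _, [::] => True
  | [::], _ => False
  end.

Definition nc_orth E := forall i j, nc_eqn i j = false -> nc_get E i *m nc_get E j = 0.

Fixpoint nc_units E env tys (units : seq nat) : Prop :=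
  match units with
  | [::] => True
  | i :: l => [/\ nc_get env i = nc_get E (nth (0, 0)%N tys i).1,
     nc_get env i = nc_get E (nth (0, 0)%N tys i).2 & nc_units E env tys l]
  end.

Lemma nc_ok_cat env rs rs' : nc_ok env rs -> nc_ok env rs' -> nc_ok env (cat rs rs').
Proof. by elim: rs => //= [[[i j] k] rs IH] [E ok] ok'; split; [|exact: IH]. Qed.

Lemma nc_typedP E env tys i t s : nc_typed E env tys -> onth tys i = Some (t, s) ->
  nc_get E t *m nc_get env i = nc_get env i /\ nc_get env i *m nc_get E s = nc_get env i.
Proof.
elim: env tys i => [|x env IH] [|[a b] tys] [|i] //=.
  by case=> E1 E2 _ [<- <-].
by case=> _ _ ty; exact: IH.
Qed.

(** A product [a *m b] equals [a *m E s *m E t *m b] for the source [s] of [a] and the target [t] of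
    [b], and vanishes by orthogonality when these differ. *)
Lemma nc_gen_ok E env tys units : nc_orth E -> nc_typed E env tys ->
  nc_units E env tys units -> nc_ok env (nc_gen units tys tys 0).
Proof.
move=> oE ty un.
have unP i : nc_mem i units -> nc_get env i = nc_get E (nth (0, 0)%N tys i).1 /\
    nc_get env i = nc_get E (nth (0, 0)%N tys i).2.
  elim: units un => //= j l IH [E1 E2 un]; case: ifP => [/nc_eqnP -> _|_]; [by []|exact: IH].
suff gen tys' i : (forall k, onth tys' k = onth tys (i + k)) ->
    nc_ok env (nc_gen units tys tys' i) by apply: gen.
elim: tys' i => [|[ti si] tys' IH] i Hi //=; apply: nc_ok_cat; last first.
  by apply: IH => k; rewrite addSnnS -Hi.
have /= Ei := Hi 0; rewrite addn0 in Ei.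
have [Ei1 Ei2] := nc_typedP ty (esym Ei).
suff row tys'' j : (forall k, onth tys'' k = onth tys (j + k)) ->
    nc_ok env (nc_row units tys'' i si j) by apply: row.
elim: tys'' j => [|[tj sj] tys'' IH'] j Hj //=.
have /= Ej := Hj 0; rewrite addn0 in Ej.
have [Ej1 Ej2] := nc_typedP ty (esym Ej).
have rest : nc_ok env (nc_row units tys'' i si j.+1).
  by apply: IH' => k; rewrite addSnnS -Hj.
have nthE k t s : Some (t, s) = onth tys k -> nth (0, 0)%N tys k = (t, s).
  by move=> /esym /(onth_nth (0, 0)%N).
case: ifP => [/nc_eqnP eq|ne]; last first.
  by split=> //=; rewrite -Ei2 -Ej1 mulmxA -(mulmxA _ (nc_get E si)) oE// mulmx0 mul0mx.
case: ifP => [/unP[E1 _]|_].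
  by split=> //=; rewrite E1 (nthE _ _ _ Ej) /= -eq Ei2.
case: ifP => [/unP[_ E2]|_] //.
by split=> //=; rewrite E2 (nthE _ _ _ Ei) /= eq Ej1.
Qed.

End NC_typed.

Ltac nc_index x env :=
  lazymatch env with
  | ?y :: ?env' => match constr:(Set) with
                   | _ => let _ := constr:(erefl : x = y) in
                          lazymatch x with y => constr:(0%N) end
                   | _ => let i := nc_index x env' in constr:(i.+1)
                   end
  | _ => fail 100 "letter not found" x
  end.

Ltac nc_quote K env t :=
  lazymatch t with
  | ?a *m ?b => let a' := nc_quote K env a in let b' := nc_quote K env b in
                constr:(@NCmul K a' b')
  | (?a + ?b)%R => let a' := nc_quote K env a in let b' := nc_quote K env b in
                constr:(@NCadd K a' b')
  | (- ?a)%R => let a' := nc_quote K env a in constr:(@NCopp K a')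
  | (?c *: ?a)%R => let a' := nc_quote K env a in constr:(@NCscale K c a')
  | 1%:M => constr:(@NCone K)
  | 0%R => constr:(@NCzero K)
  | ?x => let i := nc_index x env in constr:(@NCvar K i)
  end.

Ltac nc_compute :=
  cbv beta iota zeta delta [nc_eqn nc_leqn nc_eqw nc_lew nc_lookup nc_push nc_red nc_app
    nc_rot nc_cyc nc_minrot nc_len nc_canon lc_app lc_opp lc_scale lc_mul1 lc_mul
    lc_insert lc_collect nc_nf lc_cyc lc_zero].

(* [nc ok] reduces an equality between matrix expressions, or between traces of
   such, to the equality of the coefficients of the reduced words; [ok] proves
   the rewriting rules. *)
Ltac nc ok :=
  lazymatch type of ok with
  | @nc_ok ?K ?n ?env ?rs =>
    let env' := eval hnf in env in
    lazymatch goal with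
    | |- \tr ?a = \tr ?b =>
        let a' := nc_quote K env a in let b' := nc_quote K env b in
        refine (@nc_tr_eq K n env rs a' b' ok _)
    | |- ?a = ?b =>
        let a' := nc_quote K env a in let b' := nc_quote K env b in
        refine (@nc_eq K n env rs a' b' ok _)
    end
  end; nc_compute; try exact I; repeat split.


(** The table made by [nc_gen] is evaluated beforehand, so that [nc_compute] meets a literal
    list. *)
Ltac nc_have ok H :=
  lazymatch type of H with
  | @nc_ok ?K ?n ?env ?rs =>
      let rs' := eval vm_compute in rs in have ok : @nc_ok K n env rs' := H
  end.

Local Open Scope classical_set_scope.
Local Open Scope complex_scope.
Local Open Scope sesquilinear_scope.
Local Notation derive_mx := Defs.derive_mx.


(** * Differential calculus of real and complex valued maps *)

Section Ck_calculus.
Context {R : realType} {V : normedModType R}.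
Implicit Types (U : set V) (f g : V -> R^o) (u v : V).

Lemma near_open U u : open U -> U u -> \forall x \near u, U x.
Proof. by move=> oU Uu; exact: open_nbhs_nbhs. Qed.

Lemma eq_on_derive U f g u v : open U -> (forall x, U x -> f x = g x) -> U u ->
  'D_v f u = 'D_v g u.
Proof.
move=> oU fg Uu; have [->|v0] := eqVneq v 0; first by rewrite !derive0.
apply: near_eq_derive => //.
by near=> x; apply: fg; near: x; exact: near_open.
Unshelve. all: by end_near. Qed.

Lemma eq_on_differentiable U f g u : open U -> (forall x, U x -> f x = g x) ->
  U u -> differentiable f u -> differentiable g u.
Proof.
move=> oU fg Uu df.
have H : \forall x \near u, f x = g x by near=> x; apply: fg; near: x; exact: near_open.
have [cd /eqaddoP Ef] := (diff_locallyP _ _).1 df.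
have Eg : g \o shift u = cst (g u) + 'd f u +o_0 id.
  apply/eqaddoP => e e0; have := Ef e e0.
  have : \forall x \near (0 : V), f (x + u) = g (x + u).
    by move/nbhs0P: H; apply: filterS => x; rewrite addrC.
  apply: filterS2 => x fgx; rewrite !fctE/= (fg u Uu) -fgx//.
have Ed := diff_unique cd Eg.
by apply/diff_locallyP; rewrite Ed.
Unshelve. all: by end_near. Qed.

Lemma Ck_eq n U f g : open U -> (forall x, U x -> f x = g x) -> Ck n U f -> Ck n U g.
Proof.
move=> oU; elim: n f g => [|n IHn] f g fg /=.
  move=> cf u Uu; have := cf u Uu.
  rewrite /prop_for /continuous_at (fg _ Uu).
  apply: cvg_trans; apply: near_eq_cvg.
  by near=> x; rewrite fg//; near: x; exact: near_open.
move=> [df cf]; split=> [u Uu|v].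
  exact: (eq_on_differentiable oU fg Uu (df u Uu)).
apply: (IHn (fun u => 'D_v f u)) => // u Uu; exact: (eq_on_derive v oU fg Uu).
Unshelve. all: by end_near. Qed.

Lemma Ck_cst n U (a : R) : Ck n U (cst a : V -> R^o).
Proof.
elim: n a => [|n IHn] a /=; first by move=> u _; exact: cst_continuous.
split=> [u _|v]; first exact: differentiable_cst.
have -> : (fun u => 'D_v (cst a : V -> R^o) u) = cst 0; last exact: IHn.
by apply/funext => u; rewrite derive_cst.
Qed.

Lemma CkW n U f : Ck n.+1 U f -> Ck n U f.
Proof.
elim: n f => [|n IHn] f /=.
  by move=> [df _] u Uu; exact: differentiable_continuous (df u Uu).
by move=> [df cf]; split=> // v; apply: IHn; exact: cf.
Qed.

Lemma CkD n U f g : open U -> Ck n U f -> Ck n U g -> Ck n U (fun u => f u + g u).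
Proof.
move=> oU; elim: n f g => [|n IHn] f g /=.
  by move=> cf cg u Uu; apply: cvgD; [exact: cf | exact: cg].
move=> [df cf] [dg cg]; split=> [u Uu|v].
  by apply: differentiableD; [exact: df | exact: dg].
apply: (@Ck_eq _ _ (fun u => 'D_v f u + 'D_v g u)) => //; last exact: IHn.
by move=> u Uu; rewrite deriveD//; apply: diff_derivable; [exact: df|exact: dg].
Qed.

Lemma CkM n U f g : open U -> Ck n U f -> Ck n U g -> Ck n U (fun u => f u * g u).
Proof.
move=> oU; elim: n f g => [|n IHn] f g.
  by move=> cf cg u Uu; apply: cvgM; [exact: cf | exact: cg].
move=> cf1 cg1; have cf0 := CkW cf1; have cg0 := CkW cg1.
case: cf1 cg1 => df cf [dg cg]; split=> [u Uu|v].
  by apply: differentiableM; [exact: df | exact: dg].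
apply: (@Ck_eq _ _ (fun u => f u * 'D_v g u + g u * 'D_v f u)) => //.
  by move=> u Uu; rewrite deriveM//; apply: diff_derivable; [exact: df|exact: dg].
by apply: CkD => //; apply: IHn => //; [exact: cg | exact: cf].
Qed.


Lemma smooth_eq U f g : open U -> (forall x, U x -> f x = g x) ->
  smooth U f -> smooth U g.
Proof. by move=> oU fg sf n; exact: (Ck_eq oU fg (sf n)). Qed.

Lemma smooth_cst U (a : R) : smooth U (fun=> a : R^o).
Proof. by move=> n; exact: Ck_cst. Qed.

Lemma smoothD U f g : open U -> smooth U f -> smooth U g ->
  smooth U (fun u => f u + g u).
Proof. by move=> oU sf sg n; exact: CkD. Qed.

Lemma smoothM U f g : open U -> smooth U f -> smooth U g ->
  smooth U (fun u => f u * g u).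
Proof. by move=> oU sf sg n; exact: CkM. Qed.

Lemma smoothN U f : open U -> smooth U f -> smooth U (fun u => - f u).
Proof.
move=> oU sf; apply: (@smooth_eq _ (fun u => (-1) * f u)) => //.
  by move=> x _; rewrite mulN1r.
by apply: smoothM => //; exact: smooth_cst.
Qed.

Lemma smoothB U f g : open U -> smooth U f -> smooth U g ->
  smooth U (fun u => f u - g u).
Proof. by move=> oU sf sg; apply: smoothD => //; exact: smoothN. Qed.

Lemma smooth_sum U (I : Type) (r : seq I) (F : I -> V -> R^o) : open U ->
  (forall i, smooth U (F i)) -> smooth U (fun u => \sum_(i <- r) F i u).
Proof.
move=> oU sF; elim: r => [|i r IHr].
  by apply: (@smooth_eq _ (fun=> 0)) => //; [move=> x _; rewrite big_nil | exact: smooth_cst].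
apply: (@smooth_eq _ (fun u => F i u + \sum_(i <- r) F i u)) => //.
  by move=> x _; rewrite big_cons.
exact: smoothD.
Qed.

Lemma smooth_diff U f u : smooth U f -> U u -> differentiable f u.
Proof. by move=> sf; case: (sf 1%N) => df _; exact: df. Qed.

Lemma smooth_derive U f v : smooth U f -> smooth U (fun u => 'D_v f u).
Proof. by move=> sf n; case: (sf n.+1) => _; exact. Qed.

Lemma smooth_sub U U' f : U `<=` U' -> smooth U' f -> smooth U f.
Proof.
move=> UU' sf n; elim: n f sf => [|n IHn] f sf.
  by move=> u Uu; apply: (sf 0%N); exact: UU'.
split=> [u Uu|v]; first by apply: (smooth_diff sf); exact: UU'.
by apply: IHn; exact: smooth_derive.
Qed.

Lemma comp_real_derive f (h : R -> R) (d : R) u v :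
  differentiable f u -> is_derive (f u) (1 : R) h d ->
  differentiable (fun x => h (f x) : R^o) u /\
  'D_v (fun x => h (f x) : R^o) u = d * 'D_v f u.
Proof.
move=> df [dh hd].
have dh' : differentiable h (f u) by apply/derivable1_diffP.
split; first exact: differentiable_comp.
rewrite deriveE; last exact: differentiable_comp.
rewrite (@diff_comp _ _ _ _ f h) //= deriv1E // derive1E hd -deriveE //.
by rewrite mulrC.
Qed.

(* The recursion g' = - f' g^3 / 2 for g = f^(-1/2) makes g as regular as f. *)
Lemma smooth_rsqrt U f : open U -> (forall u, U u -> 0 < f u) -> smooth U f ->
  smooth U (fun u => (Num.sqrt (f u))^-1).
Proof.
move=> oU f0 sf.
have dsq u : U u -> differentiable (fun x => (Num.sqrt (f x))^-1 : R^o) u /\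
    forall v, 'D_v (fun x => (Num.sqrt (f x))^-1 : R^o) u =
      - 2^-1 * ((Num.sqrt (f u))^-1 * (Num.sqrt (f u))^-1 * (Num.sqrt (f u))^-1 * 'D_v f u).
  move=> Uu; have fu := f0 u Uu; have df := smooth_diff sf Uu.
  have su : 0 < Num.sqrt (f u) by rewrite sqrtr_gt0.
  have hd : is_derive (f u) (1 : R) (fun x => (Num.sqrt x)^-1)
      (- 2^-1 * ((Num.sqrt (f u))^-1 * (Num.sqrt (f u))^-1 * (Num.sqrt (f u))^-1)).
    have [dq eq] := is_derive1_sqrt fu.
    split; first by apply: derivableV => //; rewrite gt_eqF.
    rewrite deriveV ?gt_eqF// eq; set a := Num.sqrt _ in su *.
    by rewrite /GRing.scale/=; field; rewrite gt_eqF.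
  split=> [|v]; first by case: (comp_real_derive 0 df hd).
  by case: (comp_real_derive v df hd) => _ ->; rewrite !mulrA.
move=> n; elim: n => [|n IHn].
  by move=> u Uu; apply: differentiable_continuous; case: (dsq u Uu).
split=> [u Uu|v]; first by case: (dsq u Uu).
apply: (@Ck_eq _ _ (fun u => - 2^-1 * ((Num.sqrt (f u))^-1 * (Num.sqrt (f u))^-1 * (Num.sqrt (f u))^-1 * 'D_v f u))) => //.
  by move=> u Uu; case: (dsq u Uu) => _ ->.
apply: CkM => //; first exact: Ck_cst.
have sD := @smooth_derive _ _ v sf n.
by do 3 (apply: CkM => //).
Qed.

End Ck_calculus.

Lemma re_leibniz (K : comNzRingType) (a b c d a' b' c' d' : K) :
  a * c' + c * a' - (b * d' + d * b') = a' * c - b' * d + (a * c' - b * d').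
Proof. by ring. Qed.

Lemma im_leibniz (K : comNzRingType) (a b c d a' b' c' d' : K) :
  a * d' + d * a' + (b * c' + c * b') = a' * d + b' * c + (a * d' + b * c').
Proof. by ring. Qed.

Section Complex_calculus.
Context {R : realType} {V : normedModType R}.
Implicit Types (U : set V) (f g : V -> R[i]) (u v : V).

Definition smoothc U f := smooth U (fun u => complex.Re (f u)) /\
                          smooth U (fun u => complex.Im (f u)).

Definition diffc f u := differentiable (fun u => complex.Re (f u) : R^o) u /\
                        differentiable (fun u => complex.Im (f u) : R^o) u.

Definition Dc v f u : R[i] := 'D_v (fun u => complex.Re (f u) : R^o) u +i*
                              'D_v (fun u => complex.Im (f u) : R^o) u.

Lemma ReM (x y : R[i]) : complex.Re (x * y) =
  complex.Re x * complex.Re y - complex.Im x * complex.Im y.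
Proof. by case: x y => a b []. Qed.
Lemma ImM (x y : R[i]) : complex.Im (x * y) =
  complex.Re x * complex.Im y + complex.Im x * complex.Re y.
Proof. by case: x y => a b [] c d /=. Qed.
Lemma ReD (x y : R[i]) : complex.Re (x + y) = complex.Re x + complex.Re y.
Proof. by case: x y => a b []. Qed.
Lemma ImD (x y : R[i]) : complex.Im (x + y) = complex.Im x + complex.Im y.
Proof. by case: x y => a b []. Qed.
Lemma ReN (x : R[i]) : complex.Re (- x) = - complex.Re x. Proof. by case: x. Qed.
Lemma ImN (x : R[i]) : complex.Im (- x) = - complex.Im x. Proof. by case: x. Qed.
Lemma ReJ (x : R[i]) : complex.Re x^*%C = complex.Re x. Proof. by case: x. Qed.
Lemma ImJ (x : R[i]) : complex.Im x^*%C = - complex.Im x. Proof. by case: x. Qed.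
Lemma Re_sum I r (P : pred I) (F : I -> R[i]) :
  complex.Re (\sum_(i <- r | P i) F i) = \sum_(i <- r | P i) complex.Re (F i).
Proof. by apply: (big_morph _ ReD). Qed.
Lemma Im_sum I r (P : pred I) (F : I -> R[i]) :
  complex.Im (\sum_(i <- r | P i) F i) = \sum_(i <- r | P i) complex.Im (F i).
Proof. by apply: (big_morph _ ImD). Qed.
Lemma complexP (x y : R[i]) : complex.Re x = complex.Re y ->
  complex.Im x = complex.Im y -> x = y.
Proof. by case: x y => a b [] c d /= -> ->. Qed.

Lemma smoothc_eq U f g : open U -> (forall x, U x -> f x = g x) ->
  smoothc U f -> smoothc U g.
Proof.
move=> oU fg [r i]; split; [apply: (smooth_eq oU _ r)|apply: (smooth_eq oU _ i)];
  by move=> x Ux /=; rewrite fg.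
Qed.

Lemma smoothc_cst U a : smoothc U (fun=> a).
Proof. by split; exact: smooth_cst. Qed.

Lemma smoothc_real U (f : V -> R^o) : smooth U f -> smoothc U (fun u => (f u)%:C).
Proof. by move=> sf; split => //; exact: smooth_cst. Qed.

Lemma smoothcD U f g : open U -> smoothc U f -> smoothc U g ->
  smoothc U (fun u => f u + g u).
Proof.
move=> oU [fr fi] [gr gi]; split.
  by apply: (smooth_eq oU _ (smoothD oU fr gr)) => x _; rewrite ReD.
by apply: (smooth_eq oU _ (smoothD oU fi gi)) => x _; rewrite ImD.
Qed.

Lemma smoothcM U f g : open U -> smoothc U f -> smoothc U g ->
  smoothc U (fun u => f u * g u).
Proof.
move=> oU [fr fi] [gr gi]; split.
  apply: (smooth_eq oU _ (smoothB oU (smoothM oU fr gr) (smoothM oU fi gi))).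
  by move=> x _; rewrite ReM.
apply: (smooth_eq oU _ (smoothD oU (smoothM oU fr gi) (smoothM oU fi gr))).
by move=> x _; rewrite ImM.
Qed.

Lemma smoothcJ U f : open U -> smoothc U f -> smoothc U (fun u => (f u)^*%C).
Proof.
move=> oU [fr fi]; split; first by apply: (smooth_eq oU _ fr) => x _; rewrite ReJ.
by apply: (smooth_eq oU _ (smoothN oU fi)) => x _; rewrite ImJ.
Qed.

Lemma smoothc_sum U (I : Type) (r : seq I) (F : I -> V -> R[i]) : open U ->
  (forall i, smoothc U (F i)) -> smoothc U (fun u => \sum_(i <- r) F i u).
Proof.
move=> oU sF; split.
  apply: (smooth_eq oU _ (smooth_sum r oU (fun i => (sF i).1))) => x _.
  by rewrite Re_sum.
apply: (smooth_eq oU _ (smooth_sum r oU (fun i => (sF i).2))) => x _.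
by rewrite Im_sum.
Qed.

Lemma smoothc_diff U f u : smoothc U f -> U u -> diffc f u.
Proof. by move=> [r i] Uu; split; [exact: (smooth_diff r)|exact: (smooth_diff i)]. Qed.

Lemma eq_on_Dc U f g u v : open U -> (forall x, U x -> f x = g x) -> U u ->
  Dc v f u = Dc v g u.
Proof.
move=> oU fg Uu; apply: complexP => /=;
  by apply: (eq_on_derive v oU _ Uu) => x Ux; rewrite fg.
Qed.

Lemma diffc_cst a u : diffc (fun=> a) u.
Proof. by split; exact: differentiable_cst. Qed.

Lemma Dc_cst a u v : Dc v (fun=> a) u = 0.
Proof. by apply: complexP => /=; exact: derive_cst. Qed.

Lemma diffcD f g u : diffc f u -> diffc g u -> diffc (fun x => f x + g x) u.
Proof.
move=> [fr fi] [gr gi]; split.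
  under eq_fun do rewrite ReD; exact: differentiableD.
under eq_fun do rewrite ImD; exact: differentiableD.
Qed.

Lemma DcD f g u v : diffc f u -> diffc g u ->
  Dc v (fun x => f x + g x) u = Dc v f u + Dc v g u.
Proof.
move=> [fr fi] [gr gi]; apply: complexP => /=.
  under eq_fun do rewrite ReD.
  by rewrite deriveD//; exact: diff_derivable.
under eq_fun do rewrite ImD.
by rewrite deriveD//; exact: diff_derivable.
Qed.

Lemma diffcM f g u : diffc f u -> diffc g u -> diffc (fun x => f x * g x) u.
Proof.
move=> [fr fi] [gr gi]; split.
  under eq_fun do rewrite ReM.
  by apply: differentiableB; apply: differentiableM.
under eq_fun do rewrite ImM.
by apply: differentiableD; apply: differentiableM.
Qed.

Lemma DcM f g u v : diffc f u -> diffc g u ->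
  Dc v (fun x => f x * g x) u = Dc v f u * g u + f u * Dc v g u.
Proof.
move=> [fr fi] [gr gi]; apply: complexP; rewrite ?ReD ?ReM ?ImD ?ImM /=.
  under eq_fun do rewrite ReM.
  rewrite deriveB; [|by apply: derivableM; exact: diff_derivable..].
  rewrite !deriveM; [|by exact: diff_derivable..].
  exact: re_leibniz.
under eq_fun do rewrite ImM.
rewrite deriveD; [|by apply: derivableM; exact: diff_derivable..].
rewrite !deriveM; [|by exact: diff_derivable..].
exact: im_leibniz.
Qed.

Lemma diffcJ f u : diffc f u -> diffc (fun x => (f x)^*%C) u.
Proof.
move=> [fr fi]; split; first by under eq_fun do rewrite ReJ.
by under eq_fun do rewrite ImJ; exact: differentiableN.
Qed.

Lemma DcJ f u v : diffc f u -> Dc v (fun x => (f x)^*%C) u = (Dc v f u)^*%C.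
Proof.
move=> [fr fi]; apply: complexP => /=; first by under eq_fun do rewrite ReJ.
under eq_fun do rewrite ImJ.
by rewrite deriveN//; exact: diff_derivable.
Qed.

Lemma diffc_sum (I : Type) (r : seq I) (F : I -> V -> R[i]) u :
  (forall i, diffc (F i) u) -> diffc (fun x => \sum_(i <- r) F i x) u /\
  forall v, Dc v (fun x => \sum_(i <- r) F i x) u = \sum_(i <- r) Dc v (F i) u.
Proof.
move=> dF; elim: r => [|i r [IHd IHr]].
  under eq_fun do rewrite big_nil.
  by split=> [|v]; [exact: diffc_cst | rewrite big_nil Dc_cst].
under eq_fun do rewrite big_cons.
by split=> [|v]; [exact: diffcD | rewrite big_cons DcD// IHr].
Qed.

Lemma derive_scalev (f : V -> R^o) u (a : R) v : differentiable f u ->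
  'D_(a *: v) f u = a * 'D_v f u.
Proof. by move=> df; rewrite !deriveE// linearZ. Qed.

Lemma derive_addv (f : V -> R^o) u v w : differentiable f u ->
  'D_(v + w) f u = 'D_v f u + 'D_w f u.
Proof. by move=> df; rewrite !deriveE// linearD. Qed.

Lemma DcZv f u (a : R) v : diffc f u -> Dc (a *: v) f u = a%:C * Dc v f u.
Proof.
move=> [fr fi]; apply: complexP; rewrite ?ReM ?ImM; cbn [complex.Re complex.Im Dc].
  by rewrite derive_scalev// mul0r subr0.
by rewrite derive_scalev// mul0r addr0.
Qed.

Lemma DcDv f u v w : diffc f u -> Dc (v + w) f u = Dc v f u + Dc w f u.
Proof.
by move=> [fr fi]; apply: complexP; rewrite ?ReD ?ImD; cbn [complex.Re complex.Im Dc];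
  rewrite derive_addv.
Qed.

End Complex_calculus.

(** * Matrix-valued maps *)

Section Matrix_calculus.
Context {R : realType} {V : normedModType R} {m : nat}.
Implicit Types (U : set V) (F G : V -> cmat R m) (u v : V).

Definition diff_mx F u := forall i j, diffc (fun x => F x i j) u.

Lemma derive_mxE F u v i j : derive_mx F u v i j = Dc v (fun x => F x i j) u.
Proof. by rewrite mxE. Qed.

Lemma smooth_mx_eq U F G : open U -> (forall x, U x -> F x = G x) ->
  smooth_mx U F -> smooth_mx U G.
Proof.
by move=> oU FG sF i j; apply: (smoothc_eq oU _ (sF i j)) => x Ux; rewrite FG.
Qed.

Lemma smooth_mx_diff U F u : smooth_mx U F -> U u -> diff_mx F u.
Proof. by move=> sF Uu i j; exact: (smoothc_diff (sF i j)). Qed.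

Lemma smooth_mx_derive U F v : smooth_mx U F -> smooth_mx U (fun u => derive_mx F u v).
Proof.
move=> sF i j; have [r k] := sF i j; split.
  by under eq_fun do rewrite derive_mxE; exact: (smooth_derive v r).
by under eq_fun do rewrite derive_mxE; exact: (smooth_derive v k).
Qed.

Lemma smooth_mx_sub U U' F : U `<=` U' -> smooth_mx U' F -> smooth_mx U F.
Proof. by move=> UU' sF i j; split; apply: (smooth_sub UU'); case: (sF i j). Qed.

Lemma eq_on_derive_mx U F G u v : open U -> (forall x, U x -> F x = G x) -> U u ->
  derive_mx F u v = derive_mx G u v.
Proof.
move=> oU FG Uu; apply/matrixP => i j; rewrite !derive_mxE.
by apply: (eq_on_Dc v oU _ Uu) => x Ux; rewrite FG.
Qed.

Lemma smooth_mx_cst U A : smooth_mx U (fun=> A : cmat R m).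
Proof. by move=> i j; exact: smoothc_cst. Qed.

Lemma smooth_mxD U F G : open U -> smooth_mx U F -> smooth_mx U G ->
  smooth_mx U (fun x => F x + G x).
Proof.
move=> oU sF sG i j; apply: (smoothc_eq oU _ (smoothcD oU (sF i j) (sG i j))).
by move=> x _; rewrite mxE.
Qed.

Lemma smooth_mxZ U (a : V -> R[i]) F : open U -> smoothc U a -> smooth_mx U F ->
  smooth_mx U (fun x => a x *: F x).
Proof.
move=> oU sa sF i j; apply: (smoothc_eq oU _ (smoothcM oU sa (sF i j))).
by move=> x _; rewrite mxE.
Qed.

Lemma smooth_mxN U F : open U -> smooth_mx U F -> smooth_mx U (fun x => - F x).
Proof.
move=> oU sF; apply: (smooth_mx_eq oU _ (smooth_mxZ oU (smoothc_cst U (-1)) sF)).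
by move=> x _; rewrite scaleN1r.
Qed.

Lemma smooth_mxB U F G : open U -> smooth_mx U F -> smooth_mx U G ->
  smooth_mx U (fun x => F x - G x).
Proof. by move=> oU sF sG; apply: smooth_mxD => //; exact: smooth_mxN. Qed.

Lemma smooth_mxM U F G : open U -> smooth_mx U F -> smooth_mx U G ->
  smooth_mx U (fun x => F x *m G x).
Proof.
move=> oU sF sG i j.
apply: (smoothc_eq oU _ (smoothc_sum _ oU (fun k => smoothcM oU (sF i k) (sG k j)))).
by move=> x _; rewrite mxE.
Qed.

Lemma smooth_mx_sum U (I : Type) (r : seq I) (F : I -> V -> cmat R m) : open U ->
  (forall i, smooth_mx U (F i)) -> smooth_mx U (fun u => \sum_(i <- r) F i u).
Proof.
move=> oU sF i j.
apply: (smoothc_eq oU _ (smoothc_sum r oU (fun k => sF k i j))).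
by move=> x _; rewrite summxE.
Qed.

Lemma smooth_mxT U F : smooth_mx U F -> smooth_mx U (fun x => (F x)^T).
Proof. by move=> sF i j; under eq_fun do rewrite mxE; under [X in _ /\ smooth _ X]eq_fun do rewrite mxE; exact: sF. Qed.

Lemma smooth_mxJ U F : open U -> smooth_mx U F ->
  smooth_mx U (fun x => map_mx conjc (F x)).
Proof.
move=> oU sF i j; apply: (smoothc_eq oU _ (smoothcJ oU (sF i j))).
by move=> x _; rewrite mxE.
Qed.

Lemma smooth_trace U F : open U -> smooth_mx U F -> smoothc U (fun x => \tr (F x)).
Proof.
by move=> oU sF; apply: (smoothc_sum _ oU) => i; exact: sF.
Qed.

Lemma smooth_gmet U F G : open U -> smooth_mx U F -> smooth_mx U G ->
  smooth U (fun x => gmet (F x) (G x) : R^o).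
Proof.
move=> oU sF sG; apply: smoothM => //; last exact: smooth_cst.
by case: (smooth_trace oU (smooth_mxM oU sF sG)).
Qed.

Lemma entryD F G i j : (fun x => (F x + G x) i j) = (fun x => F x i j + G x i j).
Proof. by apply/funext => x; rewrite mxE. Qed.

Lemma entryZ (a : V -> R[i]) F i j :
  (fun x => (a x *: F x) i j) = (fun x => a x * F x i j).
Proof. by apply/funext => x; rewrite mxE. Qed.

Lemma entryM F G i j :
  (fun x => (F x *m G x) i j) = (fun x => \sum_k F x i k * G x k j).
Proof. by apply/funext => x; rewrite mxE. Qed.

Lemma diff_mx_cst A u : diff_mx (fun=> A : cmat R m) u.
Proof. by move=> i j; exact: diffc_cst. Qed.

Lemma derive_mx_cst A u v : derive_mx (fun=> A : cmat R m) u v = 0.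
Proof. by apply/matrixP => i j; rewrite derive_mxE Dc_cst mxE. Qed.

Lemma diff_mxD F G u : diff_mx F u -> diff_mx G u -> diff_mx (fun x => F x + G x) u.
Proof.
by move=> dF dG i j; rewrite entryD; exact: diffcD.
Qed.

Lemma derive_mxD F G u v : diff_mx F u -> diff_mx G u ->
  derive_mx (fun x => F x + G x) u v = derive_mx F u v + derive_mx G u v.
Proof.
move=> dF dG; apply/matrixP => i j; by rewrite [RHS]mxE !derive_mxE entryD DcD.
Qed.

Lemma diff_mxZ (a : V -> R[i]) F u : diffc a u -> diff_mx F u ->
  diff_mx (fun x => a x *: F x) u.
Proof.
by move=> dF dG i j; rewrite entryZ; exact: diffcM.
Qed.

Lemma derive_mxZ (a : V -> R[i]) F u v : diffc a u -> diff_mx F u ->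
  derive_mx (fun x => a x *: F x) u v = Dc v a u *: F u + a u *: derive_mx F u v.
Proof.
move=> da dF; apply/matrixP => i j; rewrite [RHS]mxE [X in X + _]mxE [X in _ + X]mxE !derive_mxE.
by rewrite entryZ DcM.
Qed.

Lemma diff_mxN F u : diff_mx F u -> diff_mx (fun x => - F x) u.
Proof.
move=> dF; have := diff_mxZ (diffc_cst (-1) u) dF.
by under eq_fun do rewrite scaleN1r.
Qed.

Lemma derive_mxN F u v : diff_mx F u ->
  derive_mx (fun x => - F x) u v = - derive_mx F u v.
Proof.
move=> dF; have := derive_mxZ v (diffc_cst (-1) u) dF.
by under eq_fun do rewrite scaleN1r; rewrite Dc_cst scale0r add0r scaleN1r.
Qed.

Lemma diff_mxB F G u : diff_mx F u -> diff_mx G u -> diff_mx (fun x => F x - G x) u.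
Proof. by move=> dF dG; apply: diff_mxD => //; exact: diff_mxN. Qed.

Lemma derive_mxB F G u v : diff_mx F u -> diff_mx G u ->
  derive_mx (fun x => F x - G x) u v = derive_mx F u v - derive_mx G u v.
Proof. by move=> dF dG; rewrite derive_mxD ?derive_mxN//; exact: diff_mxN. Qed.

Lemma diff_mxM F G u : diff_mx F u -> diff_mx G u -> diff_mx (fun x => F x *m G x) u.
Proof.
move=> dF dG i j; rewrite entryM.
by case: (@diffc_sum _ _ _ (index_enum _) (fun k x => F x i k * G x k j) u
  (fun k => diffcM (dF i k) (dG k j))).
Qed.

Lemma derive_mxM F G u v : diff_mx F u -> diff_mx G u ->
  derive_mx (fun x => F x *m G x) u v = derive_mx F u v *m G u + F u *m derive_mx G u v.
Proof.
move=> dF dG; apply/matrixP => i j; rewrite derive_mxE entryM !mxE -big_split/=.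
case: (@diffc_sum _ _ _ (index_enum _) (fun k x => F x i k * G x k j) u
  (fun k => diffcM (dF i k) (dG k j))) => _ ->.
by apply: eq_bigr => k _; rewrite DcM// !derive_mxE.
Qed.

Lemma diff_mx_sum (I : Type) (r : seq I) (F : I -> V -> cmat R m) u :
  (forall i, diff_mx (F i) u) -> diff_mx (fun x => \sum_(i <- r) F i x) u /\
  forall v, derive_mx (fun x => \sum_(i <- r) F i x) u v = \sum_(i <- r) derive_mx (F i) u v.
Proof.
move=> dF; elim: r => [|i r [IHd IHr]].
  under eq_fun do rewrite big_nil.
  by split=> [|v]; [exact: diff_mx_cst | rewrite big_nil derive_mx_cst].
under eq_fun do rewrite big_cons.
by split=> [|v]; [exact: diff_mxD | rewrite big_cons derive_mxD// IHr].
Qed.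

Lemma diff_mxT F u : diff_mx F u -> diff_mx (fun x => (F x)^T) u.
Proof. by move=> dF i j; under eq_fun do rewrite mxE; exact: dF. Qed.

Lemma derive_mxT F u v : derive_mx (fun x => (F x)^T) u v = (derive_mx F u v)^T.
Proof. by apply/matrixP => i j; rewrite !mxE; congr (_ +i* _); congr ('D_v _ u); apply/funext => x; rewrite mxE. Qed.

Lemma diff_mxJ F u : diff_mx F u -> diff_mx (fun x => map_mx conjc (F x)) u.
Proof. by move=> dF i j; under eq_fun do rewrite mxE; exact: diffcJ. Qed.

Lemma derive_mxJ F u v : diff_mx F u ->
  derive_mx (fun x => map_mx conjc (F x)) u v = map_mx conjc (derive_mx F u v).
Proof.
move=> dF; apply/matrixP => i j; rewrite !derive_mxE !mxE -DcJ; last exact: dF.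
by under eq_fun do rewrite mxE.
Qed.

Lemma diffc_trace F u : diff_mx F u -> diffc (fun x => \tr (F x)) u.
Proof. by move=> dF; case: (@diffc_sum _ _ _ (index_enum _) (fun k x => F x k k) u (fun k => dF k k)). Qed.

Lemma Dc_trace F u v : diff_mx F u -> Dc v (fun x => \tr (F x)) u = \tr (derive_mx F u v).
Proof.
move=> dF; case: (@diffc_sum _ _ _ (index_enum _) (fun k x => F x k k) u (fun k => dF k k)) => _ ->.
by apply: eq_bigr => k _; rewrite derive_mxE.
Qed.

Lemma diff_gmet F G u : diff_mx F u -> diff_mx G u ->
  differentiable (fun x => gmet (F x) (G x) : R^o) u.
Proof.
by move=> dF dG; apply: differentiableM => //; case: (diffc_trace (diff_mxM dF dG)).
Qed.

Lemma derive_gmet F G u v : diff_mx F u -> diff_mx G u ->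
  'D_v (fun x => gmet (F x) (G x) : R^o) u =
  gmet (derive_mx F u v) (G u) + gmet (F u) (derive_mx G u v).
Proof.
move=> dF dG; have dFG := diff_mxM dF dG; have [dr _] := diffc_trace dFG.
rewrite /gmet -mulrDl -ReD -raddfD/= -derive_mxM// -Dc_trace//=.
rewrite (@deriveMr _ _ (fun x => complex.Re (\tr (F x *m G x)))) 1?mulrC//.
exact: diff_derivable.
Qed.

Lemma derive_mxZv F u (a : R) v : diff_mx F u ->
  derive_mx F u (a *: v) = a%:C *: derive_mx F u v.
Proof. by move=> dF; apply/matrixP => i j; rewrite [RHS]mxE !derive_mxE DcZv. Qed.

Lemma derive_mxDv F u v w : diff_mx F u ->
  derive_mx F u (v + w) = derive_mx F u v + derive_mx F u w.
Proof. by move=> dF; apply/matrixP => i j; rewrite [RHS]mxE !derive_mxE DcDv. Qed.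

End Matrix_calculus.

(** * Mean values on segments and symmetry of second derivatives *)

Section Segments.
Context {R : realType} {V : normedModType R}.
Implicit Types (U : set V) (f g : V -> R^o) (u v w x : V).

Lemma is_derive_segment f x w (t : R) : differentiable f (x + t *: w) ->
  is_derive t (1 : R) (fun s : R => f (x + s *: w)) ('D_w f (x + t *: w)).
Proof.
move=> df.
have dl : differentiable (fun s : R => x + s *: w) t.
  by apply: differentiableD => //; apply: differentiableZl.
have dc : differentiable (fun s : R => f (x + s *: w)) t by exact: differentiable_comp.
split; first exact: diff_derivable.
rewrite deriveE// (@diff_comp _ _ _ _ (fun s : R => x + s *: w) f)//= -!deriveE//.
congr ('D__ _ _).
rewrite (_ : (fun s : R => _) = cst x + (fun s : R => s *: w))//.
have ds : differentiable (fun s : R => s *: w) t by apply: differentiableZl.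
rewrite deriveD //; [|exact: diff_derivable..].
rewrite [X in X + _](derive_cst x t) add0r deriveE//.
by case: (is_diff_scalel t w) => _ ->; rewrite scale1r.
Qed.

Lemma segment_MVT f x w (h : R) : 0 < h ->
  (forall t, 0 <= t <= h -> differentiable f (x + t *: w)) ->
  exists2 t, 0 < t < h & f (x + h *: w) - f x = 'D_w f (x + t *: w) * h.
Proof.
move=> h0 df.
have [||t] := @MVT R (fun s => f (x + s *: w)) (fun s => 'D_w f (x + s *: w)) 0 h h0.
- move=> t; rewrite in_itv/= => /andP[t0 th].
  by apply: is_derive_segment; apply: df; rewrite !ltW.
- apply: derivable_within_continuous => t; rewrite in_itv/= => /df /is_derive_segment.
  by case.
- by rewrite in_itv/= scale0r addr0 subr0 => th Et; exists t.
Qed.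

(** The mean value theorem is applied to the increment of [f] along [w] on a segment in direction
    [v], then to ['D_v f] on a segment in direction [w]. *)
Lemma second_difference_MVT U f u v w (h : R) : open U -> smooth U f -> 0 < h ->
  (forall s t, 0 <= s <= h -> 0 <= t <= h -> U (u + s *: v + t *: w)) ->
  exists s t, [/\ 0 <= s <= h, 0 <= t <= h &
    f (u + h *: v + h *: w) - f (u + h *: v) - (f (u + h *: w) - f u) =
    'D_w (fun x => 'D_v f x : R^o) (u + s *: v + t *: w) * h * h].
Proof.
move=> oU sf h0 inU.
have hh : 0 <= h <= h by rewrite lexx ltW.
have h00 : 0 <= (0 : R) <= h by rewrite lexx ltW.
have lein t : 0 < t < h -> 0 <= t <= h by move=> /andP[? ?]; rewrite !ltW.
pose g (x : V) : R^o := f (x + h *: w) - f x.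
have dsh x : U (x + h *: w) -> differentiable (fun y => f (y + h *: w)) x.
  move=> Ux; apply: (@differentiable_comp _ _ _ _ (fun y => y + h *: w) f).
    by apply: differentiableD.
  exact: (smooth_diff sf).
have Dsh x : U (x + h *: w) -> 'D_v (fun y => f (y + h *: w)) x = 'D_v f (x + h *: w).
  move=> Ux; rewrite deriveE; last exact: dsh.
  rewrite (@diff_comp _ _ _ _ (fun y => y + h *: w) f)//=; last exact: (smooth_diff sf).
  rewrite -deriveE; last exact: (smooth_diff sf).
  congr ('D__ _ _); rewrite -deriveE; last by apply: differentiableD.
  rewrite (_ : (fun y : V => _) = id + cst (h *: w))//.
  by rewrite deriveD// derive_id derive_cst addr0.
have [t0 ht0|s hs Es] := @segment_MVT g u v h h0.
  apply: differentiableB; first by apply: dsh; exact: inU.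
  by apply: (smooth_diff sf); have := inU _ _ ht0 h00; rewrite scale0r addr0.
have [t0 ht0|t ht Et] := @segment_MVT (fun x => 'D_v f x) (u + s *: v) w h h0.
  by apply: (smooth_diff (smooth_derive v sf)); apply: inU => //; exact: lein.
exists s, t; split; [exact: lein|exact: lein|].
rewrite -Et; rewrite /g in Es; rewrite Es; congr (_ * _).
have Us := inU _ _ (lein _ hs) hh.
have Us0 := inU _ _ (lein _ hs) h00; rewrite scale0r addr0 in Us0.
rewrite deriveB; [by rewrite Dsh | by apply: diff_derivable; exact: dsh|].
by apply: diff_derivable; exact: (smooth_diff sf).
Qed.

Lemma subBBAC (A : zmodType) (a b c d : A) : a - b - (c - d) = a - c - (b - d).
Proof. by rewrite !opprB addrACA [RHS]addrACA [- b - c]addrC. Qed.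

(** The second difference over a small parallelogram does not depend on the order of its sides. It
    equals [h * h] times either mixed derivative at some nearby point, and both mixed derivatives
    are continuous. *)
Lemma second_derive_symmetric U f u v w : open U -> U u -> smooth U f ->
  'D_v (fun x => 'D_w f x : R^o) u = 'D_w (fun x => 'D_v f x : R^o) u.
Proof.
move=> oU Uu sf.
have svw := smooth_derive v (smooth_derive w sf).
have swv := smooth_derive w (smooth_derive v sf).
apply/eqP; rewrite -subr_eq0 -normr_le0; apply/ler_addgt0Pl => e e0; rewrite addr0.
have c1 : \forall x \near u, `|'D_v (fun x => 'D_w f x : R^o) u -
    'D_v (fun x => 'D_w f x : R^o) x| < e / 2.
  have /cvgrPdist_lt := svw 0%N u Uu; apply; exact: divr_gt0.
have c2 : \forall x \near u, `|'D_w (fun x => 'D_v f x : R^o) u -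
    'D_w (fun x => 'D_v f x : R^o) x| < e / 2.
  have /cvgrPdist_lt := swv 0%N u Uu; apply; exact: divr_gt0.
have /nbhs_ballP[r /= r0 Hr] : \forall x \near u, [/\ U x,
   `|'D_v (fun x => 'D_w f x : R^o) u - 'D_v (fun x => 'D_w f x : R^o) x| < e / 2 &
   `|'D_w (fun x => 'D_v f x : R^o) u - 'D_w (fun x => 'D_v f x : R^o) x| < e / 2].
  by apply: filterS3 (near_open oU Uu) c1 c2 => x.
(* With this [h] every point of the parallelogram lies within [r / 2] of [u]. *)
pose h := r / (2 * (`|v| + `|w| + 1)).
have n0 : 0 < `|v| + `|w| + 1 by rewrite ltr_wpDl// addr_ge0.
have h0 : 0 < h by rewrite divr_gt0// mulr_gt0.
have inball s t : 0 <= s <= h -> 0 <= t <= h -> ball u r (u + s *: v + t *: w).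
  move=> /andP[s0 sh] /andP[t0 th].
  rewrite -ball_normE /ball_/= -addrA opprD addrA subrr add0r normrN.
  apply: (le_lt_trans (ler_normD _ _)); rewrite !normrZ !ger0_norm//.
  apply: (@le_lt_trans _ _ (h * (`|v| + `|w| + 1))).
    rewrite !mulrDr mulr1 -[leLHS]addr0; apply: lerD; last exact: ltW.
    by apply: lerD; apply: ler_wpM2r.
  have -> : h * (`|v| + `|w| + 1) = r / 2 by rewrite /h; field; rewrite gt_eqF.
  by rewrite ltr_pdivrMr// ltr_pMr// ltr1n.
have inU s t : 0 <= s <= h -> 0 <= t <= h -> U (u + s *: v + t *: w).
  by move=> hs ht; case: (Hr _ (inball _ _ hs ht)).
have [s [t [hs ht ED1]]] := second_difference_MVT oU sf h0 inU.
have inU' a b : 0 <= a <= h -> 0 <= b <= h -> U (u + a *: w + b *: v).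
  by move=> ha hb; rewrite addrAC; exact: inU.
have [s' [t' [hs' ht' ED2]]] := second_difference_MVT oU sf h0 inU'.
have [_ H1 _] := Hr _ (inball _ _ ht' hs').
have [_ _ H2] := Hr _ (inball _ _ hs ht).
have EE : 'D_w ('D_v f) (u + s *: v + t *: w) = 'D_v ('D_w f) (u + t' *: v + s' *: w).
  apply: (mulIf (lt0r_neq0 h0)); apply: (mulIf (lt0r_neq0 h0)).
  rewrite (addrAC u (t' *: v)).
  apply: etrans (esym ED1) (etrans _ ED2); rewrite (addrAC u (h *: w)).
  exact: subBBAC.
rewrite EE distrC in H2.
apply: ltW; rewrite (splitr e); apply: le_lt_trans (ltrD H1 H2).
by apply: le_trans (ler_normD _ _); rewrite addrA subrK.
Qed.

Lemma segment_constant f x w (h : R) : 0 < h ->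
  (forall t, 0 <= t <= h -> differentiable f (x + t *: w) /\ 'D_w f (x + t *: w) = 0) ->
  f (x + h *: w) = f x.
Proof.
move=> h0 H; have [t /H[]//|t /andP[t0 th] E] := @segment_MVT f x w h h0.
apply/eqP; rewrite -subr_eq0 E; have [|_ ->] := H t; first by rewrite !ltW.
by rewrite mul0r.
Qed.

End Segments.

Lemma derive_mx_symmetric {R : realType} {V : normedModType R} {m : nat}
    (U : set V) (F : V -> cmat R m) u v w : open U -> U u -> smooth_mx U F ->
  derive_mx (fun x => derive_mx F x w) u v = derive_mx (fun x => derive_mx F x v) u w.
Proof.
move=> oU Uu sF; apply/matrixP => i j; have [r k] := sF i j.
apply: etrans (derive_mxE _ _ _ _ _) (etrans _ (esym (derive_mxE _ _ _ _ _))).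
have E (z : V) : (fun x => derive_mx F x z i j) = (fun x => Dc z (fun y => F y i j) x).
  by apply/funext => x; exact: derive_mxE.
rewrite E [in RHS]E; apply: complexP.
  exact: (second_derive_symmetric v w oU Uu r).
exact: (second_derive_symmetric v w oU Uu k).
Qed.

(** * Adjoints and the trace metric *)

Section Adjoint.
Context {R : realType}.
Implicit Types (m n p : nat).

Lemma adjE m n (A : 'M[R[i]]_(m, n)) i j : A ^t* i j = (A j i)^*%C.
Proof. by rewrite !mxE. Qed.

Lemma adjM m n p (A : 'M[R[i]]_(m, n)) (B : 'M[R[i]]_(n, p)) :
  (A *m B)^t* = B^t* *m A^t*.
Proof. by rewrite trmx_mul map_mxM. Qed.

Lemma adjD m n (A B : 'M[R[i]]_(m, n)) : (A + B)^t* = A^t* + B^t*.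
Proof. by rewrite linearD/= map_mxD. Qed.

Lemma adjN m n (A : 'M[R[i]]_(m, n)) : (- A)^t* = - A^t*.
Proof. by rewrite linearN/= map_mxN. Qed.

Lemma adjB m n (A B : 'M[R[i]]_(m, n)) : (A - B)^t* = A^t* - B^t*.
Proof. by rewrite adjD adjN. Qed.

Lemma adjZ m n a (A : 'M[R[i]]_(m, n)) : (a *: A)^t* = a^*%C *: A^t*.
Proof. by rewrite linearZ/= map_mxZ. Qed.

Lemma adj1 n : (1%:M : 'M[R[i]]_n)^t* = 1%:M.
Proof. by rewrite trmx1 map_mx1. Qed.

Lemma adj0 m n : (0 : 'M[R[i]]_(m, n))^t* = 0.
Proof. by rewrite trmx0 map_mx0. Qed.

Lemma adjK m n (A : 'M[R[i]]_(m, n)) : A^t*^t* = A.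
Proof. exact: trmxCK. Qed.

Lemma tr_adj n (A : 'M[R[i]]_n) : \tr (A^t*) = (\tr A)^*%C.
Proof. by rewrite trace_map_mx mxtrace_tr. Qed.

Lemma Re_mulJ (x : R[i]) : complex.Re (x * x^*%C) = complex.Re x ^+ 2 + complex.Im x ^+ 2.
Proof. by case: x => a b /=; rewrite !expr2; ring. Qed.

Lemma Re_tr_adj m n (A : 'M[R[i]]_(m, n)) :
  complex.Re (\tr (A *m A^t*)) = \sum_i \sum_j (complex.Re (A i j) ^+ 2 + complex.Im (A i j) ^+ 2).
Proof.
rewrite Re_sum; apply: eq_bigr => i _; rewrite mxE Re_sum; apply: eq_bigr => j _.
by rewrite adjE Re_mulJ.
Qed.

Lemma Re_tr_adj_ge0 m n (A : 'M[R[i]]_(m, n)) : 0 <= complex.Re (\tr (A *m A^t*)).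
Proof. by rewrite Re_tr_adj; do 2! (apply: sumr_ge0 => ? _); rewrite addr_ge0// sqr_ge0. Qed.

Lemma Re_tr_adj_eq0 m n (A : 'M[R[i]]_(m, n)) : complex.Re (\tr (A *m A^t*)) = 0 -> A = 0.
Proof.
rewrite Re_tr_adj => /eqP; rewrite psumr_eq0 => [/allP H|i _]; last first.
  by apply: sumr_ge0 => ? _; rewrite addr_ge0// sqr_ge0.
apply/matrixP => i j; have := H i (mem_index_enum _); rewrite /= psumr_eq0 => [/allP H'|? _]; last first.
  by rewrite addr_ge0// sqr_ge0.
have := H' j (mem_index_enum _); rewrite /= paddr_eq0 ?sqr_ge0// !sqrf_eq0 mxE.
by case: (A i j) => a b /= /andP[/eqP -> /eqP ->].
Qed.

Lemma Re_trC n (A B : 'M[R[i]]_n) : complex.Re (\tr (A *m B)) = complex.Re (\tr (B *m A)).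
Proof. by rewrite mxtrace_mulC. Qed.

Lemma ReZ (a : R) (x : R[i]) : complex.Re (a%:C * x) = a * complex.Re x.
Proof. by rewrite ReM/= mul0r subr0. Qed.

End Adjoint.

Section Metric.
Context {R : realType} {m : nat}.
Implicit Types (X Y Z : cmat R m).

Lemma gmetC X Y : gmet X Y = gmet Y X.
Proof. by rewrite /gmet Re_trC. Qed.
Lemma gmetDl X Y Z : gmet (X + Y) Z = gmet X Z + gmet Y Z.
Proof. by rewrite /gmet mulmxDl linearD/= ReD mulrDl. Qed.
Lemma gmetDr X Y Z : gmet X (Y + Z) = gmet X Y + gmet X Z.
Proof. by rewrite gmetC gmetDl !(gmetC X). Qed.
Lemma gmetNl X Y : gmet (- X) Y = - gmet X Y.
Proof. by rewrite /gmet mulNmx linearN/= ReN mulNr. Qed.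
Lemma gmetNr X Y : gmet X (- Y) = - gmet X Y.
Proof. by rewrite gmetC gmetNl gmetC. Qed.
Lemma gmetBl X Y Z : gmet (X - Y) Z = gmet X Z - gmet Y Z.
Proof. by rewrite gmetDl gmetNl. Qed.
Lemma gmetBr X Y Z : gmet X (Y - Z) = gmet X Y - gmet X Z.
Proof. by rewrite gmetDr gmetNr. Qed.
Lemma gmetZl a X Y : gmet (a%:C *: X) Y = a * gmet X Y.
Proof. by rewrite /gmet -scalemxAl linearZ/= ReZ mulrA. Qed.
Lemma gmetZr a X Y : gmet X (a%:C *: Y) = a * gmet X Y.
Proof. by rewrite gmetC gmetZl gmetC. Qed.
Lemma gmet0l X : gmet 0 X = 0.
Proof. by rewrite /gmet mul0mx linear0 mul0r. Qed.
Lemma gmet0r X : gmet X 0 = 0.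
Proof. by rewrite gmetC gmet0l. Qed.
Lemma gmet_suml I r (P : pred I) (F : I -> cmat R m) X :
  gmet (\sum_(i <- r | P i) F i) X = \sum_(i <- r | P i) gmet (F i) X.
Proof. by apply: (big_morph (fun Y => gmet Y X)) => [Y Z|]; rewrite ?gmetDl ?gmet0l. Qed.
Lemma gmet_sumr I r (P : pred I) (F : I -> cmat R m) X :
  gmet X (\sum_(i <- r | P i) F i) = \sum_(i <- r | P i) gmet X (F i).
Proof. by rewrite gmetC gmet_suml; apply: eq_bigr => i _; rewrite gmetC. Qed.

Lemma gmet_ge0 X : X^t* = X -> 0 <= gmet X X.
Proof. by move=> hX; rewrite /gmet -{2}hX divr_ge0// Re_tr_adj_ge0. Qed.
Lemma gmet_eq0 X : X^t* = X -> gmet X X = 0 -> X = 0.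
Proof.
move=> hX /eqP; rewrite /gmet mulf_eq0 invr_eq0 pnatr_eq0 orbF => /eqP E.
by apply: Re_tr_adj_eq0; rewrite hX.
Qed.

End Metric.

(** * Linear algebra of the Grassmannian and of its tangent spaces *)

Section Grassmannian_tangent.
Context {R : realType} {m : nat}.
Implicit Types (P X Y H : cmat R m).

(** [U] is the Gram-Schmidt basis of the row space of [P]. Then [P U^t* U = P] and [U P = U], and
    the adjoint of the first identity turns [P] into [U^t* U]. *)
Lemma rank_projection_frame n (P : 'M[R[i]]_n) : P^t* = P -> P *m P = P ->
  exists2 U : 'M[R[i]]_(\rank P, n), U *m U^t* = 1%:M & U^t* *m U = P.
Proof.
move=> hP PP; pose U := schmidt (row_base P).
have Uu : U *m U^t* = 1%:M.
  by apply/unitarymxP; apply: schmidt_unitarymx; exact: rank_leq_col.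
have UP : (U :=: P)%MS.
  by apply: eqmx_trans (eq_row_base P); apply: eqmx_schmidt_free; exact: row_base_free.
exists U => //.
have /submxP[Z EZ] : (U <= P)%MS by rewrite UP.
have /submxP[Y EY] : (P <= U)%MS by rewrite UP.
have E1 : P *m (U^t* *m U) = P by rewrite {1}EY -!mulmxA (mulmxA U) Uu mul1mx -EY.
have E2 : U *m P = U by rewrite EZ -mulmxA PP.
have E3 : (P *m (U^t* *m U))^t* = U^t* *m U by rewrite !adjM adjK hP -!mulmxA E2.
by rewrite -E3 E1 hP.
Qed.

Lemma trace_projection n (P : 'M[R[i]]_n) : P^t* = P -> P *m P = P ->
  \tr P = (\rank P)%:R.
Proof.
by move=> hP PP; have [U UU {1}<-] := rank_projection_frame hP PP; rewrite mxtrace_mulC UU mxtrace1.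
Qed.

Lemma G2_frame P : G2 R m P ->
  exists K : 'M[R[i]]_(m.+2, 2), exists L : 'M[R[i]]_(m.+2, m),
  [/\ K^t* *m K = 1%:M, K *m K^t* = P, L^t* *m L = 1%:M, L *m L^t* = 1%:M - P &
      K^t* *m L = 0].
Proof.
move=> [hP PP rP].
have hQ : (1%:M - P)^t* = 1%:M - P by rewrite adjB adj1 hP.
have QQ : (1%:M - P) *m (1%:M - P) = 1%:M - P.
  by rewrite mulmxBl !mulmxBr !mul1mx !mulmx1 PP subrr subr0.
have rQ : \rank (1%:M - P) = m.
  have := trace_projection hQ QQ; rewrite linearB/= mxtrace1 (trace_projection hP PP) rP.
  rewrite -natrB// subn2/= => /eqP; rewrite eqr_nat => /eqP //.
have [U UU UP] : exists2 U : 'M[R[i]]_(2, m.+2), U *m U^t* = 1%:M & U^t* *m U = P.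
  by have := rank_projection_frame hP PP; case: (\rank P) / (esym rP).
have [W WW WP] : exists2 U : 'M[R[i]]_(m, m.+2), U *m U^t* = 1%:M & U^t* *m U = 1%:M - P.
  by have := rank_projection_frame hQ QQ; case: (\rank (1%:M - P)) / (esym rQ).
exists (U^t*), (W^t*); rewrite !adjK; split => //.
have E : U *m P = U by rewrite -UP mulmxA UU mul1mx.
have E' : P *m W^t* = 0.
  have : (1%:M - P) *m W^t* = W^t* by rewrite -WP -mulmxA WW mulmx1.
  by rewrite mulmxBl mul1mx => /eqP; rewrite subr_eq addrC -subr_eq subrr => /eqP.
by rewrite -E -mulmxA E' mulmx0.
Qed.

Lemma G2_trace P : G2 R m P -> \tr P = 2%:R.
Proof. by move=> [hP PP rP]; rewrite trace_projection// rP. Qed.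

Lemma G2_projP P H : G2 R m P -> H^t* = H -> G2_tangent P (G2_proj P H).
Proof.
move=> [hP PP _] hH; rewrite /G2_proj; split.
  by rewrite adjD !adjM adjB adj1 hP hH !mulmxA addrC.
have ok : nc_ok [:: P; H] [:: (0, 0, NRlet 0)]%N by [].
by nc ok; ring.
Qed.

Lemma G2_tangent_PXP P X : G2 R m P -> G2_tangent P X -> P *m X *m P = 0.
Proof.
move=> [hP PP _] [_ E]; have := f_equal (fun Z => P *m Z *m P) E.
rewrite mulmxDr mulmxDl !mulmxA PP -!mulmxA PP => /eqP.
by rewrite -subr_eq0 addrK => /eqP.
Qed.

Lemma G2_proj_id P X : G2 R m P -> G2_tangent P X -> G2_proj P X = X.
Proof.
move=> hP hX; have E := G2_tangent_PXP hP hX; case: hX => _ EX.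
by rewrite /G2_proj mulmxBr mulmxBl mulmx1 mul1mx mulmxBl E !subr0 EX.
Qed.

Lemma gmet_G2_proj P H X : G2 R m P -> G2_tangent P X -> gmet (G2_proj P H) X = gmet H X.
Proof.
move=> hP hX; rewrite -[in RHS](G2_proj_id hP hX) /gmet /G2_proj.
congr (complex.Re _ / _).
have ok : nc_ok [:: P; H; X] [:: (0, 0, NRlet 0)]%N by case: hP => _ PP _; split.
by nc ok; ring.
Qed.


(* Real coordinates of the tangent space at P, seen as Hom (im P, (im P)^perp). *)
Lemma G2_tangent_coordinates P : G2 R m P ->
  exists (phi : cmat R m -> 'rV[R]_(m * 2 + m * 2)) (psi : 'rV[R]_(m * 2 + m * 2) -> cmat R m),
  [/\ forall a X Y, phi (a%:C *: X + Y) = a *: phi X + phi Y,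
      forall a x y, psi (a *: x + y) = a%:C *: psi x + psi y &
      forall X, G2_tangent P X -> psi (phi X) = X].
Proof.
move=> hP; have [K [L [KK KP LL LP KL]]] := G2_frame hP.
pose phi X : 'rV[R]_(m * 2 + m * 2) :=
  row_mx (mxvec (map_mx (@complex.Re R) (L^t* *m X *m K)))
         (mxvec (map_mx (@complex.Im R) (L^t* *m X *m K))).
pose z (x : 'rV[R]_(m * 2 + m * 2)) : 'M[R[i]]_(m, 2) :=
  \matrix_(i, j) (vec_mx (lsubmx x) i j +i* vec_mx (rsubmx x) i j).
exists phi, (fun x => L *m z x *m K^t* + (L *m z x *m K^t*)^t*); split.
- move=> a X Y; rewrite /phi mulmxDr mulmxDl -scalemxAr -scalemxAl.
  move: (L^t* *m X *m K) (L^t* *m Y *m K) => A B.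
  rewrite scale_row_mx add_row_mx -!linearZ/= -!linearD/=.
  congr (row_mx (mxvec _) (mxvec _)); apply/matrixP => i j; rewrite !mxE.
    by rewrite ReD ReZ.
  by rewrite ImD ImM/= mul0r addr0.
- move=> a x y; have -> : z (a *: x + y) = a%:C *: z x + z y.
    apply/matrixP => i j; rewrite !mxE; apply: complexP; rewrite ?ReD ?ImD ?ReM ?ImM/= ?mxE.
      by rewrite mul0r subr0.
    by rewrite mul0r addr0.
  rewrite mulmxDr mulmxDl -scalemxAr -scalemxAl adjD adjZ conjc_real scalerDr.
  by rewrite addrACA.
- move=> X hX; have -> : z (phi X) = L^t* *m X *m K.
    apply/matrixP => i j; rewrite mxE row_mxKl row_mxKr !mxvecK ![map_mx _ _ _ _]mxE.
    by apply: complexP.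
  rewrite !mulmxA LP -mulmxA KP !adjM adjB adj1.
  by rewrite (proj1 hX); have [-> _ _] := hP; rewrite addrC mulmxA; exact: G2_proj_id.
Qed.

(** A dimension count: the tangent space of the Grassmannian has real dimension [4m], its vectors
    orthogonal to [N] form a space of dimension [4m - 1], and the injective [D] must fill it. The
    count is made with ranks in real coordinates. *)
Lemma hyperplane_surj P N (n : nat) (D : 'rV[R]_n -> cmat R m) :
  G2 R m P -> G2_tangent P N -> gmet N N = 1 -> (0 < m)%N -> n = (4 * m).-1 ->
  (forall a v w, D (a *: v + w) = a%:C *: D v + D w) ->
  (forall v, D v = 0 -> v = 0) ->
  (forall v, G2_tangent P (D v) /\ gmet N (D v) = 0) ->
  forall X, G2_tangent P X -> gmet N X = 0 -> exists v, X = D v.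
Proof.
move=> hP hN NN m0 En Dlin Dinj DT X hX NX.
have [phi [psi [phil psil psiK]]] := G2_tangent_coordinates hP.
have fl : linear (phi \o D) by move=> a v w /=; rewrite Dlin phil.
pose f : {linear 'rV[R]_n -> 'rV[R]_(m * 2 + m * 2)} :=
  HB.pack (phi \o D) (GRing.isLinear.Build R _ _ _ _ fl).
have gl : linear (fun x => (gmet N (psi x))%:M : 'rV[R]_1).
  by move=> a x y; rewrite psil gmetDr gmetZr raddfD/= -scale_scalar_mx.
pose g : {linear 'rV[R]_(m * 2 + m * 2) -> 'rV[R]_1} :=
  HB.pack (fun x => (gmet N (psi x))%:M : 'rV[R]_1) (GRing.isLinear.Build R _ _ _ _ gl).
have Ag (v : 'rV_n) : v *m lin1_mx f *m lin1_mx g = 0.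
  rewrite !mul_rV_lin1 /= psiK; last by case: (DT v).
  by case: (DT v) => _ ->; rewrite -scalemx1 scale0r.
have Afree : row_free (lin1_mx f).
  apply: inj_row_free => v; rewrite mul_rV_lin1 /= => E; apply: Dinj.
  rewrite -(psiK (D v)); last by case: (DT v).
  have := psil 0 0 (0 : 'rV_(m * 2 + m * 2)); rewrite !scale0r !add0r E => {}E.
  by have := psil 1 0 (0 : 'rV_(m * 2 + m * 2)); rewrite !scale1r addr0 => /eqP; rewrite -subr_eq subrr eq_sym => /eqP.
have sub : (lin1_mx f <= kermx (lin1_mx g))%MS.
  apply/sub_kermxP/row_matrixP => i; rewrite row_mul rowE Ag row0 //.
have rg : \rank (lin1_mx g) = 1%N.
  apply/eqP; rewrite eqn_leq rank_leq_col lt0n mxrank_eq0; apply/eqP => E.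
  have := mul_rV_lin1 g (phi N); rewrite E mulmx0 /= psiK// NN => /matrixP/(_ 0 0).
  by rewrite !mxE eqxx => /eqP; rewrite eq_sym oner_eq0.
have nE : (n == (m * 2 + m * 2 - 1))%N by rewrite En -mulnDr mulnC subn1.
have [_] := mxrank_leqif_eq sub; rewrite mxrank_ker rg (eqP Afree) nE.
move=> /esym/andP[_ sub'].
have : (phi X <= lin1_mx f)%MS.
  apply: submx_trans sub'; apply/sub_kermxP; rewrite mul_rV_lin1 /= psiK// NX.
  by rewrite -scalemx1 scale0r.
move=> /submxP[v]; rewrite mul_rV_lin1 /= => E; exists v.
by rewrite -(psiK X hX) E psiK//; case: (DT v).
Qed.

(** The Gram matrix of the vectors [D e_i] is invertible because [gmet] is definite on Hermitian
    matrices, and its inverse gives the dual family. Pairing with [C j] recovers coordinates from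
    ambient matrices, which serves as a first-order inverse of the immersion. *)
Lemma dual_frame n (D : 'rV[R]_n -> cmat R m) :
  (forall a v w, D (a *: v + w) = a%:C *: D v + D w) ->
  (forall v, D v = 0 -> v = 0) -> (forall v, (D v)^t* = D v) ->
  exists C : 'I_n -> cmat R m, forall j w, gmet (C j) (D w) = w 0 j.
Proof.
move=> Dl Dinj Dh; have D0 : D 0 = 0.
  by have := Dl 1 0 0; rewrite !scale1r addr0 => /eqP; rewrite -subr_eq subrr eq_sym => /eqP.
have Dsum (w : 'rV_n) : D w = \sum_j (w 0 j)%:C *: D (delta_mx 0 j).
  have Dadd : {morph D : x y / x + y} by move=> x y; rewrite -[x]scale1r Dl !scale1r.
  rewrite {1}[w]row_sum_delta (big_morph D Dadd D0); apply: eq_bigr => j _.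
  by rewrite -[_ *: delta_mx _ _]addr0 Dl D0 addr0.
pose G : 'M[R]_n := \matrix_(i, j) gmet (D (delta_mx 0 i)) (D (delta_mx 0 j)).
have Gu : G \in unitmx.
  rewrite -row_free_unit; apply: inj_row_free => v vG; apply: Dinj.
  apply: gmet_eq0 => //; rewrite {2}(Dsum v) gmet_sumr big1 // => j _.
  rewrite gmetZr; have /matrixP/(_ 0 j) := vG; rewrite !mxE => E.
  rewrite (Dsum v) gmet_suml (eq_bigr (fun i => v 0 i * G i j)) ?E ?mulr0// => i _.
  by rewrite gmetZl mxE.
exists (fun j => \sum_i (invmx G j i)%:C *: D (delta_mx 0 i)) => j w.
rewrite gmet_suml (eq_bigr (fun i => invmx G j i * (G *m w^T) i 0)).
  by have /matrixP/(_ j 0) := mulKmx Gu w^T; rewrite !mxE.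
move=> i _; rewrite gmetZl (Dsum w) gmet_sumr !mxE; congr (_ * _).
by apply: eq_bigr => k _; rewrite gmetZr !mxE mulrC.
Qed.

End Grassmannian_tangent.

(** * Changes of charts *)

Lemma near_forall_ord {T : Type} (F : set_system T) {FF : Filter F} n
    (P : 'I_n -> T -> Prop) :
  (forall j, \forall t \near F, P j t) -> \forall t \near F, forall j, P j t.
Proof. by move=> H; exact: (@filter_forall T 'I_n (fun j t => P j t) F FF H). Qed.

Lemma derivable_lipschitz_near {R : realType} (f : R -> R) : derivable f 0 1 ->
  \forall t \near (0 : R), `|f t - f 0| <= (1 + `|f^`()%classic 0|) * `|t|.
Proof.
move=> df; have df' : differentiable f 0 by apply/derivable1_diffP.
have [_ /eqaddoP/(_ 1 ltr01)] := (diff_locallyP _ _).1 df'.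
rewrite deriv1E//; apply: filterS => t; rewrite !fctE /= addr0 mul1r => H.
have -> : f t - f 0 = (f t - (f 0 + t *: f^`()%classic 0)) + t *: f^`()%classic 0.
  by rewrite opprD addrA subrK.
apply: le_trans (ler_normD _ _) _.
by rewrite mulrDl mul1r normrZ [_ * `|t|]mulrC lerD.
Qed.

Lemma rV_norm_attained {R : realType} n (x : 'rV[R]_n) : x != 0 ->
  exists j, `|x| = `|x 0 j|.
Proof.
rewrite -normr_eq0 => /(@mx_norm_neq0 R 1 n x)[[i j] /= E].
by exists j; rewrite -[LHS]/(mx_norm x) E (ord1 i).
Qed.

Section Charts.
Context {R : realType} {m : nat} (M : hypersurface R m).
Implicit Types (p q : M) (u v w : 'rV[R]_((4 * m).-1)).

Lemma derive_mx_adj {V : normedModType R} (F : V -> cmat R m) (u v : V) : diff_mx F u ->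
  derive_mx (fun x => (F x)^t*) u v = (derive_mx F u v)^t*.
Proof. by move=> dF; rewrite -(derive_mxT F) -derive_mxJ//; exact: diff_mxT. Qed.

Lemma Phi_smooth p : smooth_mx (dom p) (imm \o chart p).
Proof. exact: imm_smooth. Qed.

Lemma Phi_diff p u : dom p u -> diff_mx (imm \o chart p) u.
Proof. by move=> pu; exact: (smooth_mx_diff (@imm_smooth _ _ M p)). Qed.

Lemma Phi_linear p u : dom p u -> forall a v w,
  derive_mx (imm \o chart p) u (a *: v + w) =
  a%:C *: derive_mx (imm \o chart p) u v + derive_mx (imm \o chart p) u w.
Proof. by move=> pu a v w; rewrite derive_mxDv ?derive_mxZv//; exact: Phi_diff. Qed.

Lemma Phi_herm p u v : dom p u ->
  (derive_mx (imm \o chart p) u v)^t* = derive_mx (imm \o chart p) u v.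
Proof.
move=> pu; rewrite -derive_mx_adj; last exact: Phi_diff.
by congr (derive_mx _ u v); apply/funext => x /=; case: (imm_G2 (chart p x)).
Qed.

Lemma Phi_G2_tangent p u v : dom p u ->
  G2_tangent (imm (chart p u)) (derive_mx (imm \o chart p) u v).
Proof.
move=> pu; split; first exact: Phi_herm.
have dP := Phi_diff pu.
rewrite addrC -[LHS](derive_mxM v dP dP); congr (derive_mx _ u v).
by apply/funext => x /=; case: (imm_G2 (chart p x)).
Qed.

(** A chart is only known to be a homeomorphism onto its image, so [g] is merely continuous at
    first. Pairing with the dual frame gives functions with [h j x = h j 0 + x 0 j + o(x)] for which
    [h j (g t)] is differentiable in [t]. This yields first a Lipschitz bound for [g] at 0, then its
    derivative. *)
Lemma chart_transition p u v : dom p u ->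
  exists2 g : R -> 'rV[R]_((4 * m).-1),
    g 0 = 0 /\ differentiable g 0 &
    \forall t \near (0 : R), chart (chart p u) (g t) = chart p (u + t *: v).
Proof.
move=> pu; set q := chart p u.
have [q0 cq0] := dom_center q.
have line_cvg : (u + t *: v) @[t --> (0 : R)] --> u.
  rewrite -[X in _ --> X]addr0 -[X in _ --> u + X](scale0r v).
  by apply: cvgD; [exact: cvg_cst | apply: cvgZr_tmp; exact: cvg_id].
have curve_cvg : chart p (u + t *: v) @[t --> (0 : R)] --> q.
  by apply: cvg_comp line_cvg _; exact: chart_cont.
have near_img (A : set 'rV[R]_((4 * m).-1)) : open A -> A 0 -> A `<=` dom q ->
    \forall t \near (0 : R), exists2 w, A w & chart q w = chart p (u + t *: v).
  move=> oA A0 Aq; have nb : nbhs q (chart q @` A).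
    by apply: open_nbhs_nbhs; split; [exact: chart_open oA Aq | exists 0].
  exact: (curve_cvg _ nb).
(* Where the two charts do not overlap [g] takes the default value 0; only small [t] matter. *)
pose g t := xget 0 [set w | dom q w /\ chart q w = chart p (u + t *: v)].
have gP : \forall t \near (0 : R), dom q (g t) /\ chart q (g t) = chart p (u + t *: v).
  have := near_img _ (dom_open (p := q)) q0 (@subset_refl _ _).
  apply: filterS => t [w qw E]; rewrite /g.
  exact: (@xgetPex _ 0 [set w | dom q w /\ chart q w = chart p (u + t *: v)] (ex_intro _ w (conj qw E))).
have gA (A : set 'rV[R]_((4 * m).-1)) : open A -> A 0 -> A `<=` dom q -> \forall t \near (0 : R), A (g t).
  move=> oA A0 Aq; apply: filterS2 gP (near_img A oA A0 Aq) => t [gq E] [w Aw Ew].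
  suff -> : g t = w by [].
  by apply: (@chart_inj _ _ _ q); rewrite ?inE//; [exact: Aq|rewrite E Ew].
have g0 : g 0 = 0.
  have [h1 h2] := nbhs_singleton gP.
  by apply: (@chart_inj _ _ _ q); rewrite ?inE// h2 scale0r addr0 cq0.
exists g; last by apply: filterS gP => t [].
split=> //; apply/derivable1_diffP.
have [C HC] := dual_frame (Phi_linear q0) (fun w => @imm_immersion _ _ M q 0 w q0) (fun v => Phi_herm v q0).
pose k j (t : R) := gmet (C j) (imm (chart p (u + t *: v))) : R^o.
have dk j : derivable (k j) 0 (1 : R).
  have df : differentiable (fun x => gmet (C j) ((imm \o chart p) x) : R^o) (u + 0 *: v).
    by rewrite scale0r addr0; apply: diff_gmet; [exact: diff_mx_cst|exact: Phi_diff].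
  by have [] := is_derive_segment df.
pose h j x := gmet (C j) ((imm \o chart q) x) : R^o.
have dh j : differentiable (h j) 0 by apply: diff_gmet; [exact: diff_mx_cst|exact: Phi_diff].
have Dh j w : 'd (h j) 0 w = w 0 j.
  rewrite -deriveE // derive_gmet; [|exact: diff_mx_cst|exact: Phi_diff].
  by rewrite derive_mx_cst gmet0l add0r HC.
have hlin j e : 0 < e -> \forall x \near (0 : 'rV[R]_((4 * m).-1)), `|h j x - h j 0 - x 0 j| <= e * `|x|.
  move=> e0; have [_ /eqaddoP/(_ e e0)] := (diff_locallyP _ _).1 (dh j).
  by apply: filterS => x; rewrite !fctE /= addr0 Dh opprD addrA.
have g_cvg : g t @[t --> (0 : R)] --> (0 : 'rV[R]_((4 * m).-1)).
  apply/cvgr0Pnorm_lt => e e0.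
  have oB : open (ball (0 : 'rV[R]_((4 * m).-1)) e `&` dom q).
    by apply: openI; [exact: ball_open | exact: dom_open].
  have := gA _ oB (conj (ballxx _ e0) q0) (@subIsetr _ _ _).
  by apply: filterS => t [+ _]; rewrite -ball_normE /ball_/= sub0r normrN.
have hkE : \forall t \near (0 : R), forall j, h j (g t) = k j t.
  by apply: filterS gP => t [_ E] j; rewrite /h /k /= E.
have hk0 j : h j 0 = k j 0 by rewrite /h /k /= cq0 scale0r addr0.
have klip : exists2 B : R, 0 < B & \forall t \near (0 : R), forall j, `|k j t - k j 0| <= B * `|t|.
  pose c j := (1 + `|(k j)^`()%classic 0|).
  have c0 j : 0 <= c j by rewrite addr_ge0.
  exists (1 + \sum_j c j); first by rewrite ltr_pwDl// sumr_ge0.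
  suff H j : \forall t \near (0 : R), `|k j t - k j 0| <= (1 + \sum_j c j) * `|t|.
    exact: (near_forall_ord H).
  apply: filterS (derivable_lipschitz_near (dk j)) => t /le_trans; apply.
  rewrite ler_wpM2r// -/(c j) (bigD1 j)//= addrCA lerDl addr_ge0// sumr_ge0//.
have [B B0 kB] := klip.
(* The error [|g t| / 2] is absorbed on the left at a coordinate where the sup norm is attained,
   whence the factor 2. *)
have gB : \forall t \near (0 : R), `|g t| <= 2 * B * `|t|.
  have half0 : (0 : R) < 2^-1 by rewrite invr_gt0.
  have hall : \forall t \near (0 : R), forall j, `|h j (g t) - h j 0 - g t 0 j| <= 2^-1 * `|g t|.
    have H j : \forall t \near (0 : R), `|h j (g t) - h j 0 - g t 0 j| <= 2^-1 * `|g t|.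
      exact: (g_cvg _ (hlin j _ half0)).
    exact: (near_forall_ord H).
  apply: filterS3 hkE kB hall => t E1 E2 E3.
  have [->|gt0] := eqVneq (g t) 0; first by rewrite normr0 !mulr_ge0// ltW.
  have [j Ej] := rV_norm_attained gt0.
  have := E3 j; rewrite E1 hk0 Ej => H1; have H2 := E2 j.
  have : `|g t 0 j| <= B * `|t| + 2^-1 * `|g t 0 j|.
    have {1}-> : g t 0 j = (k j t - k j 0) - (k j t - k j 0 - g t 0 j) by rewrite subKr.
    by apply: le_trans (ler_normB _ _) _; exact: lerD.
  by rewrite -(mulrA 2); move: (`|g t 0 j|) (B * `|t|) => x y; lra.
have rem j e : 0 < e -> \forall t \near (0 : R), `|k j t - k j 0 - g t 0 j| <= e * `|t|.
  move=> e0; have e1 : 0 < e / (2 * B) by rewrite divr_gt0// mulr_gt0.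
  have := g_cvg _ (hlin j _ e1); apply: filterS3 hkE gB => t hkt gBt /=.
  rewrite hkt hk0 => /le_trans; apply.
  by apply: le_trans (ler_wpM2l (ltW e1) gBt) _; rewrite mulrA divfK // gt_eqF ?mulr_gt0.
apply/derivable_mxP => i j; rewrite (ord1 i).
have rd : derivable (fun t => k j t - k j 0 - g t 0 j : R) 0 (1 : R).
  apply/cvg_ex; exists 0; apply/cvgr0Pnorm_le => e e0.
  have := rem j e e0 => /nbhs_dnbhs; apply: filterS2 (nbhs_dnbhs_neq 0) => t t0 /=.
  rewrite -[t *: 1]/(t * 1) mulr1 addr0 subrr g0 mxE !subr0 normrZ normfV.
  by move=> H; rewrite ler_pdivrMl ?normr_gt0// [leRHS]mulrC.
have -> : (fun t => g t 0 j) = (k j - cst (k j 0)) - (fun t => k j t - k j 0 - g t 0 j : R).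
  by apply/funext => t; rewrite !fctE subKr.
exact: (derivableB (derivableB (dk j) (derivable_cst _ _ _)) rd).
Qed.

(** The vector [w] is the velocity of the transition curve, hence the same for all [f]. *)
Lemma chart_change p u v : dom p u -> exists w, forall f : M -> R,
  differentiable (fun x => f (chart p x) : R^o) u ->
  differentiable (fun x => f (chart (chart p u) x) : R^o) 0 ->
  'D_v (fun x => f (chart p x) : R^o) u = 'D_w (fun x => f (chart (chart p u) x) : R^o) 0.
Proof.
move=> pu; have [g [g0 dg] gE] := chart_transition v pu.
exists ('D_1 g 0) => f dp dq.
have dp' : differentiable (fun x => f (chart p x) : R^o) (u + 0 *: v) by rewrite scale0r addr0.
have [_] := is_derive_segment dp'; rewrite scale0r addr0 => <-.
pose fq x : R^o := f (chart (chart p u) x).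
have dq' : differentiable fq (g 0) by rewrite g0.
transitivity ('D_1 (fq \o g) 0).
  apply: near_eq_derive.
  by apply: filterS gE => t /= E; rewrite /fq /= E.
rewrite deriveE; last exact: differentiable_comp.
by rewrite (diff_comp dg dq') /= -!deriveE// g0.
Qed.

Lemma tcoordE q w : tcoord q (derive_mx (imm \o chart q) 0 w) = w.
Proof.
have [q0 _] := dom_center q.
have dq := Phi_diff q0.
have /= E := @xgetPex _ 0 [set v | derive_mx (imm \o chart q) 0 w = derive_mx (imm \o chart q) 0 v]
  (ex_intro _ w erefl).
apply/eqP; rewrite eq_sym -subr_eq0; apply/eqP/(imm_immersion q0).
by rewrite -[- _]scaleN1r addrC Phi_linear// /tcoord -E rmorphN1 scaleN1r addNr.
Qed.

Lemma chart_change_mx p u v : dom p u -> exists2 w,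
  derive_mx (imm \o chart p) u v = derive_mx (imm \o chart (chart p u)) 0 w &
  forall Y : M -> cmat R m, diff_mx (Y \o chart p) u -> diff_mx (Y \o chart (chart p u)) 0 ->
  derive_mx (Y \o chart p) u v = derive_mx (Y \o chart (chart p u)) 0 w.
Proof.
move=> pu; have [w Hw] := chart_change v pu.
have H (Y : M -> cmat R m) : diff_mx (Y \o chart p) u -> diff_mx (Y \o chart (chart p u)) 0 ->
    derive_mx (Y \o chart p) u v = derive_mx (Y \o chart (chart p u)) 0 w.
  move=> dp dq; apply/matrixP => i j; apply: etrans (derive_mxE _ _ _ _ _) (etrans _ (esym (derive_mxE _ _ _ _ _))).
  have [rp ip] := dp i j; have [rq iq] := dq i j.
  apply: complexP; first exact: (Hw (fun z => complex.Re (Y z i j)) rp rq).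
  exact: (Hw (fun z => complex.Im (Y z i j)) ip iq).
exists w => //; apply: H; first exact: Phi_diff.
by apply: Phi_diff; case: (dom_center (chart p u)).
Qed.

(** [dirM_mx] at [chart p u] refers to the chart centred there. Replacing it by the single chart [p]
    is what second derivatives require. *)
Lemma dirM_mx_chart p u v (Y : M -> cmat R m) : dom p u ->
  diff_mx (Y \o chart p) u -> diff_mx (Y \o chart (chart p u)) 0 ->
  dirM_mx (chart p u) (derive_mx (imm \o chart p) u v) Y = derive_mx (Y \o chart p) u v.
Proof.
move=> pu dp dq; have [w E H] := chart_change_mx v pu.
by rewrite /dirM_mx E tcoordE H.
Qed.

Lemma tangent_chart p u v : dom p u ->
  tangent (chart p u) (derive_mx (imm \o chart p) u v).
Proof. by move=> pu; have [w E _] := chart_change_mx v pu; exists w. Qed.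

End Charts.

(** * Fields along a hypersurface *)

Section Fields.
Context {R : realType} {m : nat} (M : hypersurface R m).
Implicit Types (p q : M) (W : set M) (X Y Z : M -> cmat R m) (f g : M -> R)
  (V H : cmat R m).

Lemma open_dom_chart W p : open W -> open (dom p `&` chart p @^-1` W).
Proof.
move=> oW; rewrite openE => u [du Wu]; apply: filterI.
  by apply: open_nbhs_nbhs; split => //; exact: dom_open.
by apply: chart_cont => //; apply: open_nbhs_nbhs.
Qed.

Arguments open_dom_chart {W} p oW.

Lemma smooth_field_eq W Y Z : open W -> (forall q, W q -> Y q = Z q) ->
  smooth_field W Y -> smooth_field W Z.
Proof.
move=> oW YZ sY p; apply: (@smooth_mx_eq _ _ _ _ (Y \o chart p) (Z \o chart p) (open_dom_chart p oW) _ (sY p)).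
by move=> u [_ Wu] /=; exact: YZ.
Qed.

Lemma smooth_field_sub W W' Y : W `<=` W' -> smooth_field W' Y -> smooth_field W Y.
Proof. by move=> WW' sY p; apply: smooth_mx_sub (sY p) => u [du /WW' Wu]. Qed.

Lemma smooth_fun_sub W W' f : W `<=` W' -> smooth_fun W' f -> smooth_fun W f.
Proof. by move=> WW' sY p; apply: smooth_sub (sY p) => u [du /WW' Wu]. Qed.

Lemma smooth_field_cst W H : smooth_field W (fun=> H).
Proof. by move=> p; exact: smooth_mx_cst. Qed.

Lemma smooth_field_imm W : smooth_field W (@imm R m M).
Proof. by move=> p; apply: smooth_mx_sub (@imm_smooth _ _ M p) => u []. Qed.

Lemma smooth_fieldD W Y Z : open W -> smooth_field W Y -> smooth_field W Z ->
  smooth_field W (fun q => Y q + Z q).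
Proof. by move=> oW sY sZ p; exact: (@smooth_mxD _ _ _ _ (Y \o chart p) (Z \o chart p) (open_dom_chart p oW) (sY p) (sZ p)). Qed.

Lemma smooth_fieldN W Y : open W -> smooth_field W Y -> smooth_field W (fun q => - Y q).
Proof. by move=> oW sY p; exact: (@smooth_mxN _ _ _ _ (Y \o chart p) (open_dom_chart p oW) (sY p)). Qed.

Lemma smooth_fieldB W Y Z : open W -> smooth_field W Y -> smooth_field W Z ->
  smooth_field W (fun q => Y q - Z q).
Proof. by move=> oW sY sZ p; exact: (@smooth_mxB _ _ _ _ (Y \o chart p) (Z \o chart p) (open_dom_chart p oW) (sY p) (sZ p)). Qed.

Lemma smooth_fieldM W Y Z : open W -> smooth_field W Y -> smooth_field W Z ->
  smooth_field W (fun q => Y q *m Z q).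
Proof. by move=> oW sY sZ p; exact: (@smooth_mxM _ _ _ _ (Y \o chart p) (Z \o chart p) (open_dom_chart p oW) (sY p) (sZ p)). Qed.

Lemma smooth_fieldZ W f Y : open W -> smooth_fun W f -> smooth_field W Y ->
  smooth_field W (fun q => (f q)%:C *: Y q).
Proof.
move=> oW sf sY p.
exact: (@smooth_mxZ _ _ _ _ (fun u => (f (chart p u))%:C) (Y \o chart p) (open_dom_chart p oW) (smoothc_real (sf p)) (sY p)).
Qed.

Lemma smooth_fieldZc W (a : R[i]) Y : open W -> smooth_field W Y ->
  smooth_field W (fun q => a *: Y q).
Proof.
by move=> oW sY p; exact: (@smooth_mxZ _ _ _ _ (fun=> a) (Y \o chart p) (open_dom_chart p oW) (smoothc_cst _ a) (sY p)).
Qed.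

Lemma smooth_field_sum W I (r : seq I) (F : I -> M -> cmat R m) : open W ->
  (forall i, smooth_field W (F i)) -> smooth_field W (fun q => \sum_(i <- r) F i q).
Proof. by move=> oW sF p; exact: (@smooth_mx_sum _ _ _ _ _ r (fun i => F i \o chart p) (open_dom_chart p oW) (fun i => sF i p)). Qed.

Lemma smooth_fun_gmet W Y Z : open W -> smooth_field W Y -> smooth_field W Z ->
  smooth_fun W (fun q => gmet (Y q) (Z q)).
Proof. by move=> oW sY sZ p; exact: (@smooth_gmet _ _ _ _ (Y \o chart p) (Z \o chart p) (open_dom_chart p oW) (sY p) (sZ p)). Qed.

Lemma smooth_fun_cst W a : smooth_fun W (fun _ : M => a).
Proof. by move=> p; exact: smooth_cst. Qed.

Lemma smooth_funM W f g : open W -> smooth_fun W f -> smooth_fun W g ->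
  smooth_fun W (fun q => f q * g q).
Proof. by move=> oW sf sg p; exact: (@smoothM _ _ _ (fun u => f (chart p u)) (fun u => g (chart p u)) (open_dom_chart p oW) (sf p) (sg p)). Qed.

Lemma smooth_field_J W Y : open W -> smooth_field W Y ->
  smooth_field W (fun q => map_mx conjc (Y q)).
Proof. by move=> oW sY p; exact: (@smooth_mxJ _ _ _ _ (Y \o chart p) (open_dom_chart p oW) (sY p)). Qed.

Lemma smooth_field_T W Y : smooth_field W Y -> smooth_field W (fun q => (Y q)^T).
Proof. by move=> sY p; exact: (@smooth_mxT _ _ _ _ (Y \o chart p) (sY p)). Qed.

Lemma smooth_field_diff W Y p u : smooth_field W Y -> dom p u -> W (chart p u) ->
  diff_mx (Y \o chart p) u.
Proof. by move=> sY du Wu; exact: (smooth_mx_diff (sY p)). Qed.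

Lemma smooth_field_diff0 W Y q : smooth_field W Y -> W q -> diff_mx (Y \o chart q) 0.
Proof.
move=> sY Wq; have [q0 cq] := dom_center q.
by apply: (smooth_field_diff sY) => //; rewrite cq.
Qed.

Lemma dirM_mx_chartE W Y p u v : smooth_field W Y -> dom p u -> W (chart p u) ->
  dirM_mx (chart p u) (derive_mx (imm \o chart p) u v) Y = derive_mx (Y \o chart p) u v.
Proof.
move=> sY du Wu; apply: dirM_mx_chart => //; first exact: (smooth_field_diff sY).
exact: (smooth_field_diff0 sY).
Qed.

Lemma eq_on_dirM_mx W Y Z q V : open W -> W q -> (forall q, W q -> Y q = Z q) ->
  dirM_mx q V Y = dirM_mx q V Z.
Proof.
move=> oW Wq YZ; have [q0 cq] := dom_center q.
apply: (eq_on_derive_mx _ (open_dom_chart q oW)) => [u [_ Wu]|].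
  exact: YZ.
by split=> //=; rewrite cq.
Qed.

Lemma dirM_mxD W Y Z q V : smooth_field W Y -> smooth_field W Z -> W q ->
  dirM_mx q V (fun q => Y q + Z q) = dirM_mx q V Y + dirM_mx q V Z.
Proof. by move=> sY sZ Wq; apply: (@derive_mxD _ _ _ (Y \o chart q) (Z \o chart q)); exact: (@smooth_field_diff0 W). Qed.

Lemma dirM_mxB W Y Z q V : smooth_field W Y -> smooth_field W Z -> W q ->
  dirM_mx q V (fun q => Y q - Z q) = dirM_mx q V Y - dirM_mx q V Z.
Proof. by move=> sY sZ Wq; apply: (@derive_mxB _ _ _ (Y \o chart q) (Z \o chart q)); exact: (@smooth_field_diff0 W). Qed.

Lemma dirM_mxM W Y Z q V : smooth_field W Y -> smooth_field W Z -> W q ->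
  dirM_mx q V (fun q => Y q *m Z q) = dirM_mx q V Y *m Z q + Y q *m dirM_mx q V Z.
Proof.
move=> sY sZ Wq; have [q0 cq] := dom_center q.
have E := @derive_mxM _ _ _ (Y \o chart q) (Z \o chart q) 0 (tcoord q V)
  (smooth_field_diff0 sY Wq) (smooth_field_diff0 sZ Wq).
by rewrite [(Y \o _) 0](congr1 Y cq) [(Z \o _) 0](congr1 Z cq) in E.
Qed.

Lemma dirM_mxZ W f Y q V : smooth_fun W f -> smooth_field W Y -> W q ->
  dirM_mx q V (fun q => (f q)%:C *: Y q) =
  (dirM q V f)%:C *: Y q + (f q)%:C *: dirM_mx q V Y.
Proof.
move=> sf sY Wq; have [q0 cq] := dom_center q.
have df : diffc (fun u => (f (chart q u))%:C) 0.
  by apply: (smoothc_diff (smoothc_real (sf q))); split => //=; rewrite cq.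
have E := @derive_mxZ _ _ _ (fun u => (f (chart q u))%:C) (Y \o chart q) 0 (tcoord q V) df
  (smooth_field_diff0 sY Wq).
rewrite [(Y \o _) 0](congr1 Y cq) cq in E; apply: etrans E _; congr (_ *: _ + _).
by apply: complexP => //=; exact: derive_cst.
Qed.

Lemma dirM_mxZc W a Y q V : smooth_field W Y -> W q ->
  dirM_mx q V (fun q => a *: Y q) = a *: dirM_mx q V Y.
Proof.
move=> sY Wq.
have := @derive_mxZ _ _ _ (fun=> a) (Y \o chart q) 0 (tcoord q V) (diffc_cst _ _)
  (smooth_field_diff0 sY Wq).
by rewrite Dc_cst scale0r add0r.
Qed.

Lemma dirM_gmet W Y Z q V : smooth_field W Y -> smooth_field W Z -> W q ->
  dirM q V (fun q => gmet (Y q) (Z q)) =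
  gmet (dirM_mx q V Y) (Z q) + gmet (Y q) (dirM_mx q V Z).
Proof.
move=> sY sZ Wq; have [q0 cq] := dom_center q.
have E := @derive_gmet _ _ _ (Y \o chart q) (Z \o chart q) 0 (tcoord q V)
  (smooth_field_diff0 sY Wq) (smooth_field_diff0 sZ Wq).
by rewrite [(Y \o _) 0](congr1 Y cq) [(Z \o _) 0](congr1 Z cq) in E.
Qed.

Lemma dirM_mx_cst q V H : dirM_mx q V (fun=> H) = 0.
Proof. exact: derive_mx_cst. Qed.

Lemma dirM_mx_imm q V : tangent q V -> dirM_mx q V imm = V.
Proof. by move=> [v ->]; rewrite /dirM_mx tcoordE. Qed.

Lemma tangent_lin q a V V' : tangent q V -> tangent q V' ->
  tangent q (a%:C *: V + V') /\ tcoord q (a%:C *: V + V') = a *: tcoord q V + tcoord q V'.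
Proof.
have [q0 _] := dom_center q.
move=> [v ->] [w ->]; rewrite -Phi_linear// !tcoordE; split=> //.
by eexists; reflexivity.
Qed.

Lemma dirM_mx_lin W Y q a V V' : smooth_field W Y -> W q -> tangent q V -> tangent q V' ->
  dirM_mx q (a%:C *: V + V') Y = a%:C *: dirM_mx q V Y + dirM_mx q V' Y.
Proof.
move=> sY Wq tV tV'; rewrite /dirM_mx (tangent_lin a tV tV').2.
have dY := smooth_field_diff0 sY Wq.
by rewrite derive_mxDv// derive_mxZv.
Qed.

Lemma tangent0 q : tangent q (0 : cmat R m).
Proof.
exists 0; have [q0 _] := dom_center q.
by rewrite -[0 in RHS](scale0r 0) derive_mxZv ?scale0r//; exact: Phi_diff.
Qed.

Lemma tangentZ q a V : tangent q V -> tangent q (a%:C *: V).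
Proof. by move=> tV; rewrite -[_ *: V]addr0; exact: (tangent_lin a tV (tangent0 q)).1. Qed.

Lemma tangentD q V V' : tangent q V -> tangent q V' -> tangent q (V + V').
Proof. by move=> tV tV'; rewrite -[V]scale1r; exact: (tangent_lin 1 tV tV').1. Qed.

Lemma tangentN q V : tangent q V -> tangent q (- V).
Proof. by move=> tV; rewrite -scaleN1r -(rmorphN1 (real_complex R)); exact: tangentZ. Qed.

Lemma tangent_sum q I (r : seq I) (F : I -> cmat R m) :
  (forall i, tangent q (F i)) -> tangent q (\sum_(i <- r) F i).
Proof.
move=> tF; elim: r => [|i r IH]; first by rewrite big_nil; exact: tangent0.
by rewrite big_cons; exact: tangentD.
Qed.

Lemma tangent_G2 q V : tangent q V -> G2_tangent (imm q) V.
Proof.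
by move=> [v ->]; have [q0 cq] := dom_center q; have := Phi_G2_tangent v q0; rewrite cq.
Qed.

End Fields.

Arguments open_dom_chart {R m M W} p oW.

(** * The second fundamental forms *)

Section Tangent_blocks.
Context {R : realType} {m : nat}.
Implicit Types (P X Y Z V : cmat R m).

(* [II] and [tproj] are locked because failed unifications would unfold them. *)
Fact II_key : unit. Proof. by []. Qed.
Definition II := locked_with II_key (fun P X Y : cmat R m =>
  let S := X *m Y + Y *m X in S - P *m S - P *m S).
Lemma IIE P X Y :
  II P X Y = X *m Y + Y *m X - P *m (X *m Y + Y *m X) - P *m (X *m Y + Y *m X).
Proof. by rewrite /II unlock. Qed.

Lemma tangent_blocks P X : G2 R m P -> G2_tangent P X ->
  [/\ P *m (X *m P) = 0, (X *m P) *m P = X *m P, P *m (P *m X) = P *m X,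
      (P *m X) *m P = 0 & X = X *m P + P *m X].
Proof.
move=> hP hX; have E := G2_tangent_PXP hP hX; case: hP hX => hP PP _ [_ EX].
by split; rewrite ?mulmxA ?PP// -?mulmxA ?PP// ?mulmxA// addrC.
Qed.

(** The hypothesis is the derivative along [X] of [P Y + Y P = Y], with [Z] for the derivative of
    [Y]. It determines the diagonal blocks of [Z], and these make up the second fundamental form
    [(1 - 2P)(XY + YX)] of the Grassmannian among Hermitian matrices. *)
Lemma G2_gauss P X Y Z : P *m P = P -> X *m Y + P *m Z + (Z *m P + Y *m X) = Z ->
  Z = G2_proj P Z + II P X Y.
Proof.
move=> PP E; have ok : nc_ok [:: P; X; Y; Z] [:: (0, 0, NRlet 0)]%N by [].
have E1 : P *m Z *m P = - (P *m (X *m Y + Y *m X)).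
  have /eqP := congr1 (mulmx P) E; rewrite -subr_eq0 => /eqP E'.
  by apply/eqP; rewrite -subr_eq0 -E'; apply/eqP; nc ok; ring.
have -> : II P X Y = (X *m Y + Y *m X) + P *m Z *m P + P *m Z *m P.
  by rewrite IIE E1.
have E2 : X *m Y + Y *m X = Z - P *m Z - Z *m P by rewrite -{1}E; nc ok; ring.
by rewrite E2 /G2_proj; nc ok; ring.
Qed.

(** The two off-diagonal blocks of each tangent vector are the letters of the normal form; their
    source and target blocks account for all vanishing products. *)
Lemma tangent_letters P X Y Z : G2 R m P -> G2_tangent P X -> G2_tangent P Y ->
  G2_tangent P Z ->
  exists x x' y y' z z', [/\ X = x + x', Y = y + y', Z = z + z' &
    nc_ok [:: P; x; x'; y; y'; z; z']
      (nc_gen [:: 0] [:: (0, 0); (1, 0); (0, 1); (1, 0); (0, 1); (1, 0); (0, 1)]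
         [:: (0, 0); (1, 0); (0, 1); (1, 0); (0, 1); (1, 0); (0, 1)] 0)%N].
Proof.
move=> hP hX hY hZ; have PP : P *m P = P by case: hP.
have [x1 x2 x3 x4 x5] := tangent_blocks hP hX; have [y1 y2 y3 y4 y5] := tangent_blocks hP hY.
have [z1 z2 z3 z4 z5] := tangent_blocks hP hZ.
exists (X *m P), (P *m X), (Y *m P), (P *m Y), (Z *m P), (P *m Z); split => //.
pose E := [:: P; 1%:M - P].
apply: (@nc_gen_ok _ _ E) => //=.
  by move=> [|[|i]] [|[|j]] //=; rewrite ?mul0mx ?mulmx0// ?mulmxBl ?mulmxBr ?mul1mx ?mulmx1 PP subrr.
rewrite ?mulmxBl ?mulmxBr ?mul1mx ?mulmx1 ?x1 ?x2 ?x3 ?x4 ?y1 ?y2 ?y3 ?y4 ?z1 ?z2 ?z3 ?z4.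
by rewrite ?subr0 ?PP; do !split.
Qed.

(** The second fundamental form is block diagonal, whereas tangent vectors are off-diagonal. *)
Lemma gmet_II P X Y V : G2 R m P -> G2_tangent P X -> G2_tangent P Y ->
  G2_tangent P V -> gmet (II P X Y) V = 0.
Proof.
move=> hP hX hY hV.
have [x [x' [y [y' [z [z' [-> -> -> ok0]]]]]]] := tangent_letters hP hX hY hV; nc_have ok ok0.
have E : \tr (II P (x + x') (y + y') *m (z + z')) = \tr (0 : cmat R m).
  by rewrite IIE; nc ok.
by rewrite /gmet E linear0 mul0r.
Qed.

Lemma G2_proj_II P X Y : G2 R m P -> G2_tangent P X -> G2_tangent P Y ->
  G2_proj P (II P X Y) = 0.
Proof.
move=> hP hX hY.
have [x [x' [y [y' [z [z' [-> -> _ ok0]]]]]]] := tangent_letters hP hX hY hY; nc_have ok ok0.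
by rewrite IIE /G2_proj; nc ok; ring.
Qed.

Lemma G2_projD P X Y : G2_proj P (X + Y) = G2_proj P X + G2_proj P Y.
Proof.
have ok : nc_ok [:: P; X; Y] [::] by [].
by rewrite /G2_proj; nc ok; ring.
Qed.

Lemma G2_projZ P a X : G2_proj P (a *: X) = a *: G2_proj P X.
Proof.
have ok : nc_ok [:: P; X] [::] by [].
by rewrite /G2_proj; nc ok; ring.
Qed.

End Tangent_blocks.

Lemma addNr_eq0 (A : zmodType) (a b : A) : - a + b = 0 -> a = b.
Proof. by move=> /eqP; rewrite addrC subr_eq0 => /eqP. Qed.

Section Normal.
Context {R : realType} {m : nat} (M : hypersurface R m).
Context (N : M -> cmat R m) (hN : unit_normal N) (m_gt0 : (0 < m)%N).
Implicit Types (p q : M) (W : set M) (X Y Z : M -> cmat R m) (V H : cmat R m).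

Lemma N_smooth : smooth_field setT N. Proof. by case: hN. Qed.
Lemma N_smoothW W : smooth_field W N.
Proof. by apply: smooth_field_sub N_smooth => q. Qed.
Lemma N_G2 q : G2_tangent (imm q) (N q). Proof. by case: hN => _ /(_ q)[]. Qed.
Lemma N_unit q : gmet (N q) (N q) = 1. Proof. by case: hN => _ /(_ q)[]. Qed.
Lemma N_perp q V : tangent q V -> gmet (N q) V = 0.
Proof. by case: hN => _ /(_ q)[_ _]; exact. Qed.

Lemma tangentP q V : tangent q V <-> G2_tangent (imm q) V /\ gmet (N q) V = 0.
Proof.
split=> [tV|[gV NV]]; first by split; [exact: tangent_G2 | exact: N_perp].
have [q0 cq] := dom_center q; have gq := imm_G2 q.
have := hyperplane_surj gq (N_G2 q) (N_unit q) m_gt0 erefl (Phi_linear q0)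
  (fun v => @imm_immersion _ _ M q 0 v q0) _ gV NV.
apply=> v; split; first by have := Phi_G2_tangent v q0; rewrite cq.
by apply: N_perp; exists v.
Qed.

Fact tproj_key : unit. Proof. by []. Qed.
Definition tproj := locked_with tproj_key (fun (q : M) (H : cmat R m) =>
  G2_proj (imm q) H - (gmet (N q) H)%:C *: N q).
Lemma tprojE q H : tproj q H = G2_proj (imm q) H - (gmet (N q) H)%:C *: N q.
Proof. by rewrite /tproj unlock. Qed.

Lemma tproj_tangent q H : H^t* = H -> tangent q (tproj q H).
Proof.
move=> hH; have gq := imm_G2 q; have [hNq _] := N_G2 q; have [tP1 tP2] := G2_projP gq hH.
apply/tangentP; split.
  split; first by rewrite tprojE adjB adjZ hNq conjc_real tP1.
  rewrite tprojE mulmxBr mulmxBl -scalemxAl -scalemxAr addrACA -opprD -scalerDr tP2.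
  by case: (N_G2 q) => _ ->.
have E := gmet_G2_proj H gq (N_G2 q).
by rewrite tprojE gmetBr gmetZr N_unit mulr1 gmetC E gmetC subrr.
Qed.

Lemma tproj_id q V : tangent q V -> tproj q V = V.
Proof.
by move=> /tangentP[gV NV]; rewrite tprojE NV scale0r subr0 G2_proj_id//; exact: imm_G2.
Qed.

Lemma gmet_tproj q H V : tangent q V -> gmet (tproj q H) V = gmet H V.
Proof.
move=> /tangentP[gV NV]; rewrite tprojE gmetBl gmetZl NV mulr0 subr0.
by apply: gmet_G2_proj => //; exact: imm_G2.
Qed.

Lemma tprojD q H H' : tproj q (H + H') = tproj q H + tproj q H'.
Proof. by rewrite !tprojE G2_projD gmetDr rmorphD/= scalerDl opprD addrACA. Qed.

Lemma tprojZ q a H : tproj q (a%:C *: H) = a%:C *: tproj q H.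
Proof. by rewrite !tprojE G2_projZ gmetZr rmorphM/= -scalerA -scalerBr. Qed.

Lemma tprojN q H : tproj q (- H) = - tproj q H.
Proof. by rewrite -scaleN1r -(rmorphN1 (real_complex R)) tprojZ rmorphN1 scaleN1r. Qed.

Lemma tproj_N q : tproj q (N q) = 0.
Proof. by rewrite tprojE N_unit scale1r G2_proj_id ?subrr//; [exact: imm_G2|exact: N_G2]. Qed.

Lemma tangent_eq0 q V : tangent q V -> (forall V', tangent q V' -> gmet V V' = 0) -> V = 0.
Proof.
by move=> tV H; apply: gmet_eq0; [case: (tangent_G2 tV)|exact: H].
Qed.

Lemma smooth_tproj W Y : open W -> smooth_field W Y -> smooth_field W (fun q => tproj q (Y q)).
Proof.
move=> oW sY; rewrite (_ : (fun q => _) =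
  (fun q => G2_proj (imm q) (Y q) - (gmet (N q) (Y q))%:C *: N q)); last first.
  by apply/funext => q; rewrite tprojE.
have sN := @N_smoothW W; have sI := @smooth_field_imm _ _ M W.
apply: smooth_fieldB => //; last first.
  by apply: smooth_fieldZ => //; exact: smooth_fun_gmet.
have s1 : smooth_field W (fun q => 1%:M - imm q) by apply: smooth_fieldB => //; exact: smooth_field_cst.
by apply: smooth_fieldD => //; do !apply: smooth_fieldM.
Qed.

Lemma vfield_tproj W Y : open W -> smooth_field W Y -> (forall q, W q -> (Y q)^t* = Y q) ->
  vfield W (fun q => tproj q (Y q)).
Proof.
by move=> oW sY hY; split=> [q Wq|]; [apply: tproj_tangent; exact: hY | exact: smooth_tproj].
Qed.

Lemma vfield_tproj_cst W H : open W -> H^t* = H -> vfield W (fun q => tproj q H).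
Proof. by move=> oW hH; apply: vfield_tproj => //; exact: smooth_field_cst. Qed.

(** ** The Gauss and Weingarten formulas *)

Lemma dirM_mx_tangent W Y q V : open W -> W q -> smooth_field W Y ->
  (forall q, W q -> G2_tangent (imm q) (Y q)) -> tangent q V ->
  dirM_mx q V Y = G2_proj (imm q) (dirM_mx q V Y) + II (imm q) V (Y q).
Proof.
move=> oW Wq sY tY tV; have [_ PP _] := imm_G2 q; apply: G2_gauss => //.
have sI := @smooth_field_imm _ _ M W.
rewrite -[X in _ = X](@eq_on_dirM_mx _ _ _ W (fun q => imm q *m Y q + Y q *m imm q)) //; last first.
  by move=> q' Wq'; case: (tY q' Wq').
rewrite (@dirM_mxD _ _ _ W) //; [|exact: smooth_fieldM..].
by rewrite !(@dirM_mxM _ _ _ W)// dirM_mx_imm.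
Qed.

Lemma dirM_mx_herm W Y q V : open W -> W q -> smooth_field W Y ->
  (forall q, W q -> (Y q)^t* = Y q) -> (dirM_mx q V Y)^t* = dirM_mx q V Y.
Proof.
move=> oW Wq sY hY; have [q0 cq] := dom_center q.
rewrite -derive_mx_adj; last exact: (smooth_field_diff0 sY).
apply: (@eq_on_derive_mx _ _ _ _ (fun x => ((Y \o chart q) x)^t*) (Y \o chart q) 0 _ (open_dom_chart q oW)).
  by move=> u [_ Wu]; exact: hY.
by split; rewrite //= cq.
Qed.

Lemma dirM_N q V : tangent q V ->
  dirM_mx q V N = - shape_op N q V + II (imm q) V (N q).
Proof.
move=> tV; rewrite /shape_op opprK.
by apply: (@dirM_mx_tangent setT) => //; [exact: openT|exact: N_smooth|move=> q' _; exact: N_G2].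
Qed.

Lemma shape_tangent q V : tangent q V -> tangent q (shape_op N q V).
Proof.
move=> tV; have oT := @openT M; have gq := imm_G2 q.
have hD : (dirM_mx q V N)^t* = dirM_mx q V N.
  by apply: (@dirM_mx_herm setT) => //; [exact: N_smooth|move=> q' _; case: (N_G2 q')].
apply: tangentN; apply/tangentP; split; first exact: G2_projP.
rewrite gmetC gmet_G2_proj//; last exact: N_G2.
have E : dirM q V (fun q => gmet (N q) (N q)) = 0.
  rewrite /dirM (_ : (fun u => _) = cst 1) ?derive_cst//.
  by apply/funext => u; rewrite N_unit.
move: E; rewrite (@dirM_gmet _ _ _ setT)//; [|exact: N_smooth..].
by rewrite gmetC => /eqP; rewrite -mulr2n mulrn_eq0/= => /eqP.
Qed.

Lemma shape_lin q a V V' : tangent q V -> tangent q V' ->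
  shape_op N q (a%:C *: V + V') = a%:C *: shape_op N q V + shape_op N q V'.
Proof.
move=> tV tV'; rewrite /shape_op (dirM_mx_lin _ N_smooth)//.
by rewrite G2_projD G2_projZ opprD scalerN.
Qed.

Lemma shape_gmet W Y q V : open W -> W q -> vfield W Y -> tangent q V ->
  gmet (shape_op N q V) (Y q) = gmet (N q) (dirM_mx q V Y).
Proof.
move=> oW Wq [tY sY] tV; have gq := imm_G2 q.
have gY := tangent_G2 (tY q Wq).
have E : dirM q V (fun q => gmet (N q) (Y q)) = 0.
  have [q0 cq] := dom_center q.
  transitivity ('D_(tcoord q V) (fun=> 0 : R^o) 0); last exact: derive_cst.
  apply: (@eq_on_derive _ _ _ (fun u => gmet (N (chart q u)) (Y (chart q u)) : R^o) (fun=> 0 : R^o) 0 _ (open_dom_chart q oW)).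
    by move=> u [_ Wu]; apply: N_perp; exact: tY.
  by split; rewrite //= cq.
move: E; rewrite (@dirM_gmet _ _ _ W)//; last exact: N_smoothW.
rewrite dirM_N// gmetDl gmetNl (gmet_II gq (tangent_G2 tV) (N_G2 q) gY) addr0.
exact: addNr_eq0.
Qed.

(** Differentiating the orthogonality of [N] to the coordinate fields shows that both sides pair [N]
    with a second derivative of the immersion. *)
Lemma shape_sym q V V' : tangent q V -> tangent q V' ->
  gmet (shape_op N q V) V' = gmet V (shape_op N q V').
Proof.
move=> [v ->] [w ->]; have [q0 cq] := dom_center q.
have oq := @dom_open _ _ M q; have oT := @openT M.
have sN : smooth_mx (dom q) (N \o chart q).
  by apply: smooth_mx_sub (N_smooth q) => u qu.
have sP := @imm_smooth _ _ M q.
have NP z x : dom q x -> gmet (N (chart q x)) (derive_mx (imm \o chart q) x z) = 0.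
  by move=> qx; apply: N_perp; exact: tangent_chart.
have key y z : gmet (shape_op N q (derive_mx (imm \o chart q) 0 y)) (derive_mx (imm \o chart q) 0 z) =
    gmet (N q) (derive_mx (fun x => derive_mx (imm \o chart q) x z) 0 y).
  have tz : tangent q (derive_mx (imm \o chart q) 0 z) by exists z.
  have ty : tangent q (derive_mx (imm \o chart q) 0 y) by exists y.
  have E : 'D_y (fun x => gmet ((N \o chart q) x) (derive_mx (imm \o chart q) x z) : R^o) 0 = 0.
    transitivity ('D_y (fun=> 0 : R^o) (0 : 'rV[R]_((4 * m).-1))); last exact: derive_cst.
    by apply: (eq_on_derive y oq) => // x qx; exact: NP.
  move: E; rewrite derive_gmet; [|exact: (smooth_mx_diff sN)|exact: (smooth_mx_diff (smooth_mx_derive z sP))].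
  have -> : derive_mx (N \o chart q) 0 y = dirM_mx q (derive_mx (imm \o chart q) 0 y) N.
    by rewrite /dirM_mx tcoordE.
  have EN : (N \o chart q) 0 = N q by rewrite /= cq.
  rewrite EN (dirM_N ty) gmetDl gmetNl.
  rewrite (gmet_II (imm_G2 q) (tangent_G2 ty) (N_G2 q) (tangent_G2 tz)) addr0.
  exact: addNr_eq0.
by rewrite key [RHS]gmetC key (derive_mx_symmetric _ _ oq q0 sP).
Qed.

End Normal.

(** * A Parseval frame of the Hermitian matrices *)

Section Hermitian_basis.
Context {R : realType} {m : nat}.
Implicit Types (X H : cmat R m).

(** Both [(i, j)] and [(j, i)] occur. The redundancy makes this a Parseval frame for [gmet]:
    off-diagonal members have square length 1/2 and appear twice, while [2 E_ii] has length 1 and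
    appears once. *)
Definition hb (k : ('I_m.+2 * 'I_m.+2) * bool) : cmat R m :=
  let: (i, j, b) := k in
  if b then 'i%C *: (delta_mx i j - delta_mx j i) else delta_mx i j + delta_mx j i.

Lemma adj_delta (i j : 'I_m.+2) : (delta_mx i j : cmat R m)^t* = delta_mx j i.
Proof. by rewrite trmx_delta map_delta_mx. Qed.

Lemma hb_herm k : (hb k)^t* = hb k.
Proof.
case: k => [[i j] []] /=; last by rewrite adjD !adj_delta addrC.
rewrite adjZ adjB !adj_delta -opprB scalerN -scaleNr; congr (_ *: _).
by apply: complexP; rewrite /= ?opprK ?oppr0.
Qed.

Lemma gmet_delta X i j : gmet X (delta_mx i j) = complex.Re (X j i) / 4.
Proof.
rewrite /gmet /mxtrace (bigD1 j)//= big1 ?addr0 => [|k kj].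
  rewrite mxE (bigD1 i)//= big1 ?addr0 ?mxE ?eqxx ?mulr1// => l li.
  by rewrite mxE (negPf li) mulr0.
by rewrite mxE big1// => l _; rewrite mxE (negPf kj) andbF mulr0.
Qed.

Lemma herm_expand X : X^t* = X -> X = \sum_k (gmet X (hb k))%:C *: hb k.
Proof.
move=> hX; have XJ i j : X j i = (X i j)^*%C by rewrite -{1}hX adjE.
pose s : cmat R m := \matrix_(i, j) (complex.Re (X i j) / 2)%:C.
pose t : cmat R m := \matrix_(i, j) (complex.Im (X i j) / 2)%:C.
have gS i j : gmet X (hb (i, j, false)) = complex.Re (X i j) / 2.
  by rewrite /= gmetDr !gmet_delta XJ ReJ; field.
have gT i j : gmet X (hb (i, j, true)) = complex.Im (X i j) / 2.
  rewrite /= /gmet -scalemxAr linearZ/= ReM/= mul0r mul1r sub0r.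
  have -> : \tr (X *m (delta_mx i j - delta_mx j i)) = X j i - X i j.
    rewrite mulmxBr linearB/=; congr (_ - _); rewrite /mxtrace.
      rewrite (bigD1 j)//= big1 ?addr0 => [|k kj].
        rewrite mxE (bigD1 i)//= big1 ?addr0 ?mxE ?eqxx ?mulr1// => l li.
        by rewrite mxE (negPf li) mulr0.
      by rewrite mxE big1// => l _; rewrite mxE (negPf kj) andbF mulr0.
    rewrite (bigD1 i)//= big1 ?addr0 => [|k kj].
      rewrite mxE (bigD1 j)//= big1 ?addr0 ?mxE ?eqxx ?mulr1// => l li.
      by rewrite mxE (negPf li) mulr0.
    by rewrite mxE big1// => l _; rewrite mxE (negPf kj) andbF mulr0.
  by rewrite ImD ImN XJ ImJ; field.
have E : \sum_k (gmet X (hb k))%:C *: hb k = (s + s^T) + 'i%C *: (t - t^T).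
  have -> : \sum_k (gmet X (hb k))%:C *: hb k =
      \sum_i \sum_j \sum_(b : bool) (gmet X (hb (i, j, b)))%:C *: hb (i, j, b).
    rewrite (pair_bigA _ (fun i j => \sum_(b : bool) (gmet X (hb (i, j, b)))%:C *: hb (i, j, b))) /=.
    rewrite (pair_bigA _ (fun (p : 'I_m.+2 * 'I_m.+2) (b : bool) =>
      (gmet X (hb (p.1, p.2, b)))%:C *: hb (p.1, p.2, b))) /=.
    by apply: eq_bigr => [[[i j] b]].
  rewrite (matrix_sum_delta s) (matrix_sum_delta t) !raddf_sum -!big_split/= scaler_sumr.
  rewrite -big_split/=; apply: eq_bigr => i _.
  rewrite !raddf_sum -!big_split/= scaler_sumr -big_split/=; apply: eq_bigr => j _.
  rewrite big_bool /= -/(hb (i, j, true)) -/(hb (i, j, false)) gS gT addrC !mxE.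
  have ZT (a : R[i]) : (a *: delta_mx i j : cmat R m)^T = a *: delta_mx j i.
    by apply/matrixP => k l; rewrite !mxE andbC.
  rewrite !ZT -scalerDr -scalerBr; congr (_ + _).
  by rewrite /= !scalerA mulrC.
rewrite E; apply/matrixP => i j; rewrite !mxE XJ; apply: complexP.
  by rewrite !ReD ReM/= ?ReJ; field.
by rewrite !ImD ImM/= ?ImJ ?ReN ?ReD; field.
Qed.

Lemma gmet_expand X Y : X^t* = X -> gmet X Y = \sum_k gmet X (hb k) * gmet (hb k) Y.
Proof.
move=> hX; rewrite {1}(herm_expand hX) gmet_suml; apply: eq_bigr => k _.
by rewrite gmetZl.
Qed.

End Hermitian_basis.

(** * The Levi-Civita connection as a projected derivative *)

(** The algebra behind the uniqueness of the Levi-Civita connection: alternating the two rules,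
    three times each, brings the arguments back to their order with the opposite sign. *)
Lemma sym_skew_eq0 {R : numDomainType} (T : Type) (v : T -> Prop) (f : T -> T -> T -> R) :
  (forall X Y Z, v X -> v Y -> v Z -> f X Y Z = f Y X Z) ->
  (forall X Y Z, v X -> v Y -> v Z -> f X Y Z = - f X Z Y) ->
  forall X Y Z, v X -> v Y -> v Z -> f X Y Z = 0.
Proof.
move=> sym skew X Y Z vX vY vZ.
have E : f X Y Z = - f X Y Z.
  rewrite {1}skew// sym// skew// opprK sym// skew//; congr (- _).
  by rewrite sym.
by move/eqP: E; rewrite -subr_eq0 opprK -mulr2n mulrn_eq0 => /eqP.
Qed.

Lemma sub_swap (A : zmodType) (x y u v : A) : x - y = u - v -> x - u = y - v.
Proof.
move=> E; have -> : x = u - v + y by rewrite -E subrK.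
by rewrite -addrA addrC addrA subrK addrC.
Qed.

Section Connection.
Context {R : realType} {m : nat} (M : hypersurface R m).
Context (N : M -> cmat R m) (hN : unit_normal N) (m_gt0 : (0 < m)%N).
Context (nabla : (M -> cmat R m) -> (M -> cmat R m) -> M -> cmat R m)
  (hnabla : levi_civita nabla).
Implicit Types (p q : M) (W : set M) (X Y Z : M -> cmat R m) (V H : cmat R m).
Local Notation tproj := (tproj N).

Lemma vfield_sub W W' Y : W `<=` W' -> vfield W' Y -> vfield W Y.
Proof. by move=> WW' [tY sY]; split=> [q /WW'|]; [exact: tY | exact: smooth_field_sub sY]. Qed.

Lemma vfield_herm W Y q : vfield W Y -> W q -> (Y q)^t* = Y q.
Proof. by move=> [tY _] Wq; case: (tangent_G2 (tY q Wq)). Qed.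

Lemma bracket_tangent W X Y q : open W -> W q -> vfield W X -> vfield W Y ->
  tangent q (bracket X Y q).
Proof.
move=> oW Wq vX vY; rewrite -(lc_torsion hnabla oW vX vY Wq).
by apply: tangentD; [|apply: tangentN];
  [case: (lc_field hnabla oW vX vY)|case: (lc_field hnabla oW vY vX)] => t _; exact: t.
Qed.

(* The difference of the two connections is symmetric in X, Y and skew in Y, Z. *)
Lemma nablaE W X Y q : open W -> W q -> vfield W X -> vfield W Y ->
  nabla X Y q = tproj q (dirM_mx q (X q) Y).
Proof.
move=> oW Wq vX vY.
pose T X Y := nabla X Y q - tproj q (dirM_mx q (X q) Y).
have sf Y' : vfield W Y' -> smooth_field W Y' by case.
have hD X' Y' : vfield W Y' -> (dirM_mx q (X' q) Y')^t* = dirM_mx q (X' q) Y'.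
  by move=> vY'; apply: (dirM_mx_herm _ oW Wq (sf _ vY')) => q' Wq'; exact: (vfield_herm vY').
have tq Y' : vfield W Y' -> tangent q (Y' q) by case=> t _; exact: t.
have skew X' Y' Z' : vfield W X' -> vfield W Y' -> vfield W Z' ->
    gmet (T X' Y') (Z' q) = - gmet (T X' Z') (Y' q).
  move=> vX' vY' vZ'; have E := lc_metric hnabla oW vX' vY' vZ' Wq.
  have D := dirM_gmet (X' q) (sf _ vY') (sf _ vZ') Wq.
  have e1 := gmet_tproj hN m_gt0 (dirM_mx q (X' q) Y') (tq _ vZ').
  have e2 := gmet_tproj hN m_gt0 (dirM_mx q (X' q) Z') (tq _ vY').
  have e3 := gmetC (Y' q) (dirM_mx q (X' q) Z').
  have e4 := gmetC (Y' q) (nabla X' Z' q).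
  rewrite /T (gmetBl (nabla X' Y' q)) (gmetBl (nabla X' Z' q)) e1 e2.
  rewrite E e3 e4 in D; apply/eqP; rewrite -subr_eq0 opprK addrACA D -opprD subrr //.
have sym X' Y' : vfield W X' -> vfield W Y' -> T X' Y' = T Y' X'.
  move=> vX' vY'; have E := lc_torsion hnabla oW vX' vY' Wq.
  have tb := bracket_tangent oW Wq vX' vY'.
  rewrite /T; apply: sub_swap; rewrite E -tprojN -tprojD.
  by rewrite [RHS](tproj_id hN m_gt0 tb).
have TT : tangent q (T X Y).
  apply: tangentD; first by case: (lc_field hnabla oW vX vY) => t _; exact: t.
  by apply: tangentN; apply: tproj_tangent => //; exact: hD.
apply/eqP; rewrite -subr_eq0; apply/eqP/(tangent_eq0 TT) => V tV.
have vZ : vfield W (fun q => tproj q V).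
  by apply: vfield_tproj_cst => //; case: (tangent_G2 tV).
rewrite -[V](tproj_id hN m_gt0 tV) -/((fun q => tproj q V) q).
set Z := fun q => tproj q V in vZ *.
have sym' X' Y' Z' : vfield W X' -> vfield W Y' -> vfield W Z' ->
    gmet (T X' Y') (Z' q) = gmet (T Y' X') (Z' q).
  by move=> vX' vY' _; rewrite (sym X' Y').
exact: (@sym_skew_eq0 R _ (vfield W) (fun X Y Z => gmet (T X Y) (Z q)) sym' skew X Y Z).
Qed.

Lemma vfield_smooth W Y : vfield W Y -> smooth_field W Y. Proof. by case. Qed.

Lemma vfield_tangent W Y q : vfield W Y -> W q -> tangent q (Y q).
Proof. by case=> t _; exact: t. Qed.

(** For the tangential part of a constant matrix the covariant derivative is an explicit expression
    in [imm] and the field, plus the shape operator with coefficient [<N, H>]. This lets [lc_field]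
    say something about the shape operator. *)
Lemma nabla_tproj_cst W Y H q : open W -> W q -> vfield W Y -> H^t* = H ->
  let P := imm q in let V := Y q in
  nabla Y (fun q => tproj q H) q =
  tproj q (V *m H *m (1%:M - P) - P *m H *m V - (V *m H *m P - (1%:M - P) *m H *m V))
  + (gmet (N q) H)%:C *: shape_op N q V.
Proof.
move=> oW Wq vY hH P V; have tV : tangent q V by exact: (vfield_tangent vY).
have gq := imm_G2 q.
rewrite (nablaE oW Wq vY (vfield_tproj_cst hN m_gt0 oW hH)) -/V.
have sI := @smooth_field_imm _ _ M W; have sN := N_smoothW hN W.
have sH := @smooth_field_cst _ _ M W H.
have s1 : smooth_field W (fun q => 1%:M - imm q) by apply: smooth_fieldB => //; exact: smooth_field_cst.
have D1 : dirM_mx q V (fun q => 1%:M - imm q) = - V.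
  by rewrite (dirM_mxB _ (@smooth_field_cst _ _ M W 1%:M) sI Wq) dirM_mx_cst dirM_mx_imm// sub0r.
have sg : smooth_fun W (fun q => gmet (N q) H) by exact: smooth_fun_gmet.
have sIH : smooth_field W (fun q => imm q *m H) by exact: smooth_fieldM.
have s1H : smooth_field W (fun q => (1%:M - imm q) *m H) by exact: smooth_fieldM.
have -> : (fun q => tproj q H) = (fun q => imm q *m H *m (1%:M - imm q) +
    (1%:M - imm q) *m H *m imm q - (gmet (N q) H)%:C *: N q).
  by apply/funext => q'; rewrite tprojE.
have sA : smooth_field W (fun q => imm q *m H *m (1%:M - imm q)) by exact: smooth_fieldM.
have sB : smooth_field W (fun q => (1%:M - imm q) *m H *m imm q) by exact: smooth_fieldM.
rewrite (dirM_mxB _ (smooth_fieldD oW sA sB) (smooth_fieldZ oW sg sN) Wq).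
rewrite (dirM_mxD _ sA sB Wq) (dirM_mxM _ sIH s1 Wq) (dirM_mxM _ s1H sI Wq).
rewrite (dirM_mxM _ sI sH Wq) (dirM_mxM _ s1 sH Wq) (dirM_mxZ _ sg sN Wq).
rewrite dirM_mx_cst D1 dirM_mx_imm// !mulmx0 !addr0 dirM_N// -/P.
set a := dirM q V _; set b := gmet (N q) H; set A := shape_op N q V.
rewrite tprojD tprojN [tproj q (_ *: N q + _)]tprojD !tprojZ (tproj_N hN) scaler0 add0r.
rewrite [tproj q (- A + _)]tprojD [tproj q (- A)]tprojN (tproj_id hN m_gt0 (shape_tangent hN m_gt0 tV)).
have -> : tproj q (II P V (N q)) = 0.
  have gV := tangent_G2 tV; have gN := N_G2 hN q.
  by rewrite tprojE G2_proj_II// gmetC gmet_II// scale0r subr0.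
rewrite addr0 scalerN opprK; congr (tproj q _ + _).
have ok : nc_ok [:: P; V; H] [::] by [].
by nc ok; ring.
Qed.

(** [shape_op] at [q] differentiates in the chart centred at [q], so its smoothness in [q] is taken
    from [lc_field] instead. Solving [nabla_tproj_cst] for the shape operator leaves the factor
    [<N, H>], which may vanish; multiplying by it once more and summing over the frame [hb] gives
    the factor [<N, N> = 1]. *)
Lemma vfield_shape W Y : open W -> vfield W Y -> vfield W (fun q => shape_op N q (Y q)).
Proof.
move=> oW vY; split=> [q Wq|].
  by apply: shape_tangent => //; exact: (vfield_tangent vY).
have sI := @smooth_field_imm _ _ M W; have sN := N_smoothW hN W; have sY := vfield_smooth vY.
pose F (k : ('I_m.+2 * 'I_m.+2) * bool) q := (gmet (N q) (hb k))%:C *: (nabla Y (fun q => tproj q (hb k)) q -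
  tproj q (Y q *m hb k *m (1%:M - imm q) - imm q *m hb k *m Y q -
    (Y q *m hb k *m imm q - (1%:M - imm q) *m hb k *m Y q))).
apply: (@smooth_field_eq _ _ _ W (fun q => \sum_k F k q)) => //.
  move=> q Wq; have hNq : (N q)^t* = N q by case: (N_G2 hN q).
  rewrite (eq_bigr (fun k => (gmet (N q) (hb k) * gmet (hb k) (N q))%:C *: shape_op N q (Y q))).
    rewrite -scaler_suml -(rmorph_sum (real_complex R)) -gmet_expand// (N_unit hN).
    by rewrite scale1r.
  move=> k _; rewrite /F (nabla_tproj_cst oW Wq vY (hb_herm k)) addrAC subrr add0r.
  by rewrite scalerA -rmorphM/= [gmet (hb k) _]gmetC.
apply: smooth_field_sum => // k; apply: smooth_fieldZ => //.
  by apply: smooth_fun_gmet => //; exact: smooth_field_cst.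
have sH := @smooth_field_cst _ _ M W (hb k).
have s1 : smooth_field W (fun q => 1%:M - imm q) by apply: smooth_fieldB => //; exact: smooth_field_cst.
apply: smooth_fieldB => //.
  by apply: vfield_smooth; apply: (lc_field hnabla) => //; apply: vfield_tproj_cst => //; exact: hb_herm.
apply: smooth_tproj => //.
by do !(first [apply: smooth_fieldB => // | apply: smooth_fieldM => //]).
Qed.

End Connection.

(** * The Gauss equation *)

Section Gauss_equation.
Context {R : realType} {m : nat} (M : hypersurface R m).
Context (N : M -> cmat R m) (hN : unit_normal N) (m_gt0 : (0 < m)%N).
Context (nabla : (M -> cmat R m) -> (M -> cmat R m) -> M -> cmat R m)
  (hnabla : levi_civita nabla).
Implicit Types (p q : M) (W : set M) (X Y Z : M -> cmat R m) (V H : cmat R m).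
Local Notation tproj := (tproj N).

Lemma dirM_mx_lincomb W (I : finType) (f : I -> M -> R) (G : I -> M -> cmat R m) q V :
  open W -> W q -> (forall k, smooth_fun W (f k)) -> (forall k, smooth_field W (G k)) ->
  dirM_mx q V (fun q => \sum_k (f k q)%:C *: G k q) =
  \sum_k ((dirM q V (f k))%:C *: G k q + (f k q)%:C *: dirM_mx q V (G k)).
Proof.
move=> oW Wq sf sG.
have sfG k : smooth_field W (fun q => (f k q)%:C *: G k q) by exact: smooth_fieldZ.
have [_ E] := @diff_mx_sum _ _ _ _ (index_enum I) (fun k => (fun q => (f k q)%:C *: G k q) \o chart q) 0
  (fun k => smooth_field_diff0 (sfG k) Wq).
apply: etrans (E (tcoord q V)) _; apply: eq_bigr => k _.
exact: (dirM_mxZ V (sf k) (sG k) Wq).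
Qed.

Lemma tangent_expand q V : tangent q V ->
  V = \sum_k (gmet V (hb k))%:C *: tproj q (hb k).
Proof.
move=> tV; have [hV _] := tangent_G2 tV.
have E (I : finType) (f : I -> R) (G : I -> cmat R m) :
    tproj q (\sum_k (f k)%:C *: G k) = \sum_k (f k)%:C *: tproj q (G k).
  have t0 : tproj q 0 = 0 by rewrite -(scale0r (0 : cmat R m)) -(rmorph0 (real_complex R)) tprojZ rmorph0 !scale0r.
  rewrite (big_morph (tproj q) (tprojD N q) t0).
  by apply: eq_bigr => k _; rewrite tprojZ.
by rewrite -E -herm_expand// (tproj_id hN m_gt0 tV).
Qed.

Lemma dirM_mx_expand W Z q V : open W -> W q -> smooth_field W Z -> tangent q V ->
  dirM_mx q V Z = \sum_k (gmet V (hb k))%:C *: dirM_mx q (tproj q (hb k)) Z.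
Proof.
move=> oW Wq sZ tV; rewrite {1}(tangent_expand tV).
have th k : tangent q (tproj q (hb k)) by apply: tproj_tangent => //; exact: hb_herm.
elim: (index_enum _) => [|k r IH].
  have := dirM_mx_lin (-1) sZ Wq (tangent0 q) (tangent0 q).
  by rewrite !big_nil rmorphN1 scaler0 addr0 scaleN1r addNr.
rewrite !big_cons (dirM_mx_lin _ sZ Wq) ?IH//; apply: tangent_sum => i; exact: tangentZ.
Qed.

Lemma sum_addrI (A : zmodType) (I : finType) (a a' b b' : I -> A) :
  \sum_k (a k + b k) = \sum_k (a' k + b' k) -> a =1 a' -> \sum_k b k = \sum_k b' k.
Proof. by move=> + E; rewrite !big_split/= (eq_bigr _ (fun k _ => E k)) => /addrI. Qed.

Lemma sum_addKr (A : zmodType) (I : finType) (a a' b b' : I -> A) :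
  \sum_k b k = \sum_k b' k ->
  \sum_k (a k + b k) - \sum_k (a' k + b' k) = \sum_k (a k - a' k).
Proof. by move=> E; rewrite !big_split/= E opprD addrACA subrr addr0 sumrN. Qed.

Lemma eq_sum_scale (K : pzRingType) (A : lmodType K) (I : finType) (f g : I -> K)
    (a a' b b' : I -> A) : \sum_k f k *: a k = \sum_k g k *: b k -> a =1 a' -> b =1 b' ->
  \sum_k f k *: a' k = \sum_k g k *: b' k.
Proof.
move=> E aa bb; rewrite -(eq_bigr _ (fun k _ => congr1 _ (aa k))) E.
by apply: eq_bigr => k _; rewrite bb.
Qed.

(* Both sides are derivatives of [dirM_mx _ V' Z = sum_k <V', hb k> G_k] along
   coordinate fields, so this is the symmetry of second derivatives. *)
Lemma dirM_mx_gradient_sym W Z q V V' : open W -> W q -> smooth_field W Z ->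
  (forall k, smooth_field W (fun q => dirM_mx q (tproj q (hb k)) Z)) ->
  tangent q V -> tangent q V' ->
  \sum_k (gmet V' (hb k))%:C *: dirM_mx q V (fun q => dirM_mx q (tproj q (hb k)) Z) =
  \sum_k (gmet V (hb k))%:C *: dirM_mx q V' (fun q => dirM_mx q (tproj q (hb k)) Z).
Proof.
move=> oW Wq sZ sG tV tV'; have [q0 cq] := dom_center q.
pose G k q := dirM_mx q (tproj q (hb k)) Z.
pose U := dom q `&` chart q @^-1` W.
have oU : open U := open_dom_chart q oW.
have U0 : U 0 by split; rewrite //= cq.
have sP : smooth_mx U (imm \o chart q) by apply: smooth_mx_sub (@imm_smooth _ _ M q) => u [].
have sPw w : smooth_mx U (fun u => derive_mx (imm \o chart q) u w) := smooth_mx_derive w sP.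
have sGq k : smooth_mx U (G k \o chart q) := sG k q.
have key v w : derive_mx (fun u => derive_mx (Z \o chart q) u w) 0 v =
    \sum_k ((gmet (derive_mx (fun u => derive_mx (imm \o chart q) u w) 0 v) (hb k))%:C *: G k q
      + (gmet (derive_mx (imm \o chart q) 0 w) (hb k))%:C *: derive_mx (G k \o chart q) 0 v).
  transitivity (derive_mx (fun u => \sum_k (gmet (derive_mx (imm \o chart q) u w) (hb k))%:C *: (G k \o chart q) u) 0 v).
    apply: (@eq_on_derive_mx _ _ _ _ (fun u => derive_mx (Z \o chart q) u w) _ 0 v oU) => // u [qu Wu].
    rewrite -(dirM_mx_chartE w sZ qu Wu) (dirM_mx_expand oW Wu sZ)//.
    exact: tangent_chart.
  have sg k : smooth U (fun u => gmet (derive_mx (imm \o chart q) u w) (hb k) : R^o).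
    by apply: smooth_gmet => //; exact: smooth_mx_cst.
  have sgG k : smooth_mx U (fun u => (gmet (derive_mx (imm \o chart q) u w) (hb k))%:C *: (G k \o chart q) u).
    by apply: smooth_mxZ => //; exact: smoothc_real (sg k).
  have [_ ->] := @diff_mx_sum _ _ _ _ (index_enum _) _ 0 (fun k => smooth_mx_diff (sgG k) U0).
  apply: eq_bigr => k _.
  rewrite derive_mxZ; [|exact: (smoothc_diff (smoothc_real (sg k)))|exact: (smooth_mx_diff (sGq k))].
  have -> : (G k \o chart q) 0 = G k q by rewrite /= cq.
  congr (_ *: _ + _); apply: complexP => /=; last exact: derive_cst.
  rewrite derive_gmet; [|exact: (smooth_mx_diff (sPw w))|exact: diff_mx_cst].
  by rewrite derive_mx_cst gmet0r addr0.
case: tV tV' => v -> [w ->].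
have S1 := etrans (esym (key v w)) (etrans (derive_mx_symmetric v w oU U0 (sZ q)) (key w v)).
have S2 := derive_mx_symmetric v w oU U0 sP.
have S3 := sum_addrI S1 (fun k => congr1 (fun A => (gmet A (hb k))%:C *: G k q) S2).
have dG x k : derive_mx (G k \o chart q) 0 x = dirM_mx q (derive_mx (imm \o chart q) 0 x) (G k).
  exact: (congr1 (derive_mx (G k \o chart q) 0) (esym (tcoordE q x))).
exact: eq_sum_scale S3 (dG v) (dG w).
Qed.

(** The space of matrices is flat: the second derivatives of [Z] cancel by [dirM_mx_gradient_sym],
    and what remains is the derivative along the bracket. *)
Lemma dirM_mx_commutator W X Y Z q : open W -> W q -> vfield W X -> vfield W Y ->
  smooth_field W Z ->
  (forall k, smooth_field W (fun q => dirM_mx q (tproj q (hb k)) Z)) ->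
  dirM_mx q (X q) (fun q => dirM_mx q (Y q) Z) - dirM_mx q (Y q) (fun q => dirM_mx q (X q) Z)
  = dirM_mx q (bracket X Y q) Z.
Proof.
move=> oW Wq vX vY sZ sG; pose G k q := dirM_mx q (tproj q (hb k)) Z.
have D X' Y' : vfield W X' -> vfield W Y' -> dirM_mx q (X' q) (fun q => dirM_mx q (Y' q) Z) =
    \sum_k ((gmet (dirM_mx q (X' q) Y') (hb k))%:C *: G k q + (gmet (Y' q) (hb k))%:C *: dirM_mx q (X' q) (G k)).
  move=> vX' vY'; have sY' := vfield_smooth vY'.
  rewrite (@eq_on_dirM_mx _ _ _ W _ (fun q => \sum_k (gmet (Y' q) (hb k))%:C *: G k q)) //; last first.
    by move=> q' Wq'; exact: (dirM_mx_expand oW Wq' sZ (vfield_tangent vY' Wq')).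
  have sg k : smooth_fun W (fun q => gmet (Y' q) (hb k)) by apply: smooth_fun_gmet => //; exact: smooth_field_cst.
  rewrite (dirM_mx_lincomb _ oW Wq sg sG); apply: eq_bigr => k _; congr (_%:C *: _ + _).
  by rewrite (dirM_gmet _ sY' (@smooth_field_cst _ _ M W (hb k)) Wq) dirM_mx_cst gmet0r addr0.
have S := dirM_mx_gradient_sym oW Wq sZ sG (vfield_tangent vX Wq) (vfield_tangent vY Wq).
rewrite (D _ _ vX vY) (D _ _ vY vX).
apply: etrans (sum_addKr _ _ S) _.
rewrite (dirM_mx_expand oW Wq sZ (bracket_tangent hnabla oW Wq vX vY)).
by apply: eq_bigr => k _; rewrite gmetBl rmorphB/= scalerBl.
Qed.

Lemma bracket_vfield W X Y : open W -> vfield W X -> vfield W Y -> vfield W (bracket X Y).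
Proof.
move=> oW vX vY; have v1 := lc_field hnabla oW vX vY; have v2 := lc_field hnabla oW vY vX.
split=> [q Wq|]; first by apply: (bracket_tangent hnabla oW Wq vX vY).
apply: (@smooth_field_eq _ _ _ W (fun q => nabla X Y q - nabla Y X q)) => //.
  by move=> q Wq; exact: (lc_torsion hnabla oW vX vY Wq).
by apply: smooth_fieldB => //; exact: vfield_smooth.
Qed.

Lemma dirM_mx_gauss W Y Z q : open W -> W q -> vfield W Y -> vfield W Z ->
  dirM_mx q (Y q) Z =
    nabla Y Z q + (gmet (shape_op N q (Y q)) (Z q))%:C *: N q + II (imm q) (Y q) (Z q).
Proof.
move=> oW Wq vY vZ; have tY := vfield_tangent vY Wq.
have gZ q' : W q' -> G2_tangent (imm q') (Z q') by move=> /(vfield_tangent vZ); exact: tangent_G2.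
rewrite (dirM_mx_tangent oW Wq (vfield_smooth vZ) gZ tY); congr (_ + _).
rewrite (nablaE hN m_gt0 hnabla oW Wq vY vZ) (shape_gmet hN oW Wq vZ tY) tprojE.
by rewrite subrK.
Qed.

Lemma II_smooth W Y Z : open W -> smooth_field W Y -> smooth_field W Z ->
  smooth_field W (fun q => II (imm q) (Y q) (Z q)).
Proof.
move=> oW sY sZ; apply: (@smooth_field_eq _ _ _ W (fun q =>
  Y q *m Z q + Z q *m Y q - imm q *m (Y q *m Z q + Z q *m Y q)
   - imm q *m (Y q *m Z q + Z q *m Y q))) => //; first by move=> q _; rewrite IIE.
have sI := @smooth_field_imm _ _ M W.
by do !(first [apply: smooth_fieldB => // | apply: smooth_fieldD => // | apply: smooth_fieldM => //]).
Qed.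

Lemma dirM_mx_II W Y Z q V : open W -> W q -> smooth_field W Y -> smooth_field W Z ->
  tangent q V ->
  dirM_mx q V (fun q => II (imm q) (Y q) (Z q)) =
    II (imm q) (dirM_mx q V Y) (Z q) + II (imm q) (Y q) (dirM_mx q V Z)
    - 2%:R *: (V *m (Y q *m Z q + Z q *m Y q)).
Proof.
move=> oW Wq sY sZ tV; have sI := @smooth_field_imm _ _ M W.
have sYZ := smooth_fieldM oW sY sZ; have sZY := smooth_fieldM oW sZ sY.
have sS := smooth_fieldD oW sYZ sZY; have sPS := smooth_fieldM oW sI sS.
rewrite (@eq_on_dirM_mx _ _ _ W _ (fun q => (Y q *m Z q + Z q *m Y q)
   - imm q *m (Y q *m Z q + Z q *m Y q) - imm q *m (Y q *m Z q + Z q *m Y q))) //; last first.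
  by move=> q' _; rewrite IIE.
rewrite (dirM_mxB V (smooth_fieldB oW sS sPS) sPS Wq) (dirM_mxB V sS sPS Wq).
rewrite (dirM_mxM V sI sS Wq) (dirM_mxD V sYZ sZY Wq) (dirM_mxM V sY sZ Wq) (dirM_mxM V sZ sY Wq).
rewrite (dirM_mx_imm tV) !IIE.
move: (dirM_mx q V Y) (dirM_mx q V Z) (imm q) (Y q) (Z q) => a b P y z.
have ok : nc_ok [:: a; b; P; y; z; V] [::] by [].
by nc ok; ring.
Qed.

(** Tangential parts of the derivatives of [Y] and [Z] only contribute values of [II], which are
    normal. The coefficient [1 - 2P] and the normal parts remain, and they carry the curvature of
    the Grassmannian. *)
Lemma G2_proj_dirM_II W Y Z q V : open W -> W q -> vfield W Y -> vfield W Z -> tangent q V ->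
  G2_proj (imm q) (dirM_mx q V (fun q => II (imm q) (Y q) (Z q))) =
  - G2_proj (imm q) (V *m (Y q *m Z q + Z q *m Y q) + (Y q *m Z q + Z q *m Y q) *m V).
Proof.
move=> oW Wq vY vZ tV; rewrite (dirM_mx_II oW Wq (vfield_smooth vY) (vfield_smooth vZ) tV).
have gt q' X : vfield W X -> W q' -> G2_tangent (imm q') (X q').
  by move=> vX Wq'; exact: tangent_G2 (vfield_tangent vX Wq').
have gY := gt q _ vY Wq; have gZ := gt q _ vZ Wq; have gV := tangent_G2 tV.
have gP := imm_G2 q.
have EY := dirM_mx_tangent oW Wq (vfield_smooth vY) (fun q' => gt q' _ vY) tV.
have EZ := dirM_mx_tangent oW Wq (vfield_smooth vZ) (fun q' => gt q' _ vZ) tV.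
have hD X : vfield W X -> (dirM_mx q V X)^t* = dirM_mx q V X.
  move=> vX; apply: (dirM_mx_herm V oW Wq (vfield_smooth vX)) => q' Wq'; exact: (vfield_herm vX Wq').
have [tY tZ] : G2_tangent (imm q) (G2_proj (imm q) (dirM_mx q V Y)) /\
    G2_tangent (imm q) (G2_proj (imm q) (dirM_mx q V Z)).
  by split; apply: G2_projP => //; exact: hD.
rewrite EY EZ; move: (G2_proj _ (dirM_mx q V Y)) (G2_proj _ (dirM_mx q V Z)) tY tZ => s t gs gt'.
have ZY := G2_proj_II gP gs gZ; have ZZ := G2_proj_II gP gY gt'.
move: (imm q) (Y q) (Z q) gP gY gZ gV gs gt' ZY ZZ => P y z gP gY gZ gV gs gt' ZY ZZ.
have IIDl a b c : II P (a + b) c = II P a c + II P b c.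
  by rewrite !IIE; have ok : nc_ok [:: P; a; b; c] [::] by []; nc ok; ring.
have IIDr a b c : II P a (b + c) = II P a b + II P a c.
  by rewrite !IIE; have ok : nc_ok [:: P; a; b; c] [::] by []; nc ok; ring.
rewrite IIDl IIDr !G2_projD ZY ZZ !add0r -G2_projD -G2_projD.
have [x [x' [y1 [y' [z1 [z' [-> -> -> ok0]]]]]]] := tangent_letters gP gV gY gZ; nc_have ok ok0.
by rewrite !IIE /G2_proj; nc ok; ring.
Qed.

Lemma tproj_G2_proj q H : tproj q (G2_proj (imm q) H) = tproj q H.
Proof.
have gP := imm_G2 q; have [_ PP _] := gP.
have E : gmet (N q) (G2_proj (imm q) H) = gmet (N q) H.
  by rewrite gmetC (gmet_G2_proj H gP (N_G2 hN q)) gmetC.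
rewrite !tprojE E; congr (_ - _); rewrite /G2_proj.
move: (imm q) PP => P PP; have ok : nc_ok [:: P; H] [:: (0, 0, NRlet 0)]%N by [].
by nc ok; ring.
Qed.

Lemma tproj0 q : tproj q 0 = 0.
Proof. by rewrite -(scale0r (0 : cmat R m)) -(rmorph0 (real_complex R)) tprojZ rmorph0 !scale0r. Qed.

Lemma dirM_mx_frame_smooth W Z k : open W -> vfield W Z ->
  smooth_field W (fun q => dirM_mx q (tproj q (hb k)) Z).
Proof.
move=> oW vZ; have vH := vfield_tproj_cst hN m_gt0 oW (hb_herm k).
apply: (@smooth_field_eq _ _ _ W (fun q => nabla (fun q => tproj q (hb k)) Z q +
   (gmet (shape_op N q (tproj q (hb k))) (Z q))%:C *: N q + II (imm q) (tproj q (hb k)) (Z q))) => //.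
  by move=> q Wq; rewrite -(dirM_mx_gauss oW Wq vH vZ).
have sN := N_smoothW hN W.
apply: smooth_fieldD => //; last by apply: II_smooth; [|exact: vfield_smooth|exact: vfield_smooth].
apply: smooth_fieldD => //; first exact: vfield_smooth (lc_field hnabla oW vH vZ).
apply: smooth_fieldZ => //; apply: smooth_fun_gmet => //; last exact: vfield_smooth.
exact: vfield_smooth (vfield_shape hN m_gt0 hnabla oW vH).
Qed.

Lemma nabla_nabla W X Y Z q : open W -> W q -> vfield W X -> vfield W Y -> vfield W Z ->
  tproj q (dirM_mx q (X q) (fun q => dirM_mx q (Y q) Z)) =
  nabla X (nabla Y Z) q - (gmet (shape_op N q (Y q)) (Z q))%:C *: shape_op N q (X q)
  - tproj q (X q *m (Y q *m Z q + Z q *m Y q) + (Y q *m Z q + Z q *m Y q) *m X q).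
Proof.
move=> oW Wq vX vY vZ; have tX := vfield_tangent vX Wq.
have vD := lc_field hnabla oW vY vZ.
rewrite (@eq_on_dirM_mx _ _ _ W _ (fun q => nabla Y Z q +
   (gmet (shape_op N q (Y q)) (Z q))%:C *: N q + II (imm q) (Y q) (Z q))) //; last first.
  by move=> q' Wq'; exact: (dirM_mx_gauss oW Wq' vY vZ).
have sN := N_smoothW hN W.
have sII := II_smooth oW (vfield_smooth vY) (vfield_smooth vZ).
have sf : smooth_fun W (fun q => gmet (shape_op N q (Y q)) (Z q)).
  apply: smooth_fun_gmet => //; last exact: vfield_smooth.
  exact: vfield_smooth (vfield_shape hN m_gt0 hnabla oW vY).
have sfN := smooth_fieldZ oW sf sN.
have s1 := smooth_fieldD oW (vfield_smooth vD) sfN.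
rewrite (dirM_mxD _ s1 sII Wq) (dirM_mxD _ (vfield_smooth vD) sfN Wq) (dirM_mxZ _ sf sN Wq).
rewrite !(tprojD N) -(nablaE hN m_gt0 hnabla oW Wq vX vD); congr (_ + _ + _).
  rewrite !(tprojZ N) (tproj_N hN) scaler0 add0r (dirM_N hN tX) (tprojD N) (tprojN N).
  rewrite (tproj_id hN m_gt0 (shape_tangent hN m_gt0 tX)).
  rewrite -(tproj_G2_proj q (II _ _ _)) G2_proj_II; [|exact: imm_G2|exact: tangent_G2|exact: (N_G2 hN)].
  by rewrite tproj0 addr0 scalerN.
rewrite -[LHS]tproj_G2_proj (G2_proj_dirM_II oW Wq vY vZ tX) (tprojN N).
by rewrite tproj_G2_proj (tprojD N).
Qed.

(** The Gauss equation, as the tangential part of [dirM_mx_commutator]. The double bracket [[[X, Y],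
    Z]] is the curvature tensor of the Grassmannian as a symmetric space. *)
Lemma curvatureE W X Y Z q : open W -> W q -> vfield W X -> vfield W Y -> vfield W Z ->
  curvature nabla X Y Z q =
  tproj q ((X q *m Y q - Y q *m X q) *m Z q - Z q *m (X q *m Y q - Y q *m X q))
  + ((gmet (shape_op N q (Y q)) (Z q))%:C *: shape_op N q (X q)
     - (gmet (shape_op N q (X q)) (Z q))%:C *: shape_op N q (Y q)).
Proof.
move=> oW Wq vX vY vZ.
have C := dirM_mx_commutator oW Wq vX vY (vfield_smooth vZ) (fun k => dirM_mx_frame_smooth k oW vZ).
have B a b : tproj q (a - b) = tproj q a - tproj q b by rewrite (tprojD N) (tprojN N).
have T := etrans (esym (congr1 (tproj q) C)) (etrans (B _ _)
  (congr2 (fun x y => x - y) (nabla_nabla oW Wq vX vY vZ) (nabla_nabla oW Wq vY vX vZ))).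
rewrite /curvature (nablaE hN m_gt0 hnabla oW Wq (bracket_vfield oW vX vY) vZ) T.
have K (n1 n2 a b c d : cmat R m) : n1 - n2 - (n1 - a - c - (n2 - b - d)) = c - d + (a - b).
  by have ok : nc_ok [:: n1; n2; a; b; c; d] [::] by []; nc ok; ring.
apply: etrans (K _ _ _ _ _ _) _; rewrite -B; congr (tproj q _ + _).
by have ok : nc_ok [:: X q; Y q; Z q] [::] by []; nc ok; ring.
Qed.

End Gauss_equation.

(** * Orthonormal frames and the Ricci tensor *)

Lemma sum_option (A : nmodType) (I : finType) (F : option I -> A) :
  \sum_i F i = F None + \sum_i F (Some i).
Proof.
rewrite (bigD1 None)//= (reindex_omap (some : I -> _) id)/=; last by case.
by congr (_ + _); apply: eq_bigl => i; rewrite eqxx.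
Qed.

Lemma sum_scaleB {R : realType} (V : lmodType R[i]) (I : finType) (f c : I -> R) (a : V)
    (b : I -> V) :
  \sum_i ((f i)%:C *: a - (c i)%:C *: b i) = (\sum_i f i)%:C *: a - \sum_i (c i)%:C *: b i.
Proof. by rewrite sumrB -scaler_suml -(rmorph_sum (real_complex R)). Qed.

(** * Parseval frames and traces on the tangent space *)

Section Parseval_frames.
Context {R : realType} {m : nat}.
Implicit Types (P X H V : cmat R m).

(** The reproducing property is all that traces need, and it is inherited by the image of a frame
    under [kahlerJ]. *)
Definition parseval_frame (I : finType) P (f : I -> cmat R m) : Prop :=
  (forall i, G2_tangent P (f i)) /\
  forall V, G2_tangent P V -> V = \sum_i (gmet V (f i))%:C *: f i.

Lemma tr_herm_real H V : H^t* = H -> V^t* = V -> \tr (H *m V) = (4 * gmet H V)%:C.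
Proof.
move=> hH hV; rewrite /gmet mulrC divfK ?pnatr_eq0//.
have : (\tr (H *m V))^*%C = \tr (H *m V) by rewrite -tr_adj adjM hH hV mxtrace_mulC.
by case: (\tr _) => a b [/eqP]; rewrite eq_sym -subr_eq0 opprK -mulr2n mulrn_eq0/= => /eqP ->.
Qed.

(** Both sides are complex linear in [H], and [H] is a complex combination of two Hermitian
    matrices, for which this is the reproducing property. *)
Lemma parseval_G2_proj (I : finType) P (f : I -> cmat R m) H : G2 R m P -> parseval_frame P f ->
  G2_proj P H = \sum_i (\tr (H *m f i) / 4) *: f i.
Proof.
move=> gP [tf ef].
have herm K : K^t* = K -> G2_proj P K = \sum_i (\tr (K *m f i) / 4) *: f i.
  move=> hK; rewrite {1}(ef _ (G2_projP gP hK)); apply: eq_bigr => i _.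
  rewrite (gmet_G2_proj _ gP (tf i)) (tr_herm_real hK (tf i).1); congr (_ *: _).
  rewrite (rmorphM (real_complex R) 4) rmorph_nat mulrAC divff ?pnatr_eq0//.
  by rewrite mul1r.
pose H1 := 2^-1 *: (H + H^t*); pose H2 := ('i%C / 2) *: (H^t* - H).
have h1 : H1^t* = H1.
  rewrite /H1 adjZ adjD adjK addrC; congr (_ *: _).
  by rewrite (_ : (2 : R[i])^-1 = (2^-1)%:C) ?conjc_real// fmorphV rmorph_nat.
have h2 : H2^t* = H2.
  rewrite /H2 adjZ adjB adjK -opprB scalerN -scaleNr; congr (_ *: _).
  have -> : (2 : R[i])^-1 = (2^-1)%:C by rewrite fmorphV rmorph_nat.
  by apply/eqP; rewrite eq_complex/=; apply/andP; split; apply/eqP; ring.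
have E : H = H1 + 'i%C *: H2.
  rewrite /H1 /H2 scalerA mulrA -expr2 sqr_i mulN1r scaleNr -scalerN opprB -scalerDr.
  by rewrite addrACA subrr addr0 -(mulr2n H) -(scaler_nat 2 H) scalerA mulVf ?scale1r// pnatr_eq0.
move: H1 H2 h1 h2 E => H1 H2 h1 h2 ->.
rewrite G2_projD G2_projZ (herm _ h1) (herm _ h2) scaler_sumr -big_split/=.
apply: eq_bigr => i _; rewrite scalerA -scalerDl; congr (_ *: _).
by rewrite mulmxDl -scalemxAl linearD linearZ/= mulrDl mulrA.
Qed.

Lemma tr_delta (b d : 'I_m.+2) X : \tr (delta_mx b d *m X) = X d b.
Proof.
rewrite /mxtrace (bigD1 b)//= big1 ?addr0 => [|k kb].
  rewrite mxE (bigD1 d)//= big1 ?addr0 ?mxE ?eqxx ?mul1r// => l ld.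
  by rewrite mxE (negPf ld) andbF mul0r.
by rewrite mxE big1// => l _; rewrite mxE (negPf kb) mul0r.
Qed.

(** Since the trace of [E_bd f] is an entry of [f], the sum is entrywise an expansion of [G2_proj P]
    at matrix units, which is explicit. The factor 4 undoes the normalization of [gmet]. *)
Lemma parseval_casimir (I : finType) P (f : I -> cmat R m) X : G2 R m P -> parseval_frame P f ->
  \sum_i f i *m X *m f i =
  4%:R *: (\tr (X *m P) *: (1%:M - P) + \tr (X *m (1%:M - P)) *: P).
Proof.
move=> gP pf; apply/matrixP => a b.
have -> : (\sum_i f i *m X *m f i) a b =
    \sum_c \sum_d X c d * (\sum_i \tr (delta_mx b d *m f i) *: f i) a c.
  rewrite summxE; transitivity (\sum_i \sum_c \sum_d X c d * (f i d b * f i a c)).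
    apply: eq_bigr => i _; rewrite mxE exchange_big/=; apply: eq_bigr => d _.
    rewrite [X in X * _]mxE big_distrl/=; apply: eq_bigr => c _.
    by rewrite -mulrA mulrC -mulrA.
  rewrite exchange_big/=; apply: eq_bigr => c _; rewrite exchange_big/=; apply: eq_bigr => d _.
  rewrite summxE big_distrr/=; apply: eq_bigr => i _.
  by rewrite mxE tr_delta.
have D d c : (\sum_i \tr (delta_mx b d *m f i) *: f i) a c =
    4 * (P a b * (1%:M - P) d c + (1%:M - P) a b * P d c).
  have <- : G2_proj P (delta_mx b d) a c = P a b * (1%:M - P) d c + (1%:M - P) a b * P d c.
    have S Y Z : (Y *m delta_mx b d *m Z : cmat R m) a c = Y a b * Z d c.
      rewrite mxE (bigD1 d)//= big1 => [|k kd].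
        rewrite addr0 mxE (bigD1 b)//= big1 => [|k kb]; first by rewrite addr0 mxE !eqxx mulr1.
        by rewrite mxE (negPf kb) mulr0.
      by rewrite mxE big1 ?mul0r// => l _; rewrite mxE (negPf kd) andbF mulr0.
    by rewrite /G2_proj [LHS]mxE !S.
  rewrite (parseval_G2_proj _ gP pf) !summxE big_distrr/=; apply: eq_bigr => i _.
  by rewrite !mxE mulrA mulrCA divff ?mulr1// pnatr_eq0.
transitivity (4 * (\sum_c \sum_d (X c d * (1%:M - P) d c) * P a b +
    \sum_c \sum_d (X c d * P d c) * (1%:M - P) a b)).
  rewrite -big_split/= big_distrr/=; apply: eq_bigr => c _.
  rewrite -big_split/= big_distrr/=; apply: eq_bigr => d _; rewrite D.
  by move: (X c d) (P a b) (P d c) ((1%:M - P) a b) ((1%:M - P) d c) => x y z u v; ring.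
have T (Y : cmat R m) : \sum_c \sum_d X c d * Y d c = \tr (X *m Y) by apply: eq_bigr => c _; rewrite mxE.
have Z c Y : (c *: Y : cmat R m) a b = c * Y a b by rewrite mxE.
have A (Y Y' : cmat R m) : (Y + Y') a b = Y a b + Y' a b by rewrite mxE.
move: (1%:M - P) => Q'; rewrite Z A !Z addrC -!T !big_distrl/=.
by congr (_ * (_ + _)); apply: eq_bigr => c _; rewrite big_distrl.
Qed.

Lemma parseval_trace (I K : finType) P (f : I -> cmat R m) (g : K -> cmat R m)
    (L : cmat R m -> cmat R m) : parseval_frame P f -> parseval_frame P g ->
  (forall a X Y, G2_tangent P X -> G2_tangent P Y -> L (a%:C *: X + Y) = a%:C *: L X + L Y) ->
  (forall X, G2_tangent P X -> G2_tangent P (L X)) ->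
  \sum_i gmet (L (f i)) (f i) = \sum_k gmet (L (g k)) (g k).
Proof.
move=> [tf ef] [tg eg] Ll tL.
have t0 : G2_tangent P (0 : cmat R m) by split; rewrite ?adj0// mulmx0 mul0mx addr0.
have tD X Y : G2_tangent P X -> G2_tangent P Y -> G2_tangent P (X + Y).
  by move=> [hX eX] [hY eY]; split; rewrite ?adjD ?hX ?hY// mulmxDl mulmxDr addrACA eX eY.
have tZ a X : G2_tangent P X -> G2_tangent P (a%:C *: X).
  move=> [hX eX]; split; first by rewrite adjZ hX conjc_real.
  by rewrite -scalemxAl -scalemxAr -scalerDr eX.
have L0 : L 0 = 0 by have := Ll (-1) 0 0 t0 t0; rewrite rmorphN1 scaler0 addr0 scaleN1r addNr.
have tS (r : seq K) (c : K -> R) : G2_tangent P (\sum_(k <- r) (c k)%:C *: g k).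
  elim: r => [|k r IH]; first by rewrite big_nil.
  by rewrite big_cons; apply: tD => //; exact: tZ.
have LS (r : seq K) (c : K -> R) : L (\sum_(k <- r) (c k)%:C *: g k) = \sum_(k <- r) (c k)%:C *: L (g k).
  by elim: r => [|k r IH]; rewrite ?big_nil ?L0// !big_cons Ll// IH.
have E i : gmet (L (f i)) (f i) = \sum_k gmet (f i) (g k) * gmet (L (g k)) (f i).
  rewrite {1}(eg _ (tf i)) LS gmet_suml; apply: eq_bigr => k _; exact: gmetZl.
rewrite (eq_bigr _ (fun i _ => E i)) exchange_big/=; apply: eq_bigr => k _.
rewrite [X in gmet X (g k)](ef _ (tL _ (tg k))) gmet_suml; apply: eq_bigr => i _.
by rewrite gmetZl mulrC.
Qed.

End Parseval_frames.

Section Frames.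
Context {R : realType} {m : nat} (M : hypersurface R m).
Context (N : M -> cmat R m) (hN : unit_normal N) (m_gt0 : (0 < m)%N).
Implicit Types (p q : M) (W : set M) (X Y Z : M -> cmat R m) (V H : cmat R m).
Local Notation tproj := (tproj N).

Lemma open_smooth_fun_gt0 W (f : M -> R) : open W -> smooth_fun W f ->
  open [set q | W q /\ 0 < f q].
Proof.
move=> oW sf; rewrite openE => q [Wq fq]; have [q0 cq] := dom_center q.
pose U := dom q `&` chart q @^-1` W.
have oU : open U := open_dom_chart q oW.
have U0 : U 0 by split; rewrite //= cq.
pose A := [set u | U u /\ 0 < f (chart q u)].
have oA : open A.
  rewrite openE => u [Uu fu]; rewrite /interior.
  have c : {for u, continuous (fun u => f (chart q u) : R^o)} := sf q 0%N u Uu.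
  have n1 := near_open oU Uu.
  have n2 : \forall x \near u, 0 < f (chart q x).
    have o : nbhs (f (chart q u) : R^o) [set t : R^o | 0 < t].
      by apply: open_nbhs_nbhs; split=> //; exact: open_gt.
    exact: (c _ o).
  by near=> x; split; near: x.
have AU : A `<=` dom q by move=> u [[]].
have oB : open (chart q @` A) by exact: chart_open.
have Bq : (chart q @` A) q by exists 0 => //; split; rewrite ?cq.
have BA : chart q @` A `<=` [set q | W q /\ 0 < f q] by move=> _ [u [[_ Wu] fu] <-].
exact: (filterS BA (open_nbhs_nbhs (conj oB Bq))).
Unshelve. all: by end_near. Qed.

Lemma orthogonal_tangent q n (e : 'I_n -> cmat R m) : (n < (4 * m).-1)%N ->
  (forall i, (e i)^t* = e i) ->
  exists2 V, tangent q V /\ V <> 0 & forall i, gmet V (e i) = 0.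
Proof.
move=> nm he; have [q0 cq] := dom_center q.
pose D v := derive_mx (imm \o chart q) 0 v.
pose A : 'M[R]_((4 * m).-1, n) := \matrix_(k, i) gmet (D (delta_mx 0 k)) (e i).
have kA : kermx A != 0.
  rewrite kermx_eq0; apply/negP => /eqP E; have := rank_leq_col A.
  by rewrite E leqNgt nm.
have /rowV0Pn [v vk v0] := kA.
have Dl (a : R) x y : D (a *: x + y) = a%:C *: D x + D y by exact: (Phi_linear q0).
have D0 : D 0 = 0 by have := Dl (-1) 0 0; rewrite rmorphN1 scaler0 addr0 scaleN1r addNr.
exists (D v); first split; first by exists v.
  by move=> /(@imm_immersion _ _ M q 0 v q0) E; rewrite E eqxx in v0.
move=> i; have /sub_kermxP/matrixP/(_ 0 i) := vk; rewrite !mxE => <-.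
rewrite {1}(row_sum_delta v).
have -> : D (\sum_j v 0 j *: delta_mx 0 j) = \sum_j (v 0 j)%:C *: D (delta_mx 0 j).
  elim: (index_enum _) => [|j r IH]; first by rewrite !big_nil.
  by rewrite !big_cons Dl IH.
by rewrite gmet_suml; apply: eq_bigr => j _; rewrite gmetZl mxE.
Qed.

(** Gram-Schmidt for fields: a vector orthogonal to the previous fields at [p] is extended by
    [tproj] and corrected, and the domain shrinks to where the corrected field does not vanish. *)
Lemma orthonormal_fields_exist p n : (n <= (4 * m).-1)%N ->
  exists W, exists e : 'I_n -> M -> cmat R m, [/\ open W, W p, forall i, vfield W (e i) &
    forall q i j, W q -> gmet (e i q) (e j q) = (i == j)%:R].
Proof.
elim: n => [_|n IH nm].
  by exists setT, (fun=> fun=> 0); split=> //; [exact: openT|case|move=> q; case].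
have [W [e [oW Wp ve oe]]] := IH (ltnW nm).
have he i q : W q -> (e i q)^t* = e i q by move=> Wq; exact: (vfield_herm (ve i) Wq).
have [V [tV V0] Ve] := orthogonal_tangent p nm (fun i => he i p Wp).
have hV : V^t* = V by case: (tangent_G2 tV).
pose Y q := tproj q V - \sum_i (gmet V (e i q))%:C *: e i q.
have sS : smooth_field W (fun q => \sum_i (gmet V (e i q))%:C *: e i q).
  apply: smooth_field_sum => // i; apply: smooth_fieldZ => //; last exact: vfield_smooth.
  by apply: smooth_fun_gmet => //; [exact: smooth_field_cst|exact: vfield_smooth].
have vV := vfield_tproj_cst hN m_gt0 oW hV.
have vY : vfield W Y.
  split=> [q Wq|]; last by apply: smooth_fieldB => //; exact: vfield_smooth.
  apply: tangentD; first exact: (vfield_tangent vV Wq).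
  by apply/tangentN/tangent_sum => i; apply: tangentZ; exact: (vfield_tangent (ve i) Wq).
have Yp : Y p = V.
  by rewrite /Y (tproj_id hN m_gt0 tV) big1 ?subr0// => i _; rewrite Ve scale0r.
have Ye q i : W q -> gmet (Y q) (e i q) = 0.
  move=> Wq; rewrite /Y gmetBl gmet_suml (gmet_tproj hN m_gt0 _ (vfield_tangent (ve i) Wq)).
  rewrite (bigD1 i)//= gmetZl oe// eqxx mulr1 big1 ?addr0 ?subrr// => j ji.
  by rewrite gmetZl oe// (negPf ji) mulr0.
have sYY : smooth_fun W (fun q => gmet (Y q) (Y q)).
  by apply: smooth_fun_gmet => //; exact: vfield_smooth.
pose W' := [set q | W q /\ 0 < gmet (Y q) (Y q)].
have oW' : open W' := open_smooth_fun_gt0 oW sYY.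
have WW' : W' `<=` W by move=> q [].
have vY' := vfield_sub WW' vY.
pose c q := (Num.sqrt (gmet (Y q) (Y q)))^-1.
have sc : smooth_fun W' c.
  move=> q; apply: smooth_rsqrt; first exact: open_dom_chart.
    by move=> u [_ []].
  exact: (smooth_fun_sub WW' sYY).
have cY q : W' q -> gmet ((c q)%:C *: Y q) ((c q)%:C *: Y q) = 1.
  move=> [Wq Yq]; rewrite gmetZl gmetZr /c -[X in _ * (_ * X)]sqr_sqrtr ?ltW// expr2.
  by rewrite mulKf ?mulVf// sqrtr_eq0 -ltNge.
exists W', (fun i q => if unlift ord_max i is Some j then e j q else (c q)%:C *: Y q); split=> //.
- split=> //; rewrite Yp lt_def gmet_ge0// andbT; apply/eqP => /(gmet_eq0 hV); exact: V0.
- move=> i; case: unlift => [j|]; first exact: vfield_sub (ve j).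
  split=> [q Wq|]; first by apply: tangentZ; exact: (vfield_tangent vY' Wq).
  by apply: smooth_fieldZ => //; exact: vfield_smooth vY'.
move=> q i j Wq; have Wq' := WW' _ Wq.
case: (unliftP ord_max i) => [i' ->|->]; case: (unliftP ord_max j) => [j' ->|->].
- by rewrite oe// (inj_eq lift_inj).
- by rewrite gmetZr gmetC Ye// mulr0 eq_sym (negPf (neq_lift _ _)).
- by rewrite gmetZl Ye// mulr0 (negPf (neq_lift _ _)).
by rewrite cY// eqxx.
Qed.

Lemma onb_expand q (e : 'I_((4 * m).-1) -> cmat R m) : (forall i, tangent q (e i)) ->
  (forall i j, gmet (e i) (e j) = (i == j)%:R) ->
  forall V, tangent q V -> V = \sum_i (gmet V (e i))%:C *: e i.
Proof.
move=> te oe V tV; pose D (v : 'rV[R]_((4 * m).-1)) := \sum_i (v 0 i)%:C *: e i.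
have De v i : gmet (D v) (e i) = v 0 i.
  rewrite gmet_suml (bigD1 i)//= gmetZl oe eqxx mulr1 big1 ?addr0// => j ji.
  by rewrite gmetZl oe (negPf ji) mulr0.
have tD v : tangent q (D v) by apply: tangent_sum => i; exact: tangentZ.
have [gV NV] := (tangentP hN m_gt0 q V).1 tV.
have Dl a v w : D (a *: v + w) = a%:C *: D v + D w.
  rewrite scaler_sumr -big_split/=; apply: eq_bigr => i _.
  by rewrite !mxE rmorphD rmorphM/= scalerDl scalerA.
have Di v : D v = 0 -> v = 0 by move=> D0; apply/rowP => i; rewrite -De D0 gmet0l mxE.
have [v ->] := hyperplane_surj (imm_G2 q) (N_G2 hN q) (N_unit hN q) m_gt0 erefl Dl
  Di (fun v => (tangentP hN m_gt0 q (D v)).1 (tD v)) gV NV.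
by apply: eq_bigr => i _; rewrite De.
Qed.

Lemma onb_parseval q (e : 'I_((4 * m).-1) -> cmat R m) : (forall i, tangent q (e i)) ->
  (forall i j, gmet (e i) (e j) = (i == j)%:R) -> parseval_frame (imm q) (oapp e (N q)).
Proof.
move=> te oe; split=> [[i|]|V gV] /=; [exact: tangent_G2|exact: (N_G2 hN)|].
have tV : tangent q (V - (gmet V (N q))%:C *: N q).
  apply/(tangentP hN m_gt0); split; last first.
    by rewrite gmetBr gmetZr (N_unit hN) mulr1 gmetC subrr.
  have [hV eV] := gV; have [hn en] := N_G2 hN q.
  split; first by rewrite adjB adjZ hV hn conjc_real.
  by rewrite mulmxBl mulmxBr -scalemxAl -scalemxAr addrACA -opprD -scalerDr eV en.
rewrite sum_option; apply/eqP; rewrite addrC -subr_eq; apply/eqP.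
rewrite /= {1}(onb_expand te oe tV); apply: eq_bigr => i _.
by rewrite gmetBl gmetZl (N_perp hN (te i)) mulr0 subr0.
Qed.

End Frames.

Section Ricci.
Context {R : realType} {m : nat} (M : hypersurface R m).
Context (N : M -> cmat R m) (hN : unit_normal N) (m_gt0 : (0 < m)%N).
Context (nabla : (M -> cmat R m) -> (M -> cmat R m) -> M -> cmat R m)
  (hnabla : levi_civita nabla) (S : M -> cmat R m -> cmat R m)
  (hS : ricci_tensor nabla S).
Implicit Types (p q : M) (W : set M) (X Y Z : M -> cmat R m) (V H : cmat R m).
Local Notation tproj := (tproj N).

Lemma shape0 q : shape_op N q 0 = 0.
Proof.
have := shape_lin hN (-1) (tangent0 q) (tangent0 q).
by rewrite rmorphN1 scaler0 addr0 scaleN1r addNr.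
Qed.

Lemma shape_sum q (I : finType) (c : I -> R) (e : I -> cmat R m) :
  (forall i, tangent q (e i)) ->
  shape_op N q (\sum_i (c i)%:C *: e i) = \sum_i (c i)%:C *: shape_op N q (e i).
Proof.
move=> te; elim: (index_enum _) => [|i r IH]; first by rewrite !big_nil shape0.
rewrite !big_cons (shape_lin hN)// ?IH//.
by apply: tangent_sum => j; exact: tangentZ.
Qed.

(** The Gauss equation summed over a frame. With [N] added the frame becomes one of the
    Grassmannian, whose Einstein constant [4m + 8] results from the Casimir sum; the contribution of
    [N] is then subtracted. *)
Lemma ricci_shape q : exists e : 'I_((4 * m).-1) -> cmat R m,
  [/\ forall i, tangent q (e i), forall i j, gmet (e i) (e j) = (i == j)%:R &
   forall X, vfield setT X -> let A := shape_op N q in let x := X q in let n := N q in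
   S q x = (4 * m + 8)%:R *: x - tproj q (x *m n *m n - 2%:R *: (n *m x *m n) + n *m n *m x)
     + ((\sum_i gmet (A (e i)) (e i))%:C *: A x - A (A x))].
Proof.
have [W [e [oW Wq ve oe]]] := orthonormal_fields_exist hN m_gt0 q (leqnn _).
exists (fun i => e i q).
have te i : tangent q (e i q) by exact: vfield_tangent (ve i) Wq.
have oeq i j := oe q i j Wq.
split=> // X vX /=; set A := shape_op N q; set x := X q; set n := N q.
have vXW : vfield W X by apply: vfield_sub vX.
have tx : tangent q x := vfield_tangent vX I.
rewrite (hS oW (conj ve oe) vXW Wq).
rewrite (eq_bigr _ (fun i _ => curvatureE hN m_gt0 hnabla oW Wq vXW (ve i) (ve i))).
rewrite big_split/=; congr (_ + _); last first.
  apply: etrans (sum_scaleB _ _ _ _) _; apply: (congr2 (fun a b => a - b)) => //.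
  apply: etrans (esym (shape_sum _ te)) _; apply: (congr1 A).
  exact: esym (onb_expand hN m_gt0 te oeq (shape_tangent hN m_gt0 tx)).
have pf := onb_parseval hN m_gt0 te oeq.
have gP := imm_G2 q.
have C H := parseval_casimir H gP pf.
have gx := tangent_G2 tx; have gn : G2_tangent (imm q) n := N_G2 hN q.
have [_ PP _] := gP; have [_ xP] := gx.
have PxP := G2_tangent_PXP gP gx.
have trP : \tr (x *m imm q) = 0.
  by rewrite -PP mulmxA mxtrace_mulC mulmxA PxP linear0.
have trQ : \tr (x *m (1%:M - imm q)) = 0.
  by rewrite mulmxBr mulmx1 linearB/= trP subr0 -xP linearD/= mxtrace_mulC trP addr0.
(* At 1 the Casimir sum evaluates the squares [f_i f_i]; at the tangent vector [x] both traces
   vanish, and with them the sum of the [f_i x f_i]. *)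
have C1 := C 1%:M; have Cx := C x.
rewrite trP trQ !scale0r addr0 scaler0 in Cx.
have t1 : \tr (1%:M *m imm q) = 2%:R by rewrite mul1mx (G2_trace gP).
have t2 : \tr (1%:M *m (1%:M - imm q)) = m.+2%:R - 2%:R.
  by rewrite mul1mx raddfB/= mxtrace1 (G2_trace gP).
rewrite t1 t2 in C1.
pose f i := oapp (fun i => e i q) n i.
pose G (f : cmat R m) := x *m f *m f - 2%:R *: (f *m x *m f) + f *m f *m x.
have S0 : \sum_i G (f i) = (4 * m + 8)%:R *: x.
  have -> : \sum_i G (f i) = x *m (\sum_i f i *m 1%:M *m f i)
      - 2%:R *: (\sum_i f i *m x *m f i) + (\sum_i f i *m 1%:M *m f i) *m x.
    rewrite mulmx_sumr mulmx_suml scaler_sumr -sumrB -big_split/=; apply: eq_bigr => i _.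
    by rewrite /G !mulmx1 mulmxA.
  rewrite C1 Cx scaler0 subr0 natrD natrM.
  have -> : (m.+2%:R - 2%:R : R[i]) = m%:R by rewrite -addn2 natrD addrK.
  have [y [y' [? [? [? [? [-> _ _ ok0]]]]]]] := tangent_letters gP gx gx gx; nc_have ok ok0.
  by move: (m%:R : R[i]) => c; nc ok; ring.
rewrite sum_option in S0.
have tS (I : finType) (F : I -> cmat R m) : \sum_i tproj q (F i) = tproj q (\sum_i F i).
  by rewrite (big_morph (tproj q) (tprojD N q) (tproj0 N q)).
have tpx := tproj_id hN m_gt0 (tangentZ (4 * m + 8)%:R tx).
rewrite rmorph_nat in tpx; rewrite tS -[X in X - _]tpx.
have E : (4 * m + 8)%:R *: x - G n = \sum_i G (f (Some i)).
  by apply/eqP; rewrite subr_eq -S0; apply/eqP; exact: addrC.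
rewrite -(tprojN N) -(tprojD N) -/(G n) E; congr (tproj q _); apply: eq_bigr => i _.
by rewrite /G/= -/x; move: (e i q) => g; have ok : nc_ok [:: x; g] [::] by []; nc ok; ring.
Qed.

End Ricci.

(** * The Reeb field in the maximal quaternionic subbundle *)

Lemma typed_ok {K : comNzRingType} {n : nat} (P : 'M[K]_n) (env : seq 'M[K]_n) tys :
  P *m P = P -> nc_typed [:: P; 1%:M - P] (P :: env) ((0, 0)%N :: tys) ->
  nc_ok (P :: env) (nc_gen [:: 0%N] ((0, 0)%N :: tys) ((0, 0)%N :: tys) 0).
Proof.
move=> PP ty; apply: (@nc_gen_ok _ _ [:: P; 1%:M - P]) => //.
by move=> [|[|i]] [|[|j]] //=;
  rewrite ?mul0mx ?mulmx0// ?mulmxBl ?mulmxBr ?mul1mx ?mulmx1 PP ?subrr.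
Qed.

Section Hopf_algebra.
Context {R : realType} {m : nat}.
Implicit Types (P n X Y Z k s : cmat R m).

Lemma G2_tangent_split P X : G2 R m P -> G2_tangent P X -> exists x x',
  [/\ X = x + x', (1%:M - P) *m x = x, x *m P = x, P *m x' = x' & x' *m (1%:M - P) = x'].
Proof.
move=> gP gX; have [x1 x2 x3 x4 x5] := tangent_blocks gP gX.
exists (X *m P), (P *m X); split=> //; first by rewrite mulmxBl mul1mx x1 subr0.
by rewrite mulmxBr mulmx1 x4 subr0.
Qed.

(* The matrices i, j, k of quaternions acting on C^2. *)
Definition pauli (a : 'I_3) : 'M[R[i]]_2 :=
  \matrix_(x, y) (if a == 0 then (if x == y then (if x == 0 then 'i%C else - 'i%C) else 0)
   else if a == 1 then (if x == y then 0 else (if x == 0 then 1 else - 1))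
   else (if x == y then 0 else 'i%C)).

Lemma mx2P (K : nmodType) (A B : 'M[K]_2) : A 0 0 = B 0 0 -> A 0 1 = B 0 1 ->
  A 1 0 = B 1 0 -> A 1 1 = B 1 1 -> A = B.
Proof.
move=> e1 e2 e3 e4; apply/matrixP => i j.
have ord2 (c : 'I_2) : c = 0 \/ c = 1.
  by case: c => [[|[|]]] // ?; [left|right]; apply/val_inj.
by case: (ord2 i) => ->; case: (ord2 j) => ->.
Qed.

Lemma pauli_quat (a b : 'I_3) : pauli a *m pauli b + pauli b *m pauli a =
  - (((a == b)%:R *+ 2) *: 1%:M).
Proof.
have ord3 (c : 'I_3) : [\/ c = 0, c = 1 | c = 2%:R].
  by case: c => [[|[|[|]]]] // ?; [constructor 1|constructor 2|constructor 3]; apply/val_inj.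
have s2 (F : 'I_2 -> R[i]) : \sum_i F i = F 0 + F 1.
  by rewrite !big_ord_recl big_ord0 addr0; congr (_ + F _); apply/val_inj.
by case: (ord3 a) => ->; case: (ord3 b) => ->; apply: mx2P; rewrite !mxE !s2 !mxE /=;
  apply/eqP; rewrite eq_complex/=; apply/andP; split; apply/eqP; ring.
Qed.

Lemma pauli_skew a : (pauli a)^t* = - pauli a /\ \tr (pauli a) = 0.
Proof.
have ord3 (c : 'I_3) : [\/ c = 0, c = 1 | c = 2%:R].
  by case: c => [[|[|[|]]]] // ?; [constructor 1|constructor 2|constructor 3]; apply/val_inj.
split.
  by case: (ord3 a) => ->; apply: mx2P; rewrite !mxE /=;
    apply/eqP; rewrite eq_complex/=; apply/andP; split; apply/eqP; ring.
rewrite /mxtrace !big_ord_recl big_ord0 addr0.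
by case: (ord3 a) => ->; rewrite !mxE /= ?addr0 ?subrr.
Qed.

Lemma pauli_prod : pauli 0 *m pauli 1 = pauli 2%:R.
Proof.
have s2 (F : 'I_2 -> R[i]) : \sum_i F i = F 0 + F 1.
  by rewrite !big_ord_recl big_ord0 addr0; congr (_ + F _); apply/val_inj.
by apply: mx2P; rewrite !mxE !s2 !mxE /=;
  apply/eqP; rewrite eq_complex/=; apply/andP; split; apply/eqP; ring.
Qed.

Lemma quat_basis_exists P : G2 R m P -> exists K : 'M[R[i]]_(m.+2, 2),
  [/\ K^t* *m K = 1%:M, K *m K^t* = P & quat_basis P (fun a => K *m pauli a *m K^t*)].
Proof.
move=> gP; have [K [L [KK KP _ _ _]]] := G2_frame gP; exists K; split=> //; split=> [a|a b].
  have [ps pt] := pauli_skew a.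
  split.
  - by rewrite !adjM adjK ps mulNmx mulmxN mulmxA.
  - by rewrite -KP !mulmxA -(mulmxA K (K^t*)) KK mulmx1.
  - by rewrite -KP !mulmxA -(mulmxA (K *m _) (K^t*)) KK mulmx1.
  by rewrite mxtrace_mulC mulmxA KK mul1mx.
have e c d : K *m pauli c *m K^t* *m (K *m pauli d *m K^t*) = K *m (pauli c *m pauli d) *m K^t*.
  by rewrite !mulmxA -(mulmxA (K *m _) (K^t*)) KK mulmx1.
rewrite !e -mulmxDl -mulmxDr pauli_quat mulmxN mulNmx -scalemxAr -scalemxAl mulmx1.
by rewrite KP.
Qed.

(* For a Hermitian form on C^2, orthogonality to i, j, k means being a multiple
   of the identity. *)
Lemma pauli_orthogonal (G : 'M[R[i]]_2) : G^t* = G ->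
  (forall a, complex.Re ('i%C * \tr (pauli a *m G)) = 0) -> 2%:R *: G = \tr G *: 1%:M.
Proof.
have s2 (F : 'I_2 -> R[i]) : \sum_i F i = F 0 + F 1.
  by rewrite !big_ord_recl big_ord0 addr0; congr (_ + F _); apply/val_inj.
move=> hG H; have hE i j : G i j = (G j i)^*%C by rewrite -[in LHS]hG adjE.
have := H 0; have := H 1; have := H 2%:R.
rewrite /mxtrace !s2 !mxE !s2 !mxE /=.
have := hE 0 0; have := hE 0 1; have := hE 1 1.
case E00: (G 0 0) => [a b]; case E01: (G 0 1) => [c d]; case E10: (G 1 0) => [e f].
case E11: (G 1 1) => [g h]; rewrite /=.
move=> [h0] [c0 d0] [b0] h2 h1 h3.
apply: mx2P; rewrite !mxE ?s2 ?E00 ?E01 ?E10 ?E11 /=; apply/eqP; rewrite eq_complex/=;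
  apply/andP; split; apply/eqP; lra.
Qed.

(** The product of [J n] with [J_a n] is a multiple of the real part of the trace of ['i q_a n^2].
    So the Hermitian form of [n^2] on the plane is orthogonal to su(2), hence scalar, and the length
    of [n] makes the scalar 1. *)
Lemma normal_square P n : G2 R m P -> G2_tangent P n -> gmet n n = 1 ->
  (forall q, quat_basis P q -> forall a, gmet (- kahlerJ P n) (- quatJ (q a) n) = 0) ->
  P *m n *m n = P.
Proof.
move=> gP gn nn H; have [hP PP _] := gP; have [hn _] := gn.
have [K [KK KP qb]] := quat_basis_exists gP.
pose G := K^t* *m (n *m n) *m K.
have hG : G^t* = G by rewrite /G !adjM adjK hn mulmxA.
have [n2 [n1 [en a1 a2 a3 a4]]] := G2_tangent_split gP gn.
have T q : P *m q = q -> q *m P = q ->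
    \tr ((- kahlerJ P n) *m (- quatJ q n)) = - 2%:R * ('i%C * \tr (q *m (n *m n))).
  move=> q1 q2; rewrite -!mxtraceZ.
  have ok0 : nc_ok [:: P; n2; n1; q] (nc_gen [:: 0] [:: (0, 0); (1, 0); (0, 1); (0, 0)]
      [:: (0, 0); (1, 0); (0, 1); (0, 0)] 0)%N by apply: typed_ok => //=; do !split.
  by nc_have ok ok0; rewrite en /kahlerJ /quatJ; nc ok; ring.
have tnn : \tr (n *m n) = 4%:R by rewrite (tr_herm_real hn hn) nn mulr1 rmorph_nat.
have ok0 : nc_ok [:: P; n2; n1] (nc_gen [:: 0] [:: (0, 0); (1, 0); (0, 1)]
      [:: (0, 0); (1, 0); (0, 1)] 0)%N by apply: typed_ok => //=; do !split.
nc_have ok ok0.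
have trG : \tr G = 2%:R.
  have E : \tr (n *m n) = \tr (2%:R *: (P *m (n *m n))) by rewrite en; nc ok; ring.
  rewrite mxtraceZ tnn in E; apply: (@mulfI _ 2%:R); first by rewrite pnatr_eq0.
  have -> : \tr G = \tr (P *m (n *m n)) by rewrite /G (mxtrace_mulC (_ *m _) K) mulmxA KP.
  by rewrite -E -natrM.
have G1 : 2%:R *: G = \tr G *: 1%:M.
  apply: pauli_orthogonal => // a.
  have [_ q1 q2 _] := qb.1 a; have := H _ qb a.
  rewrite /gmet (T _ q1 q2) => /eqP; rewrite mulf_eq0 invr_eq0 pnatr_eq0 orbF => /eqP E.
  have -> : \tr (pauli a *m G) = \tr (K *m pauli a *m K^t* *m (n *m n)).
    by rewrite /G -!(mulmxA K) -(mulmxA (pauli a) (K^t*)) (mxtrace_mulC K) -(mulmxA (pauli a)).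
  move: E; case: ('i%C * _) => x y /= E.
  have {}E : 2%:R * x = 0 by rewrite -[RHS]oppr0 -E; ring.
  by move/eqP: E; rewrite mulf_eq0 pnatr_eq0 => /eqP.
rewrite trG in G1; have {}G1 : G = 1%:M by apply: (@scalerI _ _ 2%:R) G1; rewrite pnatr_eq0.
have : K *m G *m K^t* = P by rewrite G1 mulmx1.
rewrite /G !mulmxA KP -!mulmxA KP => E.
by rewrite -[RHS]E en; nc ok; ring.
Qed.

End Hopf_algebra.

(** * The Codazzi equation for principal fields *)

Lemma Re_trD {R : realType} {m : nat} (A B : cmat R m) :
  complex.Re (\tr (A + B)) = complex.Re (\tr A) + complex.Re (\tr B).
Proof. by rewrite linearD ReD. Qed.

(** Cancels the terms that occur on both sides. The remainders [U], [U'] can then be prescribed as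
    the intended consequence, and the two trace identities are left to the normal form. *)
Lemma codazzi_trace {R : realType} {m : nat} (a : R) (X X' Y Y' Z Z' T T' : cmat R m) :
  gmet X X' - gmet Y Y' = a * (gmet Z Z' - gmet T T') -> forall U U' : cmat R m,
  \tr (X *m X') = \tr (Y *m Y' + U) -> \tr (Z *m Z') = \tr (T *m T' + U') ->
  complex.Re (\tr U) / 4 = a * (complex.Re (\tr U') / 4).
Proof.
move=> E U U' e1 e2; move: E; rewrite /gmet e1 e2 !Re_trD.
move: (complex.Re _) (complex.Re _) (complex.Re _) (complex.Re _) => r1 r2 r3 r4 E.
have -> : r3 / 4 = (r4 + r3) / 4 - r4 / 4 by ring.
by rewrite E; ring.
Qed.

Lemma codazzi_scale {R : realType} {m : nat} (a : R) (t1 t2 t3 t4 : cmat R m) :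
  complex.Re (\tr (- 2%:R *: t1 + 2%:R *: t2)) / 4 = a * (complex.Re (\tr (- (t3 + t4))) / 4) ->
  (- 2) * (complex.Re (\tr t1) / 4) + 2 * (complex.Re (\tr t2) / 4) =
  - a * (complex.Re (\tr t3) / 4 + complex.Re (\tr t4) / 4).
Proof.
have Z c (t : cmat R m) : complex.Re (\tr (c%:C *: t)) = c * complex.Re (\tr t) by rewrite mxtraceZ ReZ.
rewrite -[_ t3 t4]opprK -(scaleN1r (t3 + t4)) opprK -(rmorph_nat (real_complex R)) -(rmorphN1 (real_complex R)) -rmorphN.
rewrite !Re_trD !Z Re_trD.
by move: (complex.Re _) (complex.Re _) (complex.Re _) (complex.Re _) => r1 r2 r3 r4 E; move: E; lra.
Qed.

Lemma conjc_im {R : realType} : ('i%C : R[i])^*%C = - 'i%C.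
Proof. by apply/eqP; rewrite eq_complex/= oppr0 !eqxx. Qed.

Lemma codazzi_arith {R : comPzRingType} (a t1 t2 t3 t4 t5 t6 t7 t8 : R) :
  t1 - t2 = - a * (t3 - t4) -> t1 + t5 = - a * (t3 + t6) -> t2 + t7 = - a * (t4 + t8) ->
  t5 - t7 = a * (t8 - t6).
Proof.
move=> e1 e2 e3; have -> : t5 - t7 = (t1 + t5) - (t2 + t7) - (t1 - t2) by ring.
by rewrite e1 e2 e3; ring.
Qed.

Section Reeb_in_Q.
Context {R : realType} {m : nat} (M : hypersurface R m).
Context (N : M -> cmat R m) (hN : unit_normal N) (m_gt0 : (0 < m)%N).
Context (nabla : (M -> cmat R m) -> (M -> cmat R m) -> M -> cmat R m)
  (hnabla : levi_civita nabla) (hQ : forall p : M, distQ N p (reeb N p)).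
Implicit Types (p q : M) (W : set M) (X Y Z K : M -> cmat R m) (V H k s : cmat R m).

Lemma normal_sq q : imm q *m N q *m N q = imm q.
Proof.
apply: normal_square; [exact: imm_G2|exact: (N_G2 hN)|exact: (N_unit hN)|].
by move=> b qb a; have [_ H] := hQ q; exact: H qb a.
Qed.

(* Derivative of [imm *m N *m N = imm]; the second fundamental form of the
   Grassmannian is block diagonal, so only the shape operator contributes. *)
Lemma shape_block q V : tangent q V ->
  let P := imm q in let n := N q in let A := shape_op N q V in
  P *m (A *m n + n *m A) *m P = 0.
Proof.
move=> tV P n A; have gP := imm_G2 q; have [_ PP _] := gP.
have sN := N_smooth hN; have sI := @smooth_field_imm _ _ M setT.
have sIN := smooth_fieldM openT sI sN.
have D : dirM_mx q V (fun q => imm q *m N q *m N q) = V.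
  rewrite -[RHS](dirM_mx_imm tV); apply: (@eq_on_dirM_mx _ _ _ setT) => //; first exact: openT.
  by move=> q' _; exact: normal_sq.
rewrite (dirM_mxM V sIN sN I) (dirM_mxM V sI sN I) (dirM_mx_imm tV) (dirM_N hN tV) in D.
have gA := tangent_G2 (shape_tangent hN m_gt0 tV).
have [v [v' [ev v1 v2 v3 v4]]] := G2_tangent_split gP (tangent_G2 tV).
have [a [a' [ea a1 a2 a3 a4]]] := G2_tangent_split gP gA.
have [x [x' [en x1 x2 x3 x4]]] := G2_tangent_split gP (N_G2 hN q).
have ok0 : nc_ok [:: P; v; v'; a; a'; x; x'] (nc_gen [:: 0] [:: (0, 0); (1, 0); (0, 1); (1, 0); (0, 1); (1, 0); (0, 1)]
      [:: (0, 0); (1, 0); (0, 1); (1, 0); (0, 1); (1, 0); (0, 1)] 0)%N.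
  by apply: typed_ok => //=; do !split.
nc_have ok ok0.
have := congr1 (fun H => - (P *m H *m P)) D; rewrite IIE -/P -/A -/n /n en /A ea ev => E.
have e0 : - (P *m (v + v') *m P) = 0 by nc ok.
by rewrite -[RHS]e0 -E; nc ok; ring.
Qed.

Lemma weingarten_smooth c : smooth_field setT (fun q => dirM_mx q (tproj N q (hb c)) N).
Proof.
have vH := vfield_tproj_cst hN m_gt0 (@openT M) (hb_herm c).
apply: (@smooth_field_eq _ _ _ setT (fun q => - shape_op N q (tproj N q (hb c)) +
   II (imm q) (tproj N q (hb c)) (N q))) => //; first exact: openT.
  by move=> q _; rewrite -(dirM_N hN)//; exact: (vfield_tangent vH I).
apply: smooth_fieldD; [exact: openT| |].
  apply: smooth_fieldN; first exact: openT.
  exact: vfield_smooth (vfield_shape hN m_gt0 hnabla openT vH).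
by apply: II_smooth; [exact: openT|exact: vfield_smooth|exact: (N_smooth hN)].
Qed.

(** The Codazzi equation paired with a field of constant principal curvature [a]. The relation
    [<dN(X), Z> = - a <X, Z>] is differentiated and antisymmetrized; second derivatives of [N]
    cancel because the space of matrices is flat, so no curvature term shows up in the formula. *)
Lemma codazzi_eigen (a : R) Z q V V' : vfield setT Z ->
  (forall q, shape_op N q (Z q) = a%:C *: Z q) -> tangent q V -> tangent q V' ->
  gmet (dirM_mx q V' N) (dirM_mx q V Z) - gmet (dirM_mx q V N) (dirM_mx q V' Z) =
  a * (gmet V (dirM_mx q V' Z) - gmet V' (dirM_mx q V Z)).
Proof.
move=> vZ AZ tV tV'; have oT := @openT M; have sN := N_smooth hN; have sZ := vfield_smooth vZ.
have hV := (tangent_G2 tV).1; have hV' := (tangent_G2 tV').1.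
pose X q := tproj N q V; pose Y q := tproj N q V'.
have vX : vfield setT X := vfield_tproj_cst hN m_gt0 oT hV.
have vY : vfield setT Y := vfield_tproj_cst hN m_gt0 oT hV'.
have Xq : X q = V := tproj_id hN m_gt0 tV.
have Yq : Y q = V' := tproj_id hN m_gt0 tV'.
have sD X' : vfield setT X' -> smooth_field setT (fun q => dirM_mx q (X' q) N).
  move=> vX'; apply: (@smooth_field_eq _ _ _ setT (fun q => - shape_op N q (X' q) +
     II (imm q) (X' q) (N q))) => //.
    by move=> q' _; rewrite -(dirM_N hN)//; exact: (vfield_tangent vX' I).
  apply: smooth_fieldD => //; last by apply: II_smooth => //; exact: vfield_smooth.
  apply: smooth_fieldN => //.
  exact: vfield_smooth (vfield_shape hN m_gt0 hnabla oT vX').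
have E X' q' : vfield setT X' -> gmet (dirM_mx q' (X' q') N) (Z q') = - a * gmet (X' q') (Z q').
  move=> vX'; have tX := vfield_tangent vX' (I : setT q').
  have tZ := vfield_tangent vZ (I : setT q').
  rewrite (dirM_N hN tX) gmetDl gmetNl (gmet_II (imm_G2 q') (tangent_G2 tX) (N_G2 hN q') (tangent_G2 tZ)).
  by rewrite addr0 (shape_sym hN tX tZ) AZ gmetZr mulNr.
have D X' X'' : vfield setT X' -> vfield setT X'' ->
    gmet (dirM_mx q (X' q) (fun q => dirM_mx q (X'' q) N)) (Z q) + gmet (dirM_mx q (X'' q) N) (dirM_mx q (X' q) Z)
    = - a * (gmet (dirM_mx q (X' q) X'') (Z q) + gmet (X'' q) (dirM_mx q (X' q) Z)).
  move=> vX' vX''; rewrite -(dirM_gmet (X' q) (sD _ vX'') sZ I).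
  have sX := vfield_smooth vX''.
  have -> : (fun q => gmet (dirM_mx q (X'' q) N) (Z q)) = (fun q => gmet ((- a)%:C *: X'' q) (Z q)).
    by apply/funext => q'; rewrite gmetZl; exact: E.
  rewrite (dirM_gmet (X' q) (smooth_fieldZc (- a)%:C oT sX) sZ I) (dirM_mxZc _ _ sX I).
  by rewrite !gmetZl mulrDr.
have C := congr1 (fun A => gmet A (Z q)) (dirM_mx_commutator hN m_gt0 hnabla oT (I : setT q) vX vY sN weingarten_smooth).
rewrite /= gmetBl (E _ _ (bracket_vfield hnabla oT vX vY)) /bracket gmetBl in C.
have D1 := D _ _ vX vY; have D2 := D _ _ vY vX.
rewrite !Xq !Yq in C D1 D2.
exact: codazzi_arith C D1 D2.
Qed.

Definition skewP (P k : cmat R m) : Prop := [/\ k^t* = - k, P *m k = k & k *m P = k].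

(** This is [- quatJ k n]: the choice [k = 'i P] gives the Reeb field, and traceless [k] give the
    span of the [xi_nu]. *)
Definition Zfield (n k : cmat R m) : cmat R m := k *m n - n *m k.

Lemma Zfield_tangent q k : skewP (imm q) k -> tangent q (Zfield (N q) k).
Proof.
move=> [hk k1 k2]; have gP := imm_G2 q; have [_ PP _] := gP; have gn := N_G2 hN q; have [hn _] := gn.
apply/(tangentP hN m_gt0); split; last first.
  have E : \tr (N q *m Zfield (N q) k) = \tr (0 : cmat R m).
    have ok : nc_ok [:: N q; k] [::] by [].
    by rewrite /Zfield; nc ok; ring.
  by rewrite /gmet E linear0 mul0r.
split; first by rewrite /Zfield adjB !adjM hn hk mulmxN mulNmx opprK addrC.
have [x [x' [en x1 x2 x3 x4]]] := G2_tangent_split gP gn.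
have ok0 : nc_ok [:: imm q; x; x'; k] (nc_gen [:: 0] [:: (0, 0); (1, 0); (0, 1); (0, 0)]
      [:: (0, 0); (1, 0); (0, 1); (0, 0)] 0)%N by apply: typed_ok => //=; do !split.
by nc_have ok ok0; rewrite /Zfield en; nc ok; ring.
Qed.

(** The condition on [K] says that [K] is parallel at [q] as an endomorphism of the tautological
    plane: its derivative has off-diagonal blocks only. *)
Lemma dirM_Zfield K q V : smooth_field setT K -> tangent q V ->
  dirM_mx q V K = V *m K q + K q *m V ->
  let n := N q in let k := K q in let w := dirM_mx q V N in let d := V *m k + k *m V in
  dirM_mx q V (fun q => Zfield (N q) (K q)) = d *m n + k *m w - (w *m k + n *m d).
Proof.
move=> sK tV DK n k w d; have sN := N_smooth hN.
have sKN := smooth_fieldM openT sK sN; have sNK := smooth_fieldM openT sN sK.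
rewrite (dirM_mxB V sKN sNK I) (dirM_mxM V sK sN I) (dirM_mxM V sN sK I) DK.
by [].
Qed.

(** Pairing [n s + s n] with [A V] only sees the plane block of [A n + n A], which [shape_block]
    makes zero; symmetry of [A] finishes. These vectors span the [phi xi_nu]. *)
Lemma shape_Ys q s : s^t* = s -> imm q *m s = s -> s *m imm q = s -> \tr s = 0 ->
  tangent q (N q *m s + s *m N q) /\ shape_op N q (N q *m s + s *m N q) = 0.
Proof.
move=> hs s1 s2 ts; have gP := imm_G2 q; have [_ PP _] := gP; have gn := N_G2 hN q; have [hn _] := gn.
have [x [x' [en x1 x2 x3 x4]]] := G2_tangent_split gP gn.
have ok0 : nc_ok [:: imm q; x; x'; s] (nc_gen [:: 0] [:: (0, 0); (1, 0); (0, 1); (0, 0)]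
      [:: (0, 0); (1, 0); (0, 1); (0, 0)] 0)%N by apply: typed_ok => //=; do !split.
have tY : tangent q (N q *m s + s *m N q).
  apply/(tangentP hN m_gt0); split; last first.
    have E : \tr (N q *m (N q *m s + s *m N q)) = \tr (2%:R *: (imm q *m N q *m N q *m s)).
      by nc_have ok ok0; rewrite en; nc ok; ring.
    by rewrite /gmet E normal_sq s1 mxtraceZ ts mulr0 mul0r.
  split; first by rewrite adjD !adjM hn hs addrC.
  by nc_have ok ok0; rewrite en; nc ok; ring.
split=> //; apply: (tangent_eq0 (shape_tangent hN m_gt0 tY)) => V tV.
rewrite (shape_sym hN tY tV); have E := shape_block tV; rewrite /= in E.
set A := shape_op N q V in E *; set n := N q in E *.
have E' : \tr ((n *m s + s *m n) *m A) = \tr (s *m (imm q *m (A *m n + n *m A) *m imm q)).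
  have ok : nc_ok [:: imm q; A; n; s] [:: (0, 0, NRlet 0); (0, 3, NRlet 3); (3, 0, NRlet 3)]%N by do !split.
  by nc ok; ring.
by rewrite /gmet E' E mulmx0 linear0 mul0r.
Qed.

(** Codazzi for the Reeb field against [n s + s n], on which [A] vanishes. As [W] runs through the
    span of the [xi_nu], these turn out to be principal with curvature [-4 / a]. *)
Lemma codazzi_Ys (a : R) q s V : (forall q, shape_op N q (reeb N q) = a%:C *: reeb N q) ->
  s^t* = s -> imm q *m s = s -> s *m imm q = s -> \tr s = 0 -> tangent q V ->
  let W := 'i%C *: (N q *m s - s *m N q) in
  a * gmet W (shape_op N q V) = - 4 * gmet W V.
Proof.
move=> Ha hs s1 s2 ts tV W; have [tY AY] := shape_Ys hs s1 s2 ts.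
have sK : smooth_field setT (fun q => 'i%C *: imm q).
  by apply: smooth_fieldZc; [exact: openT|exact: smooth_field_imm].
have Zr q' : Zfield (N q') ('i%C *: imm q') = reeb N q'.
  have ok : nc_ok [:: imm q'; N q'] [::] by [].
  by rewrite /Zfield /reeb /kahlerJ; nc ok; ring.
have ski q' : skewP (imm q') ('i%C *: imm q').
  have [hP PP _] := imm_G2 q'.
  split; [by rewrite adjZ hP conjc_im scaleNr|by rewrite -scalemxAr PP|by rewrite -scalemxAl PP].
have vZ : vfield setT (fun q => Zfield (N q) ('i%C *: imm q)).
  split=> [q' _|]; first exact: Zfield_tangent.
  have sN := N_smooth hN.
  by apply: smooth_fieldB; [exact: openT| |]; apply: smooth_fieldM => //; exact: openT.
have AZ q' : shape_op N q' (Zfield (N q') ('i%C *: imm q')) = a%:C *: Zfield (N q') ('i%C *: imm q').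
  by rewrite Zr.
have DK V' : tangent q V' -> dirM_mx q V' (fun q => 'i%C *: imm q) = V' *m ('i%C *: imm q) + ('i%C *: imm q) *m V'.
  move=> tV'; rewrite (dirM_mxZc _ _ (@smooth_field_imm _ _ M setT) I) (dirM_mx_imm tV').
  by rewrite -scalemxAr -scalemxAl -scalerDr addrC; have [_ ->] := tangent_G2 tV'.
have := codazzi_eigen vZ AZ tV tY.
rewrite (dirM_Zfield sK tV (DK _ tV)) (dirM_Zfield sK tY (DK _ tY)) (dirM_N hN tV) (dirM_N hN tY) AY.
have gP := imm_G2 q; have [_ PP _] := gP; have nsq := normal_sq q.
have gA := tangent_G2 (shape_tangent hN m_gt0 tV).
have [v [v' [ev v1 v2 v3 v4]]] := G2_tangent_split gP (tangent_G2 tV).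
have [c [c' [ea a1 a2 a3 a4]]] := G2_tangent_split gP gA.
have [x [x' [en x1 x2 x3 x4]]] := G2_tangent_split gP (N_G2 hN q).
have xx : x' *m x = imm q.
  have ok0 : nc_ok [:: imm q; x; x'] (nc_gen [:: 0] [:: (0, 0); (1, 0); (0, 1)]
      [:: (0, 0); (1, 0); (0, 1)] 0)%N by apply: typed_ok => //=; do !split.
  by rewrite -[RHS]nsq; nc_have ok ok0; rewrite en; nc ok; ring.
have ok0 : nc_ok [:: imm q; v; v'; c; c'; x; x'; s] ((6, 5, NRlet 0) ::
    nc_gen [:: 0] [:: (0, 0); (1, 0); (0, 1); (1, 0); (0, 1); (1, 0); (0, 1); (0, 0)]
      [:: (0, 0); (1, 0); (0, 1); (1, 0); (0, 1); (1, 0); (0, 1); (0, 0)] 0)%N.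
  by split=> //; apply: typed_ok => //=; do !split.
nc_have ok ok0.
(* The arguments are the two sides of the claim up to the constants; the normal form confirms that
   all other traces cancel. *)
move=> /codazzi_trace /(_ ((- 4%:R) *: (W *m V)) (W *m shape_op N q V)) E.
lapply E; [clear E => E; lapply E; [clear E => E|]|].
- by rewrite -[LHS]E mxtraceZ -(rmorph_nat (real_complex R)) -rmorphN ReZ mulrA.
- by rewrite !IIE /W ea ev en; nc ok; ring.
by rewrite !IIE /W ea ev en; nc ok; ring.
Qed.

(** The vectors [Zfield n k] and [n s + s n] pair with [V] through the plane block of [n V]. Its
    vanishing expresses orthogonality to all of them at once. *)
Definition D0 q V := tangent q V /\ imm q *m N q *m V *m imm q = 0.

(** Codazzi for the principal field attached to [K]. With [r] the structure induced by [K], this is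
    the polarized form of [A r A - r = (a / 2) (r A + A r)]. *)
Lemma codazzi_D0 (a : R) K q V V' : smooth_field setT K -> (forall q, skewP (imm q) (K q)) ->
  (forall q, shape_op N q (Zfield (N q) (K q)) = a%:C *: Zfield (N q) (K q)) ->
  (forall V, tangent q V -> dirM_mx q V K = V *m K q + K q *m V) ->
  D0 q V -> D0 q V' -> D0 q (shape_op N q V) -> D0 q (shape_op N q V') ->
  let A := shape_op N q in let r (X : cmat R m) := X *m K q - K q *m X in
  (- 2) * gmet (A V') (r (A V)) + 2 * gmet V' (r V) = - a * (gmet (A V') (r V) + gmet V' (r (A V))).
Proof.
move=> sK skK AZ DK [tV dV] [tV' dV'] [tA dA] [tA' dA'] A r.
have vZ : vfield setT (fun q => Zfield (N q) (K q)).
  split=> [q' _|]; first exact: Zfield_tangent.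
  have sN := N_smooth hN.
  by apply: smooth_fieldB; [exact: openT| |]; apply: smooth_fieldM => //; exact: openT.
have := codazzi_eigen vZ AZ tV tV'.
rewrite (dirM_Zfield sK tV (DK _ tV)) (dirM_Zfield sK tV' (DK _ tV')) (dirM_N hN tV) (dirM_N hN tV').
have gP := imm_G2 q; have [_ PP _] := gP; have nsq := normal_sq q; have [hk k1 k2] := skK q.
have nX H : G2_tangent (imm q) H -> imm q *m N q *m H *m imm q = 0 -> imm q *m H *m N q *m imm q = 0.
  move=> [hH _] /(congr1 (fun G => G^t*)); rewrite !adjM adj0 hH.
  by have [-> _ _] := gP; have [-> _] := N_G2 hN q; rewrite !mulmxA.
have uV := nX _ (tangent_G2 tV) dV; have uV' := nX _ (tangent_G2 tV') dV'.
have uA := nX _ (tangent_G2 tA) dA; have uA' := nX _ (tangent_G2 tA') dA'.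
rewrite /A /r.
have [x [x' [en x1 x2 x3 x4]]] := G2_tangent_split gP (N_G2 hN q).
have okx : nc_ok [:: imm q; x; x'] (nc_gen [:: 0] [:: (0, 0); (1, 0); (0, 1)]
      [:: (0, 0); (1, 0); (0, 1)] 0)%N by apply: typed_ok => //=; do !split.
have xx : x' *m x = imm q.
  by rewrite -[RHS]nsq; nc_have ok okx; rewrite en; nc ok; ring.
have split0 H : G2_tangent (imm q) H -> imm q *m N q *m H *m imm q = 0 ->
    imm q *m H *m N q *m imm q = 0 -> exists v v',
    [/\ H = v + v', (1%:M - imm q) *m v = v, v *m imm q = v, imm q *m v' = v' & v' *m (1%:M - imm q) = v']
    /\ (x' *m v = 0 /\ v' *m x = 0).
  move=> gH e1 e2; have [v [v' [ev v1 v2 v3 v4]]] := G2_tangent_split gP gH.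
  exists v, v'; split=> //.
  have ok0 : nc_ok [:: imm q; x; x'; v; v'] (nc_gen [:: 0] [:: (0, 0); (1, 0); (0, 1); (1, 0); (0, 1)]
      [:: (0, 0); (1, 0); (0, 1); (1, 0); (0, 1)] 0)%N by apply: typed_ok => //=; do !split.
  by split; [rewrite -[RHS]e1|rewrite -[RHS]e2]; nc_have ok ok0; rewrite en ev; nc ok; ring.
have [v [v' [[ev v1 v2 v3 v4] [v5 v6]]]] := split0 _ (tangent_G2 tV) dV uV.
have [w [w' [[ew w1 w2 w3 w4] [w5 w6]]]] := split0 _ (tangent_G2 tV') dV' uV'.
have [c [c' [[ec c1 c2 c3 c4] [c5 c6]]]] := split0 _ (tangent_G2 tA) dA uA.
have [d [d' [[ed d1 d2 d3 d4] [d5 d6]]]] := split0 _ (tangent_G2 tA') dA' uA'.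
move: (K q) hk k1 k2 => k hk k1 k2.
have ok0 : nc_ok [:: imm q; x; x'; k; v; v'; w; w'; c; c'; d; d'] ((2, 1, NRlet 0) ::
    (2, 4, NRzero) :: (5, 1, NRzero) :: (2, 6, NRzero) :: (7, 1, NRzero) :: (2, 8, NRzero) :: (9, 1, NRzero)
    :: (2, 10, NRzero) :: (11, 1, NRzero) ::
    nc_gen [:: 0] [:: (0, 0); (1, 0); (0, 1); (0, 0); (1, 0); (0, 1); (1, 0); (0, 1); (1, 0); (0, 1); (1, 0); (0, 1)]
     [:: (0, 0); (1, 0); (0, 1); (0, 0); (1, 0); (0, 1); (1, 0); (0, 1); (1, 0); (0, 1); (1, 0); (0, 1)] 0)%N.
  by do 9![split; first by []]; apply: typed_ok => //=; do !split.
nc_have ok ok0.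
set a1 := shape_op N q V in ec *; set a2 := shape_op N q V' in ed *.
move=> /codazzi_trace /(_ ((- 2%:R) *: (a2 *m (a1 *m k - k *m a1)) + 2%:R *: (V' *m (V *m k - k *m V)))
  (- (a2 *m (V *m k - k *m V) + V' *m (a1 *m k - k *m a1)))) E.
lapply E; [clear E => E; lapply E; [clear E => E|]|].
- exact: codazzi_scale E.
- by rewrite !IIE ev ew ec ed en; nc ok; ring.
by rewrite !IIE ev ew ec ed en; nc ok; ring.
Qed.

End Reeb_in_Q.

(** * The shape operator *)

Lemma shape_arith {R : realType} (c g1 g2 g3 g4 : R) :
  (- 2) * g1 + 2 * g2 = - c * (g3 + g4) ->
  - 1 * g2 + (- c / 2 * g4 + (- c / 2 * g3 + g1)) = 0.
Proof.
move=> E; have -> : - 1 * g2 + (- c / 2 * g4 + (- c / 2 * g3 + g1)) =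
    - (((- 2) * g1 + 2 * g2) - (- c * (g3 + g4))) / 2 by field.
by rewrite E subrr oppr0 mul0r.
Qed.

Section Shape_structure.
Context {R : realType} {m : nat} (M : hypersurface R m).
Context (N : M -> cmat R m) (hN : unit_normal N) (m_gt0 : (0 < m)%N).
Context (nabla : (M -> cmat R m) -> (M -> cmat R m) -> M -> cmat R m)
  (hnabla : levi_civita nabla) (hQ : forall p : M, distQ N p (reeb N p)).
Context (a : R) (a_neq0 : a != 0)
  (Areeb : forall q, shape_op N q (reeb N q) = a%:C *: reeb N q).
Implicit Types (p q : M) (W : set M) (X Y Z K : M -> cmat R m) (V H k s : cmat R m).
Local Notation beta := (- 4 / a).
Local Notation A := (shape_op N).

Lemma shapeZ q c V : tangent q V -> A q (c%:C *: V) = c%:C *: A q V.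
Proof.
move=> tV; have := shape_lin hN c tV (tangent0 q).
by rewrite (shape0 hN) !addr0.
Qed.

Lemma shapeD q V V' : tangent q V -> tangent q V' -> A q (V + V') = A q V + A q V'.
Proof. by move=> tV tV'; have := shape_lin hN 1 tV tV'; rewrite !scale1r. Qed.

Lemma shapeN q V : tangent q V -> A q (- V) = - A q V.
Proof. by move=> tV; have := shapeZ (-1) tV; rewrite rmorphN1 !scaleN1r. Qed.

Lemma shapeB q V V' : tangent q V -> tangent q V' -> A q (V - V') = A q V - A q V'.
Proof. by move=> tV tV'; rewrite shapeD ?shapeN//; exact: tangentN. Qed.

Lemma reebE q : reeb N q = Zfield (N q) ('i%C *: imm q).
Proof.
have ok : nc_ok [:: imm q; N q] [::] by [].
by rewrite /Zfield /reeb /kahlerJ; nc ok; ring.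
Qed.

Lemma skewP_iP q : skewP (imm q) ('i%C *: imm q).
Proof.
have [hP PP _] := imm_G2 q.
by split; [rewrite adjZ hP conjc_im scaleNr|rewrite -scalemxAr PP|rewrite -scalemxAl PP].
Qed.

Lemma shape_Zfield q k : skewP (imm q) k -> \tr k = 0 ->
  A q (Zfield (N q) k) = beta%:C *: Zfield (N q) k.
Proof.
move=> sk tk; have [hk k1 k2] := sk; have tZ := Zfield_tangent hN m_gt0 sk.
pose s := 'i%C *: k.
have hs : s^t* = s by rewrite adjZ hk conjc_im scalerN scaleNr opprK.
have EW : 'i%C *: (N q *m s - s *m N q) = Zfield (N q) k.
  rewrite /s /Zfield -scalemxAr -scalemxAl -scalerBr scalerA.
  have -> : 'i%C * 'i%C = -1 :> R[i] by apply/eqP; rewrite eq_complex/=; apply/andP; split; apply/eqP; ring.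
  by rewrite scaleN1r opprB.
have C V : tangent q V -> a * gmet (Zfield (N q) k) (A q V) = - 4 * gmet (Zfield (N q) k) V.
  move=> tV; rewrite -EW; apply: (codazzi_Ys hN m_gt0 hnabla hQ Areeb hs _ _ _ tV).
  - by rewrite -scalemxAr k1.
  - by rewrite -scalemxAl k2.
  by rewrite mxtraceZ tk mulr0.
apply/eqP; rewrite -subr_eq0; apply/eqP.
have tA := shape_tangent hN m_gt0 tZ.
apply: (tangent_eq0 (tangentD tA (tangentN (tangentZ beta tZ)))) => V tV.
have {}C := C V tV; rewrite gmetBl gmetZl (shape_sym hN tZ tV).
by apply: (mulfI a_neq0); rewrite mulr0 mulrBr C (mulrA a) (mulrC a beta) divfK// subrr.
Qed.

Lemma gmet_Zfield V n k : gmet V (Zfield n k) = complex.Re (\tr (k *m (n *m V - V *m n))) / 4.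
Proof.
have ok : nc_ok [:: V; n; k] [::] by [].
by rewrite /gmet; congr (complex.Re _ / 4); rewrite /Zfield; nc ok; ring.
Qed.

Lemma D0_adj q V : D0 N q V -> imm q *m V *m N q *m imm q = 0.
Proof.
move=> [/tangent_G2[hV _] dV]; have := congr1 (fun G => G^t*) dV.
have [hP _ _] := imm_G2 q; have [hn _] := N_G2 hN q.
by rewrite !adjM adj0 hV hP hn !mulmxA.
Qed.

Lemma D0_Zfield q V k : D0 N q V -> skewP (imm q) k -> gmet V (Zfield (N q) k) = 0.
Proof.
move=> dV [_ k1 k2]; have uV := D0_adj dV; have [_ vV] := dV.
rewrite gmet_Zfield.
have -> : \tr (k *m (N q *m V - V *m N q)) = \tr (k *m (imm q *m N q *m V *m imm q - imm q *m V *m N q *m imm q)).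
  have ok : nc_ok [:: imm q; N q; V; k] [:: (0, 3, NRlet 3); (3, 0, NRlet 3)]%N by do !split.
  by nc ok; ring.
by rewrite uV vV subr0 mulmx0 linear0 mul0r.
Qed.

Lemma skewP_split q k : skewP (imm q) k -> exists k0 c, [/\ skewP (imm q) k0, \tr k0 = 0 &
  k = k0 + c%:C *: ('i%C *: imm q)].
Proof.
move=> sk; have [hk k1 k2] := sk; have gP := imm_G2 q; have [hP PP _] := gP.
pose c := complex.Im (\tr k) / 2.
have sc : skewP (imm q) (c%:C *: ('i%C *: imm q)).
  have [h1 h2 h3] := skewP_iP q.
  by split; [rewrite adjZ h1 conjc_real scalerN|rewrite -scalemxAr h2|rewrite -scalemxAl h3].
have [h1 h2 h3] := sc.
exists (k - c%:C *: ('i%C *: imm q)), c; split; last by rewrite subrK.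
  split; first by rewrite adjB hk h1 opprB opprK addrC.
    by rewrite mulmxBr k1 h2.
  by rewrite mulmxBl k2 h3.
have : (\tr k)^*%C = - \tr k by rewrite -tr_adj hk linearN.
rewrite linearB/= !mxtraceZ (G2_trace gP) /c.
case: (\tr k) => x y [] xx; apply/eqP; rewrite eq_complex/=; apply/andP; split; apply/eqP.
  by rewrite !(mul0r, mulr0, subr0, add0r, addr0); move: xx; lra.
by field.
Qed.

(** The span of the [Zfield n k] is invariant under the symmetric [A], so [A V] is orthogonal to it.
    The plane block [t] of [n (A V)] is skew by [shape_block], so [k = t] is admissible and forces
    the norm of [t] to vanish. *)
Lemma shape_D0 q V : D0 N q V -> D0 N q (A q V).
Proof.
move=> dV; have [tV vV] := dV; have tA := shape_tangent hN m_gt0 tV; split=> //.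
have gP := imm_G2 q; have [hP PP _] := gP; have [hn _] := N_G2 hN q; have [hA _] := tangent_G2 tA.
set t := imm q *m N q *m A q V *m imm q.
have ht : t^t* = - t.
  have := shape_block hN m_gt0 hQ tV; rewrite /= mulmxDr mulmxDl => /eqP; rewrite addr_eq0 => /eqP E.
  by rewrite /t !adjM hP hn hA !mulmxA in E *; rewrite E.
have st : skewP (imm q) t by split=> //; rewrite /t ?mulmxA ?PP// -mulmxA PP.
have E0 : gmet (A q V) (Zfield (N q) t) = 0.
  have [t0 [c [s0 tr0 et]]] := skewP_split st.
  have -> : Zfield (N q) t = Zfield (N q) t0 + c%:C *: reeb N q.
    rewrite reebE et /Zfield; have ok : nc_ok [:: imm q; N q; t0] [::] by [].
    by nc ok; ring.
  rewrite gmetDr gmetZr !(shape_sym hN tV); last 2 first.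
  - by rewrite reebE; apply: (Zfield_tangent hN m_gt0); exact: skewP_iP.
  - exact: (Zfield_tangent hN m_gt0).
  rewrite (shape_Zfield s0 tr0) Areeb !gmetZr (D0_Zfield dV s0) reebE (D0_Zfield dV (skewP_iP q)).
  by rewrite !mulr0 addr0.
have [_ t1 t2] := st.
have E1 : \tr (t *m (N q *m A q V - A q V *m N q)) = \tr ((- 2)%:C *: (t *m t^t*)).
  have -> : t^t* = imm q *m A q V *m N q *m imm q by rewrite /t !adjM hP hn hA !mulmxA.
  have e3 : \tr (t *m (N q *m A q V - A q V *m N q)) = \tr (t *m (t - imm q *m A q V *m N q *m imm q)).
    rewrite {3}/t; move: t t1 t2 {ht st E0} => t t1 t2.
    have ok : nc_ok [:: imm q; N q; A q V; t] [:: (0, 3, NRlet 3); (3, 0, NRlet 3)]%N by do !split.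
    by nc ok; ring.
  rewrite e3; have -> : imm q *m A q V *m N q *m imm q = - t.
    by rewrite -ht /t !adjM hP hn hA !mulmxA.
  have ok : nc_ok [:: t] [::] by [].
  by nc ok; rewrite rmorphN rmorph_nat; ring.
rewrite gmet_Zfield E1 mxtraceZ ReZ in E0.
apply: Re_tr_adj_eq0; move/eqP: E0; rewrite mulf_eq0 invr_eq0 pnatr_eq0 orbF mulf_eq0 oppr_eq0 pnatr_eq0.
by move/eqP.
Qed.

Lemma D0_lin q c V V' : D0 N q V -> D0 N q V' -> D0 N q (c%:C *: V + V').
Proof.
move=> [tV dV] [tV' dV']; split; first by apply: tangentD => //; exact: tangentZ.
by rewrite mulmxDr mulmxDl -scalemxAr -scalemxAl dV dV' scaler0 addr0.
Qed.

Lemma D0_quatJ q k V : skewP (imm q) k -> D0 N q V -> D0 N q (quatJ k V).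
Proof.
move=> [hk k1 k2] [tV dV]; have gP := imm_G2 q; have [hP PP _] := gP.
have [gV nV] := (tangentP hN m_gt0 q V).1 tV; have [hV _] := gV.
have gn := N_G2 hN q.
have [v [v' [ev v1 v2 v3 v4]]] := G2_tangent_split gP gV.
have [x [x' [en x1 x2 x3 x4]]] := G2_tangent_split gP gn.
have ok0 : nc_ok [:: imm q; v; v'; x; x'; k] (nc_gen [:: 0] [:: (0, 0); (1, 0); (0, 1); (1, 0); (0, 1); (0, 0)]
      [:: (0, 0); (1, 0); (0, 1); (1, 0); (0, 1); (0, 0)] 0)%N by apply: typed_ok => //=; do !split.
nc_have ok ok0.
split; last first.
  rewrite -[RHS](mul0mx _ k) -dV /quatJ ev en; nc ok; ring.
apply/(tangentP hN m_gt0); split.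
  split; first by rewrite /quatJ adjB !adjM hV hk mulmxN mulNmx opprK addrC.
  by rewrite /quatJ ev; nc ok; ring.
have uV : gmet V (Zfield (N q) k) = 0 by apply: D0_Zfield.
rewrite gmetC -[RHS]uV /gmet; congr (complex.Re _ / 4).
by rewrite /quatJ /Zfield; have ok' : nc_ok [:: V; N q; k] [::] by []; nc ok'; ring.
Qed.

Lemma D0_eq0 q V : D0 N q V -> (forall V', D0 N q V' -> gmet V' V = 0) -> V = 0.
Proof. by move=> dV H; apply: gmet_eq0; [case: dV => /tangent_G2[]|exact: H]. Qed.

Lemma shape_quatJ (c : R) K q V : smooth_field setT K -> (forall q, skewP (imm q) (K q)) ->
  (forall q, A q (Zfield (N q) (K q)) = c%:C *: Zfield (N q) (K q)) ->
  (forall V, tangent q V -> dirM_mx q V K = V *m K q + K q *m V) -> D0 N q V ->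
  let r := quatJ (K q) in
  A q (r (A q V)) - r V = (c / 2)%:C *: (r (A q V) + A q (r V)).
Proof.
move=> sK skK AZ DK dV r; have dr V' : D0 N q V' -> D0 N q (r V') by apply: D0_quatJ.
have dA := shape_D0 dV; have drA := dr _ dA; have dAr := shape_D0 (dr _ dV); have dArA := shape_D0 drA.
apply/eqP; rewrite -subr_eq0; apply/eqP.
set U := _ - _; have eU : U = (- 1)%:C *: r V + ((- c / 2)%:C *: r (A q V) + ((- c / 2)%:C *: A q (r V) + A q (r (A q V)))).
  have -> : (- 1)%:C = - 1 :> R[i] by rewrite rmorphN1.
  have -> : (- c / 2)%:C = - (c / 2)%:C :> R[i] by rewrite mulNr rmorphN.
  rewrite /U; move: (c / 2)%:C => d.
  move: (r V) (r (A q V)) (A q (r V)) (A q (r (A q V))) => y1 y2 y3 y4.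
  by have ok : nc_ok [:: y1; y2; y3; y4] [::] by []; nc ok; ring.
have dU : D0 N q U by rewrite eU; exact: (D0_lin _ (dr _ dV) (D0_lin _ drA (D0_lin _ dAr dArA))).
apply: (D0_eq0 dU) => V' dV'; have dA' := shape_D0 dV'.
have E : (- 2) * gmet (A q V') (r (A q V)) + 2 * gmet V' (r V)
    = - c * (gmet (A q V') (r V) + gmet V' (r (A q V))).
  exact: (codazzi_D0 hN m_gt0 hnabla hQ sK skK AZ DK dV dV' dA dA').
rewrite (shape_sym hN dV'.1 drA.1) (shape_sym hN dV'.1 (dr _ dV).1) in E.
rewrite eU !gmetDr !gmetZr.
exact: shape_arith E.
Qed.

(** The traceless part of the compression of a constant matrix. If [k] lies in su(im P) at one
    point, this extends it to a smooth field which is parallel there. *)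
Definition quat_field k q := imm q *m k *m imm q - (2 * gmet (imm q) (- 'i%C *: k))%:C *: ('i%C *: imm q).

Lemma quat_field_skew k q : k^t* = - k -> skewP (imm q) (quat_field k q) /\ \tr (quat_field k q) = 0.
Proof.
move=> hk; have gP := imm_G2 q; have [hP PP _] := gP.
have sc c : skewP (imm q) (c%:C *: ('i%C *: imm q)).
  have [h1 h2 h3] := skewP_iP q.
  by split; [rewrite adjZ h1 conjc_real scalerN|rewrite -scalemxAr h2|rewrite -scalemxAl h3].
split.
  rewrite /quat_field; move: (_ * gmet _ _) => c; have [c1 c2 c3] := sc c; split.
  - by rewrite adjB c1 !adjM hP hk mulNmx mulmxN mulmxA opprD.
  - by rewrite mulmxBr c2 !mulmxA PP.
  by rewrite mulmxBl c3 -!mulmxA PP.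
have hik : (- 'i%C *: k)^t* = - 'i%C *: k.
  rewrite adjZ hk scalerN -scaleNr; congr (_ *: _).
  by apply/eqP; rewrite eq_complex/=; apply/andP; split; apply/eqP; ring.
have E := tr_herm_real hP hik; rewrite -scalemxAr mxtraceZ in E.
have -> : \tr (quat_field k q) = \tr (imm q *m k *m imm q) -
    (2 * gmet (imm q) (- 'i%C *: k))%:C * ('i%C * 2%:R).
  by rewrite /quat_field linearB/= (mxtraceZ _ ('i%C *: _)) mxtraceZ (G2_trace gP).
have -> : \tr (imm q *m k *m imm q) = \tr (imm q *m k) by rewrite mxtrace_mulC mulmxA PP.
move: E; case: (\tr _) => x y [e1 e2]; apply/eqP; rewrite eq_complex/=; apply/andP; split; apply/eqP;
  move: e1 e2; lra.
Qed.

Lemma quat_field_smooth k : smooth_field setT (quat_field k).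
Proof.
have oT := @openT M; have sI := @smooth_field_imm _ _ M setT.
have sk := @smooth_field_cst _ _ M setT k; have sk' := @smooth_field_cst _ _ M setT (- 'i%C *: k).
apply: smooth_fieldB => //; first by do 2?apply: smooth_fieldM => //.
have sf : smooth_fun setT (fun q => 2 * gmet (imm q) (- 'i%C *: k)).
  by apply: smooth_funM => //; [exact: smooth_fun_cst|exact: smooth_fun_gmet].
exact: (smooth_fieldZ oT sf (smooth_fieldZc 'i%C oT sI)).
Qed.

Lemma quat_field_id k q : skewP (imm q) k -> \tr k = 0 -> quat_field k q = k.
Proof.
move=> [hk k1 k2] tk; rewrite /quat_field /gmet -scalemxAr mxtraceZ !k1 k2 tk.
by rewrite mulr0 !mul0r mulr0 scale0r subr0.
Qed.

Lemma dirM_quat_field k q V : skewP (imm q) k -> \tr k = 0 -> tangent q V ->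
  dirM_mx q V (quat_field k) = V *m quat_field k q + quat_field k q *m V.
Proof.
move=> sk tk tV; rewrite quat_field_id//; have [hk k1 k2] := sk.
have oT := @openT M; have sI := @smooth_field_imm _ _ M setT.
have sK := @smooth_field_cst _ _ M setT k; have sk' := @smooth_field_cst _ _ M setT (- 'i%C *: k).
have sf : smooth_fun setT (fun q => 2 * gmet (imm q) (- 'i%C *: k)).
  by apply: smooth_funM => //; [exact: smooth_fun_cst|exact: smooth_fun_gmet].
have siP := smooth_fieldZc 'i%C oT sI.
have sIk := smooth_fieldM oT sI sK; have sIkI := smooth_fieldM oT sIk sI.
rewrite (dirM_mxB V sIkI (smooth_fieldZ oT sf siP) I) (dirM_mxM V sIk sI I) (dirM_mxM V sI sK I).
rewrite (dirM_mxZ V sf siP I) (dirM_mx_imm tV) dirM_mx_cst mulmx0 addr0.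
have g0 : gmet (imm q) (- 'i%C *: k) = 0.
  by rewrite /gmet -scalemxAr mxtraceZ k1 tk mulr0 mul0r.
have gP := imm_G2 q; have PVP := G2_tangent_PXP gP (tangent_G2 tV).
have g1 : gmet V (- 'i%C *: k) = 0.
  have tVk : \tr (V *m k) = 0.
    by rewrite -k1 mulmxA -k2 mulmxA mxtrace_mulC !mulmxA PVP !mul0mx linear0.
  by rewrite /gmet -scalemxAr mxtraceZ tVk mulr0 mul0r.
have -> : dirM q V (fun q => 2 * gmet (imm q) (- 'i%C *: k)) = 0.
  have -> : (fun q => 2 * gmet (imm q) (- 'i%C *: k)) = (fun q => gmet (imm q) (2%:C *: (- 'i%C *: k))).
    by apply/funext => q'; rewrite gmetZr.
  rewrite (dirM_gmet V sI (@smooth_field_cst _ _ M setT _) I) dirM_mx_cst gmet0r addr0.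
  by rewrite (dirM_mx_imm tV) gmetZr g1 mulr0.
rewrite g0 mulr0 !scale0r addr0 subr0 -[in X in X + _](mulmxA V) k2.
by rewrite k1.
Qed.

Lemma shape_quat q k V : skewP (imm q) k -> \tr k = 0 -> D0 N q V ->
  let r := quatJ k in
  A q (r (A q V)) - r V = (beta / 2)%:C *: (r (A q V) + A q (r V)).
Proof.
move=> sk tk dV; have [hk _ _] := sk.
have := @shape_quatJ beta (quat_field k) q V (quat_field_smooth k) _ _ _ dV.
rewrite (quat_field_id sk tk); apply.
- by move=> q'; have [] := quat_field_skew q' hk.
- by move=> q'; have [s' t'] := quat_field_skew q' hk; exact: shape_Zfield.
by move=> V' tV'; have := dirM_quat_field sk tk tV'; rewrite (quat_field_id sk tk).
Qed.

Lemma kahler_quatJ P V : kahlerJ P V = quatJ ('i%C *: P) V.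
Proof.
have ok : nc_ok [:: P; V] [::] by [].
by rewrite /kahlerJ /quatJ; nc ok; ring.
Qed.

Lemma shape_kahler q V : D0 N q V -> let r := kahlerJ (imm q) in
  A q (r (A q V)) - r V = (a / 2)%:C *: (r (A q V) + A q (r V)).
Proof.
move=> dV /=; rewrite !kahler_quatJ.
apply: (@shape_quatJ a (fun q => 'i%C *: imm q) q V) => //.
- by apply: smooth_fieldZc; [exact: openT|exact: smooth_field_imm].
- exact: skewP_iP.
- by move=> q'; rewrite -reebE.
move=> V' tV'; rewrite (dirM_mxZc _ _ (@smooth_field_imm _ _ M setT) I) (dirM_mx_imm tV').
by rewrite -scalemxAr -scalemxAl -scalerDr addrC; have [_ ->] := tangent_G2 tV'.
Qed.

(** Recentring by [beta / 2] turns [A r A - r = (beta / 2) (r A + A r)] into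
    [B r B = (1 + (beta / 2)^2) r]. *)
Definition shb q V := A q V - (beta / 2)%:C *: V.
Local Notation kap := (1 + (beta / 2) ^+ 2).

Lemma D0_shb q V : D0 N q V -> D0 N q (shb q V).
Proof.
move=> dV; have := D0_lin (- (beta / 2)) dV (shape_D0 dV).
by rewrite rmorphN scaleNr addrC.
Qed.

Lemma shb_lin q c V V' : tangent q V -> tangent q V' -> shb q (c%:C *: V + V') = c%:C *: shb q V + shb q V'.
Proof.
move=> tV tV'; rewrite /shb (shape_lin hN c tV tV').
move: (A q V) (A q V') (c%:C) ((beta / 2)%:C) => u v d e.
by have ok : nc_ok [:: u; v; V; V'] [::] by []; nc ok; ring.
Qed.

Lemma quatJ_lin k c V V' : quatJ k (c *: V + V') = c *: quatJ k V + quatJ k V'.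
Proof.
by have ok : nc_ok [:: k; V; V'] [::] by []; rewrite /quatJ; nc ok; ring.
Qed.

Lemma shb_quatJ_shb q k (c : R) V : skewP (imm q) k -> D0 N q V ->
  A q (quatJ k (A q V)) - quatJ k V = (c / 2)%:C *: (quatJ k (A q V) + A q (quatJ k V)) ->
  shb q (quatJ k (shb q V)) = ((c - beta) / 2)%:C *: (quatJ k (shb q V) + shb q (quatJ k V))
    + (1 + c * beta / 2 - (beta / 2) ^+ 2)%:C *: quatJ k V.
Proof.
move=> sk dV E; have dA := shape_D0 dV; have dr V' : D0 N q V' -> D0 N q (quatJ k V') by exact: D0_quatJ.
have e1 : quatJ k (shb q V) = (- (beta / 2))%:C *: quatJ k V + quatJ k (A q V).
  by rewrite -quatJ_lin rmorphN scaleNr addrC.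
rewrite e1 (shb_lin _ (dr _ dV).1 (dr _ dA).1) /shb.
have -> : A q (quatJ k (A q V)) = quatJ k V + (c / 2)%:C *: (quatJ k (A q V) + A q (quatJ k V)).
  by rewrite -E addrC subrK.
have -> : (1 + c * beta / 2 - (beta / 2) ^+ 2)%:C = 1 + (2 * (c / 2) * (beta / 2))%:C - ((beta / 2) * (beta / 2))%:C :> R[i].
  rewrite -(rmorph1 (real_complex R)) -rmorphD -rmorphB; congr (_%:C); rewrite expr2.
  by move: beta => b; field.
have -> : ((c - beta) / 2)%:C = (c / 2)%:C - (beta / 2)%:C :> R[i] by rewrite mulrBl rmorphB.
rewrite !rmorphM rmorphN rmorph_nat.
move: (quatJ k V) (quatJ k (A q V)) (A q (quatJ k V)) ((c / 2)%:C) ((beta / 2)%:C) => u v w d e.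
by have ok : nc_ok [:: u; v; w] [::] by []; nc ok; ring.
Qed.

Lemma quatJ_comp P k l V : G2 R m P -> G2_tangent P V -> P *m k = k -> k *m P = k ->
  P *m l = l -> l *m P = l -> k *m l = - (l *m k) -> quatJ k (quatJ l V) = quatJ (l *m k) V.
Proof.
move=> gP gV k1 k2 l1 l2 kl; have [_ PP _] := gP.
have [v [v' [-> v1 v2 v3 v4]]] := G2_tangent_split gP gV.
have ok0 : nc_ok [:: P; v; v'; k; l] (nc_gen [:: 0] [:: (0, 0); (1, 0); (0, 1); (0, 0); (0, 0)]
      [:: (0, 0); (1, 0); (0, 1); (0, 0); (0, 0)] 0)%N by apply: typed_ok => //=; do !split.
have -> : quatJ (l *m k) (v + v') = v *m (l *m k) + k *m l *m v'.
  by rewrite kl /quatJ; nc_have ok ok0; nc ok; ring.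
by rewrite /quatJ; nc_have ok ok0; nc ok; ring.
Qed.

Lemma quatJ_sq P k V : G2 R m P -> G2_tangent P V -> P *m k = k -> k *m P = k ->
  k *m k = - P -> quatJ k (quatJ k V) = - V.
Proof.
move=> gP gV k1 k2 kk; have [_ PP _] := gP.
have [v [v' [-> v1 v2 v3 v4]]] := G2_tangent_split gP gV.
have ok0 : nc_ok [:: P; v; v'; k] (nc_gen [:: 0] [:: (0, 0); (1, 0); (0, 1); (0, 0)]
      [:: (0, 0); (1, 0); (0, 1); (0, 0)] 0)%N by apply: typed_ok => //=; do !split.
nc_have ok ok0.
have -> : quatJ k (quatJ k (v + v')) = v *m (k *m k) + k *m k *m v' by rewrite /quatJ; nc ok; ring.
by rewrite kk; nc ok; ring.
Qed.

Lemma quat_units q : exists k l, [/\ [/\ skewP (imm q) k, \tr k = 0 & k *m k = - imm q],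
  [/\ skewP (imm q) l, \tr l = 0 & l *m l = - imm q], k *m l = - (l *m k) &
  [/\ skewP (imm q) (l *m k), \tr (l *m k) = 0 & (l *m k) *m (l *m k) = - imm q]].
Proof.
have gP := imm_G2 q; have [K [KK KP [qb1 qb2]]] := quat_basis_exists gP.
pose f c := K *m pauli c *m K^t*.
have ff c d : f c *m f d = K *m (pauli c *m pauli d) *m K^t*.
  by rewrite /f !mulmxA -(mulmxA (K *m _) (K^t*)) KK mulmx1.
have f01 : f 0 *m f 1 = f 2%:R by rewrite ff pauli_prod.
have sf c : skewP (imm q) (f c) /\ \tr (f c) = 0 by have [h1 h2 h3 h4] := qb1 c.
have sq c : f c *m f c = - imm q.
  have := qb2 c c; rewrite eqxx -/(f c) -mulr2n -scaler_nat => E.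
  by apply: (@scalerI _ _ 2%:R); rewrite ?pnatr_eq0// E scalerN.
have ac c d : c != d -> f c *m f d = - (f d *m f c).
  move=> cd; have := qb2 c d; rewrite (negPf cd) mul0rn scale0r oppr0 => /eqP.
  by rewrite addr_eq0 => /eqP.
exists (f 1), (f 0); rewrite f01.
have sf3 c : [/\ skewP (imm q) (f c), \tr (f c) = 0 & f c *m f c = - imm q].
  by have [s0 t0] := sf c; split; [exact: s0|exact: t0|exact: sq].
split; [exact: sf3|exact: sf3| |exact: sf3].
by rewrite -f01; apply: ac.
Qed.

Lemma shb_quat_shb q k V : skewP (imm q) k -> \tr k = 0 -> D0 N q V ->
  shb q (quatJ k (shb q V)) = kap%:C *: quatJ k V.
Proof.
move=> sk tk dV; rewrite (shb_quatJ_shb sk dV (shape_quat sk tk dV)).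
rewrite subrr mul0r scale0r add0r; congr (_%:C *: _).
by move: beta => b; field.
Qed.

Lemma shbZ q c V : tangent q V -> shb q (c%:C *: V) = c%:C *: shb q V.
Proof.
move=> tV; have := shb_lin c tV (tangent0 q).
by rewrite addr0 /shb (shape0 hN) scaler0 subrr addr0.
Qed.

Lemma kap_gt0 : 0 < kap. Proof. by rewrite ltr_wpDr ?sqr_ge0. Qed.

(** Write [B] for [shb] and [r_k] for [quatJ k]. Evaluating [B r_k B r_l B] in two ways shows that
    [B] commutes with [r_k r_l]. This composite is again one of the structures, so
    [r_k r_l B^2 = B r_k r_l B = kap r_k r_l]. *)
Lemma shb_sq q V : D0 N q V -> shb q (shb q V) = kap%:C *: V.
Proof.
move=> dV; have [k [l [[sk tk kk] [sl tl ll] kl [slk tlk lklk]]]] := quat_units q.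
have gP := imm_G2 q; have [[_ k1 k2] [_ l1 l2]] := (sk, sl); have [_ lk1 lk2] := slk.
have db := D0_shb dV; have bb := D0_shb db.
have comp V' : D0 N q V' -> quatJ k (quatJ l V') = quatJ (l *m k) V'.
  by move=> [/tangent_G2 gV' _]; apply: (quatJ_comp gP gV').
have q0 k' : quatJ k' 0 = 0 by rewrite /quatJ mulmx0 mul0mx subrr.
have qZ k' c V' : quatJ k' (c *: V') = c *: quatJ k' V'.
  by rewrite -[c *: V']addr0 quatJ_lin q0 addr0.
have kap0 : (kap%:C : R[i]) != 0.
  by apply/eqP => -[]; move: kap_gt0 => /[swap] ->; rewrite ltxx.
have cm V' : D0 N q V' -> shb q (quatJ (l *m k) V') = quatJ (l *m k) (shb q V').
  move=> dV'; have db' := D0_shb dV'.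
  have := shb_quat_shb sk tk (D0_quatJ sl db').
  rewrite (shb_quat_shb sl tl dV') qZ (comp _ dV') (comp _ db') (shbZ _ (D0_quatJ slk dV').1).
  exact: scalerI.
have e5 : quatJ (l *m k) (shb q (shb q V)) = kap%:C *: quatJ (l *m k) V.
  by rewrite -(cm _ db); exact: shb_quat_shb slk tlk dV.
have sq V' : D0 N q V' -> quatJ (l *m k) (quatJ (l *m k) V') = - V'.
  by move=> [/tangent_G2 gV' _]; exact: quatJ_sq gP gV' lk1 lk2 lklk.
have := congr1 (quatJ (l *m k)) e5; rewrite qZ (sq _ bb) (sq _ dV).
by rewrite scalerN => /oppr_inj.
Qed.

Lemma shb_quatJ q k V : skewP (imm q) k -> \tr k = 0 -> D0 N q V ->
  shb q (quatJ k V) = quatJ k (shb q V).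
Proof.
move=> sk tk dV; have db := D0_shb dV.
have kap0 : (kap%:C : R[i]) != 0.
  by apply/eqP => -[]; move: kap_gt0 => /[swap] ->; rewrite ltxx.
apply: (scalerI kap0); rewrite -(shbZ _ (D0_quatJ sk dV).1).
by rewrite -(shb_quat_shb sk tk dV) (shb_sq (D0_quatJ sk db)).
Qed.

(** With [a beta = -4] the relation for [J] reads [B J B = d (J B + B J) - kap J], where
    [d = (a - beta) / 2]. Hence [s = J B V + B J V] satisfies [B s = d s]. But [B^2 = kap], while
    [d^2 = kap + 1 + (a / 2)^2], so [s = 0]. *)
Lemma shb_kahler q V : D0 N q V -> shb q (kahlerJ (imm q) V) = - kahlerJ (imm q) (shb q V).
Proof.
move=> dV; have db := D0_shb dV; have sk := skewP_iP q.
have := shb_quatJ_shb sk dV; rewrite -!kahler_quatJ => /(_ a (shape_kahler dV)).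
have dJ V' : D0 N q V' -> D0 N q (kahlerJ (imm q) V') by rewrite kahler_quatJ; exact: D0_quatJ.
set s := _ + shb q _; have -> : 1 + a * beta / 2 - (beta / 2) ^+ 2 = - kap.
  by field; rewrite a_neq0.
move=> E; set d := (a - beta) / 2 in E.
have ds : D0 N q s.
  by have := D0_lin 1 (dJ _ db) (D0_shb (dJ _ dV)); rewrite scale1r.
have E2 : shb q (kahlerJ (imm q) (shb q V)) + kap%:C *: kahlerJ (imm q) V = d%:C *: s.
  by rewrite E rmorphN scaleNr addrNK.
have bs : shb q s = d%:C *: s.
  rewrite -E2 /s; have := shb_lin 1 (dJ _ db).1 (D0_shb (dJ _ dV)).1.
  by rewrite !scale1r => ->; rewrite (shb_sq (dJ _ dV)).
have : shb q (shb q s) = kap%:C *: s by exact: shb_sq.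
rewrite bs (shbZ _ ds.1) bs scalerA -rmorphM => /eqP; rewrite -subr_eq0 -scalerBl -rmorphB scaler_eq0.
case/orP => [/eqP[]|/eqP s0].
  suff : d * d - kap > 0 by move=> /[swap] ->; rewrite ltxx.
  have -> : d * d - kap = 1 + (a / 2) ^+ 2 by rewrite /d; field; rewrite a_neq0.
  by rewrite ltr_wpDr ?sqr_ge0.
by apply/eqP; rewrite -addr_eq0 addrC -/s s0.
Qed.

End Shape_structure.

(** * The Ricci tensor of the hypersurface *)

Lemma ricci_scalar {R : realType} (n : nat) (x y : R) :
  ((n + 4)%:R + x * y - y ^+ 2)%:C = n%:R + 4%:R + x%:C * y%:C - y%:C * y%:C :> R[i].
Proof.
have e (j : nat) : j%:R = (j%:R)%:C :> R[i] by rewrite rmorph_nat.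
by rewrite (e n) (e 4%N) expr2 natrD rmorphB !rmorphD !rmorphM.
Qed.

Lemma gtw_scalar {R : realType} (V : lmodType R[i]) (a b d : R) (u : V) :
  d%:C *: (a%:C *: u) - b%:C *: (d%:C *: u) = (d * (a - b))%:C *: u.
Proof. by rewrite !scalerA -scalerBl -!rmorphM -rmorphB mulrBr (mulrC b). Qed.

Section Ricci_structure.
Context {R : realType} {m : nat} (M : hypersurface R m).
Context (N : M -> cmat R m) (hN : unit_normal N) (m_gt0 : (0 < m)%N).
Context (nabla : (M -> cmat R m) -> (M -> cmat R m) -> M -> cmat R m)
  (hnabla : levi_civita nabla) (hQ : forall p : M, distQ N p (reeb N p)).
Context (a : R) (a_neq0 : a != 0)
  (Areeb : forall q, shape_op N q (reeb N q) = a%:C *: reeb N q).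
Implicit Types (p q : M) (W : set M) (X Y Z K : M -> cmat R m) (V H k s : cmat R m).
Local Notation beta := (- 4 / a).
Local Notation A := (shape_op N).
Local Notation tproj := (tproj N).

Lemma normal_blocks q : exists b b', [/\ N q = b + b', (1%:M - imm q) *m b = b, b *m imm q = b,
  imm q *m b' = b' & b' *m (1%:M - imm q) = b'] /\ b' *m b = imm q.
Proof.
have gP := imm_G2 q; have [_ PP _] := gP; have gn := N_G2 hN q.
have [b [b' [en b1 b2 b3 b4]]] := G2_tangent_split gP gn; exists b, b'; split=> //.
have ok0 : nc_ok [:: imm q; b; b'] (nc_gen [:: 0] [:: (0, 0); (1, 0); (0, 1)]
      [:: (0, 0); (1, 0); (0, 1)] 0)%N by apply: typed_ok => //=; do !split.
by rewrite -[RHS](normal_sq hN hQ q); nc_have ok ok0; rewrite en; nc ok; ring.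
Qed.

Lemma blocks_ok q b b' k : (1%:M - imm q) *m b = b -> b *m imm q = b -> imm q *m b' = b' ->
  b' *m (1%:M - imm q) = b' -> b' *m b = imm q -> imm q *m k = k -> k *m imm q = k ->
  nc_ok [:: imm q; b; b'; k] ((2, 1, NRlet 0) :: nc_gen [:: 0] [:: (0, 0); (1, 0); (0, 1); (0, 0)]
      [:: (0, 0); (1, 0); (0, 1); (0, 0)] 0)%N.
Proof.
move=> b1 b2 b3 b4 bb k1 k2; have [_ PP _] := imm_G2 q.
by split=> //; apply: typed_ok => //=; do !split.
Qed.

Lemma kahlerJ_lin P c V V' : kahlerJ P (c *: V + V') = c *: kahlerJ P V + kahlerJ P V'.
Proof. by rewrite !kahler_quatJ quatJ_lin. Qed.

Lemma kahlerJD P V V' : kahlerJ P (V + V') = kahlerJ P V + kahlerJ P V'.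
Proof.
by have ok : nc_ok [:: P; V; V'] [::] by []; rewrite /kahlerJ; nc ok; ring.
Qed.

Lemma kahlerJ_tangent P V : G2 R m P -> G2_tangent P V -> G2_tangent P (kahlerJ P V).
Proof.
move=> gP gV; have [hP PP _] := gP; have [hV _] := gV; split.
  rewrite /kahlerJ adjZ adjB !adjM hP hV conjc_im scaleNr -scalerN opprB.
  by [].
have [v [v' [-> v1 v2 v3 v4]]] := G2_tangent_split gP gV.
have ok0 : nc_ok [:: P; v; v'] (nc_gen [:: 0] [:: (0, 0); (1, 0); (0, 1)]
      [:: (0, 0); (1, 0); (0, 1)] 0)%N by apply: typed_ok => //=; do !split.
by nc_have ok ok0; rewrite /kahlerJ; nc ok; ring.
Qed.

Lemma kahlerJ_sq P V : G2 R m P -> G2_tangent P V -> kahlerJ P (kahlerJ P V) = - V.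
Proof.
move=> gP gV; have [hP PP _] := gP.
have ii : 'i%C * 'i%C = - 1 :> R[i] by apply/eqP; rewrite eq_complex/=; apply/andP; split; apply/eqP; ring.
rewrite !kahler_quatJ; apply: (quatJ_sq gP gV).
- by rewrite -scalemxAr PP.
- by rewrite -scalemxAl PP.
by rewrite -scalemxAl -scalemxAr PP scalerA ii scaleN1r.
Qed.

Lemma gmet_kahlerJ P V V' : gmet (kahlerJ P V) V' = - gmet V (kahlerJ P V').
Proof.
rewrite -gmetNr /gmet; congr (complex.Re _ / 4).
by have ok : nc_ok [:: P; V; V'] [::] by []; rewrite /kahlerJ; nc ok; ring.
Qed.

Lemma kahlerJ_reeb q : kahlerJ (imm q) (reeb N q) = N q.
Proof.
have := kahlerJ_sq (imm_G2 q) (N_G2 hN q); rewrite /reeb => E.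
have := kahlerJ_lin (imm q) (-1) (kahlerJ (imm q) (N q)) 0.
have J0 : kahlerJ (imm q) 0 = 0 by rewrite /kahlerJ mul0mx mulmx0 subrr scaler0.
by rewrite !scaleN1r J0 !addr0 E opprK.
Qed.

Lemma kahlerJ_Zfield q k : skewP (imm q) k -> \tr k = 0 ->
  tangent q (kahlerJ (imm q) (Zfield (N q) k)) /\ A q (kahlerJ (imm q) (Zfield (N q) k)) = 0.
Proof.
move=> [hk k1 k2] tk.
have hs : (- 'i%C *: k)^t* = - 'i%C *: k.
  rewrite adjZ hk scalerN -scaleNr; congr (_ *: _).
  by apply/eqP; rewrite eq_complex/=; apply/andP; split; apply/eqP; ring.
have [b [b' [[en b1 b2 b3 b4] bb]]] := normal_blocks q.
have ok0 := blocks_ok b1 b2 b3 b4 bb k1 k2.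
have -> : kahlerJ (imm q) (Zfield (N q) k) = N q *m (- 'i%C *: k) + (- 'i%C *: k) *m N q.
  by rewrite /kahlerJ /Zfield en; nc_have ok ok0; nc ok; ring.
apply: (shape_Ys hN m_gt0 hQ hs).
- by rewrite -scalemxAr k1.
- by rewrite -scalemxAl k2.
by rewrite mxtraceZ tk mulr0.
Qed.

Lemma herm_skew_split (t t' : cmat R m) : t^t* = t' ->
  let s := 2^-1 *: (t + t') in let k := 2^-1 *: (t' - t) in
  [/\ s^t* = s, k^t* = - k & t = s - k].
Proof.
move=> ht; have ht' : t'^t* = t by rewrite -ht adjK.
have r2 : (2^-1 : R[i])^*%C = 2^-1 by rewrite -(rmorph_nat (real_complex R)) -fmorphV conjc_real.
split.
- by rewrite adjZ adjD ht ht' r2 addrC.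
- by rewrite adjZ adjB ht ht' r2 -scalerN opprB.
have ok : nc_ok [:: t; t'] [::] by [].
by nc ok; field.
Qed.

(** The Hermitian and skew parts of the plane block of [n V] are, up to sign, the coordinates [s]
    and [k]; the trace of [s] vanishes because [V] is orthogonal to the normal. *)
Lemma tangent_decomp q V : tangent q V -> exists s k V0,
  [/\ [/\ s^t* = s, imm q *m s = s, s *m imm q = s & \tr s = 0], skewP (imm q) k, D0 N q V0 &
   V = N q *m s + s *m N q + Zfield (N q) k + V0].
Proof.
move=> tV; have gV := tangent_G2 tV; have gP := imm_G2 q; have [hP PP _] := gP.
have [hn _] := N_G2 hN q; have [hV _] := gV.
pose t := imm q *m N q *m V *m imm q; pose t' := imm q *m V *m N q *m imm q.
have ht : t^t* = t' by rewrite /t /t' !adjM hP hn hV !mulmxA.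
have [t1 t2 t3 t4] : [/\ imm q *m t = t, t *m imm q = t, imm q *m t' = t' & t' *m imm q = t'].
  by split; rewrite /t /t' ?mulmxA ?PP// -mulmxA PP.
have [hs hk tsk] := herm_skew_split ht.
pose s := 2^-1 *: (t + t'); pose k := 2^-1 *: (t' - t).
have s1 : imm q *m s = s by rewrite -scalemxAr mulmxDr t1 t3.
have s2 : s *m imm q = s by rewrite -scalemxAl mulmxDl t2 t4.
have k1 : imm q *m k = k by rewrite -scalemxAr mulmxBr t1 t3.
have k2 : k *m imm q = k by rewrite -scalemxAl mulmxBl t2 t4.
have sk : skewP (imm q) k by [].
have trs : \tr s = 0.
  rewrite mxtraceZ; suff -> : \tr (t + t') = 0 by rewrite mulr0.
  have E : \tr (t + t') = \tr (N q *m V).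
    have [b [b' [en b1 b2 b3 b4]]] := G2_tangent_split gP (N_G2 hN q).
    have [v [v' [ev v1 v2 v3 v4]]] := G2_tangent_split gP gV.
    have ok0 : nc_ok [:: imm q; b; b'; v; v'] (nc_gen [:: 0] [:: (0, 0); (1, 0); (0, 1); (1, 0); (0, 1)]
      [:: (0, 0); (1, 0); (0, 1); (1, 0); (0, 1)] 0)%N by apply: typed_ok => //=; do !split.
    by nc_have ok ok0; rewrite /t /t' en ev; nc ok; ring.
  by rewrite E (tr_herm_real hn hV) (N_perp hN tV) mulr0.
have [tY _] := shape_Ys hN m_gt0 hQ hs s1 s2 trs.
exists s, k, (V - (N q *m s + s *m N q + Zfield (N q) k)); split=> //; last by rewrite addrC subrK.
split.
  apply: tangentD => //; apply/tangentN/tangentD => //; exact: (Zfield_tangent hN m_gt0).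
have [b [b' [[en b1 b2 b3 b4] bb]]] := normal_blocks q.
have E : imm q *m N q *m (N q *m s + s *m N q + Zfield (N q) k) *m imm q = t.
  rewrite [RHS]tsk -/s -/k.
  have ok0 : nc_ok [:: imm q; b; b'; s; k] ((2, 1, NRlet 0) ::
     nc_gen [:: 0] [:: (0, 0); (1, 0); (0, 1); (0, 0); (0, 0)]
      [:: (0, 0); (1, 0); (0, 1); (0, 0); (0, 0)] 0)%N.
    by split=> //; apply: typed_ok => //=; do !split.
  move: s k ok0 {hs hk tsk s1 s2 k1 k2 sk trs tY} => s k ok0.
  by nc_have ok ok0; rewrite /Zfield en; nc ok; ring.
by rewrite mulmxBr mulmxBl E -/t subrr.
Qed.

(** Extended by 0 to the normal, so as to act on the whole tangent space of the Grassmannian, where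
    [kahlerJ] acts too. *)
Definition shape_ext q V := A q (V - (gmet V (N q))%:C *: N q).

Lemma tangent_perp q V : G2_tangent (imm q) V -> tangent q (V - (gmet V (N q))%:C *: N q).
Proof.
move=> gV; apply/(tangentP hN m_gt0); split; last first.
  by rewrite gmetBr gmetZr (N_unit hN) mulr1 gmetC subrr.
have [hV eV] := gV; have [hn en] := N_G2 hN q.
split; first by rewrite adjB adjZ hV hn conjc_real.
by rewrite mulmxBl mulmxBr -scalemxAl -scalemxAr addrACA -opprD -scalerDr eV en.
Qed.

Lemma shape_ext_tangent q V : G2_tangent (imm q) V -> tangent q (shape_ext q V).
Proof. by move=> gV; apply: (shape_tangent hN m_gt0); exact: tangent_perp. Qed.

Lemma shape_ext_lin q c V V' : G2_tangent (imm q) V -> G2_tangent (imm q) V' ->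
  shape_ext q (c%:C *: V + V') = c%:C *: shape_ext q V + shape_ext q V'.
Proof.
move=> gV gV'; rewrite /shape_ext -(shape_lin hN c (tangent_perp gV) (tangent_perp gV')).
congr (A q _); rewrite gmetDl gmetZl rmorphD rmorphM/=.
move: ((gmet V _)%:C) ((gmet V' _)%:C) (c%:C) => d e f; move: (N q) => n.
by have ok : nc_ok [:: V; V'; n] [::] by []; nc ok; ring.
Qed.

Lemma shape_ext_id q V : tangent q V -> shape_ext q V = A q V.
Proof. by move=> tV; rewrite /shape_ext gmetC (N_perp hN tV) scale0r subr0. Qed.

Lemma shape_ext_N q : shape_ext q (N q) = 0.
Proof. by rewrite /shape_ext (N_unit hN) scale1r subrr (shape0 hN). Qed.

(** Twice the part of [A] that commutes with [J]. On [D0] this is the scalar [beta], so its trace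
    can be found without the multiplicities of the principal curvatures. *)
Definition shape_J q V := shape_ext q V - kahlerJ (imm q) (shape_ext q (kahlerJ (imm q) V)).

Lemma shape_J_lin q c V V' : G2_tangent (imm q) V -> G2_tangent (imm q) V' ->
  shape_J q (c%:C *: V + V') = c%:C *: shape_J q V + shape_J q V'.
Proof.
move=> gV gV'; have gJ V1 : G2_tangent (imm q) V1 -> G2_tangent (imm q) (kahlerJ (imm q) V1).
  by apply: kahlerJ_tangent; exact: imm_G2.
rewrite /shape_J kahlerJ_lin (shape_ext_lin c gV gV') (shape_ext_lin c (gJ _ gV) (gJ _ gV')) kahlerJ_lin.
by rewrite opprD addrACA -scalerBr.
Qed.

Definition JR q V := beta%:C *: V +
  (a - beta)%:C *: ((gmet V (N q))%:C *: N q + (gmet V (reeb N q))%:C *: reeb N q).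

Lemma JR_lin q c V V' : JR q (c%:C *: V + V') = c%:C *: JR q V + JR q V'.
Proof.
have g U : (gmet (c%:C *: V + V') U)%:C = c%:C * (gmet V U)%:C + (gmet V' U)%:C :> R[i].
  by rewrite gmetDl gmetZl rmorphD rmorphM.
rewrite /JR !g; move: (gmet V (N q))%:C (gmet V' (N q))%:C (gmet V (reeb N q))%:C (gmet V' (reeb N q))%:C => d1 d2 d3 d4.
move: ((a - beta)%:C) (beta%:C) (c%:C) => e f d.
move: (N q) (reeb N q) => n x.
by have ok : nc_ok [:: V; V'; n; x] [::] by []; nc ok; ring.
Qed.

Lemma reeb_tangent q : tangent q (reeb N q).
Proof. by rewrite reebE; apply: (Zfield_tangent hN m_gt0); exact: skewP_iP. Qed.

Lemma reeb_unit q : gmet (reeb N q) (reeb N q) = 1.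
Proof.
by rewrite {1}/reeb gmetNl gmet_kahlerJ opprK kahlerJ_reeb (N_unit hN).
Qed.

Lemma shape_JE q V : G2_tangent (imm q) V -> shape_J q V = JR q V.
Proof.
have gP := imm_G2 q; have [hP PP _] := gP; have tx := reeb_tangent q.
have J0 : kahlerJ (imm q) 0 = 0 by rewrite /kahlerJ mul0mx mulmx0 subrr scaler0.
have JZ c V1 : kahlerJ (imm q) (c *: V1) = c *: kahlerJ (imm q) V1.
  by rewrite -[c *: V1]addr0 kahlerJ_lin J0 addr0.
have JN V1 : kahlerJ (imm q) (- V1) = - kahlerJ (imm q) V1.
  by rewrite -scaleN1r JZ scaleN1r.
have Jn : kahlerJ (imm q) (N q) = - reeb N q by rewrite /reeb opprK.
have Nx : gmet (N q) (reeb N q) = 0 by exact: N_perp.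
have cN : shape_J q (N q) = JR q (N q).
  rewrite /shape_J shape_ext_N Jn (shape_ext_id (tangentN tx)) (shapeN hN tx) Areeb JN opprK.
  rewrite add0r JZ kahlerJ_reeb /JR (N_unit hN) Nx scale1r scale0r addr0 -scalerDl -rmorphD.
  by rewrite [in RHS]addrC subrK.
have cx : shape_J q (reeb N q) = JR q (reeb N q).
  rewrite /shape_J kahlerJ_reeb shape_ext_N J0 subr0 (shape_ext_id tx) Areeb /JR reeb_unit gmetC Nx.
  by rewrite scale0r add0r scale1r -scalerDl -rmorphD [in RHS]addrC subrK.
have cZ k : skewP (imm q) k -> \tr k = 0 -> shape_J q (Zfield (N q) k) = JR q (Zfield (N q) k).
  move=> sk tk; have tZ := Zfield_tangent hN m_gt0 sk; have [tJ AJ] := kahlerJ_Zfield sk tk.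
  rewrite /shape_J (shape_ext_id tZ) (shape_ext_id tJ) AJ J0 subr0.
  rewrite (shape_Zfield hN m_gt0 hnabla hQ a_neq0 Areeb sk tk) /JR gmetC (N_perp hN tZ).
  suff -> : gmet (Zfield (N q) k) (reeb N q) = 0 by rewrite !scale0r addr0 scaler0 addr0.
  rewrite reebE gmet_Zfield; have [hk k1 k2] := sk.
  have [b [b' [[en b1 b2 b3 b4] bb]]] := normal_blocks q.
  have ok0 := blocks_ok b1 b2 b3 b4 bb k1 k2.
  have -> : \tr ('i%C *: imm q *m (N q *m Zfield (N q) k - Zfield (N q) k *m N q)) = \tr ((- 'i%C *+ 2) *: k).
    by rewrite /Zfield en; nc_have ok ok0; nc ok; ring.
  by rewrite mxtraceZ tk mulr0 mul0r.
have cY s : s^t* = s -> imm q *m s = s -> s *m imm q = s -> \tr s = 0 ->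
    shape_J q (N q *m s + s *m N q) = JR q (N q *m s + s *m N q).
  move=> hs s1 s2 ts; have [tY AY] := shape_Ys hN m_gt0 hQ hs s1 s2 ts.
  have [b [b' [[en b1 b2 b3 b4] bb]]] := normal_blocks q.
  have ok0 := blocks_ok b1 b2 b3 b4 bb s1 s2.
  pose k := - 'i%C *: s.
  have sk : skewP (imm q) k.
    split; [|by rewrite -scalemxAr s1|by rewrite -scalemxAl s2].
    by rewrite adjZ hs -scaleNr; congr (_ *: _); apply/eqP; rewrite eq_complex/=; apply/andP; split; apply/eqP; ring.
  have tk : \tr k = 0 by rewrite mxtraceZ ts mulr0.
  have EJ : kahlerJ (imm q) (N q *m s + s *m N q) = Zfield (N q) k.
    by rewrite /kahlerJ /Zfield /k en; nc_have ok ok0; nc ok; ring.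
  have tZ := Zfield_tangent hN m_gt0 sk.
  rewrite /shape_J (shape_ext_id tY) AY EJ (shape_ext_id tZ).
  rewrite (shape_Zfield hN m_gt0 hnabla hQ a_neq0 Areeb sk tk) JZ -EJ (kahlerJ_sq gP (tangent_G2 tY)).
  rewrite /JR gmetC (N_perp hN tY) scale0r.
  suff -> : gmet (N q *m s + s *m N q) (reeb N q) = 0 by rewrite scale0r addr0 scaler0 addr0 scalerN opprK add0r.
  rewrite reebE gmet_Zfield.
  have -> : \tr ('i%C *: imm q *m (N q *m (N q *m s + s *m N q) - (N q *m s + s *m N q) *m N q)) = \tr (0 : cmat R m).
    by rewrite en; nc_have ok ok0; nc ok; ring.
  by rewrite linear0 mul0r.
have cD V0 : D0 N q V0 -> shape_J q V0 = JR q V0.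
  move=> dV; have tV := dV.1.
  have dJ : D0 N q (kahlerJ (imm q) V0) by rewrite kahler_quatJ; apply: (D0_quatJ hN m_gt0) => //; exact: skewP_iP.
  rewrite /shape_J (shape_ext_id tV) (shape_ext_id dJ.1) /JR gmetC (N_perp hN tV).
  rewrite reebE (D0_Zfield hN dV (skewP_iP q)) !scale0r addr0 scaler0 addr0.
  have B := shb_kahler hN m_gt0 hnabla hQ a_neq0 Areeb dV.
  have E1 V1 : A q V1 = shb N a q V1 + (beta / 2)%:C *: V1 by rewrite /shb subrK.
  rewrite !E1 B.
  have db := D0_shb hN m_gt0 hnabla hQ a_neq0 Areeb dV.
  rewrite kahlerJD JN JZ (kahlerJ_sq gP (tangent_G2 db.1)) (kahlerJ_sq gP (tangent_G2 tV)).
  have -> : beta%:C = (beta / 2)%:C + (beta / 2)%:C :> R[i] by rewrite -rmorphD -splitr.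
  move: (shb N a q V0) ((beta / 2)%:C) => u d.
  by have ok : nc_ok [:: u; V0] [::] by []; nc ok; ring.
move=> gV.
have tP := tangent_perp gV.
have [s [k [V0 [[hs s1 s2 ts] sk dV0 EV]]]] := tangent_decomp tP.
have [k0 [c [sk0 tk0 ek]]] := skewP_split sk.
have Zk : Zfield (N q) k = c%:C *: reeb N q + Zfield (N q) k0.
  rewrite reebE ek /Zfield; have ok : nc_ok [:: imm q; N q; k0] [::] by [].
  by nc ok; ring.
have -> : V = (gmet V (N q))%:C *: N q + (1%:C *: (N q *m s + s *m N q) + (c%:C *: reeb N q + (1%:C *: Zfield (N q) k0 + V0))).
  by rewrite !scale1r -[LHS](subrK ((gmet V (N q))%:C *: N q)) EV Zk addrC -!addrA.
have [tY _] := shape_Ys hN m_gt0 hQ hs s1 s2 ts.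
have tZ0 := Zfield_tangent hN m_gt0 sk0.
have t1 := tangentD (tangentZ 1 tZ0) dV0.1.
have t2 := tangentD (tangentZ c tx) t1; have t3 := tangentD (tangentZ 1 tY) t2.
rewrite (shape_J_lin _ (N_G2 hN q) (tangent_G2 t3)) (shape_J_lin _ (tangent_G2 tY) (tangent_G2 t2)).
rewrite (shape_J_lin _ (tangent_G2 tx) (tangent_G2 t1)) (shape_J_lin _ (tangent_G2 tZ0) (tangent_G2 dV0.1)).
rewrite !JR_lin cN cx (cY s)// (cZ k0)// (cD V0)//.
Qed.

(** Moving a frame by [J] does not change the trace, so twice the trace of [A] is the trace of [JR],
    namely [4 m beta + 2 (a - beta)]. *)
Lemma shape_trace q (e : 'I_((4 * m).-1) -> cmat R m) : (forall i, tangent q (e i)) ->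
  (forall i j, gmet (e i) (e j) = (i == j)%:R) ->
  \sum_i gmet (A q (e i)) (e i) = a + (2 * m%:R - 1) * beta.
Proof.
move=> te oe; have pf := onb_parseval hN m_gt0 te oe; set f := oapp e (N q) in pf.
have [gf ef] := pf; have gP := imm_G2 q.
have pJ : parseval_frame (imm q) (fun i => kahlerJ (imm q) (f i)).
  split=> [i|V gV]; first exact: kahlerJ_tangent.
  rewrite -[LHS]opprK -(kahlerJ_sq gP gV) {1}(ef _ (kahlerJ_tangent gP gV)).
  have J0 : kahlerJ (imm q) 0 = 0 by rewrite /kahlerJ mul0mx mulmx0 subrr scaler0.
  have -> : kahlerJ (imm q) (\sum_i (gmet (kahlerJ (imm q) V) (f i))%:C *: f i) =
      \sum_i (gmet (kahlerJ (imm q) V) (f i))%:C *: kahlerJ (imm q) (f i).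
    elim: (index_enum _) => [|i r IH]; first by rewrite !big_nil.
    by rewrite !big_cons kahlerJ_lin IH.
  rewrite -sumrN; apply: eq_bigr => i _.
  by rewrite gmet_kahlerJ rmorphN scaleNr opprK.
have E1 : \sum_i gmet (shape_ext q (f i)) (f i) = \sum_i gmet (A q (e i)) (e i).
  rewrite sum_option /= shape_ext_N gmet0l add0r; apply: eq_bigr => i _.
  by rewrite shape_ext_id.
have tL V : G2_tangent (imm q) V -> G2_tangent (imm q) (shape_ext q V).
  by move=> gV; exact: tangent_G2 (shape_ext_tangent gV).
have E2 := parseval_trace pf pJ (@shape_ext_lin q) tL.
have E3 : \sum_i gmet (shape_J q (f i)) (f i) = 2 * \sum_i gmet (A q (e i)) (e i).
  rewrite -E1 mulr_natl mulr2n {2}E2 -big_split/=; apply: eq_bigr => i _.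
  by rewrite /shape_J gmetBl gmet_kahlerJ opprK.
have sq U : G2_tangent (imm q) U -> \sum_i gmet (f i) U * gmet U (f i) = gmet U U.
  move=> gU; rewrite [X in _ = gmet X _](ef _ gU) gmet_suml; apply: eq_bigr => i _.
  by rewrite gmetZl mulrC.
have card : \sum_i gmet (f i) (f i) = (4 * m)%:R.
  rewrite sum_option /= (N_unit hN) (eq_bigr (fun=> 1)) => [|i _]; last by rewrite oe eqxx.
  by rewrite sumr_const card_ord -[in RHS](@prednK (4 * m)) ?muln_gt0// -natr1 addrC.
have : \sum_i gmet (shape_J q (f i)) (f i) =
    beta * (4 * m)%:R + (a - beta) * (gmet (N q) (N q) + gmet (reeb N q) (reeb N q)).
  rewrite -{1}card -(sq _ (N_G2 hN q)) -(sq _ (tangent_G2 (reeb_tangent q))).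
  rewrite -big_split/= !big_distrr -big_split/=; apply: eq_bigr => i _.
  rewrite (shape_JE (gf i)) /JR gmetDl !gmetZl gmetDl !gmetZl.
  by [].
rewrite E3 natrM (N_unit hN) reeb_unit => E; apply: (@mulfI _ 2); first by rewrite pnatr_eq0.
by rewrite E; ring.
Qed.

Section Parallel.
Context (S : M -> cmat R m -> cmat R m) (hS : ricci_tensor nabla S).
Local Notation h := (a + (2 * m%:R - 1) * beta).

Lemma ricci_tangent q V : tangent q V -> let n := N q in
  S q V = (4 * m + 8)%:R *: V - tproj q (V *m n *m n - 2%:R *: (n *m V *m n) + n *m n *m V)
     + (h%:C *: A q V - A q (A q V)).
Proof.
move=> tV n; have [e [te oe E]] := ricci_shape hN m_gt0 hnabla hS q.
have hV := (tangent_G2 tV).1.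
have vX := vfield_tproj_cst hN m_gt0 (@openT M) hV.
by have := E _ vX; rewrite /= (tproj_id hN m_gt0 tV) (shape_trace te oe).
Qed.

Lemma ricci_Zfield q k : skewP (imm q) k -> \tr k = 0 ->
  S q (Zfield (N q) k) = ((4 * m + 4)%:R + h * beta - beta ^+ 2)%:C *: Zfield (N q) k.
Proof.
move=> sk tk; have [hk k1 k2] := sk; have tZ := Zfield_tangent hN m_gt0 sk.
have [b [b' [[en b1 b2 b3 b4] bb]]] := normal_blocks q.
have ok0 := blocks_ok b1 b2 b3 b4 bb k1 k2.
rewrite (ricci_tangent tZ) (shape_Zfield hN m_gt0 hnabla hQ a_neq0 Areeb sk tk).
rewrite (shapeZ hN _ tZ) (shape_Zfield hN m_gt0 hnabla hQ a_neq0 Areeb sk tk).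
set z := Zfield (N q) k.
have -> : z *m N q *m N q - 2%:R *: (N q *m z *m N q) + N q *m N q *m z = 4%:R *: z.
  by rewrite /z /Zfield en; nc_have ok ok0; nc ok; ring.
have := tproj_id hN m_gt0 (tangentZ 4 tZ); rewrite rmorph_nat -/z => ->.
rewrite ricci_scalar natrD; move: (h%:C) (beta%:C) ((4 * m)%:R : R[i]) => u v w.
by have ok : nc_ok [:: z] [::] by []; nc ok; ring.
Qed.

Lemma ricci_kahlerJ_Zfield q k : skewP (imm q) k -> \tr k = 0 ->
  S q (kahlerJ (imm q) (Zfield (N q) k)) = (4 * m + 8)%:R *: kahlerJ (imm q) (Zfield (N q) k).
Proof.
move=> sk tk; have [hk k1 k2] := sk; have [tJ AJ] := kahlerJ_Zfield sk tk.
have [b [b' [[en b1 b2 b3 b4] bb]]] := normal_blocks q.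
have ok0 := blocks_ok b1 b2 b3 b4 bb k1 k2.
rewrite (ricci_tangent tJ) AJ (shape0 hN) scaler0 subr0 addr0.
set z := kahlerJ _ _.
have -> : z *m N q *m N q - 2%:R *: (N q *m z *m N q) + N q *m N q *m z = 0.
  by rewrite /z /kahlerJ /Zfield en; nc_have ok ok0; nc ok; ring.
by rewrite (tproj0 _ q) subr0.
Qed.

Context (kk : R) (ak : a = 2 * kk) (hpar : gtw_reeb_parallel nabla N kk S).

Lemma nabla_reeb_Zfield q k : skewP (imm q) k -> \tr k = 0 ->
  tproj q (dirM_mx q (reeb N q) (fun q => Zfield (N q) (quat_field k q))) =
  a%:C *: kahlerJ (imm q) (Zfield (N q) k).
Proof.
move=> sk tk; have [hk k1 k2] := sk; have tx := reeb_tangent q.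
have [b [b' [[en b1 b2 b3 b4] bb]]] := normal_blocks q.
have ok0 := blocks_ok b1 b2 b3 b4 bb k1 k2; nc_have ok ok0.
rewrite (dirM_Zfield hN (quat_field_smooth k) tx (dirM_quat_field sk tk tx)).
rewrite (quat_field_id sk tk) (dirM_N hN tx) Areeb.
have -> : II (imm q) (reeb N q) (N q) = 0.
  by rewrite IIE /reeb /kahlerJ en; nc ok; ring.
rewrite addr0 -(tproj_G2_proj hN).
have -> : G2_proj (imm q) ((reeb N q *m k + k *m reeb N q) *m N q + k *m - (a%:C *: reeb N q) -
    (- (a%:C *: reeb N q) *m k + N q *m (reeb N q *m k + k *m reeb N q))) =
    a%:C *: kahlerJ (imm q) (Zfield (N q) k).
  by rewrite /G2_proj /reeb /kahlerJ /Zfield en; nc ok; ring.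
apply: (tproj_id hN m_gt0); apply: tangentZ; exact: (kahlerJ_Zfield sk tk).1.
Qed.

Lemma hopf_constant (kk_neq0 : kk != 0) (q : M) : kk ^+ 2 = m%:R - 1.
Proof.
have [k [_ [[sk tk kk1] _ _ _]]] := quat_units q; have [hk k1 k2] := sk.
pose Z q := Zfield (N q) (quat_field k q).
have sq q' := quat_field_skew q' hk.
have vZ : vfield setT Z.
  split=> [q' _|]; first by apply: (Zfield_tangent hN m_gt0); exact: (sq q').1.
  have oT := @openT M; have sN := N_smooth hN; have sK := quat_field_smooth (M := M) k.
  by apply: smooth_fieldB => //; apply: smooth_fieldM.
pose c : R := (4 * m + 4)%:R + h * beta - beta ^+ 2.
have SZ : (fun q => S q (Z q)) = (fun q => c%:C *: Z q).
  by apply/funext => q'; apply: ricci_Zfield; [exact: (sq q').1|exact: (sq q').2].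
have Zq : Z q = Zfield (N q) k by rewrite /Z (quat_field_id sk tk).
have vx : vfield setT (reeb N).
  split=> [q' _|]; first exact: reeb_tangent.
  have oT := @openT M; have sN := N_smooth hN; have sI := @smooth_field_imm _ _ M setT.
  rewrite /reeb /kahlerJ.
  apply: smooth_fieldN => //; apply: smooth_fieldZc => //.
  by apply: smooth_fieldB => //; apply: smooth_fieldM.
have vcZ : vfield setT (fun q => c%:C *: Z q).
  split=> [q' _|]; first by apply: tangentZ; exact: (vfield_tangent vZ I).
  by apply: smooth_fieldZc; [exact: openT|exact: vfield_smooth].
have nZ : nabla (reeb N) Z q = a%:C *: kahlerJ (imm q) (Zfield (N q) k).
  by rewrite (nablaE hN m_gt0 hnabla (@openT M) I vx vZ) nabla_reeb_Zfield.
have ncZ : nabla (reeb N) (fun q => c%:C *: Z q) q = c%:C *: nabla (reeb N) Z q.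
  rewrite (nablaE hN m_gt0 hnabla (@openT M) I vx vcZ) (nablaE hN m_gt0 hnabla (@openT M) I vx vZ).
  by rewrite (dirM_mxZc _ _ (vfield_smooth vZ) I) tprojZ.
have phi0 : phi N q (A q (reeb N q)) = 0.
  rewrite Areeb /phi.
  have J0 : kahlerJ (imm q) 0 = 0 by rewrite /kahlerJ mul0mx mulmx0 subrr scaler0.
  have -> : kahlerJ (imm q) (a%:C *: reeb N q) = a%:C *: N q.
    by rewrite -[_ *: reeb N q]addr0 kahlerJ_lin J0 addr0 kahlerJ_reeb.
  by rewrite gmetZl (N_unit hN) mulr1 subrr.
have [tJ _] := kahlerJ_Zfield sk tk.
have phiZ d : phi N q (d%:C *: Z q) = d%:C *: kahlerJ (imm q) (Zfield (N q) k).
  have J0 : kahlerJ (imm q) 0 = 0 by rewrite /kahlerJ mul0mx mulmx0 subrr scaler0.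
  rewrite /phi Zq -[_ *: Zfield _ _]addr0 kahlerJ_lin J0 addr0 gmetZl gmetC (N_perp hN tJ).
  by rewrite mulr0 scale0r subr0.
have etax : Defs.eta N q (reeb N q) = 1 by exact: reeb_unit.
have g Y d : Y = (fun q => d%:C *: Z q) -> nabla (reeb N) Y q = d%:C *: nabla (reeb N) Z q ->
    gtw nabla N kk (reeb N) Y q = (d * (a - kk))%:C *: kahlerJ (imm q) (Zfield (N q) k).
  move=> -> nY; rewrite /gtw nY nZ phi0 gmet0l scale0r scaler0 addr0 subr0 etax mulr1 phiZ.
  exact: gtw_scalar.
have := hpar vZ q; rewrite SZ (g _ c) // (g _ 1); last first.
- by rewrite scale1r.
- by apply/funext => q'; rewrite scale1r.
have -> : a - kk = kk by rewrite ak; ring.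
set J := kahlerJ _ _ in tJ *; rewrite mul1r.
(* [S q] is a mere function on matrices, so the factor [kk] is moved into [k], where the eigenvalue
   formula applies again. *)
have SJ : S q (kk%:C *: J) = (kk * (4 * m + 8)%:R)%:C *: J.
  have skk : skewP (imm q) (kk%:C *: k).
    by split; rewrite ?adjZ ?hk ?conjc_real ?scalerN// -?scalemxAr -?scalemxAl ?k1 ?k2.
  have tkk : \tr (kk%:C *: k) = 0 by rewrite mxtraceZ tk mulr0.
  have E : kahlerJ (imm q) (Zfield (N q) (kk%:C *: k)) = kk%:C *: J.
    have ok : nc_ok [:: imm q; N q; k] [::] by [].
    by rewrite /J /kahlerJ /Zfield; nc ok; ring.
  by rewrite -E (ricci_kahlerJ_Zfield skk tkk) E scalerA rmorphM rmorph_nat mulrC.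
rewrite SJ -scalerBl -rmorphB => /eqP; rewrite scaler_eq0 => /orP[/eqP[E]|/eqP J0].
  have {}E : c = (4 * m + 8)%:R.
    by apply: (mulfI kk_neq0); apply/eqP; rewrite -subr_eq0 mulrC E.
  have n4 : (4 * m + 4)%:R = 4 * m%:R + 4 :> R by rewrite natrD natrM.
  have n8 : (4 * m + 8)%:R = 4 * m%:R + 8 :> R by rewrite natrD natrM.
  move: E; rewrite /c ak n4 n8 => E.
  (* Multiplication by [kk^2] clears the denominators; the left-hand side becomes
     [4 m kk^2 + 8 (m - 1)]. *)
  have : (4 * m%:R + 4 + (2 * kk + (2 * m%:R - 1) * (- 4 / (2 * kk))) * (- 4 / (2 * kk)) - (- 4 / (2 * kk)) ^+ 2)
    * kk ^+ 2 = (4 * m%:R + 8) * kk ^+ 2 by rewrite E.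
  have -> : (4 * m%:R + 4 + (2 * kk + (2 * m%:R - 1) * (- 4 / (2 * kk))) * (- 4 / (2 * kk)) - (- 4 / (2 * kk)) ^+ 2)
    * kk ^+ 2 = 4 * m%:R * kk ^+ 2 + 8 * (m%:R - 1) by field.
  by lra.
(* The other alternative, a vanishing [phi xi_nu], would contradict [k^2 = - P]. *)
have k0 : k = 0.
  have [b [b' [[en b1 b2 b3 b4] bb]]] := normal_blocks q.
  have ok0 := blocks_ok b1 b2 b3 b4 bb k1 k2.
  have : imm q *m N q *m J = - 'i%C *: k by rewrite /J /kahlerJ /Zfield en; nc_have ok ok0; nc ok; ring.
  move/eqP; rewrite J0 mulmx0 eq_sym scaler_eq0 => /orP[/eqP[]|/eqP//].
  by move=> _ /eqP; rewrite oppr_eq0 oner_eq0.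
have gP := imm_G2 q; have := G2_trace gP; rewrite -[imm q]opprK -kk1 k0 mul0mx oppr0 linear0.
by move/eqP; rewrite eq_sym pnatr_eq0.
Qed.

End Parallel.
End Ricci_structure.

(** * The focal map and its quaternionic structure *)

Lemma mulmx_cancel (K : pzRingType) a b c d (A : 'M[K]_(a, b)) (B : 'M[K]_(b, c)) (C : 'M[K]_(c, b))
    (D : 'M[K]_(b, d)) : B *m C = 1%:M -> A *m B *m (C *m D) = A *m D.
Proof. by move=> BC; rewrite mulmxA -(mulmxA A) BC mulmx1. Qed.

Section Alternating_form.
Context {R : realType} {m : nat}.
Implicit Types (P X Y om g k : cmat R m).

(* On a complex plane the alternating forms are the multiples of the determinant. *)
Definition alt_form P om := om^T = - om /\ P *m om = om.

Lemma alt_form_PT P om : P^t* = P -> alt_form P om -> om *m P^T = om.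
Proof.
move=> hP [ho Po]; have := congr1 (fun X => X^T) Po.
by rewrite trmx_mul ho mulNmx => /oppr_inj.
Qed.

Lemma alt_form_frame P om : G2 R m P -> alt_form P om -> exists (K : 'M[R[i]]_(m.+2, 2)) l,
  [/\ K^t* *m K = 1%:M, K *m K^t* = P & om = l *: (K *m pauli 1 *m K^T)].
Proof.
move=> gP [ho Po]; have [K [KK KP _]] := quat_basis_exists gP.
pose g := K^t* *m om *m (K^t*)^T.
have gT : g^T = - g by rewrite /g trmx_mul trmxK trmx_mul ho mulNmx mulmxN mulmxA.
have og : om = K *m g *m K^T.
  have PT : (K^t*)^T *m K^T = P^T by rewrite -KP trmx_mul.
  have [hP _ _] := gP.
  by rewrite /g !mulmxA KP Po -mulmxA PT (alt_form_PT hP (conj ho Po)).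
move: g gT og => g gT og; have E i j : g i j = - g j i.
  by have /matrixP/(_ j i) := gT; rewrite !mxE.
have z i : g i i = 0.
  by have /eqP := E i i; rewrite -subr_eq0 opprK -mulr2n mulrn_eq0 => /eqP.
exists K, (g 0 1); split=> //; rewrite {1}og scalemxAl scalemxAr; congr (_ *m _ *m _).
by apply: mx2P; rewrite !mxE/= ?z ?mulr0 ?mulr1// mulrN1 (E 1 0).
Qed.

(** The infinitesimal form of [g om g^T = (det g) om]: on a plane, endomorphisms act on alternating
    forms through the trace. *)
Lemma alt_form_trace P om X : G2 R m P -> alt_form P om -> P *m X = X -> X *m P = X ->
  X *m om + om *m X^T = \tr X *: om.
Proof.
move=> gP ao PX XP; have [K [l [KK KP ->]]] := alt_form_frame gP ao.
pose g := K^t* *m X *m K.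
have Xg : X = K *m g *m K^t* by rewrite /g !mulmxA KP PX -!mulmxA KP XP.
have KcK : K^T *m (K^t*)^T = 1%:M by rewrite -trmx_mul KK trmx1.
have XT : X^T = (K^t*)^T *m g^T *m K^T by rewrite {1}Xg trmx_mul (trmx_mul K) mulmxA.
have trX : \tr X = \tr g by rewrite Xg -mulmxA mxtrace_mulC -mulmxA KK mulmx1.
move: g Xg XT trX => g Xg XT trX.
rewrite trX -scalemxAr -scalemxAl -scalerDr scalerA mulrC -scalerA; congr (_ *: _).
have -> : X *m (K *m pauli 1 *m K^T) = K *m (g *m pauli 1) *m K^T.
  have e : X *m (K *m (pauli 1 *m K^T)) = (K *m g) *m (pauli 1 *m K^T).
    by rewrite Xg; exact: (mulmx_cancel (K *m g) _ KK).
  rewrite -(mulmxA K (pauli 1)) e; move: (pauli 1) => u; by rewrite !mulmxA.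
have -> : K *m pauli 1 *m K^T *m X^T = K *m (pauli 1 *m g^T) *m K^T.
  have e : K *m pauli 1 *m K^T *m ((K^t*)^T *m (g^T *m K^T)) = K *m pauli 1 *m (g^T *m K^T).
    exact: (mulmx_cancel (K *m pauli 1) _ KcK).
  rewrite XT -(mulmxA ((K^t*)^T)) e; move: (pauli 1) (g^T) => u v; by rewrite !mulmxA.
rewrite -mulmxDl -mulmxDr scalemxAl scalemxAr; congr (_ *m _ *m _).
have s2 (F : 'I_2 -> R[i]) : \sum_i F i = F 0 + F 1.
  by rewrite !big_ord_recl big_ord0 addr0; congr (_ + F _); apply/val_inj.
by apply: mx2P; rewrite !mxE !s2 !mxE /= /mxtrace s2; ring.
Qed.

(** In an orthonormal frame of the plane every alternating form is a multiple of one unitary matrix,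
    so its product with its adjoint is scalar. *)
Lemma alt_form_norm P om : G2 R m P -> alt_form P om ->
  om *m om^t* = (2 * gmet om (om^t*))%:C *: P.
Proof.
move=> gP ao; have [K [l [KK KP ->]]] := alt_form_frame gP ao.
have KTK : K^T *m (K^T)^t* = 1%:M.
  have -> : (K^T)^t* = (K^t*)^T by apply/matrixP => i j; rewrite !mxE.
  by rewrite -trmx_mul KK trmx1.
have [ps _] := @pauli_skew R 1.
have pp : pauli 1 *m pauli 1 = - (1%:M : 'M[R[i]]_2).
  have := @pauli_quat R 1 1; rewrite eqxx -mulr2n -scaler_nat => E.
  by apply: (@scalerI _ _ 2%:R); rewrite ?pnatr_eq0// E scalerN.
have E : (l *: (K *m pauli 1 *m K^T)) *m (l *: (K *m pauli 1 *m K^T))^t* = (l * l^*%C) *: P.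
  rewrite adjZ -scalemxAl -scalemxAr scalerA; congr (_ *: _).
  rewrite !adjM ps !mulmxA -(mulmxA (K *m _) K^T) KTK mulmx1 -(mulmxA K) mulmxN pp opprK mulmx1.
  by rewrite KP.
rewrite /gmet E mxtraceZ (G2_trace gP); congr (_ *: _).
case: l {E} => x y; apply/eqP; rewrite eq_complex/=; apply/andP; split; apply/eqP; last by ring.
by field.
Qed.

End Alternating_form.

Section Focal.
Context {R : realType} {m : nat} (M : hypersurface R m).
Context (N : M -> cmat R m) (hN : unit_normal N) (m_gt0 : (0 < m)%N).
Context (nabla : (M -> cmat R m) -> (M -> cmat R m) -> M -> cmat R m)
  (hnabla : levi_civita nabla) (hQ : forall p : M, distQ N p (reeb N p)).
Context (k : R) (k_neq0 : k != 0).
Local Notation a := (2 * k).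
Context (Areeb : forall q, shape_op N q (reeb N q) = a%:C *: reeb N q).
Context (c s : R) (cs1 : c ^+ 2 + s ^+ 2 = 1) (sk : s = - k * c).
Implicit Types (p q : M) (W : set M) (V H x y g om : cmat R m).
Local Notation beta := (- 4 / a).
Local Notation A := (shape_op N).
Local Notation tproj := (tproj N).
Local Notation conj g := ((g^t*)^T).

(** The Jacobi operator [cos t - sin t A] of the normal geodesics at [t = 2r], valid on [D0], where
    the normal curvature operator is the identity. Up to the orientation of the normal, [s] is
    [sin 2r]. *)
Definition tau q V := c%:C *: V - s%:C *: A q V.

Lemma a_neq0 : a != 0. Proof. by rewrite mulf_neq0// pnatr_eq0. Qed.

Lemma tau_shb q V : tau q V = (k * c)%:C *: shb N a q V.
Proof.
rewrite /tau /shb sk; have -> : (- k * c)%:C = - (k * c)%:C :> R[i] by rewrite mulNr rmorphN.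
have -> : (- 4 / a / 2)%:C = - (k^-1)%:C :> R[i] by rewrite -rmorphN; congr (_%:C); field.
have -> : c%:C = (k * c)%:C * (k^-1)%:C :> R[i].
  by rewrite -rmorphM; congr (_%:C); field.
move: ((k * c)%:C) (A q V) ((k^-1)%:C) => d u e.
by have ok : nc_ok [:: V; u] [::] by []; nc ok; ring.
Qed.

Lemma tau_lin q d V V' : tangent q V -> tangent q V' ->
  tau q (d%:C *: V + V') = d%:C *: tau q V + tau q V'.
Proof.
move=> tV tV'; rewrite !tau_shb (shb_lin hN a d tV tV').
move: (shb N a q V) (shb N a q V') ((k * c)%:C) (d%:C) => u v e f.
by have ok : nc_ok [:: u; v] [::] by []; nc ok; ring.
Qed.

Lemma tau_D0 q V : D0 N q V -> D0 N q (tau q V).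
Proof.
move=> dV; have db := D0_shb hN m_gt0 hnabla hQ a_neq0 Areeb dV.
have d0 : D0 N q 0 by split; [exact: tangent0|rewrite mulmx0 mul0mx].
by rewrite tau_shb -[X in D0 _ _ X]addr0; exact: D0_lin.
Qed.

(** [tau = k c B] with [B^2 = 1 + k^-2] for [B] the recentred shape operator, and
    [k^2 c^2 + c^2 = s^2 + c^2]. *)
Lemma tau_tau q V : D0 N q V -> tau q (tau q V) = V.
Proof.
move=> dV; have db := D0_shb hN m_gt0 hnabla hQ a_neq0 Areeb dV.
rewrite !tau_shb (shbZ hN _ _ db.1) (shb_sq hN m_gt0 hnabla hQ a_neq0 Areeb dV) !scalerA -!rmorphM.
suff -> : k * c * (k * c) * (1 + (- 4 / a / 2) ^+ 2) = 1 by rewrite scale1r.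
have -> : k * c * (k * c) * (1 + (- 4 / a / 2) ^+ 2) = c ^+ 2 + (- k * c) ^+ 2 by field.
by rewrite -sk.
Qed.

Lemma quatJZ h d V : quatJ h (d *: V) = d *: quatJ h V.
Proof. by rewrite /quatJ -scalemxAl -scalemxAr -scalerBr. Qed.

Lemma tau_quatJ q h V : skewP (imm q) h -> \tr h = 0 -> D0 N q V ->
  tau q (quatJ h V) = quatJ h (tau q V).
Proof.
move=> sh th dV; rewrite !tau_shb quatJZ; congr (_ *: _).
exact: (shb_quatJ hN m_gt0 hnabla hQ a_neq0 Areeb sh th dV).
Qed.

Lemma tau_kahlerJ q V : D0 N q V -> tau q (kahlerJ (imm q) V) = - kahlerJ (imm q) (tau q V).
Proof.
move=> dV; have JZ d U : kahlerJ (imm q) (d *: U) = d *: kahlerJ (imm q) U by rewrite !kahler_quatJ quatJZ.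
rewrite !tau_shb JZ -scalerN; congr (_ *: _).
exact: (shb_kahler hN m_gt0 hnabla hQ a_neq0 Areeb dV).
Qed.

Lemma tau_sym q V V' : tangent q V -> tangent q V' -> gmet (tau q V) V' = gmet V (tau q V').
Proof.
move=> tV tV'; rewrite /tau gmetBl gmetBr !gmetZl !gmetZr.
by rewrite (shape_sym hN tV tV').
Qed.

(** [N q *m N q] projects onto the four-dimensional sum of the plane and its image under the normal;
    this is the complementary projection. *)
Definition Wp q := 1%:M - N q *m N q.

Lemma WpP q : [/\ imm q *m Wp q = 0, Wp q *m imm q = 0, N q *m Wp q = 0, Wp q *m N q = 0 & Wp q *m Wp q = Wp q]
  /\ (Wp q)^t* = Wp q.
Proof.
have [b [b' [[en b1 b2 b3 b4] bb]]] := normal_blocks hN hQ q.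
have [_ PP _] := imm_G2 q; have [hn _] := N_G2 hN q.
have ok0 : nc_ok [:: imm q; b; b'] ((2, 1, NRlet 0) :: nc_gen [:: 0] [:: (0, 0); (1, 0); (0, 1)]
      [:: (0, 0); (1, 0); (0, 1)] 0)%N by split=> //; apply: typed_ok => //=; do !split.
nc_have ok ok0; split; last by rewrite /Wp adjB adj1 adjM hn.
by rewrite /Wp en; split; nc ok; ring.
Qed.

Definition blkW q x := Wp q *m x *m imm q = x.

Lemma blkWP q x : blkW q x -> [/\ Wp q *m x = x, x *m imm q = x, imm q *m x = 0, N q *m x = 0 & x *m N q *m imm q = 0].
Proof.
move=> bx; have [[w1 w2 w3 w4 w5] _] := WpP q; have gP := imm_G2 q; have [_ PP _] := gP.
have PNP := G2_tangent_PXP gP (N_G2 hN q).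
rewrite /blkW in bx; split; rewrite -bx.
- by rewrite !mulmxA w5.
- by rewrite -(mulmxA (_ *m x)) PP.
- by rewrite !mulmxA w1 !mul0mx.
- by rewrite !mulmxA w3 !mul0mx.
by rewrite -!mulmxA [imm q *m (N q *m _)]mulmxA PNP !mulmx0.
Qed.

Lemma blkW_D0 q x : blkW q x -> D0 N q (x + x^t*).
Proof.
move=> bx; have [x1 x2 x3 x4 x5] := blkWP bx; have gP := imm_G2 q; have [hP PP _] := gP.
have [hn _] := N_G2 hN q.
have y2 : imm q *m x^t* = x^t* by rewrite -[in LHS]hP -adjM x2.
have y3 : x^t* *m imm q = 0 by rewrite -[in LHS]hP -adjM x3 adj0.
have y4 : x^t* *m N q = 0 by rewrite -[in LHS]hn -adjM x4 adj0.
split; last first.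
  rewrite mulmxDr mulmxDl -(mulmxA (imm q)) x4 mulmx0 mul0mx add0r.
  by rewrite -mulmxA y3 mulmx0.
apply/(tangentP hN m_gt0); split.
  split; first by rewrite adjD adjK addrC.
  by rewrite mulmxDr mulmxDl x3 y2 x2 y3 add0r addr0 addrC.
by rewrite /gmet mulmxDr x4 add0r mxtrace_mulC y4 linear0 mul0r.
Qed.

Lemma D0_blkW q V : D0 N q V -> blkW q (V *m imm q) /\ V = V *m imm q + (V *m imm q)^t*.
Proof.
move=> dV; have gP := imm_G2 q; have [hP PP _] := gP; have [hV eV] := tangent_G2 dV.1.
have PVP := G2_tangent_PXP gP (tangent_G2 dV.1); have [_ PNVP] := dV.
have [b [b' [[en b1 b2 b3 b4] bb]]] := normal_blocks hN hQ q.
split; last by rewrite adjM hV hP addrC eV.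
rewrite /blkW /Wp -mulmxA -(mulmxA V) PP mulmxBl mul1mx.
have -> : N q *m N q *m (V *m imm q) = 0; last by rewrite subr0.
have ok : nc_ok [:: imm q; b; b'] ((2, 1, NRlet 0) :: nc_gen [:: 0] [:: (0, 0); (1, 0); (0, 1)]
      [:: (0, 0); (1, 0); (0, 1)] 0)%N by split=> //; apply: typed_ok => //=; do !split.
have -> : N q *m N q = imm q + N q *m imm q *m (imm q *m N q) by rewrite en; nc_have ok' ok; nc ok'; ring.
have -> : (imm q + N q *m imm q *m (imm q *m N q)) *m (V *m imm q) =
    imm q *m V *m imm q + N q *m (imm q *m N q *m V *m imm q).
  have ok2 : nc_ok [:: imm q; N q; V] [:: (0, 0, NRlet 0)]%N by split.
  by nc ok2; ring.
by rewrite PVP PNVP mulmx0 addr0.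
Qed.

(** The form [om] identifies the plane with its conjugate. Commuting with su(im P) and anticommuting
    with [J] thereby become conjugate-linearity over all endomorphisms of the plane. *)
Definition TW q om x := tau q (x + x^t*) *m om.

Lemma blkWD q d x y : blkW q x -> blkW q y -> blkW q (d *: x + y).
Proof. by rewrite /blkW => bx byy; rewrite mulmxDr mulmxDl -scalemxAr -scalemxAl bx byy. Qed.

Lemma TWD q om x y : blkW q x -> blkW q y -> TW q om (x + y) = TW q om x + TW q om y.
Proof.
move=> bx byy; rewrite /TW -mulmxDl; congr (_ *m _).
have := tau_lin 1 (blkW_D0 bx).1 (blkW_D0 byy).1; rewrite !scale1r => <-.
by rewrite adjD addrACA.
Qed.

Lemma TWZ q om (d : R) x : blkW q x -> TW q om (d%:C *: x) = d%:C *: TW q om x.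
Proof.
move=> bx; rewrite /TW scalemxAl; congr (_ *m _).
have t0 := tangent0 q; have := tau_lin d (blkW_D0 bx).1 t0.
have -> : tau q 0 = 0 by rewrite /tau (shape0 hN) !scaler0 subrr.
by rewrite !addr0 => <-; rewrite adjZ conjc_real -scalerDr.
Qed.

Lemma TWE q om y V : y + y^t* = V -> TW q om y = tau q V *m om.
Proof. by rewrite /TW => ->. Qed.

Lemma TWi q om x : alt_form (imm q) om -> blkW q x -> TW q om ('i%C *: x) = - 'i%C *: TW q om x.
Proof.
move=> [ho Po] bx; have [x1 x2 x3 x4 x5] := blkWP bx; have dx := blkW_D0 bx.
have [hP PP _] := imm_G2 q.
have -> : TW q om ('i%C *: x) = tau q (kahlerJ (imm q) (x + x^t*)) *m om.
  apply: TWE; rewrite /kahlerJ.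
  have y2 : imm q *m x^t* = x^t* by rewrite -[in LHS]hP -adjM x2.
  have y3 : x^t* *m imm q = 0 by rewrite -[in LHS]hP -adjM x3 adj0.
  by rewrite mulmxDl mulmxDr x2 x3 y2 y3 add0r addr0 adjZ conjc_im scaleNr -scalerBr.
rewrite (tau_kahlerJ dx) /TW /kahlerJ -{1 2}Po.
have PtP := G2_tangent_PXP (imm_G2 q) (tangent_G2 (tau_D0 dx).1).
move: (tau q _) PtP => t PtP.
have -> : - ('i%C *: (t *m imm q - imm q *m t)) *m (imm q *m om) =
    - 'i%C *: (t *m (imm q *m om)) + 'i%C *: (imm q *m t *m imm q *m om).
  have ok : nc_ok [:: imm q; t; om] [:: (0, 0, NRlet 0)]%N by split.
  by nc ok; ring.
by rewrite PtP mul0mx scaler0 addr0.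
Qed.

Lemma conj_skew (g : cmat R m) : g^t* = - g -> conj g = - g^T.
Proof. by move=> ->; apply/matrixP => i j; rewrite !mxE. Qed.

Lemma TW_quat q om x h : alt_form (imm q) om -> skewP (imm q) h -> \tr h = 0 -> blkW q x ->
  TW q om (x *m h) = TW q om x *m conj h.
Proof.
move=> ao sh th bx; have [hh h1 h2] := sh; have [ho Po] := ao.
have [x1 x2 x3 x4 x5] := blkWP bx; have dx := blkW_D0 bx; have [hP PP _] := imm_G2 q.
have -> : TW q om (x *m h) = tau q (quatJ h (x + x^t*)) *m om.
  apply: TWE; rewrite /quatJ.
  have e1 : h *m x = 0 by rewrite -h2 -mulmxA x3 mulmx0.
  have e2 : x^t* *m h = 0 by rewrite -[LHS]adjK adjM adjK hh mulNmx e1 oppr0 adj0.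
  by rewrite adjM hh mulNmx mulmxDl mulmxDr e1 e2 add0r addr0.
rewrite (tau_quatJ sh th dx) /TW /quatJ mulmxBl -!mulmxA.
have PtP := G2_tangent_PXP (imm_G2 q) (tangent_G2 (tau_D0 dx).1).
have -> : h *m (tau q (x + x^t*) *m om) = 0.
  by rewrite -h2 -Po !mulmxA -(mulmxA h) -(mulmxA h) PtP mulmx0 mul0mx.
rewrite subr0 (conj_skew hh) mulmxN; have := alt_form_trace (imm_G2 q) ao h1 h2.
by rewrite th scale0r => /eqP; rewrite addr_eq0 => /eqP ->; rewrite mulmxN.
Qed.

(** [g] is a complex combination of two skew endomorphisms; their traceless parts are covered by
    [TW_quat], the multiples of ['i P] by [TWi]. *)
Lemma TW_mul q om x g : alt_form (imm q) om -> imm q *m g = g -> g *m imm q = g -> blkW q x ->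
  TW q om (x *m g) = TW q om x *m conj g.
Proof.
move=> ao g1 g2 bx; have [hP PP _] := imm_G2 q; have [ho Po] := ao.
have oP := alt_form_PT hP ao.
have [x1 x2 x3 x4 x5] := blkWP bx.
have bxg h : h *m imm q = h -> blkW q (x *m h) by move=> h2; rewrite /blkW -!mulmxA h2 mulmxA x1.
have sk0 h : skewP (imm q) h -> TW q om (x *m h) = TW q om x *m conj h.
  move=> sh; have [h0 [d [sh0 th0 ->]]] := skewP_split sh.
  have [_ _ h02] := sh0.
  have b0 := bxg _ h02.
  have bi : blkW q ('i%C *: x) by rewrite /blkW -scalemxAr -scalemxAl bx.
  have bd : blkW q (d%:C *: ('i%C *: x)) by rewrite /blkW -!scalemxAr -!scalemxAl bx.
  have -> : x *m (h0 + d%:C *: ('i%C *: imm q)) = x *m h0 + d%:C *: ('i%C *: x).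
    by rewrite mulmxDr -!scalemxAr x2.
  rewrite (TWD om b0 bd) (TW_quat ao sh0 th0 bx) (TWZ om d bi) (TWi ao bx).
  have TZ (z : R[i]) (Y : cmat R m) : (z *: Y)^T = z *: Y^T by rewrite linearZ.
  rewrite adjD !adjZ hP conjc_real conjc_im linearD/= mulmxDr; congr (_ + _).
  rewrite !TZ -!scalemxAr; congr (_ *: (_ *: _)).
  by rewrite /TW -mulmxA oP.
pose h1 := 2^-1 *: (g - g^t*); pose h2 := (- 'i%C / 2) *: (g + g^t*).
have r2 : (2^-1 : R[i])^*%C = 2^-1 by rewrite -(rmorph_nat (real_complex R)) -fmorphV conjc_real.
have i2 : (- 'i%C / 2 : R[i])^*%C = - (- 'i%C / 2).
  have -> : (2 : R[i])^-1 = (2^-1)%:C by rewrite fmorphV rmorph_nat.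
  by apply/eqP; rewrite eq_complex/=; apply/andP; split; apply/eqP; ring.
have ga1 : imm q *m g^t* = g^t* by rewrite -[in LHS]hP -adjM g2.
have ga2 : g^t* *m imm q = g^t* by rewrite -[in LHS]hP -adjM g1.
have s1 : skewP (imm q) h1.
  split; first by rewrite adjZ adjB adjK r2 -scalerN opprB.
    by rewrite -scalemxAr mulmxBr g1 ga1.
  by rewrite -scalemxAl mulmxBl g2 ga2.
have s2 : skewP (imm q) h2.
  split; first by rewrite adjZ adjD adjK i2 scaleNr addrC.
    by rewrite -scalemxAr mulmxDr g1 ga1.
  by rewrite -scalemxAl mulmxDl g2 ga2.
have eg : g = h1 + 'i%C *: h2.
  have -> : 'i%C *: h2 = 2^-1 *: (g + g^t*).
    rewrite /h2 scalerA; congr (_ *: _); have -> : (2 : R[i])^-1 = (2^-1)%:C by rewrite fmorphV rmorph_nat.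
    by apply/eqP; rewrite eq_complex/=; apply/andP; split; apply/eqP; ring.
  rewrite /h1; move: (g^t*) => g'; have ok : nc_ok [:: g; g'] [::] by [].
  by nc ok; field.
have TZ (z : R[i]) (Y : cmat R m) : (z *: Y)^T = z *: Y^T by rewrite linearZ.
move: h1 h2 s1 s2 eg => h1 h2 s1 s2 eg; rewrite eg mulmxDr -scalemxAr.
have b1 := bxg h1 (let: And3 _ _ e := s1 in e).
have b2 := bxg h2 (let: And3 _ _ e := s2 in e).
have bi2 : blkW q ('i%C *: (x *m h2)) by rewrite /blkW -scalemxAr -scalemxAl b2.
rewrite (TWD om b1 bi2) (TWi ao b2) (sk0 _ s1) (sk0 _ s2) adjD adjZ conjc_im linearD/= TZ mulmxDr.
by rewrite -scalemxAr.
Qed.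

Definition omW q om := 2^-1 *: \sum_i \sum_j TW q om (Wp q *m delta_mx i j *m imm q) *m delta_mx j i.

Lemma blkW_proj q Y : blkW q (Wp q *m Y *m imm q).
Proof.
have [[_ _ _ _ w5] _] := WpP q; have [_ PP _] := imm_G2 q.
by rewrite /blkW -!mulmxA PP !mulmxA w5.
Qed.

Lemma blkW_sum q (I : finType) (f : I -> cmat R m) : (forall i, blkW q (f i)) -> blkW q (\sum_i f i).
Proof. by move=> bf; rewrite /blkW mulmx_sumr mulmx_suml; apply: eq_bigr => i _; exact: bf. Qed.

Lemma TW_sum q om (I : finType) (f : I -> cmat R m) : (forall i, blkW q (f i)) ->
  TW q om (\sum_i f i) = \sum_i TW q om (f i).
Proof.
move=> bf; suff : blkW q (\sum_i f i) /\ TW q om (\sum_i f i) = \sum_i TW q om (f i) by case.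
elim/big_rec2: _ => [|i y x _ [b1 <-]].
  have b0 : blkW q 0 by rewrite /blkW mulmx0 mul0mx.
  split=> //; have := TWZ om 0 b0.
  by rewrite rmorph0 !scale0r.
split; first by have := blkWD 1 (bf i) b1; rewrite scale1r.
by rewrite TWD.
Qed.

(* [sum_ij E_ij P E_ji = (tr P) 1 = 2] on the plane, and [TW] is conjugate-linear
   over the endomorphisms of the plane. *)
Lemma omWE q om x : alt_form (imm q) om -> blkW q x -> omW q om *m conj x = TW q om x.
Proof.
move=> ao bx; have [x1 x2 x3 x4 x5] := blkWP bx; have gP := imm_G2 q; have [hP PP _] := gP.
have oP := alt_form_PT hP ao.
pose y i j := Wp q *m delta_mx i j *m imm q *m (imm q *m delta_mx j i *m x).
have cM (X Y : cmat R m) : conj (X *m Y) = conj X *m conj Y by rewrite adjM trmx_mul.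
have cE i j : conj (delta_mx i j : cmat R m) = delta_mx i j by rewrite adj_delta trmx_delta.
have E i j : TW q om (Wp q *m delta_mx i j *m imm q) *m delta_mx j i *m conj x = TW q om (y i j).
  rewrite (TW_mul ao _ _ (blkW_proj q (delta_mx i j))); last 2 first.
  - by rewrite !mulmxA PP.
  - by rewrite -mulmxA x2.
  have cP : conj (imm q) = (imm q)^T by rewrite hP.
  have TP Y : TW q om Y *m (imm q)^T = TW q om Y by rewrite /TW -mulmxA oP.
  by rewrite !cM cE cP !mulmxA TP.
have byj i j : blkW q (y i j).
  have [[_ _ _ _ w5] _] := WpP q.
  by rewrite /blkW /y -!mulmxA x2 !mulmxA w5.
rewrite /omW -scalemxAl mulmx_suml; under eq_bigr => i _ do rewrite mulmx_suml.
under eq_bigr => i _ do under eq_bigr => j _ do rewrite E.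
under eq_bigr => i _ do rewrite -(TW_sum om (byj i)).
rewrite -TW_sum; last by move=> i; apply: blkW_sum.
have -> : \sum_i \sum_j y i j = 2%:C *: x.
  have e2 i j : y i j = imm q j j *: (Wp q *m delta_mx i i *m x).
    rewrite /y !mulmxA -(mulmxA _ (imm q) (imm q)) PP.
    have -> : Wp q *m delta_mx i j *m imm q *m delta_mx j i = Wp q *m (delta_mx i j *m imm q *m delta_mx j i).
      by rewrite !mulmxA.
    have -> : delta_mx i j *m imm q *m delta_mx j i = imm q j j *: delta_mx i i.
      apply/matrixP => u v; rewrite !mxE (bigD1 j)//= big1 => [|l lj].
        rewrite addr0 !mxE eqxx (bigD1 j)//= big1 => [|l' lj'].
          by rewrite !mxE eqxx addr0 andbT /=; case: (u == i); case: (v == i); rewrite ?(mul1r, mulr1, mul0r, mulr0).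
        by rewrite !mxE (negPf lj') andbF mul0r.
      by rewrite !mxE (negPf lj) mulr0.
    by rewrite -scalemxAr -scalemxAl.
  under eq_bigr => i _ do under eq_bigr => j _ do rewrite e2.
  under eq_bigr => i _ do rewrite -scaler_suml.
  have -> : \sum_j imm q j j = 2%:R by exact: G2_trace gP.
  rewrite -scaler_sumr -mulmx_suml -mulmx_sumr.
  have -> : \sum_i delta_mx i i = 1%:M :> cmat R m.
    apply/matrixP => u v; rewrite summxE !mxE (bigD1 u)//= big1 => [|l lu].
      by rewrite addr0 !mxE eqxx eq_sym.
    by rewrite !mxE eq_sym (negPf lu).
  by rewrite mulmx1 x1 rmorph_nat.
rewrite (TWZ om 2 bx) scalerA rmorph_nat mulVf ?scale1r// pnatr_eq0.
Qed.

End Focal.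

(** * Differentials of the focal map on the summands of the tangent space *)

Section Focal_algebra.
Context {R : realType} {m : nat}.
Implicit Types (P b n V w : cmat R m) (C S B : R[i]).

Lemma sqr_compl (x y : R) : x ^+ 2 + y ^+ 2 = 1 -> y%:C ^+ 2 = 1 - x%:C ^+ 2 :> R[i].
Proof. by move=> h; apply: (canRL (addrK _)); rewrite -!rmorphXn -rmorphD addrC h rmorph1. Qed.

Lemma conjcN_real (x : R) : (- x%:C)^*%C = - x%:C :> R[i].
Proof. by rewrite -(rmorphN (real_complex R)) conjc_real. Qed.

Lemma mul_real2 (x y z : R) : x * y = 2 * z -> x%:C * y%:C = 2 * z%:C :> R[i].
Proof. by move=> h; rewrite -rmorphM h rmorphM rmorph_nat. Qed.

(* [refl] conjugates a tube to its focal submanifold: [focal_d] and [normal_d] are the differentials of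
   [P |-> refl P refl] and [n |-> refl n refl] in the direction [V], where [w] is the derivative of [n]. *)
Definition refl C S P n := C *: (P + P - n *m n) + S *: n + (1%:M - n *m n).
Definition focal_d C S n V w := C ^+ 2 *: V + (C * S) *: w + S ^+ 2 *: (w *m n + n *m w - V).
Definition normal_d C S n V w :=
  (S ^+ 2 - C ^+ 2) *: w + (2 * C * S) *: (V + V - w *m n - n *m w).

Lemma focal_dD C S n V V' w w' :
  focal_d C S n (V + V') (w + w') = focal_d C S n V w + focal_d C S n V' w'.
Proof. by have ok : nc_ok [:: n; V; V'; w; w'] [::] by []; rewrite /focal_d; nc ok; ring. Qed.

Lemma normal_dD C S n V V' w w' :
  normal_d C S n (V + V') (w + w') = normal_d C S n V w + normal_d C S n V' w'.
Proof. by have ok : nc_ok [:: n; V; V'; w; w'] [::] by []; rewrite /normal_d; nc ok; ring. Qed.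

Lemma focal_dZ C S n d V w : focal_d C S n (d *: V) (d *: w) = d *: focal_d C S n V w.
Proof. by have ok : nc_ok [:: n; V; w] [::] by []; rewrite /focal_d; nc ok; ring. Qed.

Lemma normal_dZ C S n d V w : normal_d C S n (d *: V) (d *: w) = d *: normal_d C S n V w.
Proof. by have ok : nc_ok [:: n; V; w] [::] by []; rewrite /normal_d; nc ok; ring. Qed.

Section Cases.
Context (P b b' g : cmat R m) (C S : R[i]).
Context (ok0 : nc_ok [:: P; b; b'; g] ((2, 1, NRlet 0) :: nc_gen [:: 0] [:: (0, 0); (1, 0); (0, 1); (0, 0)]
  [:: (0, 0); (1, 0); (0, 1); (0, 0)] 0)%N) (S2 : S ^+ 2 = 1 - C ^+ 2).
Local Notation n := (b + b').
Local Notation E := (refl C S P n).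

(** For the [xi_nu]: the condition on [B] is [beta = 2 cot 2r], with [C] and [S] the cosine and sine
    of [2r]. *)
Lemma focal_Z B : B * S = 2 * C -> let Z := Zfield n g in let w := - B *: Z in
  focal_d C S n Z w = E *m Z *m E /\ normal_d C S n Z w = E *m w *m E.
Proof.
move=> BS; nc_have ok ok0; rewrite /= /focal_d /normal_d /refl /Zfield.
by split; nc ok; ring: BS S2.
Qed.

Lemma focal_Y : let Y := n *m g + g *m n in let w := II P Y n in
  focal_d C S n Y w = E *m - Y *m E /\ normal_d C S n Y w = E *m II P (- Y) n *m E.
Proof.
nc_have ok ok0; rewrite /= /focal_d /normal_d /refl !IIE.
by split; nc ok; ring: S2.
Qed.

(** For the Reeb direction: the condition on [B] is [alpha = - 2 tan 2r]. The sign of [Z] is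
    reversed because the conjugation sends ['i] to [- 'i]. *)
Lemma focal_xi B : B * C = - (2 * S) -> let Z := Zfield n g in let w := - B *: Z in
  focal_d C S n Z w = E *m - Z *m E /\ normal_d C S n Z w = E *m (- B *: - Z) *m E.
Proof.
move=> BC; nc_have ok ok0; rewrite /= /focal_d /normal_d /refl /Zfield.
by split; nc ok; ring: BC S2.
Qed.

Lemma focal_D0 x x' y y' :
  nc_ok [:: P; b; b'; x; x'; y; y'] [:: (2, 1, NRlet 0), (2, 3, NRzero), (2, 5, NRzero), (4, 1, NRzero), (6, 1, NRzero) &
    nc_gen [:: 0] [:: (0, 0); (1, 0); (0, 1); (1, 0); (0, 1); (1, 0); (0, 1)]
      [:: (0, 0); (1, 0); (0, 1); (1, 0); (0, 1); (1, 0); (0, 1)] 0]%N ->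
  let V := x + x' in let v := y + y' in let w := - v + II P V n in let t := C *: V - S *: v in
  focal_d C S n V w = E *m t *m E /\
  normal_d C S n V w = E *m (- (- S *: V - C *: v) + II P t n) *m E.
Proof.
move=> ok0'; nc_have ok ok0'; rewrite /= /focal_d /normal_d /refl !IIE.
by split; nc ok; ring: S2.
Qed.

End Cases.
End Focal_algebra.

Section Focal_structure.
Context {R : realType} {m : nat} (M : hypersurface R m).
Context (N : M -> cmat R m) (hN : unit_normal N) (m_gt0 : (0 < m)%N).
Context (nabla : (M -> cmat R m) -> (M -> cmat R m) -> M -> cmat R m)
  (hnabla : levi_civita nabla) (hQ : forall p : M, distQ N p (reeb N p)).
Context (k : R) (k_neq0 : k != 0).
Local Notation a := (2 * k).
Context (Areeb : forall q, shape_op N q (reeb N q) = a%:C *: reeb N q).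
Context (c s : R) (cs1 : c ^+ 2 + s ^+ 2 = 1) (sk : s = - k * c).
Implicit Types (p q : M) (W : set M) (V H x y g om : cmat R m).
Local Notation beta := (- 4 / a).
Local Notation A := (shape_op N).
Local Notation conj g := ((g^t*)^T).
Local Notation tau := (tau N c s).
Local Notation Wp := (Wp N).
Local Notation blkW := (blkW N).
Local Notation TW := (TW N c s).
Local Notation omW := (omW N c s).

Lemma conjD (X Y : cmat R m) : conj (X + Y) = conj X + conj Y.
Proof. by rewrite adjD linearD. Qed.

Lemma conjZ z (X : cmat R m) : conj (z *: X) = z^*%C *: conj X.
Proof. by rewrite adjZ linearZ. Qed.

Lemma conjM (X Y : cmat R m) : conj (X *m Y) = conj X *m conj Y.
Proof. by rewrite adjM trmx_mul. Qed.

Lemma conjK (X : cmat R m) : conj (conj X) = X.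
Proof. by apply/matrixP => i j; rewrite !mxE conjCK. Qed.

Lemma conj_T (X : cmat R m) : conj (X^T) = X^t*.
Proof. by apply/matrixP => i j; rewrite !mxE. Qed.

Lemma conj_adj (X : cmat R m) : conj (X^t*) = X^T.
Proof. by rewrite adjK. Qed.

Lemma conj_anti (X : cmat R m) : X^T = - X -> X^t* = - conj X.
Proof.
by move/matrixP=> h; apply/matrixP => i j; have := h i j; rewrite !mxE => ->; rewrite rmorphN.
Qed.

Lemma tr_conj_swap (X Y F G : cmat R m) : G^T = - G ->
  \tr (F *m conj Y *m G *m X^t*) = - \tr (F^T *m conj X *m G *m Y^t*).
Proof.
move=> gT; rewrite -mxtrace_tr !trmx_mul gT trmxK mulNmx mulmxN linearN/= -!mulmxA; congr (- _).
by rewrite [in RHS]mxtrace_mulC !mulmxA.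
Qed.

Lemma mul_proj_eq0 q (G : cmat R m) : (forall Z, G *m Z *m imm q = 0) -> G = 0.
Proof.
move=> H; have gP := imm_G2 q; apply/matrixP => i j; rewrite mxE.
have [l Pl] : exists l, imm q l l != 0.
  apply/existsP; apply: contraT; rewrite negb_exists => /forallP P0.
  have := G2_trace gP; rewrite /mxtrace big1 => [/eqP|l _]; last by have := P0 l; rewrite negbK => /eqP.
  by rewrite eq_sym pnatr_eq0.
have /matrixP/(_ i l) := H (delta_mx j l); rewrite !mxE (bigD1 l)//= big1 => [|l' ll'].
  rewrite addr0 !mxE (bigD1 j)//= big1 => [|j' jj'].
    by rewrite addr0 !mxE !eqxx mulr1 => /eqP; rewrite mulf_eq0 (negPf Pl) orbF => /eqP.
  by rewrite !mxE (negPf jj') mulr0.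
rewrite !mxE big1 ?mul0r// => j' _; rewrite !mxE (negPf ll') andbF mulr0 //.
Qed.

(** The multiplication table of the pieces of [omQ]. [F], [n] stand for the plane and the normal,
    [o], [o'] for [om] and its adjoint, [t], [p] for the transposes of normal and plane, [X], [X']
    for [omX] and its adjoint, [V], [v] for [Wp] and its transpose. *)
Lemma focal_rules (F n o o' t p X X' V v : cmat R m) :
  F *m F = F -> F *m o = o -> o *m o' = F -> o *m p = o -> p *m o' = o' -> o *m t *m p = 0 ->
  o *m t *m o' = 0 -> o *m t *m t = o -> t *m (t *m o') = o' -> p *m (t *m o') = 0 -> X *m X' = V ->
  X *m o' = 0 -> X *m t = 0 -> X *m p = 0 -> t *m X' = 0 -> o *m X' = 0 -> F *m X = 0 -> o *m v = 0 ->
  t *m v = 0 -> X *m v = X -> n *m X = 0 -> o' *m F = o' ->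
  nc_ok [:: F; n; o; o'; t; p; X; X'; V; o *m t; t *m o'; v]
  [:: (0, 0, NRlet 0); (0, 2, NRlet 2); (2, 3, NRlet 0); (2, 5, NRlet 2); (5, 3, NRlet 3); (2, 4, NRlet 9);
      (4, 3, NRlet 10); (9, 5, NRzero); (9, 3, NRzero); (9, 4, NRlet 2); (4, 10, NRlet 3); (2, 10, NRzero);
      (5, 10, NRzero); (6, 7, NRlet 8); (6, 3, NRzero); (6, 4, NRzero); (6, 5, NRzero); (4, 7, NRzero);
      (2, 7, NRzero); (6, 10, NRzero); (9, 7, NRzero); (0, 6, NRzero); (2, 11, NRzero); (4, 11, NRzero);
      (6, 11, NRlet 6); (0, 9, NRlet 9); (9, 11, NRzero); (1, 6, NRzero); (9, 10, NRlet 0); (3, 0, NRlet 3);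
      (10, 0, NRlet 10)]%N.
Proof.
move=> h1 h2 h3 h4 h5 h6 h7 h8 h9 h10 h11 h12 h13 h14 h15 h16 h17 h18 h19 h20 h21 h22 /=.
do !split=> //.
- by rewrite mulmxA h7.
- by rewrite mulmxA h13 mul0mx.
- by rewrite -mulmxA h15 mulmx0.
- by rewrite mulmxA h2.
- by rewrite -mulmxA h19 mulmx0.
- by rewrite mulmxA h8 h3.
- by rewrite -mulmxA h22.
Qed.

Section At_point.
Context (q : M) (om : cmat R m) (ao : alt_form (imm q) om) (on : om *m om^t* = imm q).
Local Notation P := (imm q).
Local Notation n := (N q).
Local Notation Wq := (Wp q).

(** [omW] matters only on conjugates of vectors in the image of [Wp]; the factor [Wq^T] removes the
    rest. *)
Definition omX := omW q om *m Wq^T.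
Definition prime x := tau q (x + x^t*) *m P.

Let hP : P^t* = P. Proof. by have [] := imm_G2 q. Qed.
Let PP : P *m P = P. Proof. by have [] := imm_G2 q. Qed.
Let hW : Wq^t* = Wq. Proof. by have [_] := WpP hN hQ q. Qed.
Let hn : n^t* = n. Proof. by have [] := N_G2 hN q. Qed.
Let nW : n *m Wq = 0. Proof. by have [[]] := WpP hN hQ q. Qed.
Let Wn : Wq *m n = 0. Proof. by have [[]] := WpP hN hQ q. Qed.
Let PW : P *m Wq = 0. Proof. by have [[]] := WpP hN hQ q. Qed.
Let WP : Wq *m P = 0. Proof. by have [[]] := WpP hN hQ q. Qed.
Let WW : Wq *m Wq = Wq. Proof. by have [[]] := WpP hN hQ q. Qed.
Let Pn : P *m n *m P = 0. Proof. exact: G2_tangent_PXP (imm_G2 q) (N_G2 hN q). Qed.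
Let oP : om *m P^T = om. Proof. exact: alt_form_PT hP ao. Qed.
Let Po : P *m om = om. Proof. by have [] := ao. Qed.
Let ho : om^T = - om. Proof. by have [] := ao. Qed.
Let coP : conj om *m P = conj om. Proof. have PT : conj P^T = P by rewrite conj_T. by rewrite -[X in _ *m X = _]PT -conjM oP. Qed.
Let om_adj : om^t* = - conj om.
Proof. exact: conj_anti. Qed.
Let hnn : n *m n *m P = P.
Proof. by have [[_ _ _ _ _]] := WpP hN hQ q; have := WP; rewrite /Wp mulmxBl mul1mx => /eqP; rewrite subr_eq0 => /eqP. Qed.

Lemma D0_prime x : blkW q x -> [/\ blkW q (prime x), tau q (x + x^t*) = prime x + (prime x)^t* & prime (prime x) = x].
Proof.
move=> bx; have dx := blkW_D0 hN m_gt0 hQ bx; have dt := tau_D0 hN m_gt0 hnabla hQ k_neq0 Areeb sk dx.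
have [bt et] := D0_blkW hN hQ dt; have [x1 x2 x3 x4 x5] := blkWP hN hQ bx; have tt := tau_tau hN m_gt0 hnabla hQ k_neq0 Areeb cs1 sk dx.
split; [exact: bt|exact: et|rewrite /prime -et tt mulmxDl x2].
have -> : x^t* *m P = 0 by rewrite -[in LHS]hP -adjM x3 adj0.
by rewrite addr0.
Qed.

Lemma omXE x : blkW q x -> omX *m conj x = prime x *m om.
Proof.
move=> bx; have [x1 x2 x3 x4 x5] := blkWP hN hQ bx.
have cW : Wq^T *m conj x = conj x by rewrite -{1}hW -/(conj Wq) -conjM x1.
rewrite /omX -mulmxA cW (omWE hN m_gt0 hnabla hQ k_neq0 Areeb sk ao bx).
by rewrite /TW /prime -(mulmxA _ P) Po.
Qed.

Lemma prime_omX x : blkW q x -> prime x = omX *m conj x *m om^t*.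
Proof.
move=> bx; rewrite (omXE bx) -(mulmxA (prime x)) on.
by have [bp _ _] := D0_prime bx; have [_ ->] := blkWP hN hQ bp.
Qed.

Lemma Wp_omX : Wq *m omX = omX /\ omX *m Wq^T = omX.
Proof.
split; last by rewrite /omX -mulmxA -trmx_mul WW.
rewrite /omX mulmxA; congr (_ *m _); rewrite /omW -scalemxAr; congr (_ *: _).
rewrite mulmx_sumr; apply: eq_bigr => i _.
rewrite mulmx_sumr; apply: eq_bigr => j _; rewrite mulmxA; congr (_ *m _).
have bx := blkW_proj hN hQ q (delta_mx i j).
have dt := tau_D0 hN m_gt0 hnabla hQ k_neq0 Areeb sk (blkW_D0 hN m_gt0 hQ bx).
have [bt _] := D0_blkW hN hQ dt; have [t1 _ _ _ _] := blkWP hN hQ bt.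
rewrite /TW -{1 2}Po !mulmxA; congr (_ *m _).
move: t1; move: (tau q _) => t t1.
by rewrite -mulmxA.
Qed.

Lemma re_tr_prime x y : blkW q x -> blkW q y ->
  complex.Re (\tr (prime x *m y^t*)) = complex.Re (\tr (prime y *m x^t*)).
Proof.
have key u v : blkW q u -> blkW q v -> gmet (u + u^t*) (v + v^t*) = complex.Re (\tr (u *m v^t*)) / 2.
  move=> bu bv; have [u1 u2 u3 u4 u5] := blkWP hN hQ bu; have [v1 v2 v3 v4 v5] := blkWP hN hQ bv.
  rewrite /gmet mulmxDl !mulmxDr.
  have -> : u *m v = 0 by rewrite -u2 -mulmxA v3 mulmx0.
  have -> : u^t* *m v^t* = 0 by rewrite -adjM -v2 -mulmxA u3 mulmx0 adj0.
  rewrite add0r addr0 linearD/= ReD.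
  have -> : \tr (u^t* *m v) = (\tr (u *m v^t*))^*%C by rewrite -tr_adj adjM adjK mxtrace_mulC.
  by rewrite ReJ; field.
move=> bx byy; have [bx' tx _] := D0_prime bx; have [by' ty _] := D0_prime byy.
have := tau_sym hN c s (blkW_D0 hN m_gt0 hQ bx).1 (blkW_D0 hN m_gt0 hQ byy).1.
move: (prime x) (prime y) bx' by' tx ty => x' y' bx' by' -> ->.
rewrite (key x' y bx' byy) (gmetC (x + x^t*)) (key y' x by' bx).
by move/(mulIf _); apply; rewrite invr_eq0 pnatr_eq0.
Qed.

(** [prime] is antilinear, so the real identity for ['i x] in place of [x] compares the imaginary
    parts. *)
Lemma tr_prime x y : blkW q x -> blkW q y -> \tr (prime x *m y^t*) = \tr (prime y *m x^t*).
Proof.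
move=> bx byy; have bi : blkW q ('i%C *: x) by rewrite /blkW -scalemxAr -scalemxAl bx.
have r1 := re_tr_prime bx byy; have r2 := re_tr_prime bi byy.
have pi' : prime ('i%C *: x) = - 'i%C *: prime x.
  rewrite !prime_omX// adjZ conjc_im.
  have -> : (- 'i%C *: x^t*)^T = - 'i%C *: conj x by rewrite linearZ.
  by rewrite -scalemxAr -scalemxAl.
move: r2; rewrite pi'; clear pi'; move: (prime x) (prime y) r1 => x' y' r1.
rewrite -scalemxAl mxtraceZ adjZ conjc_im -scalemxAr mxtraceZ.
move: (\tr (x' *m _)) (\tr (y' *m _)) r1 => [a1 b1] [a2 b2]/= -> r2; congr (_ +i* _); move: r2.
by rewrite !(mulNr, oppr0, mul0r, sub0r, opprK, mul1r).
Qed.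

(** Symmetry of [tau] is antisymmetry of its matrix, the sign being that of [om^T = - om]. With
    [G = omX + omX^T] the trace identity, tested on a vector made from [G] itself, says that a norm
    vanishes. *)
Lemma omX_T : omX^T = - omX.
Proof.
have [w1 w2] := Wp_omX; pose G := omX + omX^T.
suff : G = 0 by rewrite /G => /eqP; rewrite addrC addr_eq0 => /eqP.
have w3 : Wq *m omX^T = omX^T by rewrite -[X in X *m _]trmxK -trmx_mul w2.
have WG : Wq *m G = G by rewrite /G mulmxDr w1 w3.
have GW : G *m Wq^T = G by rewrite /G mulmxDl w2 -trmx_mul w1.
apply: (@mul_proj_eq0 q) => Z.
have byy : blkW q (G *m Z *m P) by rewrite /blkW !mulmxA WG -(mulmxA _ P) PP.
pose x := conj (Wq^T *m (Z *m om)).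
have cx : conj x = Wq^T *m (Z *m om) by exact: conjK.
have bx : blkW q x.
  have WT : conj (Wq^T) = Wq by rewrite conj_T hW.
  rewrite /blkW /x conjM WT mulmxA WW -mulmxA; congr (_ *m _).
  by rewrite (conjM Z om) -mulmxA coP.
move: x cx bx => x cx bx.
have := tr_prime bx byy; rewrite (prime_omX bx) (prime_omX byy).
have e : om^t*^T = - om^t* by apply: oppr_inj; rewrite opprK; symmetry; exact: om_adj.
rewrite (tr_conj_swap x (G *m Z *m P) omX e).
move/eqP; rewrite -subr_eq0 opprK -linearD/= -!mulmxDl -/G cx => /eqP h.
apply: Re_tr_adj_eq0; rewrite -[RHS]/(complex.Re (0 : R[i])) -h; congr (complex.Re (\tr _)).
move: (_^t*) => Y; congr (_ *m _).
by rewrite (mulmxA G) GW -!mulmxA on.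
Qed.

(** This is [tau^2 = 1]. Applying [prime_omX] twice produces [omX] times its conjugate with a minus
    sign, and by antisymmetry minus the conjugate is the adjoint. *)
Lemma omX_unit : omX *m omX^t* = Wq.
Proof.
have [w1 w2] := Wp_omX.
have oad : omX^t* = - conj omX by exact: conj_anti omX_T.
have co : conj (om^t*) *m om^t* = - P.
  rewrite conj_adj; exact: etrans (congr1 (fun Y => Y *m om^t*) ho) (etrans (mulNmx _ _) (congr1 -%R on)).
have E x : blkW q x -> omX *m omX^t* *m x = x.
  move=> bx; have [bp _ pp] := D0_prime bx; have [x1 x2 _ _ _] := blkWP hN hQ bx.
  rewrite -{2}pp (prime_omX bp) (prime_omX bx) 2!conjM conjK.
  move: (conj omX) oad => co' ->; move: omX => F; by rewrite mulmxN mulNmx !mulmxA -(mulmxA _ _ (om^t*)) co mulmxN -!mulmxA x2.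
have z : Wq - omX *m omX^t* *m Wq = 0.
  apply: (@mul_proj_eq0 q) => Z; have bz := blkW_proj hN hQ q Z.
  have h := E _ bz; clear -h; move: h; move: (omX *m omX^t*) => F; move: Wq => W' h.
  rewrite mulmxBl mulmxBl; apply/eqP; rewrite subr_eq0; apply/eqP.
  by rewrite -{1}h !mulmxA.
have wa : omX^t* *m Wq = omX^t*.
  by move: omX w1 => X w1; rewrite -{2}w1 adjM hW.
have -> : omX *m omX^t* = omX *m omX^t* *m Wq by rewrite -mulmxA wa.
by apply/eqP; rewrite eq_sym -subr_eq0 z.
Qed.

(** The three terms are the form on the plane, its transport to the image of the plane under the
    normal, and the form that encodes [tau] on the remaining space. *)
Definition omQ := om + n *m om *m n^T + omX.

Lemma normal_sqE : n *m n = P + n *m P *m n.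
Proof.
have [b [b' [[en b1 b2 b3 b4] bb]]] := normal_blocks hN hQ q.
have ok0 : nc_ok [:: P; b; b'] ((2, 1, NRlet 0) :: nc_gen [:: 0] [:: (0, 0); (1, 0); (0, 1)]
      [:: (0, 0); (1, 0); (0, 1)] 0)%N by split=> //; apply: typed_ok => //=; do !split.
by nc_have ok ok0; rewrite en; nc ok; ring.
Qed.

Let nT_adj : (n^T)^t* = n^T.
Proof. by rewrite -{2}hn; apply/matrixP => i j; rewrite !mxE. Qed.
Let PnPT : P^T *m n^T *m P^T = 0.
Proof. by rewrite -mulmxA -!trmx_mul Pn trmx0. Qed.

Lemma omQ_rules : nc_ok [:: P; n; om; om^t*; n^T; P^T; omX; omX^t*; Wq; om *m n^T; n^T *m om^t*; Wq^T]
  [:: (0, 0, NRlet 0); (0, 2, NRlet 2); (2, 3, NRlet 0); (2, 5, NRlet 2); (5, 3, NRlet 3); (2, 4, NRlet 9);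
      (4, 3, NRlet 10); (9, 5, NRzero); (9, 3, NRzero); (9, 4, NRlet 2); (4, 10, NRlet 3); (2, 10, NRzero);
      (5, 10, NRzero); (6, 7, NRlet 8); (6, 3, NRzero); (6, 4, NRzero); (6, 5, NRzero); (4, 7, NRzero);
      (2, 7, NRzero); (6, 10, NRzero); (9, 7, NRzero); (0, 6, NRzero); (2, 11, NRzero); (4, 11, NRzero);
      (6, 11, NRlet 6); (0, 9, NRlet 9); (9, 11, NRzero); (1, 6, NRzero); (9, 10, NRlet 0); (3, 0, NRlet 3); (10, 0, NRlet 10)]%N.
Proof.
have [w1 w2] := Wp_omX; have PT : (P^T)^t* = P^T by rewrite -{2}hP; apply/matrixP => i j; rewrite !mxE.
have WT : (Wq^T)^t* = Wq^T by rewrite -{2}hW; apply/matrixP => i j; rewrite !mxE.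
have Po' : P^T *m om^t* = om^t* by rewrite -{1}PT -adjM oP.
have oP' : om^t* *m P = om^t* by rewrite -{1}hP -adjM Po.
have z1 : om *m n^T *m P^T = 0 by rewrite -oP -(mulmxA om) -mulmxA -mulmxA (mulmxA (P^T)) PnPT mulmx0.
have z2 : om *m n^T *m n^T = om by rewrite -{1}oP -mulmxA -mulmxA -!trmx_mul hnn.
have z3 : n^T *m (n^T *m om^t*) = om^t*.
  by have := congr1 (fun Y => Y^t*) z2; rewrite !adjM nT_adj.
have nW' : n^T *m Wq^T = 0 by rewrite -trmx_mul Wn trmx0.
have x4 : omX *m n^T = 0 by rewrite -w2 -mulmxA -trmx_mul nW trmx0 mulmx0.
have x5 : omX *m P^T = 0 by rewrite -w2 -mulmxA -trmx_mul PW trmx0 mulmx0.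
have x3 : omX *m om^t* = 0 by rewrite -Po' mulmxA x5 mul0mx.
have xx : om *m omX^t* = 0 by have := congr1 (fun Y => Y^t*) x3; rewrite adjM adjK adj0.
have nx : n^T *m omX^t* = 0 by have := congr1 (fun Y => Y^t*) x4; rewrite adjM nT_adj adj0.
have y3 : om *m n^T *m om^t* = 0 by rewrite -Po' mulmxA z1 mul0mx.
have xu := omX_unit.
have Px : P *m omX = 0 by rewrite -w1 mulmxA PW mul0mx.
have oW : om *m Wq^T = 0 by rewrite -oP -mulmxA -trmx_mul WP trmx0 mulmx0.
have nx' : n *m omX = 0 by rewrite -w1 mulmxA nW mul0mx.
have pu : P^T *m (n^T *m om^t*) = 0 by rewrite -{1}Po' mulmxA mulmxA PnPT mul0mx.
clear -PP Po on oP Po' z1 y3 z2 z3 pu xu x3 x4 x5 nx xx Px oW nW' w2 nx' oP'.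
exact: focal_rules.
Qed.

Lemma omQ_adj : omQ^t* = om^t* + n^T *m om^t* *m n + omX^t*.
Proof.
rewrite /omQ; move: omX => X; rewrite adjD adjD (adjM (n *m om)) (adjM n) nT_adj hn; congr (_ + _ + _).
by rewrite mulmxA.
Qed.

Lemma omQ_unit : omQ *m omQ^t* = 1%:M.
Proof.
have ok := omQ_rules; rewrite omQ_adj /omQ.
have -> : 1%:M = P + n *m P *m n + Wq by rewrite -normal_sqE /Wp addrC subrK.
move: (omX) (omX^t*) ok => X X' ok; move: (Wq) (om^t*) ok => W' om' ok.
by nc ok; ring.
Qed.

Lemma omQ_T : omQ^T = - omQ.
Proof.
have TD (X Y : cmat R m) : (X + Y)^T = X^T + Y^T by rewrite linearD.
rewrite /omQ !TD; move: omX omX_T => X ->; rewrite trmx_mul (trmx_mul n) trmxK ho; move: om => o.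
by rewrite !opprD mulNmx mulmxN mulmxA.
Qed.

Lemma omQ_PT : omQ *m P^T = om /\ P *m omQ = om.
Proof.
have ok := omQ_rules; rewrite /omQ; have E : P *m n *m om = 0 by rewrite -Po mulmxA Pn mul0mx.
move: (omX) (omX^t*) ok => X X' ok; move: (Wq) (om^t*) ok => W' om' ok.
split; first by nc ok; ring.
have -> : P *m (om + n *m om *m n^T + X) = om + P *m n *m om *m n^T by nc ok; ring.
by rewrite E mul0mx addr0.
Qed.

Lemma omQ_nT : omQ *m n^T = n *m omQ.
Proof.
have ok := omQ_rules; rewrite /omQ; have E : n *m n *m om = om by rewrite -Po mulmxA hnn.
move: (omX) (omX^t*) ok => X X' ok; move: (Wq) (om^t*) ok => W' om' ok.
have -> : n *m (om + n *m om *m n^T + X) = n *m om + n *m n *m om *m n^T by nc ok; ring.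
by rewrite E; nc ok; ring.
Qed.

Lemma omQ_WT : omQ *m Wq^T = omX.
Proof.
have ok := omQ_rules; rewrite /omQ.
move: (omX) (omX^t*) ok => X X' ok; move: (Wq^T) (om^t*) ok => W' om' ok.
by nc ok; ring.
Qed.

(** Conjugation of matrices by the antilinear map of [omQ]. It fixes [P], the normal and su(im P),
    reverses ['i], and is [tau] on [D0]. *)
Definition theta V := omQ *m conj V *m omQ^t*.

Lemma thetaM X Y : theta (X *m Y) = theta X *m theta Y.
Proof.
have u : omQ^t* *m omQ = 1%:M by apply: mulmx1C; exact: omQ_unit.
rewrite /theta conjM; move: (conj X) (conj Y) => X' Y'; move: (omQ) (omQ^t*) u => o o' u.
by rewrite !mulmxA -(mulmxA _ o' o) u mulmx1.
Qed.

Lemma thetaD X Y : theta (X + Y) = theta X + theta Y.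
Proof. by rewrite /theta conjD; move: (conj X) (conj Y) omQ (omQ^t*) => X' Y' o o'; rewrite mulmxDr mulmxDl. Qed.

Lemma thetaZ z X : theta (z *: X) = z^*%C *: theta X.
Proof. by rewrite /theta conjZ; move: (conj X) omQ (omQ^t*) => X' o o'; rewrite -scalemxAr -scalemxAl. Qed.

Lemma thetaB X Y : theta (X - Y) = theta X - theta Y.
Proof. by rewrite -scaleN1r thetaD thetaZ rmorphN rmorph1 scaleN1r. Qed.

Lemma thetaN X : theta (- X) = - theta X.
Proof. by rewrite -scaleN1r thetaZ rmorphN rmorph1 scaleN1r. Qed.

Lemma theta_adj X : theta (X^t*) = (theta X)^t*.
Proof.
rewrite /theta; have -> : conj (X^t*) = (conj X)^t* by apply/matrixP => i j; rewrite !mxE.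
by move: (conj X) omQ => Y o; rewrite adjM adjM adjK mulmxA.
Qed.

Lemma om_omQ : om *m omQ^t* = P.
Proof.
have [_ Pq] := omQ_PT; rewrite -{1}Pq; move: omQ omQ_unit => o ou.
by rewrite -mulmxA ou mulmx1.
Qed.

Lemma theta_P : theta P = P.
Proof. by rewrite /theta hP (proj1 omQ_PT) om_omQ. Qed.

Lemma theta_N : theta n = n.
Proof. by rewrite /theta hn omQ_nT -mulmxA omQ_unit mulmx1. Qed.

Lemma theta_skew g : skewP P g -> \tr g = 0 -> theta g = g.
Proof.
move=> [hg g1 g2] tg; have := alt_form_trace (imm_G2 q) ao g1 g2; rewrite tg scale0r => /eqP.
rewrite addr_eq0 => /eqP E; rewrite /theta (conj_skew hg).
have gT : g^T = P^T *m g^T by rewrite -trmx_mul g2.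
rewrite mulmxN gT mulmxA (proj1 omQ_PT).
have := om_omQ; move: omQ => o oo.
by rewrite -E -mulmxA oo g2.
Qed.

Lemma theta_D0 V : D0 N q V -> theta V = tau q V.
Proof.
move=> dV; have [bx eV] := D0_blkW hN hQ dV; move: (V *m P) bx eV => x bx eV.
have [bp tp _] := D0_prime bx; have [x1 x2 _ _ _] := blkWP hN hQ bx; have [p1 p2 _ _ _] := blkWP hN hQ bp.
have ex : theta x = prime x.
  have cW : Wq^T *m conj x = conj x by rewrite -{1}hW -/(conj Wq) -conjM x1.
  rewrite /theta -cW mulmxA omQ_WT (omXE bx) -mulmxA om_omQ; exact: p2.
by rewrite eV thetaD theta_adj ex tp.
Qed.

Local Notation E := (refl c%:C s%:C P n).
Let dN V := - A q V + II P V n.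
(** [dN V] is the derivative of the normal along [V]. The property is additive and real homogeneous,
    so it suffices to have it on the summands of [tangent_decomp]. *)
Let good V := focal_d c%:C s%:C n V (dN V) = E *m theta V *m E /\
  normal_d c%:C s%:C n V (dN V) = E *m theta (dN V) *m E.

Lemma theta_II X Y : theta (II P X Y) = II P (theta X) (theta Y).
Proof. by rewrite !IIE !(thetaB, thetaD, thetaM) theta_P. Qed.

Let S2 : s%:C ^+ 2 = 1 - c%:C ^+ 2 :> R[i]. Proof. exact: sqr_compl. Qed.

Let goodD V V' : tangent q V -> tangent q V' -> good V -> good V' -> good (V + V').
Proof.
move=> tV tV' [a1 a2] [b1 b2]; rewrite /good.
have -> : dN (V + V') = dN V + dN V'.
  rewrite /dN (shapeD hN tV tV') !IIE; move: (A q V) (A q V') => y y'.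
  have ok : nc_ok [:: P; n; V; V'; y; y'] [::] by [].
  by nc ok; ring.
move: (dN V) (dN V') a1 a2 b1 b2 => w w' a1 a2 b1 b2.
rewrite focal_dD normal_dD a1 a2 b1 b2 (thetaD V) (thetaD w).
move: (theta V) (theta V') (theta w) (theta w') E => x x' y y' e.
by split; rewrite mulmxDr mulmxDl.
Qed.

Let goodZr d V : tangent q V -> good V -> good (d%:C *: V).
Proof.
move=> tV [a1 a2]; rewrite /good.
have -> : dN (d%:C *: V) = d%:C *: dN V.
  rewrite /dN (shapeZ hN d tV) !IIE; move: (A q V) => y.
  have ok : nc_ok [:: P; n; V; y] [::] by [].
  by nc ok; ring.
move: (dN V) a1 a2 => w a1 a2.
rewrite focal_dZ normal_dZ a1 a2 !thetaZ conjc_real.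
move: (theta V) (theta w) E => x y e.
by split; rewrite -scalemxAr -scalemxAl.
Qed.

Let good_Z g : skewP P g -> \tr g = 0 -> good (Zfield n g).
Proof.
move=> sg tg; have [hg g1 g2] := sg.
have thZ : theta (Zfield n g) = Zfield n g by rewrite /Zfield thetaB !thetaM theta_N theta_skew.
have [b [b' [[en b1 b2 b3 b4] bb]]] := normal_blocks hN hQ q.
have ok0 := blocks_ok b1 b2 b3 b4 bb g1 g2.
have sb : s * beta = 2 * c by rewrite sk; field.
have E0 : dN (Zfield n g) = - (beta%:C *: Zfield n g).
  rewrite /dN (shape_Zfield hN m_gt0 hnabla hQ (a_neq0 k_neq0) Areeb sg tg) IIE -[RHS]addr0; congr (_ + _).
  by nc_have ok ok0; rewrite /Zfield en; nc ok; ring.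
rewrite /good E0 -scaleNr thetaZ thZ.
rewrite conjcN_real.
have BS : beta%:C * s%:C = 2 * c%:C :> R[i] by exact: mul_real2 (etrans (mulrC _ _) sb).
by rewrite en; exact: (focal_Z ok0 S2 BS).
Qed.

Let good_Y g : skewP P g -> \tr g = 0 -> good (n *m ('i%C *: g) + ('i%C *: g) *m n).
Proof.
move=> sg tg; have [hg g1 g2] := sg.
have thg : theta ('i%C *: g) = - ('i%C *: g) by rewrite thetaZ conjc_im theta_skew// scaleNr.
have [i1 i2 i3 i4] : [/\ ('i%C *: g)^t* = 'i%C *: g, P *m ('i%C *: g) = 'i%C *: g, ('i%C *: g) *m P = 'i%C *: g
    & \tr ('i%C *: g) = 0].
  by rewrite adjZ hg conjc_im scalerN scaleNr opprK -scalemxAr g1 -scalemxAl g2 mxtraceZ tg mulr0.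
move: ('i%C *: g) thg i1 i2 i3 i4 => h thh i1 i2 i3 i4.
have [b [b' [[en b1 b2 b3 b4] bb]]] := normal_blocks hN hQ q.
have ok0 := blocks_ok b1 b2 b3 b4 bb i2 i3.
have thY : theta (n *m h + h *m n) = - (n *m h + h *m n).
  by rewrite thetaD !thetaM theta_N thh mulmxN mulNmx opprD.
have E0 : dN (n *m h + h *m n) = II P (n *m h + h *m n) n.
  by rewrite /dN (shape_Ys hN m_gt0 hQ i1 i2 i3 i4).2 oppr0 add0r.
rewrite /good E0 theta_II thY theta_N en; exact: (focal_Y ok0 S2).
Qed.

Let good_xi : good (Zfield n ('i%C *: P)).
Proof.
have thZ : theta (Zfield n ('i%C *: P)) = - Zfield n ('i%C *: P).
  by rewrite /Zfield thetaB !thetaM thetaZ conjc_im theta_P theta_N !(mulmxN, mulNmx, scaleNr) opprB opprK addrC.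
have [sk1 sk2 sk3] := skewP_iP (M := M) q.
have [b [b' [[en b1 b2 b3 b4] bb]]] := normal_blocks hN hQ q.
have ok0 := blocks_ok b1 b2 b3 b4 bb sk2 sk3.
have sa : a * c = - (2 * s) by rewrite sk; ring.
have E0 : dN (Zfield n ('i%C *: P)) = - (a%:C *: Zfield n ('i%C *: P)).
  have Ar := Areeb q; rewrite reebE in Ar; rewrite /dN Ar IIE -[RHS]addr0; congr (_ + _).
  move: ('i%C *: P) ok0 => g ok0; nc_have ok ok0; by rewrite /Zfield en; nc ok; ring.
rewrite /good E0 -scaleNr thetaZ thZ.
rewrite conjcN_real.
have BC : a%:C * c%:C = - (2 * s%:C) :> R[i].
  by have := mul_real2 (etrans sa (esym (mulrN 2 s))); rewrite (rmorphN (real_complex R)) mulrN.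
by move: ('i%C *: P) ok0 => g ok0; rewrite en; exact: (focal_xi ok0 S2 BC).
Qed.

Let good_D0 V : D0 N q V -> good V.
Proof.
move=> dV; have dA := shape_D0 hN m_gt0 hnabla hQ (a_neq0 k_neq0) Areeb dV.
have [b [b' [[en b1 b2 b3 b4] bb]]] := normal_blocks hN hQ q.
have c0 : c != 0.
  by apply/eqP => c0; move: cs1 => /eqP; rewrite sk c0 mulr0 expr0n addr0 eq_sym oner_eq0.
have s0 : s != 0 by rewrite sk mulf_neq0// oppr_eq0.
(* Read off from [tau (tau V) = V] by cancelling [s]. *)
have tA : tau q (A q V) = - s%:C *: V - c%:C *: A q V.
  have h := tau_tau hN m_gt0 hnabla hQ k_neq0 Areeb cs1 sk dV.
  have e : A q (tau q V) = c%:C *: A q V - s%:C *: A q (A q V).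
    have tz z U : tangent q U -> tangent q (z%:C *: U).
      by move=> tU; have [] := tangent_lin z tU (tangent0 q); rewrite addr0.
    by rewrite /tau (shapeB hN (tz c _ dV.1) (tz s _ dA.1)) (shapeZ hN c dV.1) (shapeZ hN s dA.1).
  have sC : s%:C != 0 :> R[i] by rewrite (inj_eq (@complexI R)).
  apply: (scalerI sC); move: h; rewrite {1}/tau e /tau.
  move: (A q V) (A q (A q V)) (s%:C) (c%:C) S2 => y z S C S2' h.
  have -> : S *: (C *: y - S *: z) = C *: (C *: V - S *: y) - V by rewrite -[X in _ = _ - X]h subKr.
  have ok : nc_ok [:: V; y] [::] by [].
  by nc ok; ring: S2'.
have [bx eV] := D0_blkW hN hQ dV; have [bz eA] := D0_blkW hN hQ dA.
have [x1 x2 x3 x4 x5] := blkWP hN hQ bx; have [z1 z2 z3 z4 z5] := blkWP hN hQ bz.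
have thdN : theta (dN V) = - tau q (A q V) + II P (tau q V) n.
  by rewrite /dN thetaD thetaN theta_II theta_N (theta_D0 dV) (theta_D0 dA).
rewrite /good thdN (theta_D0 dV) tA /tau /dN.
move: (V *m P) (A q V *m P) bx x1 x2 x3 x4 x5 eV bz z1 z2 z3 z4 z5 eA => x y bx x1 x2 x3 x4 x5 eV bz z1 z2 z3 z4 z5 eA.
have Pb : P *m b = 0 by have /eqP := b1; rewrite mulmxBl mul1mx -subr_eq0 addrAC subrr add0r oppr_eq0 => /eqP.
have bP : b' *m P = 0 by have /eqP := b4; rewrite mulmxBr mulmx1 -subr_eq0 addrAC subrr add0r oppr_eq0 => /eqP.
have eb' : b' = P *m n by rewrite en mulmxDr Pb b3 add0r.
have eb : b = n *m P by rewrite en mulmxDl b2 bP addr0.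
have adj0' u : n *m u = 0 -> u^t* *m n = 0 by move=> h; rewrite -[in LHS]hn -adjM h adj0.
have lf u : P *m u = 0 -> (1%:M - P) *m u = u by move=> h; rewrite mulmxBl mul1mx h subr0.
have adP u : P *m u = 0 -> u^t* *m (1%:M - P) = u^t*.
  by move=> h; rewrite mulmxBr mulmx1 -[in X in _ - X]hP -adjM h adj0 subr0.
have adP' u : u *m P = u -> P *m u^t* = u^t* by move=> h; rewrite -[in LHS]hP -adjM h.
move: (A q V) eA => v eA; clear dA dV thdN tA; move: V eV => U eV.
have ok0 : nc_ok [:: P; b; b'; x; x^t*; y; y^t*] [:: (2, 1, NRlet 0), (2, 3, NRzero), (2, 5, NRzero), (4, 1, NRzero), (6, 1, NRzero) &
    nc_gen [:: 0] [:: (0, 0); (1, 0); (0, 1); (1, 0); (0, 1); (1, 0); (0, 1)]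
      [:: (0, 0); (1, 0); (0, 1); (1, 0); (0, 1); (1, 0); (0, 1)] 0]%N.
  split; first exact: bb.
  split; first by rewrite /= eb' -mulmxA x4 mulmx0.
  split; first by rewrite /= eb' -mulmxA z4 mulmx0.
  split; first by rewrite /= eb mulmxA adj0'// mul0mx.
  split; first by rewrite /= eb mulmxA adj0'// mul0mx.
  apply: typed_ok => //=; do !split => //; [exact: lf|exact: adP'|exact: adP|exact: lf|exact: adP'|exact: adP].
by rewrite en eA eV; exact: (focal_D0 S2 ok0).
Qed.

(** To first order the focal point and its normal move as if [(P, n)] were carried along by one
    fixed antiunitary map, [omQ] followed by the reflection [E]. Rigidity integrates this. *)
Lemma focal_theta V : tangent q V -> let w := dirM_mx q V N in
  focal_d c%:C s%:C n V w = E *m theta V *m E /\ normal_d c%:C s%:C n V w = E *m theta w *m E.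
Proof.
move=> tV w; have -> : w = dN V by exact: dirM_N hN _ _ tV.
suff : good V by [].
have [h [g [V0 [[h1 h2 h3 h4] sg d0 ->]]]] := tangent_decomp hN m_gt0 hQ tV.
have [g0 [d [sg0 tg0 ->]]] := skewP_split sg.
have tZ : forall g' : cmat R m, skewP P g' -> tangent q (Zfield n g').
  by move=> g' h'; exact: (Zfield_tangent hN m_gt0 h').
have ZD : Zfield n (g0 + d%:C *: ('i%C *: P)) = Zfield n g0 + d%:C *: Zfield n ('i%C *: P).
  move: ('i%C *: P) => u; have ok : nc_ok [:: n; g0; u] [::] by [].
  by rewrite /Zfield; nc ok; ring.
have hY : h = 'i%C *: (- 'i%C *: h) by rewrite scalerA mulrN -expr2 sqr_i opprK scale1r.
have sY : skewP P (- 'i%C *: h).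
  split; last by rewrite -scalemxAl h3.
    have ci : (- 'i%C : R[i])^*%C = 'i%C by apply/eqP; rewrite eq_complex /= !oppr0 opprK !eqxx.
    by rewrite adjZ h1 ci scaleNr opprK.
  by rewrite -scalemxAr h2.
have tY : \tr (- 'i%C *: h) = 0 by rewrite mxtraceZ h4 mulr0.
have gY := good_Y sY tY; rewrite -hY in gY.
have tYs := (shape_Ys hN m_gt0 hQ h1 h2 h3 h4).1.
have gd : good (d%:C *: Zfield n ('i%C *: P)) by exact: goodZr (tZ _ (skewP_iP q)) good_xi.
have td : tangent q (d%:C *: Zfield n ('i%C *: P)).
  by have [] := tangent_lin d (tZ _ (skewP_iP q)) (tangent0 q); rewrite addr0.
have tD U U' : tangent q U -> tangent q U' -> tangent q (U + U').
  by move=> tU tU'; have [t _] := tangent_lin 1 tU tU'; rewrite scale1r in t.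
have tZZ := tD _ _ (tZ _ sg0) td; have gZZ := goodD (tZ _ sg0) td (good_Z sg0 tg0) gd.
have tYZ := tD _ _ tYs tZZ; have gYZ := goodD tYs tZZ gY gZZ.
by rewrite ZD; exact: goodD tYZ d0.1 gYZ (good_D0 d0).
Qed.

End At_point.
End Focal_structure.

(** * Rigidity of the focal structure *)

Section Parallel_frame.
Context {R : realType} {m : nat} (M : hypersurface R m).
Context (N : M -> cmat R m) (hN : unit_normal N) (m_gt0 : (0 < m)%N) (hQ : forall p : M, distQ N p (reeb N p)).
Implicit Types (p q : M) (V H Z : cmat R m).
Context (W : set M) (oW : open W) (B : M -> cmat R m) (sB : smooth_field W B).
Context (BB : forall q, W q -> (B q)^t* *m B q = 1%:M).
Local Notation Y q V := ((B q)^t* *m dirM_mx q V B).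
Context (YP : forall q V, W q -> tangent q V -> Y q V *m imm q = imm q *m Y q V).
Context (YN : forall q V, W q -> tangent q V -> Y q V *m N q = N q *m Y q V).

Lemma parallel_skew q V : W q -> (Y q V)^t* = - Y q V.
Proof.
move=> Wq; have sJ : smooth_field W (fun q => (B q)^t*) by exact: smooth_field_J oW (smooth_field_T sB).
have := dirM_mxM V sJ sB Wq; rewrite (eq_on_dirM_mx V oW Wq BB) dirM_mx_cst.
have -> : dirM_mx q V (fun q => (B q)^t*) = (dirM_mx q V B)^t*.
  have d0 := smooth_field_diff0 sB Wq.
  by rewrite /dirM_mx -(derive_mx_adj _ d0).
by move/esym/eqP; rewrite addr_eq0 adjM adjK => /eqP.
Qed.

(** The identity [[Y(v), P] = 0] is differentiated along [w] and antisymmetrized. By symmetry of the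
    second derivatives of [B] the derivatives of [Y] leave a commutator of values of [Y], which
    commutes with [P] and drops out. *)
Lemma parallel_closed q V V' : W q -> tangent q V -> tangent q V' ->
  Y q V *m V' - V' *m Y q V = Y q V' *m V - V *m Y q V'.
Proof.
move=> Wq [v ev] [w ew].
have [q0 eq0] := dom_center q.
pose U := dom q `&` chart q @^-1` W.
have oU : open U := open_dom_chart q oW.
have U0 : U 0 by split=> //=; rewrite eq0.
pose b := B \o chart q; pose P := @imm _ _ M \o chart q.
have sb : smooth_mx U b by exact: sB.
have sP : smooth_mx U P by apply: smooth_mx_sub (Phi_smooth q) => u [].
pose bs u := (b u)^t*; have sbs : smooth_mx U bs by exact: smooth_mxJ oU (smooth_mxT sb).
pose y v u := bs u *m derive_mx b u v.
have syv v' : smooth_mx U (y v') by apply: smooth_mxM => //; exact: smooth_mx_derive.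
have cm v' u : U u -> y v' u *m P u = P u *m y v' u.
  move=> [du Wu]; have := YP Wu (tangent_chart v' du).
  by rewrite (dirM_mx_chartE v' sB du Wu).
have df (F : _ -> cmat R m) : smooth_mx U F -> diff_mx F 0 by move=> sF; exact: smooth_mx_diff sF U0.
have key v' w' : derive_mx (y v') 0 w' *m P 0 + y v' 0 *m derive_mx P 0 w' =
    derive_mx P 0 w' *m y v' 0 + P 0 *m derive_mx (y v') 0 w'.
  rewrite -(derive_mxM w' (df _ (syv v')) (df _ sP)) -(derive_mxM w' (df _ sP) (df _ (syv v'))).
  exact: eq_on_derive_mx oU (cm v') U0.
have Ey v' V0 : V0 = derive_mx P 0 v' -> Y q V0 = y v' 0.
  move=> ->; rewrite /y /bs /b /= eq0; congr (_ *m _).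
  by have := dirM_mx_chartE v' sB q0; rewrite eq0 => /(_ Wq).
have sk v' V0 : V0 = derive_mx P 0 v' -> (derive_mx b 0 v')^t* = - y v' 0 *m bs 0.
  move=> e; rewrite -(Ey _ _ e) -[- _](parallel_skew V0 Wq) (Ey _ _ e) /y adjM adjK.
  rewrite -mulmxA; have -> : b 0 *m bs 0 = 1%:M by apply: mulmx1C; rewrite /bs /b /= eq0 BB.
  by rewrite mulmx1.
have dy v' w' : derive_mx (y v') 0 w' = - y w' 0 *m y v' 0 +
    bs 0 *m derive_mx (fun u => derive_mx b u v') 0 w'.
  rewrite (derive_mxM w' (df _ sbs) (df _ (smooth_mx_derive v' sb))) derive_mx_adj; last exact: df.
  by rewrite (sk w' _ erefl) -mulmxA.
rewrite (Ey _ _ ev) (Ey _ _ ew) ev ew -/P.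
have k1 := key v w; have k2 := key w v; have d1 := dy v w; have d2 := dy w v.
have sy := derive_mx_symmetric v w oU U0 sb; rewrite sy in d2.
have c1 := cm v _ U0; have c2 := cm w _ U0.
move: (derive_mx (y v) 0 w) (derive_mx (y w) 0 v) d1 d2 k1 k2 => D1 D2 d1 d2 k1 k2.
move: (bs 0 *m _) (y v 0) (y w 0) (P 0) (derive_mx P 0 v) (derive_mx P 0 w) c1 c2 d1 d2 k1 k2 =>
  s y1 y2 P0 x1 x2 c1 c2 d1 d2 k1 k2; rewrite d1 in k1; rewrite d2 in k2.
have e1 : - y2 *m y1 *m P0 = P0 *m (- y2 *m y1) by rewrite -mulmxA c1 mulmxA !mulNmx c2 mulmxN !mulmxA.
have e2 : - y1 *m y2 *m P0 = P0 *m (- y1 *m y2) by rewrite -mulmxA c2 mulmxA !mulNmx c1 mulmxN !mulmxA.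
move: k1 k2; rewrite !mulmxDl !mulmxDr e1 e2.
move: (P0 *m (- y2 *m y1)) (P0 *m (- y1 *m y2)) (s *m P0) (P0 *m s) => t1 t2 t3 t4.
move: (y1 *m x2) (x2 *m y1) (y2 *m x1) (x1 *m y2) => a1 a2 a3 a4 k1 k2.
have l t a b' : t + t3 + a = b' + (t + t4) -> a - b' = t4 - t3.
  move=> h; have -> : a = b' + (t + t4) - (t + t3) by rewrite -h addrAC subrr add0r.
  have ok : nc_ok [:: b'; t; t3; t4] [::] by [].
  by nc ok; ring.
by rewrite (l _ _ _ k1) (l _ _ _ k2).
Qed.

Lemma parallel_tangent q V V' : W q -> tangent q V -> tangent q V' ->
  tangent q (Y q V *m V' - V' *m Y q V).
Proof.
move=> Wq tV tV'; have yP := YP Wq tV; have yN := YN Wq tV; have sk := parallel_skew V Wq.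
have [hV' eV'] := tangent_G2 tV'; have /(tangentP hN m_gt0) [_ nV'] := tV'.
move: (Y q V) yP yN sk => y yP yN sk; apply/(tangentP hN m_gt0); split; first split.
- by rewrite adjB !adjM hV' sk mulNmx mulmxN opprK addrC.
- have -> : imm q *m (y *m V' - V' *m y) + (y *m V' - V' *m y) *m imm q =
    y *m (imm q *m V' + V' *m imm q) - (imm q *m V' + V' *m imm q) *m y; last by rewrite eV'.
  rewrite mulmxBr mulmxBl !mulmxDr !mulmxDl !mulmxA -yP -(mulmxA V' y) yP !mulmxA.
  rewrite opprD addrACA; congr (_ + _).
- have := nV'; rewrite /gmet mulmxBr !linearB/=.
  have -> : \tr (N q *m (y *m V')) = \tr (N q *m (V' *m y)); last by rewrite subrr mul0r.
  have e1 : \tr (N q *m (y *m V')) = \tr (y *m N q *m V') by rewrite mulmxA yN.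
  have e2 : \tr (N q *m (V' *m y)) = \tr (y *m (N q *m V')) by rewrite mulmxA mxtrace_mulC.
  by rewrite e1 e2 mulmxA.
Qed.

(** The product of [[Y(V), V']] with [V''] is symmetric in the first two arguments by
    [parallel_closed] and skew in the last two by cyclicity of the trace. The bracket is itself
    tangent, so it vanishes. *)
Lemma parallel_comm q V V' : W q -> tangent q V -> tangent q V' -> Y q V *m V' = V' *m Y q V.
Proof.
move=> Wq tV tV'; apply/eqP; rewrite -subr_eq0; apply/eqP.
apply: (tangent_eq0 (parallel_tangent Wq tV tV')) => V'' tV''.
pose f V1 V2 V3 := gmet (Y q V1 *m V2 - V2 *m Y q V1) V3.
have f1 V1 V2 V3 : tangent q V1 -> tangent q V2 -> tangent q V3 -> f V1 V2 V3 = f V2 V1 V3.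
  by move=> t1 t2 t3; rewrite /f (parallel_closed Wq t1 t2).
have f2 V1 V2 V3 : tangent q V1 -> tangent q V2 -> tangent q V3 -> f V1 V2 V3 = - f V1 V3 V2.
  move=> t1 t2 t3; rewrite /f; move: (Y q V1) => y; rewrite -gmetNl opprB /gmet.
  congr (complex.Re _ / _); rewrite !mulmxBl !linearB/=.
  have -> : \tr (y *m V2 *m V3) = \tr (V3 *m y *m V2) by rewrite -mulmxA mxtrace_mulC [RHS]mxtrace_mulC mulmxA.
  by congr (_ - _); rewrite -[in LHS]mulmxA [LHS]mxtrace_mulC.
exact: (sym_skew_eq0 f1 f2 tV tV' tV'').
Qed.

(** Being the image of tangent vectors and the normal, all off-diagonal blocks commute with [Y].
    Multiplied by the normal, which is isometric on the plane, they also yield the diagonal blocks,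
    so [Y] is central. *)
Lemma parallel_scalar q V H : W q -> tangent q V -> Y q V *m H = H *m Y q V.
Proof.
move=> Wq tV; have yP := YP Wq tV; have yN := YN Wq tV.
have yV V' (tV' : tangent q V') := parallel_comm Wq tV tV'.
have gP := imm_G2 q; have [hP PP _] := gP; have gn := N_G2 hN q.
move: (Y q V) yP yN yV => y yP yN yV {V tV}.
have yX X : G2_tangent (imm q) X -> y *m X = X *m y.
  move=> gX; have tX : tangent q (X - (gmet (N q) X)%:C *: N q).
    apply/(tangentP hN m_gt0); split; last by rewrite gmetBr gmetZr (N_unit hN) mulr1 subrr.
    case: gX gn => hX eX [hn en]; split; first by rewrite adjB adjZ conjc_real hX hn.
    by rewrite mulmxBr mulmxBl -scalemxAr -scalemxAl addrACA -opprD -scalerDr eX en.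
  have := yV _ tX; rewrite mulmxBr mulmxBl -scalemxAr -scalemxAl yN => /eqP.
  by rewrite subr_eq subrK => /eqP.
have yQ z : imm q *m z = 0 -> z *m imm q = z -> y *m z = z *m y.
  move=> z1 z2.
  have z3 : z^t* *m imm q = 0 by rewrite -[in LHS]hP -adjM z1 adj0.
  have z4 : imm q *m z^t* = z^t* by rewrite -[in LHS]hP -adjM z2.
  have gz : G2_tangent (imm q) (z + z^t*).
    by split; [rewrite adjD adjK addrC|rewrite mulmxDr mulmxDl z1 z2 z3 z4 add0r addr0 addrC].
  have := congr1 (fun F => F *m imm q) (yX _ gz); rewrite -!mulmxA yP !mulmxA.
  by rewrite -(mulmxA y) mulmxDl z2 z3 addr0.
have PQ F : imm q *m ((1%:M - imm q) *m F *m imm q) = 0 by rewrite !mulmxA mulmxBr mulmx1 PP subrr !mul0mx.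
have QP F : (1%:M - imm q) *m F *m imm q *m imm q = (1%:M - imm q) *m F *m imm q by rewrite -mulmxA PP.
have yZ Z : y *m (Z *m imm q) = Z *m imm q *m y.
  have nsq := normal_sq hN hQ q.
  have -> : Z *m imm q = (1%:M - imm q) *m Z *m imm q +
      imm q *m N q *m ((1%:M - imm q) *m (N q *m imm q *m Z) *m imm q).
    have PNP := G2_tangent_PXP gP gn.
    have -> : imm q *m N q *m ((1%:M - imm q) *m (N q *m imm q *m Z) *m imm q) =
      imm q *m N q *m N q *m imm q *m Z *m imm q - imm q *m N q *m imm q *m N q *m imm q *m Z *m imm q.
      by rewrite mulmxBl mul1mx mulmxBl mulmxBr !mulmxA.
    by rewrite nsq PNP !mul0mx subr0 PP mulmxBl mul1mx mulmxBl subrK.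
  have c1 := yQ _ (PQ Z) (QP Z); have c2 := yQ _ (PQ (N q *m imm q *m Z)) (QP _).
  move: ((1%:M - imm q) *m Z *m imm q) ((1%:M - imm q) *m (N q *m imm q *m Z) *m imm q) c1 c2 => F1 F2 c1 c2.
  rewrite mulmxDr mulmxDl c1; congr (_ + _).
  by rewrite -[in RHS]mulmxA -c2 !mulmxA yP -(mulmxA _ y) yN !mulmxA.
apply/eqP; rewrite -subr_eq0; apply/eqP; apply: (@mul_proj_eq0 _ _ _ q) => Z.
have h1 := yZ (H *m Z); have h2 := yZ Z; rewrite mulmxBl mulmxBl.
have -> : y *m H *m Z *m imm q = H *m Z *m imm q *m y by rewrite -h1 !mulmxA.
have -> : H *m y *m Z *m imm q = H *m (y *m (Z *m imm q)) by rewrite !mulmxA.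
by rewrite h2 !mulmxA subrr.
Qed.

(** [Y] may be an imaginary scalar, so [B] can change by a phase; conjugation by [B] does not see
    it. The neighbourhood is the image of a ball, so that segments from the centre stay inside. *)
Lemma parallel_constant p : W p -> exists W', [/\ open W', W' p, W' `<=` W &
  forall q H, W' q -> B q *m H *m (B q)^t* = B p *m H *m (B p)^t*].
Proof.
move=> Wp; have [p0 ep] := dom_center p; pose U := dom p `&` chart p @^-1` W.
have oU : open U := open_dom_chart p oW.
have U0 : U 0 by split=> //=; rewrite ep.
have [e e0 eU] : exists2 e : R, 0 < e & ball (0 : 'rV[R]_((4 * m).-1)) e `<=` U.
  by have /nbhs_ballP[e /= e0 he] := open_nbhs_nbhs (conj oU U0); exists e.
exists (chart p @` ball 0 e); split.
- by apply: chart_open; [exact: ball_open|move=> u /eU[]].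
- by exists 0 => //; exact: ballxx.
- by move=> q [u /eU[_ Wu] <-].
move=> _ H [u bu <-].
pose b := B \o chart p; pose bs x := (b x)^t*.
have sb : smooth_mx U b by exact: sB.
have sbs : smooth_mx U bs by exact: smooth_mxJ oU (smooth_mxT sb).
pose F x := b x *m H *m bs x.
have sF : smooth_mx U F by apply: smooth_mxM => //; apply: smooth_mxM => //; exact: smooth_mx_cst.
have Ut t : 0 <= t <= 1 -> U (0 + t *: u).
  move=> /andP[t0 t1]; apply: eU; rewrite add0r; move: bu; rewrite -!ball_normE/= !sub0r !normrN normrZ.
  by apply: le_lt_trans; rewrite ger0_norm// ler_piMl.
have dF x : U x -> derive_mx F x u = 0.
  move=> Ux; have [dx Wx] := Ux; have tx := tangent_chart u dx.
  have db := smooth_mx_diff sb Ux; have dbs := smooth_mx_diff sbs Ux.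
  have dc := @diff_mx_cst R _ m H x.
  rewrite (derive_mxM u (diff_mxM db dc) dbs) (derive_mxM u db dc) derive_mx_cst mulmx0 addr0.
  rewrite (derive_mx_adj u db).
  have eb : derive_mx b x u = dirM_mx (chart p x) (derive_mx (imm \o chart p) x u) B.
    by rewrite (dirM_mx_chartE u sB dx Wx).
  rewrite eb; have ys := parallel_skew (derive_mx (imm \o chart p) x u) Wx.
  have yH := parallel_scalar H Wx tx; have bb := BB Wx; have bb' := mulmx1C bb.
  rewrite /bs /b /=; move: (B (chart p x)) (dirM_mx _ _ B) ys yH bb bb' => b0 d ys yH bb bb'.
  have ed : d = b0 *m (b0^t* *m d) by rewrite mulmxA bb' mul1mx.
  move: (b0^t* *m d) ed ys yH => y -> ys yH.
  by rewrite adjM ys -(mulmxA b0) yH mulmxA mulNmx mulmxN !mulmxA subrr.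
suff E : F (0 + 1 *: u) = F 0 by move: E; rewrite scale1r add0r /F /bs /b /= ep.
apply/matrixP => i j; apply/eqP; rewrite eq_complex; apply/andP; split; apply/eqP.
  apply: (@segment_constant _ _ (fun x => complex.Re (F x i j)) 0 u 1) => // t /Ut Ux.
  have [s1 _] := sF i j; split; first exact: smooth_diff s1 Ux.
  by have /matrixP/(_ i j) := dF _ Ux; rewrite !mxE => -[].
apply: (@segment_constant _ _ (fun x => complex.Im (F x i j)) 0 u 1) => // t /Ut Ux.
have [_ s1] := sF i j; split; first exact: smooth_diff s1 Ux.
by have /matrixP/(_ i j) := dF _ Ux; rewrite !mxE => -[].
Qed.

End Parallel_frame.

(** * The frame of the focal map and its constancy up to a phase *)

Section Refl.
Context {R : realType} {m : nat}.
Implicit Types (P n X Y : cmat R m) (C S : R[i]).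

Lemma refl_T C S P n : (refl C S P n)^T = refl C S P^T n^T.
Proof.
have TZ (z : R[i]) (Y : cmat R m) : (z *: Y)^T = z *: Y^T by rewrite linearZ.
have TD (Y Z : cmat R m) : (Y + Z)^T = Y^T + Z^T by rewrite linearD.
have TN (Y : cmat R m) : (- Y)^T = - Y^T by rewrite linearN.
by rewrite /refl !(TD, TN, TZ) trmx_mul trmx1.
Qed.

Lemma refl_adj (c s : R) P n : P^t* = P -> n^t* = n -> (refl c%:C s%:C P n)^t* = refl c%:C s%:C P n.
Proof.
move=> hP hn; have AN (Y : cmat R m) : (- Y)^t* = - Y^t* by apply/matrixP => i j; rewrite !mxE rmorphN.
have nn : (n *m n)^t* = n *m n by rewrite adjM hn.
rewrite /refl; move: (n *m n) nn => y nn.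
by rewrite !(adjD, AN, adjZ) adj1 nn hP hn !conjc_real.
Qed.

Lemma refl_intertwine C S P n (o P' n' : cmat R m) : o *m P' = P *m o -> o *m n' = n *m o ->
  o *m refl C S P' n' = refl C S P n *m o.
Proof.
move=> p1 n1; have n2 : o *m (n' *m n') = n *m n *m o by rewrite mulmxA n1 -mulmxA n1 mulmxA.
rewrite /refl; move: (n *m n) (n' *m n') n2 => y y' n2.
by rewrite !(mulmxDr, mulmxN, mulmxDl, mulNmx) -!scalemxAr -!scalemxAl
  !(mulmxDr, mulmxN, mulmxDl, mulNmx) p1 n1 n2 mul1mx mulmx1.
Qed.

Lemma conj_sandwich X Y : ((((X^t*)^T *m Y *m ((X^t*)^T)^t*)^t*)^T) = X *m (Y^t*)^T *m X^t*.
Proof.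
rewrite (conjM ((X^t*)^T *m Y)) (conjM ((X^t*)^T) Y) conjK; congr (_ *m _).
by apply/matrixP => i j; rewrite !mxE.
Qed.

End Refl.

Section Focal_frame.
Context {R : realType} {m : nat} (M : hypersurface R m).
Context (N : M -> cmat R m) (hN : unit_normal N) (m_gt0 : (0 < m)%N).
Context (nabla : (M -> cmat R m) -> (M -> cmat R m) -> M -> cmat R m)
  (hnabla : levi_civita nabla) (hQ : forall p : M, distQ N p (reeb N p)).
Context (k : R) (k_neq0 : k != 0).
Local Notation a := (2 * k).
Context (Areeb : forall q, shape_op N q (reeb N q) = a%:C *: reeb N q).
Context (c s : R) (cs1 : c ^+ 2 + s ^+ 2 = 1) (sk : s = - k * c).
Implicit Types (p q : M) (V H x y g om : cmat R m).
Local Notation conj g := ((g^t*)^T).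
Local Notation E q := (refl c%:C s%:C (imm q) (N q)).

Definition quadf (x y z : R[i]) q := x *: imm q + y *: N q + z *: (N q *m N q).
(** The point at [t = 2r] of the geodesic [(n^2 + cos 2t (2P - n^2) + sin 2t n) / 2]: one has
    [cos 4r = c^2 - s^2], and half of [1 - cos 4r] is [s^2]. *)
Definition focal := quadf (c%:C ^+ 2 - s%:C ^+ 2) (c%:C * s%:C) (s%:C ^+ 2).
(** The reversed velocity at the end of that geodesic. *)
Definition focal_normal := quadf (4 * c%:C * s%:C) (s%:C ^+ 2 - c%:C ^+ 2) (- (2 * c%:C * s%:C)).

Let S2 : s%:C ^+ 2 = 1 - c%:C ^+ 2 :> R[i]. Proof. exact: sqr_compl. Qed.

Lemma refl_blocks q : [/\ E q *m E q = 1%:M, E q *m imm q *m E q = focal q & E q *m N q *m E q = focal_normal q].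
Proof.
have [b [b' [[en b1 b2 b3 b4] bb]]] := normal_blocks hN hQ q.
have [_ PP _] := imm_G2 q.
rewrite /focal /focal_normal /quadf /refl en.
move: (c%:C) (s%:C) S2 => C S S2'.
have ok1 : nc_ok [:: imm q; b; b'] ((2, 1, NRlet 0) :: nc_gen [:: 0] [:: (0, 0); (1, 0); (0, 1)]
      [:: (0, 0); (1, 0); (0, 1)] 0)%N by split=> //; apply: typed_ok => //=; do !split.
nc_have ok ok1; split; nc ok; ring: S2'.
Qed.

Lemma focal_trace q : \tr (imm q *m focal q) = 2 * c%:C ^+ 2.
Proof.
have gP := imm_G2 q; have [_ PP _] := gP; have PNP := G2_tangent_PXP gP (N_G2 hN q).
have t1 : \tr (imm q *m N q) = 0 by rewrite -{1}PP -mulmxA mxtrace_mulC PNP mxtrace0.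
rewrite /focal /quadf; rewrite mulmxDr mulmxDr -scalemxAr -scalemxAr -scalemxAr PP mulmxA (normal_sq hN hQ) !mxtraceD !mxtraceZ t1.
by rewrite (G2_trace gP) mulr0 addr0 -mulrDl subrK mulrC.
Qed.

Lemma smooth_quadf (x y z : R[i]) W : open W -> smooth_field W (quadf x y z).
Proof.
move=> oW; have sN := N_smoothW hN W; have sP := @smooth_field_imm _ _ M W.
have sNN := smooth_fieldM oW sN sN.
apply: (smooth_fieldD oW); last exact: (smooth_fieldZc z oW sNN).
exact: (smooth_fieldD oW (smooth_fieldZc x oW sP) (smooth_fieldZc y oW sN)).
Qed.

Lemma dirM_quadf (x y z : R[i]) q V : tangent q V -> let w := dirM_mx q V N in
  dirM_mx q V (quadf x y z) = x *: V + y *: w + z *: (w *m N q + N q *m w).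
Proof.
move=> tV w; have oT : open (setT : set M) := openT; have Tq : (setT : set M) q by [].
have sN := N_smoothW hN setT; have sP := @smooth_field_imm _ _ M setT.
have sNN := smooth_fieldM oT sN sN.
have s1 := smooth_fieldZc x oT sP; have s2 := smooth_fieldZc y oT sN; have s3 := smooth_fieldZc z oT sNN.
have d1 := dirM_mxZc x V sP Tq; have d2 := dirM_mxZc y V sN Tq; have d3 := dirM_mxZc z V sNN Tq.
have dP := dirM_mx_imm tV; have dNN := dirM_mxM V sN sN Tq.
have e1 := dirM_mxD V (smooth_fieldD oT s1 s2) s3 Tq; have e2 := dirM_mxD V s1 s2 Tq.
by rewrite -/w in d2 dNN; rewrite dP in d1; rewrite dNN in d3; rewrite /quadf e1 e2 d1 d2 d3.
Qed.

Lemma dirM_focal q V : tangent q V -> let w := dirM_mx q V N in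
  dirM_mx q V focal = focal_d c%:C s%:C (N q) V w /\ dirM_mx q V focal_normal = normal_d c%:C s%:C (N q) V w.
Proof.
move=> tV w; rewrite /focal /focal_normal (dirM_quadf _ _ _ tV) (dirM_quadf _ _ _ tV) -/w /focal_d /normal_d.
move: (w) (N q) (c%:C) (s%:C) => w' n C S.
by have ok : nc_ok [:: V; n; w'] [::] by []; split; nc ok; ring.
Qed.

Section Field.
Context (W : set M) (oW : open W) (om : M -> cmat R m) (so : smooth_field W om).
Context (ao : forall q, W q -> alt_form (imm q) (om q)) (on : forall q, W q -> om q *m (om q)^t* = imm q).

Definition focal_frame q := E q *m omQ N c s q (om q).

Lemma focal_frame_facts q : W q -> let X := focal_frame q in
  [/\ X *m X^t* = 1%:M, X^T = - X, X *m (imm q)^T = focal q *m X & X *m (N q)^T = focal_normal q *m X].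
Proof.
move=> Wq /=; have aq := ao Wq; have oq := on Wq; have [ee <- <-] := refl_blocks q; have he : (E q)^t* = E q.
  by apply: refl_adj; [have [] := imm_G2 q|have [] := N_G2 hN q].
have u := omQ_unit hN m_gt0 hnabla hQ k_neq0 Areeb cs1 sk aq oq.
have hT := omQ_T hN m_gt0 hnabla hQ k_neq0 Areeb cs1 sk aq oq.
have [p1 p2] := omQ_PT hN m_gt0 hnabla hQ k_neq0 Areeb cs1 sk aq oq.
have n1 := omQ_nT hN m_gt0 hnabla hQ k_neq0 Areeb cs1 sk aq oq.
have thE : omQ N c s q (om q) *m (E q)^T = E q *m omQ N c s q (om q).
  by rewrite refl_T; apply: refl_intertwine => //; rewrite p1 p2.
rewrite /focal_frame; move: (omQ _ _ _ _ _) (E q) u hT p1 p2 n1 thE ee he => o e u hT p1 p2 n1 thE ee he.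
split.
- by rewrite adjM he -mulmxA (mulmxA o) u mul1mx.
- by rewrite trmx_mul hT mulNmx thE.
- by rewrite -mulmxA p1 -p2 !mulmxA -(mulmxA _ e e) ee mulmx1.
by rewrite -mulmxA n1 !mulmxA -(mulmxA _ e e) ee mulmx1.
Qed.

Lemma smooth_focal_frame : smooth_field W focal_frame.
Proof.
have sN := N_smoothW hN W; have sP := @smooth_field_imm _ _ M W.
have sW : smooth_field W (Wp N).
  apply: (smooth_fieldB oW); first exact: smooth_field_cst.
  exact: (smooth_fieldM oW sN sN).
have sNT := smooth_field_T sN; have sWT := smooth_field_T sW.
have sE : smooth_field W (fun q => E q).
  rewrite /refl; apply: (smooth_fieldD oW); last exact: sW.
  apply: (smooth_fieldD oW); last exact: smooth_fieldZc.
  apply: (smooth_fieldZc _ oW); apply: (smooth_fieldB oW); last exact: smooth_fieldM.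
  exact: smooth_fieldD.
have sT i j : smooth_field W (fun q => TW N c s q (om q) (Wp N q *m delta_mx i j *m imm q)).
  apply: (smooth_fieldM oW) => //.
  pose x q := Wp N q *m delta_mx i j *m imm q.
  have sx : smooth_field W x.
    by apply: (smooth_fieldM oW) => //; apply: (smooth_fieldM oW) => //; exact: smooth_field_cst.
  have sxx : smooth_field W (fun q => x q + (x q)^t*).
    by apply: (smooth_fieldD oW) => //; exact: smooth_field_J oW (smooth_field_T sx).
  have vx : vfield W (fun q => x q + (x q)^t*).
    split=> // q Wq; exact: (blkW_D0 hN m_gt0 hQ (blkW_proj hN hQ q _)).1.
  have [_ sA] := vfield_shape hN m_gt0 hnabla oW vx.
  by apply: (smooth_fieldB oW); exact: (smooth_fieldZc _ oW).
apply: (smooth_fieldM oW) => //; apply: (smooth_fieldD oW).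
  apply: (smooth_fieldD oW) => //; apply: (smooth_fieldM oW) => //; exact: (smooth_fieldM oW).
apply: (smooth_fieldM oW) => //; apply: (smooth_fieldZc _ oW); apply: (smooth_field_sum _ oW) => i.
by apply: (smooth_field_sum _ oW) => j; apply: (smooth_fieldM oW) => //; exact: smooth_field_cst.
Qed.

(** For the conjugate [B] of the frame, [X P^T = focal X] reads [B P = (conj focal) B], in which [P]
    itself occurs. Together with [focal_theta] its derivative shows that [B^-1 dB] commutes with
    [P], and likewise with the normal. *)
Lemma focal_frame_constant p : W p -> exists W', [/\ open W', W' p, W' `<=` W & forall q, W' q ->
  focal q = focal_frame p *m conj (imm q) *m (focal_frame p)^t*].
Proof.
move=> Wp; pose B q := conj (focal_frame q).
have sB : smooth_field W B.
  by apply: smooth_field_T; apply: (smooth_field_J oW); exact: smooth_field_T smooth_focal_frame.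
have cJ (X : cmat R m) : (conj X)^t* = X^T by apply/matrixP => i j; rewrite !mxE conjCK.
have BB q : W q -> (B q)^t* *m B q = 1%:M.
  move=> Wq; have [u _ _ _] := focal_frame_facts Wq; rewrite /B cJ -trmx_mul.
  by rewrite (mulmx1C u) ?trmx1.
have gen q V (F Z : M -> cmat R m) : W q -> tangent q V -> smooth_field W F -> smooth_field W Z ->
    (forall q, (Z q)^t* = Z q) -> (forall q, W q -> focal_frame q *m (Z q)^T = F q *m focal_frame q) ->
    dirM_mx q V F = E q *m theta N c s q (om q) (dirM_mx q V Z) *m E q ->
    let Y := (B q)^t* *m dirM_mx q V B in Y *m Z q = Z q *m Y.
  move=> Wq tV sF sZ hZ eF dF Y.
  have sFc : smooth_field W (fun q => conj (F q)).
    by apply: smooth_field_T; apply: (smooth_field_J oW); exact: smooth_field_T sF.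
  have eB q' : W q' -> B q' *m Z q' = conj (F q') *m B q'.
    by move=> Wq'; rewrite -(hZ q') -conj_T -!conjM (eF _ Wq').
  have dB : dirM_mx q V (fun q => B q *m Z q) = dirM_mx q V (fun q => conj (F q) *m B q).
    exact: eq_on_dirM_mx oW Wq eB.
  have dFc : dirM_mx q V (fun q => conj (F q)) = B q *m dirM_mx q V Z *m (B q)^t*.
    have -> : dirM_mx q V (fun q => conj (F q)) = conj (dirM_mx q V F).
      rewrite /dirM_mx -(derive_mx_adj _ (smooth_field_diff0 sF Wq)).
      by rewrite -derive_mxT.
    rewrite dF /theta /B /focal_frame; have he : (E q)^t* = E q.
      by apply: refl_adj; [have [] := imm_G2 q|have [] := N_G2 hN q].
    have cJ' (X : cmat R m) : conj (X^t*) = (conj X)^t* by apply/matrixP => i j; rewrite !mxE.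
    move: (omQ _ _ _ _ _) (E q) he (dirM_mx q V Z) => o e he d.
    have -> : e *m (o *m conj d *m o^t*) *m e = e *m o *m conj d *m (e *m o)^t* by rewrite adjM he !mulmxA.
    by move: (e *m o) => f; rewrite (conjM _ (f^t*)) (conjM f) conjK cJ'.
  rewrite (dirM_mxM _ sB sZ Wq) (dirM_mxM _ sFc sB Wq) dFc in dB.
  have bb := BB _ Wq; have bq := eB _ Wq.
  move: (conj (F q)) (B q) (Z q) (dirM_mx q V B) (dirM_mx q V Z) @Y dB bb bq => f b z d e Y dB bb bq.
  have bf : b^t* *m f = z *m b^t*.
    have bb' := mulmx1C bb; have := congr1 (fun X => b^t* *m X *m b^t*) bq.
    by rewrite !mulmxA bb mul1mx -!mulmxA bb' mulmx1.
  rewrite -[_ *m b]mulmxA bb mulmx1 addrC in dB; move/addrI: dB => dB.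
  by rewrite /Y -mulmxA dB mulmxA bf mulmxA.
have YP q V : W q -> tangent q V -> (B q)^t* *m dirM_mx q V B *m imm q = imm q *m ((B q)^t* *m dirM_mx q V B).
  move=> Wq tV; have s1 := smooth_quadf (c%:C ^+ 2 - s%:C ^+ 2) (c%:C * s%:C) (s%:C ^+ 2) oW.
  apply: (gen _ _ _ _ Wq tV s1 (@smooth_field_imm _ _ M W)) => [q'|q' Wq'|].
  - by have [] := imm_G2 q'.
  - by have [] := focal_frame_facts Wq'.
  have [-> _] := dirM_focal tV.
  by have [-> _] := focal_theta hN m_gt0 hnabla hQ k_neq0 Areeb cs1 sk (ao Wq) (on Wq) tV; rewrite (dirM_mx_imm tV).
have YN q V : W q -> tangent q V -> (B q)^t* *m dirM_mx q V B *m N q = N q *m ((B q)^t* *m dirM_mx q V B).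
  move=> Wq tV; have s1 := smooth_quadf (4 * c%:C * s%:C) (s%:C ^+ 2 - c%:C ^+ 2) (- (2 * c%:C * s%:C)) oW.
  apply: (gen _ _ _ _ Wq tV s1 (N_smoothW hN W)) => [q'|q' Wq'|].
  - by have [] := N_G2 hN q'.
  - by have [] := focal_frame_facts Wq'.
  have [_ ->] := dirM_focal tV.
  by have [_ ->] := focal_theta hN m_gt0 hnabla hQ k_neq0 Areeb cs1 sk (ao Wq) (on Wq) tV.
have [W' [oW' W'p W'W cst]] := parallel_constant hN m_gt0 hQ oW sB BB YP YN Wp.
exists W'; split=> // q W'q; have Wq := W'W _ W'q.
have h : focal_frame q *m conj (imm q) *m (focal_frame q)^t* = focal_frame p *m conj (imm q) *m (focal_frame p)^t*.
  exact: etrans (esym (conj_sandwich (focal_frame q) (imm q)))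
    (etrans (congr1 (fun X => conj X) (cst q (imm q) W'q)) (conj_sandwich (focal_frame p) (imm q))).
rewrite -h.
have [u _ f1 _] := focal_frame_facts Wq; have [hP _ _] := imm_G2 q.
by rewrite hP f1 -mulmxA u mulmx1.
Qed.

End Field.
Lemma alt_form_exists P : G2 R m P -> exists om, alt_form P om /\ om *m om^t* = P.
Proof.
move=> gP; have [K [KK KP _]] := quat_basis_exists gP.
have [ps _] := @pauli_skew R 1.
have pT : (pauli 1 : 'M[R[i]]_2)^T = - pauli 1.
  by apply/matrixP => i j; rewrite !mxE; case: i => [[|[|[]]]//= ?]; case: j => [[|[|[]]]//= ?] /=; rewrite ?oppr0 ?opprK.
have ao : alt_form P (K *m pauli 1 *m K^T).
  split; first by rewrite trmx_mul trmxK trmx_mul pT mulNmx mulmxN mulmxA.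
  have e : P *m (K *m (pauli 1 *m K^T)) = K *m (pauli 1 *m K^T) by rewrite mulmxA -{1}KP -(mulmxA K) KK mulmx1.
  by rewrite -(mulmxA K) e.
exists (K *m pauli 1 *m K^T); split=> //.
have pp : pauli 1 *m pauli 1 = - (1%:M : 'M[R[i]]_2).
  have := @pauli_quat R 1 1; rewrite eqxx -mulr2n -scaler_nat => E'.
  by apply: (@scalerI _ _ 2%:R); rewrite ?pnatr_eq0// E' scalerN.
have KTK : K^T *m (K^T)^t* = 1%:M.
  have -> : (K^T)^t* = (K^t*)^T by apply/matrixP => i j; rewrite !mxE.
  by rewrite -trmx_mul KK trmx1.
rewrite adjM (adjM K) ps -KP; move: (pauli 1) pp (K^T) KTK => p pp K' KTK.
by rewrite !mulmxA -(mulmxA (K *m p)) KTK mulmx1 -(mulmxA K) mulmxN pp opprK mulmx1.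
Qed.

(** A unit alternating form near [p] is found by compressing the one at [p] to the neighbouring
    planes and normalizing where its norm is positive. *)
Lemma local_focal p : exists (X : cmat R m) W, [/\ open W, W p, X *m X^t* = 1%:M, X^T = - X &
  forall q, W q -> focal q = X *m conj (imm q) *m X^t*].
Proof.
have gp := imm_G2 p; have [z [[zT Pz] zn]] := alt_form_exists gp.
pose om1 q := imm q *m z *m (imm q)^T.
have oT : open (setT : set M) := openT.
have sP := @smooth_field_imm _ _ M setT.
have so1 : smooth_field setT om1.
  apply: (smooth_fieldM oT); last exact: smooth_field_T.
  by apply: (smooth_fieldM oT) => //; exact: smooth_field_cst.
pose rho q := 2 * gmet (om1 q) ((om1 q)^t*).
have srho : smooth_fun setT rho.
  apply: (smooth_funM oT); first exact: smooth_fun_cst.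
  by apply: (smooth_fun_gmet oT) => //; exact: smooth_field_J oT (smooth_field_T so1).
pose W := [set q | setT q /\ 0 < rho q].
have oW : open W := open_smooth_fun_gt0 oT srho.
have ao1 q : alt_form (imm q) (om1 q).
  have [_ PP _] := imm_G2 q; split; last by rewrite /om1 !mulmxA PP.
  by rewrite /om1 trmx_mul trmxK trmx_mul zT mulNmx mulmxN mulmxA.
have r1 : rho p = 1.
  have -> : rho p = 2 * gmet z (z^t*).
    have [hP _ _] := gp.
    have e : om1 p = z by have az : alt_form (imm p) z by []; rewrite /om1 Pz (alt_form_PT hP az).
    by rewrite /rho e.
  by rewrite /gmet zn (G2_trace gp) /=; field.
have Wp : W p by split=> //; rewrite r1.
pose om q := ((Num.sqrt (rho q))^-1)%:C *: om1 q.
have so : smooth_field W om.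
  apply: (smooth_fieldZ oW); last by apply: smooth_field_sub so1.
  move=> q; apply: smooth_rsqrt; first exact: open_dom_chart.
    by move=> u [_ []].
  by apply: smooth_sub (srho q) => u [].
have ao q : W q -> alt_form (imm q) (om q).
  move=> _; have [h1 h2] := ao1 q; split; last by rewrite /om -scalemxAr h2.
  rewrite /om; have TZ (x : R[i]) (Y : cmat R m) : (x *: Y)^T = x *: Y^T by rewrite linearZ.
  by rewrite TZ h1 scalerN.
have on q : W q -> om q *m (om q)^t* = imm q.
  move=> [_ r0]; have h := alt_form_norm (imm_G2 q) (ao1 q); rewrite -/(rho q) in h.
  rewrite /om adjZ conjc_real -scalemxAl -scalemxAr h !scalerA -!rmorphM.
  have -> : (Num.sqrt (rho q))^-1 * (Num.sqrt (rho q))^-1 * rho q = 1.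
    by rewrite -invfM -expr2 sqr_sqrtr ?ltW// mulVf// gt_eqF.
  by rewrite scale1r.
have [W' [oW' W'p W'W cst]] := focal_frame_constant oW so ao on Wp.
have [u1 u2 _ _] := focal_frame_facts ao on Wp.
by exists (focal_frame om p), W'; split.
Qed.

End Focal_frame.

(** * Normal form of the focal structure *)

Section Quaternionic_basis.
Context {R : realType} {n : nat} (X : 'M[R[i]]_n) (XX : X *m X^t* = 1%:M) (XT : X^T = - X).
Local Notation conjv v := (v^t*)^T.

(** The members come in pairs exchanged up to sign by the antilinear map [v -> X (conj v)], whose
    square is [-1]: an orthonormal quaternionic family. *)
Definition quat_family (k : nat) (y : nat -> 'cV[R[i]]_n) :=
  (forall i j, (i < k.*2)%N -> (j < k.*2)%N -> (y i)^t* *m y j = (i == j)%:R%:M) /\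
  (forall i, (i < k)%N -> X *m conjv (y i.*2) = y i.*2.+1).

Lemma conjX_mul : X *m (X^t*)^T = - 1%:M.
Proof.
have -> : (X^t*)^T = - X^t*.
  have e i j : X j i = - X i j by have /matrixP/(_ i j) := XT; rewrite !mxE.
  by apply/matrixP => i j; rewrite !mxE e rmorphN.
by rewrite mulmxN XX.
Qed.

Lemma quat_family_J k y i : quat_family k y -> (i < k)%N -> X *m conjv (y i.*2.+1) = - y i.*2.
Proof.
move=> [_ yX] ik; rewrite -(yX i ik).
have -> : conjv (X *m conjv (y i.*2)) = (X^t*)^T *m y i.*2.
  rewrite adjM trmx_mul; congr (_ *m _); apply/matrixP => a b; by rewrite !mxE conjCK.
by rewrite mulmxA conjX_mul mulNmx mul1mx.
Qed.

Lemma quat_family_le k y : quat_family k y -> (k.*2 <= n)%N.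
Proof.
move=> [yo _]; pose K : 'M[R[i]]_(n, k.*2) := \matrix_(i, j) y j i 0.
have KK : K^t* *m K = 1%:M.
  apply/matrixP => i j; have /matrixP/(_ 0 0) := yo i j (ltn_ord i) (ltn_ord j).
  by rewrite !mxE eqxx mulr1n => <-; apply: eq_bigr => l _; rewrite !mxE.
have := mxrank1 R[i] k.*2; rewrite -KK => <-.
exact: leq_trans (mxrankM_maxl _ _) (rank_leq_col _).
Qed.

Lemma orthogonal_unit k (y : nat -> 'cV[R[i]]_n) : (k < n)%N ->
  exists v : 'cV[R[i]]_n, v^t* *m v = 1%:M /\ forall j, (j < k)%N -> v^t* *m y j = 0.
Proof.
move=> kn; pose K : 'M[R[i]]_(n, k) := \matrix_(i, j) y j i 0.
have : kermx K != 0.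
  by rewrite kermx_eq0 /row_free neq_ltn (leq_ltn_trans (rank_leq_col K) kn).
move=> /rowV0Pn[u /sub_kermxP uK u0].
pose x := complex.Re (\tr (u *m u^t*)).
have x0 : 0 < x.
  rewrite lt_neqAle Re_tr_adj_ge0 andbT eq_sym; apply: contraNneq u0 => h.
  by rewrite (Re_tr_adj_eq0 h).
have ux : u *m u^t* = x%:C%:M.
  apply/matrixP => i j; rewrite !ord1 !mxE mulr1n /x /mxtrace big_ord_recl big_ord0 addr0 !mxE.
  apply/eqP; rewrite eq_complex/= eqxx/=; apply/eqP; rewrite -[RHS](raddf0 (@complex.Im R)).
  rewrite (raddf_sum (@complex.Im R)) big1// => l _; rewrite !mxE; case: (u 0 l) => p q /=; ring.
exists (((Num.sqrt x)^-1)%:C *: u^t*); rewrite adjZ adjK conjc_real; split.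
  rewrite -scalemxAl -scalemxAr ux scalerA scale_scalar_mx -!rmorphM; congr (_%:M).
  by rewrite -invfM -expr2 sqr_sqrtr ?ltW// mulVf ?gt_eqF.
move=> j jk; rewrite -scalemxAl; have -> : u *m y j = 0; last by rewrite scaler0.
have /matrixP/(_ 0 (Ordinal jk)) := uK; rewrite !mxE => h.
by apply/matrixP => a b; rewrite !ord1 mxE [RHS]mxE -[RHS]h; apply: eq_bigr => l _; rewrite !mxE.
Qed.

(** For [w = v] this says that a vector is orthogonal to its own image. *)
Lemma skew_pairing (v w : 'cV[R[i]]_n) : v^t* *m (X *m conjv w) = - (w^t* *m (X *m conjv v)).
Proof.
have tr1 (B : 'M[R[i]]_1) : B^T = B by apply/matrixP => i j; rewrite !ord1 mxE.
rewrite -[LHS]tr1 !trmx_mul trmxK XT mulmxN mulNmx; congr (- _).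
by rewrite mulmxA.
Qed.

(** A unit vector orthogonal to the family brings its image along, which is again orthogonal to the
    family and to the vector. Thus one free dimension already provides two. *)
Lemma quat_family_extend k y : quat_family k y -> (k.*2 < n)%N -> exists y', quat_family k.+1 y'.
Proof.
move=> hy kn; have [yo yX] := hy; have [v [v1 vy]] := orthogonal_unit y kn.
have yv j : (j < k.*2)%N -> (y j)^t* *m v = 0.
  by move=> jk; rewrite -[LHS]adjK adjM adjK vy// adj0.
pose w := X *m conjv v.
have Xy j : (j < k.*2)%N -> exists2 l, (l < k.*2)%N & exists z : R[i], X *m conjv (y j) = z *: y l.
  move=> jk; have j2k : (j./2 < k)%N by rewrite -divn2 ltn_divLR// muln2.
  have := odd_double_half j; case: (odd j); rewrite ?add1n ?add0n => ej.
    exists j./2.*2; first by rewrite ltn_double.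
    by exists (-1); rewrite -{1}ej (quat_family_J hy j2k) scaleN1r.
  exists j./2.*2.+1; first by rewrite ltn_Sdouble.
  by exists 1; rewrite -{1}ej (yX _ j2k) scale1r.
have vw : v^t* *m w = 0.
  have := skew_pairing v v; rewrite -/w; move: (_ *m w) => z /eqP.
  by rewrite -subr_eq0 opprK -mulr2n -scaler_nat scaler_eq0 pnatr_eq0/= => /eqP.
have wv : w^t* *m v = 0 by rewrite -[LHS]adjK adjM adjK vw adj0.
have yw j : (j < k.*2)%N -> (y j)^t* *m w = 0.
  move=> jk; rewrite skew_pairing; have [l lk [z ->]] := Xy j jk.
  by rewrite -scalemxAr vy// scaler0 oppr0.
have wy j : (j < k.*2)%N -> w^t* *m y j = 0.
  by move=> jk; rewrite -[LHS]adjK adjM adjK yw// adj0.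
have ww : w^t* *m w = 1%:M.
  rewrite /w adjM -mulmxA (mulmxA (X^t*)) (mulmx1C XX) mul1mx.
  have -> : (conjv v)^t* = v^T by apply/matrixP => i j; rewrite !mxE conjCK.
  by rewrite -trmx_mul v1 trmx1.
pose y' j := if (j < k.*2)%N then y j else if j == k.*2 then v else w.
have yE j : (j < k.*2)%N -> y' j = y j by rewrite /y' => ->.
have yEv : y' k.*2 = v by rewrite /y' ltnn eqxx.
have yEw : y' k.*2.+1 = w by rewrite /y' ltnNge leqnSn/= eqn_leq ltnn.
have cs j : (j < k.+1.*2)%N -> [\/ (j < k.*2)%N, j = k.*2 | j = k.*2.+1].
  rewrite doubleS !ltnS leq_eqVlt => /orP[/eqP->|]; first by constructor 3.
  by rewrite ltnS leq_eqVlt => /orP[/eqP->|]; [constructor 2|constructor 1].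
exists y'; split=> [i j /cs ci /cs cj|i].
  case: ci => [ik|->|->]; case: cj => [jk|->|->]; rewrite ?yEv ?yEw ?(yE _ ik) ?(yE _ jk) ?eqxx.
  - exact: yo.
  - by rewrite (ltn_eqF ik) yv// raddf0.
  - by rewrite (ltn_eqF (ltnW ik : (i < k.*2.+1)%N)) yw// raddf0.
  - by rewrite eq_sym (ltn_eqF jk) vy// raddf0.
  - exact: v1.
  - by rewrite (ltn_eqF (ltnSn _)) vw raddf0.
  - by rewrite eq_sym (ltn_eqF (ltnW jk : (j < k.*2.+1)%N)) wy// raddf0.
  - by rewrite eq_sym (ltn_eqF (ltnSn _)) wv raddf0.
  - exact: ww.
rewrite ltnS leq_eqVlt => /orP[/eqP->|ik]; first by rewrite yEv yEw.
by rewrite yE ?ltn_double// yE ?ltn_Sdouble// yX.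
Qed.

Lemma quat_family_max k : (k.*2 <= n)%N -> exists y, quat_family k y.
Proof.
elim: k => [_|k IH]; first by exists (fun=> 0); split=> i.
rewrite doubleS => kn; have [y hy] := IH (ltnW (ltnW kn)).
exact: quat_family_extend hy (ltnW kn).
Qed.

(** In odd dimension a family with a single free direction left could still be extended by two
    vectors. *)
Lemma skew_unitary_even : ~~ odd n.
Proof.
apply/negP => on; have e := odd_double_half n; rewrite on add1n in e.
have [y hy] := @quat_family_max n./2 (ltnW (eq_leq e)).
have [y' /quat_family_le] := quat_family_extend hy (eq_leq e).
by rewrite doubleS -{2}e ltnn.
Qed.

End Quaternionic_basis.

Section Normal_form.
Context {R : realType} {m : nat}.
Implicit Types (X Y : cmat R m).

Lemma quat_Omega_normal_form X : X *m X^t* = 1%:M -> X^T = - X ->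
  exists Y, Y *m Y^t* = 1%:M /\ X = Y *m quat_Omega R m *m Y^T.
Proof.
move=> XX XT; have ev := skew_unitary_even XX XT.
have e := odd_double_half m.+2; rewrite (negPf ev) add0n in e.
have [y hy] := quat_family_max XX XT (eq_leq e); have [yo yX] := hy; rewrite e in yo.
pose Y : cmat R m := \matrix_(i, j) y j i 0.
have YY : Y^t* *m Y = 1%:M.
  apply/matrixP => i j; have /matrixP/(_ 0 0) := yo i j (ltn_ord i) (ltn_ord j).
  by rewrite !mxE eqxx mulr1n => <-; apply: eq_bigr => l _; rewrite !mxE.
have YY' := mulmx1C YY.
exists Y; split=> //.
have XY : X *m (Y^t*)^T = Y *m quat_Omega R m.
  apply/matrixP => i j.
  have -> : (X *m (Y^t*)^T) i j = (X *m ((y j)^t*)^T) i 0.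
    by rewrite !mxE; apply: eq_bigr => l _; rewrite !mxE.
  have jn := ltn_ord j; rewrite -{2}e in jn.
  have hk : (j./2 < m.+2./2)%N by rewrite -divn2 ltn_divLR// muln2.
  rewrite [RHS]mxE; have := odd_double_half j; case oj : (odd j); rewrite ?add1n ?add0n => ej.
    (* An odd column goes to minus the preceding one, which is the entry [-1] of [quat_Omega] just
       above the diagonal. *)
    have lt : (j.-1 < m.+2)%N by rewrite (leq_ltn_trans (leq_pred _) (ltn_ord j)).
    rewrite -{1}ej (quat_family_J XX XT hy hk) (bigD1 (Ordinal lt))//= big1 => [|l lj].
      have ej1 : j.-1 = j./2.*2 by rewrite -{1}ej.
      by rewrite addr0 3!mxE /= ej1 odd_double ej eqxx /= mulrN1.
    rewrite !mxE oj/= andbC/=; case: ifP => [/andP[/eqP jl _]|_]; last by rewrite mulr0.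
    by case/eqP: lj; apply/val_inj; rewrite /= jl.
  have lt : (j.+1 < m.+2)%N by have h : (j./2.*2.+1 < m.+2./2.*2)%N; [rewrite ltn_Sdouble|rewrite ej e in h].
  rewrite -{1}ej (yX _ hk) (bigD1 (Ordinal lt))//= big1 => [|l lj].
    rewrite addr0 !mxE/= oj/= eqxx ej.
    by rewrite mulr1.
  rewrite !mxE; case: ifP => [/andP[ol /eqP jl]|_].
    by move: oj; rewrite jl /= ol.
  by case: ifP => [/andP[_ /eqP lj']|_]; [case/eqP: lj; apply/val_inj; rewrite /= lj'|rewrite mulr0].
have cY : (Y^t*)^T *m Y^T = 1%:M by rewrite -trmx_mul YY' trmx1.
by rewrite -XY -mulmxA cY mulmx1.
Qed.

Lemma unitary_G2_isometry Y : Y *m Y^t* = 1%:M -> G2_isometry (fun P => Y^t* *m P *m Y).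
Proof.
move=> YY; have YY' := mulmx1C YY.
have act U P : U *m U^t* = 1%:M -> G2 R m P -> G2 R m (U^t* *m P *m U).
  move=> UU [hP PP rP]; have UU' := mulmx1C UU; split.
  - by rewrite !adjM adjK hP mulmxA.
  - by rewrite !mulmxA -(mulmxA _ U) UU mulmx1 -(mulmxA (U^t*)) PP.
  - have uU : U \in unitmx by case: (mulmx1_unit UU).
    have uU' : U^t* \in unitmx by case: (mulmx1_unit UU).
    by rewrite mxrankMfree ?row_free_unit// eqmxMfull ?row_full_unit.
split.
  split=> [P gP|P Q _ _ /= E|Q gQ]; first exact: act.
    have := congr1 (fun H => Y *m H *m Y^t*) E.
    by rewrite !mulmxA YY !mul1mx -!mulmxA YY !mulmx1.
  exists (Y *m Q *m Y^t*); first by have := act (Y^t*) Q; rewrite adjK; exact.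
  by rewrite !mulmxA YY' mul1mx -mulmxA YY' mulmx1.
move=> c gc sc; have oT : open (setT : set R^o) := openT.
have sF : smooth_mx setT ((fun P => Y^t* *m P *m Y) \o c).
  exact: smooth_mxM oT (smooth_mxM oT (smooth_mx_cst _ _) sc) (smooth_mx_cst _ _).
split=> // t; have dc : diff_mx c t by exact: smooth_mx_diff sc _.
have -> : velocity ((fun P => Y^t* *m P *m Y) \o c) t = Y^t* *m velocity c t *m Y.
  have dY (H : cmat R m) := diff_mx_cst H t.
  rewrite /velocity (derive_mxM _ (diff_mxM (dY _) dc) (dY _)) (derive_mxM _ (dY _) dc).
  by rewrite !derive_mx_cst mul0mx add0r mulmx0 addr0.
move: (velocity c t) => V; rewrite /gmet; congr (complex.Re _ / _).
by rewrite !mulmxA -(mulmxA (Y^t* *m V) Y) YY mulmx1 -!mulmxA mxtrace_mulC -!mulmxA YY mulmx1.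
Qed.

End Normal_form.

(** * Circles in the Grassmannian and the tube *)

(** In a full-rank factorization [P = C F], idempotence forces [F C = 1]. *)
Lemma idem_trace (K : fieldType) n (P : 'M[K]_n) : P *m P = P -> \tr P = (\rank P)%:R.
Proof.
move=> PP; set C := col_base P; set F := row_base P.
have e : C *m F = P := mulmx_base P.
have /row_fullP[C' C'C] : row_full C := col_base_full P.
have /row_freeP[F' FF'] : row_free F := row_base_free P.
have FC : F *m C = 1%:M.
  have h : C *m (F *m C) *m F = C *m F by rewrite mulmxA e -mulmxA e PP.
  have h1 : C' *m (C *m (F *m C) *m F) *m F' = F *m C.
    by rewrite -(mulmxA C) (mulmxA C') C'C mul1mx -mulmxA FF' mulmx1.
  have h2 : C' *m (C *m F) *m F' = 1%:M by rewrite (mulmxA C') C'C mul1mx.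
  by rewrite -h1 h h2.
by rewrite -{1}e mxtrace_mulC FC mxtrace1.
Qed.

Section Circles.
Context {R : realType} {m : nat}.
Implicit Types (P X H : cmat R m).

Lemma is_derive_trig (a b t : R^o) :
  is_derive t (1 : R^o) (fun t : R^o => a * cos (2 * t) + b * sin (2 * t) : R^o)
    ((2 * b) * cos (2 * t) + (- (2 * a)) * sin (2 * t)).
Proof.
have d2 : is_derive t (1 : R^o) (fun t : R^o => 2 * t : R^o) 2.
  by apply: is_derive_eq; rewrite /GRing.scale/= mulr1.
have dcos : is_derive t (1 : R^o) (fun t : R^o => cos (2 * t) : R^o) (- sin (2 * t) * 2).
  exact: (is_derive1_comp (is_derive_cos (2 * t)) d2).
have dsin : is_derive t (1 : R^o) (fun t : R^o => sin (2 * t) : R^o) (cos (2 * t) * 2).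
  exact: (is_derive1_comp (is_derive_sin (2 * t)) d2).
apply: is_derive_eq; rewrite /GRing.scale/=; ring.
Qed.

(** The span of [cos 2t] and [sin 2t] is closed under differentiation, so the induction runs over
    all [a] and [b]. *)
Lemma trig_smooth (a b : R) : smooth (setT : set R^o) (fun t : R^o => a * cos (2 * t) + b * sin (2 * t)).
Proof.
move=> n; elim: n a b => [|n IH] a b.
  move=> t _; apply: differentiable_continuous; apply/derivable1_diffP.
  by have [] := is_derive_trig a b t.
have df t : differentiable (fun t : R^o => a * cos (2 * t) + b * sin (2 * t) : R^o) t.
  by apply/derivable1_diffP; have [] := is_derive_trig a b t.
split=> [t _|v]; first exact: df.
have -> : (fun t : R^o => 'D_v (fun t : R^o => a * cos (2 * t) + b * sin (2 * t) : R^o) t) =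
    (fun t : R^o => (v * (2 * b)) * cos (2 * t) + (v * (- (2 * a))) * sin (2 * t)).
  apply/funext => t; have [_ e] := is_derive_trig a b t.
  transitivity (v * 'D_(1 : R^o) (fun t : R^o => a * cos (2 * t) + b * sin (2 * t) : R^o) t).
    rewrite !deriveE; [|exact: df|exact: df].
    have -> : 'd (fun t : R^o => a * cos (2 * t) + b * sin (2 * t) : R^o) t v =
        'd (fun t : R^o => a * cos (2 * t) + b * sin (2 * t) : R^o) t (v *: (1 : R^o)).
      by congr ('d _ _ _); rewrite /GRing.scale/= mulr1.
    by rewrite linearZ.
  by rewrite e mulrDr !mulrA.
exact: IH.
Qed.

Definition circ (H0 H1 H2 : cmat R m) (t : R^o) : cmat R m :=
  H0 + (cos (2 * t))%:C *: H1 + (sin (2 * t))%:C *: H2.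

Lemma circ_smooth H0 H1 H2 : smooth_mx setT (circ H0 H1 H2).
Proof.
have oT : open (setT : set R^o) := openT.
have sc (a b : R) : smoothc (setT : set R^o) (fun t : R^o => (a * cos (2 * t) + b * sin (2 * t))%:C).
  split; first exact: trig_smooth.
  by have := trig_smooth 0 0; congr smooth; apply/funext => t; rewrite /= !mul0r addr0.
have e1 : (fun t : R^o => (cos (2 * t))%:C : R[i]) = (fun t => (1 * cos (2 * t) + 0 * sin (2 * t))%:C).
  by apply/funext => t; rewrite mul1r mul0r addr0.
have e2 : (fun t : R^o => (sin (2 * t))%:C : R[i]) = (fun t => (0 * cos (2 * t) + 1 * sin (2 * t))%:C).
  by apply/funext => t; rewrite mul1r mul0r add0r.
apply: (smooth_mxD oT); first apply: (smooth_mxD oT); first exact: smooth_mx_cst.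
  by apply: (smooth_mxZ oT); [rewrite e1; exact: sc|exact: smooth_mx_cst].
by apply: (smooth_mxZ oT); [rewrite e2; exact: sc|exact: smooth_mx_cst].
Qed.

Lemma velocity_circ H0 H1 H2 t : velocity (circ H0 H1 H2) t = circ 0 (2%:C *: H2) (- 2%:C *: H1) t.
Proof.
have dc (H : cmat R m) := diff_mx_cst H t.
have dr (a b : R) : diffc (fun t : R^o => (a * cos (2 * t) + b * sin (2 * t))%:C) t.
  split; first by apply/derivable1_diffP; have [] := is_derive_trig a b t.
  exact: differentiable_cst.
have Dr (a b : R) : Dc (1 : R^o) (fun t : R^o => (a * cos (2 * t) + b * sin (2 * t))%:C) t =
    ((2 * b) * cos (2 * t) + (- (2 * a)) * sin (2 * t))%:C.
  rewrite /Dc; have [_ ->] := is_derive_trig a b t.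
  by congr (_ +i* _); exact: derive_cst.
have e1 : (fun t : R^o => (cos (2 * t))%:C : R[i]) = (fun t => (1 * cos (2 * t) + 0 * sin (2 * t))%:C).
  by apply/funext => u; rewrite mul1r mul0r addr0.
have e2 : (fun t : R^o => (sin (2 * t))%:C : R[i]) = (fun t => (0 * cos (2 * t) + 1 * sin (2 * t))%:C).
  by apply/funext => u; rewrite mul1r mul0r add0r.
have d1 : diffc (fun t : R^o => (cos (2 * t))%:C) t by rewrite e1; exact: dr.
have d2 : diffc (fun t : R^o => (sin (2 * t))%:C) t by rewrite e2; exact: dr.
rewrite /velocity /circ (derive_mxD _ (diff_mxD (dc H0) (diff_mxZ d1 (dc H1))) (diff_mxZ d2 (dc H2))).
rewrite (derive_mxD _ (dc H0) (diff_mxZ d1 (dc H1))) (derive_mxZ _ d1 (dc H1)) (derive_mxZ _ d2 (dc H2)).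
rewrite !derive_mx_cst !scaler0 !addr0 e1 e2 !Dr !add0r addrC !scalerA; congr (_ *: _ + _ *: _).
  by rewrite -rmorphM; congr (_%:C); ring.
by rewrite -rmorphN -rmorphM; congr (_%:C); ring.
Qed.

Lemma velocity0_cst (F : R^o -> cmat R m) : smooth_mx setT F -> (forall t, velocity F t = 0) -> forall t, F t = F 0.
Proof.
move=> sF v0 t.
have dF u : derive_mx F u t = 0.
  have -> : t = t *: (1 : R^o) by rewrite /GRing.scale/= mulr1.
  by rewrite (derive_mxZv _ _ (smooth_mx_diff sF _))// [derive_mx F u 1]v0 scaler0.
suff E : F (0 + 1 *: t) = F 0 by move: E; rewrite scale1r add0r.
apply/matrixP => i j; apply/eqP; rewrite eq_complex; apply/andP; split; apply/eqP.
  apply: (@segment_constant _ _ (fun x => complex.Re (F x i j)) 0 t 1) => // x _.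
  have [s1 _] := sF i j; split; first exact: smooth_diff s1 _.
  by have /matrixP/(_ i j) := dF (0 + x *: t); rewrite !mxE => -[].
apply: (@segment_constant _ _ (fun x => complex.Im (F x i j)) 0 t 1) => // x _.
have [_ s1] := sF i j; split; first exact: smooth_diff s1 _.
by have /matrixP/(_ i j) := dF (0 + x *: t); rewrite !mxE => -[].
Qed.

(* With [K := [c, c']], a geodesic satisfies [K' = [c, c''] = 0] and [c' = [c, K]]. *)
Lemma geodesic_momentum (c : R^o -> cmat R m) : G2_geodesic c ->
  let K t := c t *m velocity c t - velocity c t *m c t in
  (forall t, K t = K 0) /\ forall t, velocity c t = c t *m K t - K t *m c t.
Proof.
move=> [gc sc acc] K; have oT : open (setT : set R^o) := openT.
have sv : smooth_mx setT (velocity c) by exact: smooth_mx_derive sc.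
have dc t : diff_mx c t by exact: smooth_mx_diff sc _.
have dv t : diff_mx (velocity c) t by exact: smooth_mx_diff sv _.
have vt t : c t *m velocity c t + velocity c t *m c t = velocity c t.
  rewrite addrC -[LHS](derive_mxM (1 : R^o) (dc t) (dc t)); congr (derive_mx _ t (1 : R^o)).
  by apply/funext => x; have [_] := gc x.
have cvc t : c t *m velocity c t *m c t = 0.
  have [_ cc _] := gc t; have := congr1 (fun H => c t *m H *m c t) (vt t).
  rewrite mulmxDr mulmxDl !mulmxA cc -[X in _ + X]mulmxA cc => /eqP.
  by rewrite addrC -subr_eq0 addrK => /eqP.
split=> [t|t].
  apply: velocity0_cst => [|u]; first exact: smooth_mxB oT (smooth_mxM oT sc sv) (smooth_mxM oT sv sc).
  rewrite /velocity (derive_mxB _ (diff_mxM (dc u) (dv u)) (diff_mxM (dv u) (dc u))).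
  rewrite (derive_mxM _ (dc u) (dv u)) (derive_mxM _ (dv u) (dc u)) -/(velocity c u).
  have [_ cc _] := gc u; have := acc u; rewrite /velocity.
  move: (derive_mx (velocity c) u 1) (velocity c u) (c u) cc => w v P cc h.
  have ok : nc_ok [:: P; w] [:: (0, 0, NRlet 0)]%N by split.
  have h1 : P *m w = P *m w *m P.
    have e1 : P *m G2_proj P w = P *m w - P *m w *m P by rewrite /G2_proj; nc ok; ring.
    by apply/eqP; rewrite -subr_eq0 -e1 h mulmx0.
  have h2 : w *m P = P *m w *m P.
    have e1 : G2_proj P w *m P = w *m P - P *m w *m P by rewrite /G2_proj; nc ok; ring.
    by apply/eqP; rewrite -subr_eq0 -e1 h mul0mx.
  by rewrite h1 h2 [in X in _ - X]addrC subrr.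
have [_ cc _] := gc t; have := cvc t; have := vt t; rewrite /K.
move: (velocity c t) (c t) cc => v P cc e z.
rewrite mulmxBr mulmxBl !mulmxA cc z -(mulmxA v) cc subr0 sub0r opprK.
by rewrite e.
Qed.

(** Both curves have the same conserved momentum [K], so their difference solves the linear equation
    [d' = [d, K]]. This preserves the norm of [d], which is 0 at the start. *)
Lemma geodesic_unique (c1 c2 : R^o -> cmat R m) : G2_geodesic c1 -> G2_geodesic c2 -> c1 0 = c2 0 ->
  velocity c1 0 = velocity c2 0 -> forall t, c1 t = c2 t.
Proof.
move=> g1 g2 e0 e1 t; have [K1 v1] := geodesic_momentum g1; have [K2 v2] := geodesic_momentum g2.
have [gc1 sc1 _] := g1; have [gc2 sc2 _] := g2; have oT : open (setT : set R^o) := openT.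
set K := c1 0 *m velocity c1 0 - velocity c1 0 *m c1 0 in K1.
have K2' u : c2 u *m velocity c2 u - velocity c2 u *m c2 u = K by rewrite K2 /K e0 e1.
clearbody K; pose d u := c1 u - c2 u.
have sd : smooth_mx setT d := smooth_mxB oT sc1 sc2.
have vd u : velocity d u = d u *m K - K *m d u.
  rewrite /velocity (derive_mxB _ (smooth_mx_diff sc1 _) (smooth_mx_diff sc2 _))// -/(velocity c1 u) -/(velocity c2 u).
  rewrite v1 v2 K1 K2' /d mulmxBl mulmxBr; move: (_ *m K) (K *m _) (_ *m K) (K *m _) => a b a' b'.
  by rewrite !opprB addrACA [RHS]addrACA; congr (_ + _); rewrite addrC.
have hd : (d t)^t* = d t.
  by have [h1 _ _] := gc1 t; have [h2 _ _] := gc2 t; rewrite /d adjB h1 h2.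
suff : gmet (d t) (d t) = 0.
  rewrite /gmet => /eqP; rewrite mulf_eq0 invr_eq0 pnatr_eq0 orbF => /eqP; rewrite -{2}hd => h.
  by apply/eqP; rewrite -subr_eq0; apply/eqP; exact: Re_tr_adj_eq0.
have dd u : diff_mx d u by exact: smooth_mx_diff sd _.
suff E : gmet (d (0 + 1 *: t)) (d (0 + 1 *: t)) = gmet (d 0) (d 0).
  by move: E; rewrite scale1r add0r /d e0 subrr gmet0l.
apply: (@segment_constant _ _ (fun x => gmet (d x) (d x)) 0 t 1) => // x _.
have dg : differentiable (fun x => gmet (d x) (d x) : R^o) (0 + x *: t) by exact: diff_gmet.
split=> //; rewrite derive_gmet//.
have -> : derive_mx d (0 + x *: t) t = t%:C *: velocity d (0 + x *: t).
  rewrite -derive_mxZv//; congr (derive_mx _ _ _).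
  by rewrite /GRing.scale/= mulr1.
rewrite gmetZl gmetZr (gmetC (d _)) vd; move: (d _) => D.
suff -> : gmet (D *m K - K *m D) D = 0 by rewrite mulr0 addr0.
by rewrite /gmet mulmxBl linearB/= -(mulmxA D) (mxtrace_mulC D) subrr mul0r.
Qed.

Section Clifford.
Context (Z A B : cmat R m).
Context (hZ : Z^t* = Z) (hA : A^t* = A) (hB : B^t* = B) (tZ : \tr Z = 4).
Context (ZZ : Z *m Z = Z) (ZA : Z *m A = A) (AZ : A *m Z = A) (ZB : Z *m B = B) (BZ : B *m Z = B).
Context (AA : A *m A = Z) (BB : B *m B = Z) (AB : A *m B + B *m A = 0).

(** [A] and [B] are anticommuting Hermitian involutions of the four-dimensional image of [Z], so
    [cos 2t A + sin 2t B] is again an involution, and [arc] projects onto its eigenspace for 1. The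
    doubled angle makes [B] the initial velocity. *)
Definition arc := circ (2^-1 *: Z) (2^-1 *: A) (2^-1 *: B).

Lemma arcE t : arc t = 2^-1 *: (Z + ((cos (2 * t))%:C *: A + (sin (2 * t))%:C *: B)).
Proof. by rewrite /arc /circ !scalerA !(mulrC _ 2^-1) -!scalerA -!scalerDr addrA. Qed.

Lemma clifford_sq (x y : R) : x ^+ 2 + y ^+ 2 = 1 -> (x%:C *: A + y%:C *: B) *m (x%:C *: A + y%:C *: B) = Z.
Proof.
move=> xy; have -> : (x%:C *: A + y%:C *: B) *m (x%:C *: A + y%:C *: B) =
    (x%:C * x%:C) *: (A *m A) + (x%:C * y%:C) *: (A *m B + B *m A) + (y%:C * y%:C) *: (B *m B).
  have ok : nc_ok [:: A; B] [::] by [].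
  by nc ok; ring.
by rewrite AA BB AB scaler0 addr0 -scalerDl -!rmorphM -rmorphD -!expr2 xy scale1r.
Qed.

(** Conjugating either generator by the other changes its sign. *)
Lemma clifford_trace : \tr A = 0 /\ \tr B = 0.
Proof.
have BA : B *m A = - (A *m B) by apply/eqP; rewrite -addr_eq0 addrC AB.
have half (z : R[i]) : z = - z -> z = 0.
  by move/eqP; rewrite -subr_eq0 opprK -mulr2n -scaler_nat scaler_eq0 pnatr_eq0 => /eqP.
split; apply: half.
  by rewrite -{1}AZ -BB mulmxA mxtrace_mulC mulmxA BA mulNmx -mulmxA BB AZ linearN.
by rewrite -{1}ZB -AA -mulmxA mxtrace_mulC -mulmxA BA mulmxN mulmxA AA ZB linearN.
Qed.

Lemma arc_idem t : arc t *m arc t = arc t.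
Proof.
have := clifford_sq (cos2Dsin2 (2 * t)); rewrite arcE.
have : Z *m ((cos (2 * t))%:C *: A + (sin (2 * t))%:C *: B) = (cos (2 * t))%:C *: A + (sin (2 * t))%:C *: B.
  by rewrite mulmxDr -!scalemxAr ZA ZB.
have : ((cos (2 * t))%:C *: A + (sin (2 * t))%:C *: B) *m Z = (cos (2 * t))%:C *: A + (sin (2 * t))%:C *: B.
  by rewrite mulmxDl -!scalemxAl AZ BZ.
move: (_ + _ *: B) => T TZ ZT TT.
have ok : nc_ok [:: Z; T] [:: (0, 0, NRlet 0); (0, 1, NRlet 1); (1, 0, NRlet 1); (1, 1, NRlet 0)]%N by [].
by nc ok; field.
Qed.

Lemma arc_G2 t : G2 R m (arc t).
Proof.
have idm := arc_idem t; have [tA tB] := clifford_trace.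
have r2 : (2^-1 : R[i])^*%C = 2^-1 by rewrite -(rmorph_nat (real_complex R)) -fmorphV conjc_real.
split=> //; first by rewrite arcE adjZ !adjD !adjZ !conjc_real hZ hA hB r2.
have := idem_trace idm; rewrite arcE mxtraceZ !mxtraceD !mxtraceZ tA tB tZ !mulr0 !addr0.
have -> : (2^-1 : R[i]) * 4 = 2%:R by rewrite -[4]/(2 * 2)%N%:R natrM mulKf ?pnatr_eq0.
by move/eqP; rewrite eqr_nat eq_sym => /eqP.
Qed.

Lemma arc_velocity t : velocity arc t = circ 0 B (- A) t.
Proof.
rewrite /arc velocity_circ; have two : (2%:C : R[i]) * 2^-1 = 1 by rewrite rmorph_nat mulfV ?pnatr_eq0.
by congr circ; rewrite scalerA ?mulNr two ?scaleN1r ?scale1r.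
Qed.

Lemma arc_geodesic : G2_geodesic arc.
Proof.
split=> [t||t]; [exact: arc_G2|exact: circ_smooth|].
(* The acceleration [2 Z - 4 arc] commutes with the arc and so has no tangential part. *)
have -> : velocity (velocity arc) t = 2%:C *: Z - 4%:C *: arc t.
  have -> : velocity arc = circ 0 B (- A) by apply/funext => x; exact: arc_velocity.
  rewrite velocity_circ /arc /circ add0r.
  have ok : nc_ok [:: Z; A; B] [::] by [].
  by rewrite !rmorph_nat; nc ok; field.
have id := arc_idem t.
have cZ : arc t *m Z = arc t.
  by rewrite arcE -scalemxAl !mulmxDl -!scalemxAl ZZ AZ BZ.
have Zc : Z *m arc t = arc t.
  by rewrite arcE -scalemxAr !mulmxDr -!scalemxAr ZZ ZA ZB.
move: (arc t) id cZ Zc => P PP PZ ZP; rewrite /G2_proj.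
have ok : nc_ok [:: Z; P] [:: (0, 0, NRlet 0); (0, 1, NRlet 1); (1, 0, NRlet 1); (1, 1, NRlet 1)]%N by [].
by nc ok; ring.
Qed.

Lemma arc0 : arc 0 = 2^-1 *: (Z + A) /\ velocity arc 0 = B.
Proof.
rewrite arc_velocity arcE /circ mulr0 cos0 sin0 !scale0r !scale1r addr0 add0r addr0.
by [].
Qed.

End Clifford.

End Circles.

(** * Clifford triples from a tangent vector or from a pair of planes *)

Section Clifford_data.
Context {R : realType} {m : nat}.
Implicit Types (P Q S X Y V B : cmat R m).

Lemma halfD X : 2^-1 *: (X + X) = X.
Proof. by have ok : nc_ok [:: X] [::] by []; nc ok; field. Qed.

Lemma conjcZ_real (a : R) (x : R[i]) : conjc (a%:C * x) = a%:C * conjc x.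
Proof. by case: x => x y /=; congr (_ +i* _); ring. Qed.

Definition clifford Z A B :=
  [/\ [/\ Z^t* = Z, A^t* = A, B^t* = B & \tr Z = 4 :> R[i]],
      [/\ Z *m Z = Z, Z *m A = A, A *m Z = A, Z *m B = B & B *m Z = B] &
      [/\ A *m A = Z, B *m B = Z & A *m B + B *m A = 0 :> cmat R m]].

(** [B] exchanges the plane isometrically with an orthogonal one; [B^2] projects onto their sum, and
    [2P - B^2] is the reflection of this sum in the plane. *)
Lemma tangent_clifford P B : G2 R m P -> G2_tangent P B -> B *m B *m P = P ->
  clifford (B *m B) (P + P - B *m B) B.
Proof.
move=> gP [hB eB] BBP; have [hP PP _] := gP; have tP := G2_trace gP.
have PB : P *m B = B - B *m P by rewrite -{2}eB addrK.
have BP : B *m P = B - P *m B by rewrite -{2}eB addrC addKr.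
have PBB : P *m (B *m B) = P.
  by rewrite mulmxA PB mulmxBl -(mulmxA B P) PB mulmxBr !mulmxA opprB addrC subrK.
have BBB : B *m B *m B = B.
  have e1 : B *m B *m (P *m B) = P *m B by rewrite mulmxA BBP.
  have e2 : B *m B *m (B *m P) = B *m P by rewrite -!mulmxA (mulmxA B B P) BBP.
  by rewrite -{3}eB mulmxDr e1 e2 eB.
have tr4 : \tr (B *m B) = 4.
  have t2 : \tr (B *m B *m P) = 2 by rewrite BBP tP.
  have : \tr (B *m B) = \tr (B *m (P *m B)) + \tr (B *m (B *m P)) by rewrite -linearD/= -mulmxDr eB.
  have -> : \tr (B *m (P *m B)) = 2 by rewrite mxtrace_mulC -mulmxA (mxtrace_mulC P) t2.
  by rewrite (mulmxA B B) t2 => ->; rewrite -natrD.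
have hZ : (B *m B)^t* = B *m B by rewrite adjM hB.
have ok0 : nc_ok [:: P; B; B *m B] [:: (0, 0, NRlet 0); (1, 1, NRlet 2); (2, 0, NRlet 0); (0, 2, NRlet 0);
   (2, 1, NRlet 1); (1, 2, NRlet 1); (2, 2, NRlet 2)]%N.
  by do !split => //=; rewrite ?mulmxA ?BBB// -mulmxA.
have ABx : (P + P - B *m B) *m B + B *m (P + P - B *m B) = (P *m B + B *m P) + (P *m B + B *m P) - B - B.
  by move: (B *m B) ok0 => Z ok0; nc ok0; ring.
have AB0 : (P + P - B *m B) *m B + B *m (P + P - B *m B) = 0 by rewrite ABx eB -addrA -opprD subrr.
move: (B *m B) ok0 hZ tr4 AB0 {ABx BBB PBB BBP} => Z ok0 hZ tr4 AB0.
have zz : Z *m Z = Z by case: ok0 => _ [_ [_ [_ [_ [_ []]]]]].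
have zb : Z *m B = B by case: ok0 => _ [_ [_ [_ []]]].
have bz : B *m Z = B by case: ok0 => _ [_ [_ [_ [_ []]]]].
have bb : B *m B = Z by case: ok0 => _ [].
split; [split=> //; by rewrite adjB adjD hP hZ|split=> //; by nc ok0; ring|split=> //; by nc ok0; ring].
Qed.

(** By hypothesis the planes are isoclinic, both principal angles having cosine [|c|]. [Z] is
    [(Q - S)^2 / s^2], the projection onto their sum, and [Q], [S] are the points with coefficients
    [(c, s)] and [(c, - s)] of the arc. *)
Lemma pair_clifford Q S (c s : R) : G2 R m Q -> S^t* = S -> S *m S = S -> \tr S = 2 ->
  c ^+ 2 + s ^+ 2 = 1 -> c != 0 -> s != 0 ->
  Q *m S *m Q = (c ^+ 2)%:C *: Q -> S *m Q *m S = (c ^+ 2)%:C *: S ->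
  let Z := ((s ^+ 2)^-1)%:C *: (Q + S - Q *m S - S *m Q) in
  clifford Z ((c^-1)%:C *: (Q + S - Z)) ((s^-1)%:C *: (Q - S)).
Proof.
move=> gQ hS SS tS cs c0 s0 QSQ SQS Z; have [hQ QQ _] := gQ; have tQ := G2_trace gQ.
have ok : nc_ok [:: Q; S] [:: (0, 0, NRlet 0); (1, 1, NRlet 1)]%N by [].
pose D := Q + S - Q *m S - S *m Q.
have y0 : s ^+ 2 != 0 by rewrite expf_neq0.
have y1 : ((s ^+ 2)^-1)%:C * (s ^+ 2)%:C = 1 :> R[i] by rewrite -rmorphM mulVf.
have ZD : (s ^+ 2)%:C *: Z = D by rewrite scalerA mulrC y1 scale1r.
have cc : Q - (c ^+ 2)%:C *: Q = (s ^+ 2)%:C *: Q.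
  by rewrite -{1}(scale1r Q) -scalerBl -(rmorph1 (real_complex R)) -rmorphB -cs addrC addKr.
have cS : S - (c ^+ 2)%:C *: S = (s ^+ 2)%:C *: S.
  by rewrite -{1}(scale1r S) -scalerBl -(rmorph1 (real_complex R)) -rmorphB -cs addrC addKr.
have ZQ : Z *m Q = Q.
  have e : D *m Q = Q - Q *m S *m Q by rewrite /D; nc ok; ring.
  by rewrite /Z -scalemxAl e QSQ cc scalerA y1 scale1r.
have QZ : Q *m Z = Q.
  have e : Q *m D = Q - Q *m S *m Q by rewrite /D; nc ok; ring.
  by rewrite /Z -scalemxAr e QSQ cc scalerA y1 scale1r.
have ZS : Z *m S = S.
  have e : D *m S = S - S *m Q *m S by rewrite /D; nc ok; ring.
  by rewrite /Z -scalemxAl e SQS cS scalerA y1 scale1r.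
have SZ : S *m Z = S.
  have e : S *m D = S - S *m Q *m S by rewrite /D; nc ok; ring.
  by rewrite /Z -scalemxAr e SQS cS scalerA y1 scale1r.
have ZZ : Z *m Z = Z.
  rewrite {2}/Z -scalemxAr !mulmxBr mulmxDr (mulmxA Z Q) (mulmxA Z S) ZQ ZS; reflexivity.
have tQS : \tr (Q *m S) = 2 * (c ^+ 2)%:C.
  by rewrite -{1}QQ -mulmxA mxtrace_mulC QSQ mxtraceZ tQ mulrC.
have hZ : Z^t* = Z.
  by rewrite /Z adjZ conjc_real !adjB adjD !adjM hQ hS -[LHS]/(_ *: (Q + S - S *m Q - Q *m S)) addrAC.
have tZ : \tr Z = 4.
  have : \tr D = 4 * (s ^+ 2)%:C.
    rewrite /D !linearB/= linearD/= (mxtrace_mulC S) tQS tQ tS.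
    have -> : s ^+ 2 = 1 - c ^+ 2 by rewrite -cs addrAC subrr add0r.
    by rewrite rmorphB rmorph1; ring.
  by rewrite /Z mxtraceZ => ->; rewrite mulrCA y1 mulr1.
clearbody Z; have okZ : nc_ok [:: Q; S; Z] [:: (0, 0, NRlet 0); (1, 1, NRlet 1); (2, 0, NRlet 0); (0, 2, NRlet 0);
  (2, 1, NRlet 1); (1, 2, NRlet 1); (2, 2, NRlet 2)]%N by [].
have c1 : (c^-1)%:C * (c^-1)%:C * (c ^+ 2)%:C = 1 :> R[i].
  by rewrite -!rmorphM -invfM -expr2 mulVf// expf_neq0.
have s1 : (s^-1)%:C * (s^-1)%:C = ((s ^+ 2)^-1)%:C :> R[i] by rewrite -rmorphM -invfM -expr2.
have AA0 : (Q + S - Z) *m (Q + S - Z) = (c ^+ 2)%:C *: Z.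
  have -> : (Q + S - Z) *m (Q + S - Z) = Z - D by rewrite /D; move: (Z) okZ => Z' ok'; nc ok'; ring.
  rewrite -ZD -{1}(scale1r Z) -scalerBl -(rmorph1 (real_complex R)) -rmorphB -cs; congr (_%:C *: _); ring.
have BB0 : (Q - S) *m (Q - S) = D by rewrite /D; nc ok; ring.
have AB0 : (Q + S - Z) *m (Q - S) + (Q - S) *m (Q + S - Z) = 0 by move: (Z) okZ => Z' ok'; nc ok'; ring.
split; split=> //.
- by rewrite adjZ conjc_real adjB adjD hQ hS hZ.
- by rewrite adjZ conjc_real adjB hQ hS.
- by rewrite -scalemxAr !(mulmxBr, mulmxDr) ZQ ZS ZZ.
- by rewrite -scalemxAl !(mulmxBl, mulmxDl) QZ SZ ZZ.
- by rewrite -scalemxAr mulmxBr ZQ ZS.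
- by rewrite -scalemxAl mulmxBl QZ SZ.
- by rewrite -scalemxAl -scalemxAr AA0 !scalerA c1 scale1r.
- by rewrite -scalemxAl -scalemxAr BB0 !scalerA s1 -ZD scalerA y1 scale1r.
- by rewrite -!scalemxAl -!scalemxAr !scalerA (mulrC (s^-1)%:C) -scalerDr AB0 scaler0.
Qed.

Lemma clifford_pair_trace Z A B (x y : R) : clifford Z A B -> x ^+ 2 + y ^+ 2 = 1 ->
  \tr (2^-1 *: (Z + (x%:C *: A + y%:C *: B)) *m (2^-1 *: (Z + (x%:C *: A + y%:C *: ((-1)%:C *: B))))) =
  2 * x%:C ^+ 2.
Proof.
move=> [[hZ hA hB tZ] [ZZ ZA AZ ZB BZ] [AA BB AB]] xy.
have [tA tB] := clifford_trace AZ ZB AA BB AB.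
have -> : 2^-1 *: (Z + (x%:C *: A + y%:C *: B)) *m (2^-1 *: (Z + (x%:C *: A + y%:C *: ((-1)%:C *: B)))) =
   4^-1 *: (Z *m Z + x%:C *: (Z *m A) - y%:C *: (Z *m B) + x%:C *: (A *m Z) + (x%:C ^+ 2) *: (A *m A) +
     y%:C *: (B *m Z) - (y%:C ^+ 2) *: (B *m B) + (x%:C * y%:C) *: (B *m A - A *m B)).
  have ok : nc_ok [:: Z; A; B] [::] by [].
  by rewrite (rmorphN1 (real_complex R)); nc ok; field.
have tBA : \tr (B *m A - A *m B) = 0 by rewrite linearB/= mxtrace_mulC subrr.
rewrite ZZ ZA ZB AZ AA BZ BB; move: (B *m A - A *m B) tBA => F tF.
rewrite mxtraceZ !(mxtraceD, raddfB (@mxtrace R[i] m.+2), mxtraceZ, raddfN (@mxtrace R[i] m.+2)) /= tZ tA tB tF.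
rewrite ?mxtraceZ ?tZ ?tB !mulr0 !(addr0, subr0) (sqr_compl xy).
rewrite ?mxtraceZ ?tZ ?tB ?mulr0; by field.
Qed.

End Clifford_data.

(** * The tube around the quaternionic lines as a level set *)

Section Tube.
Context {R : realType} {m : nat} (O : cmat R m) (OO : O *m O^t* = 1%:M) (OT : O^T = - O).
Implicit Types (P Q X Y V B : cmat R m).

(** The action on matrices of the quaternionic structure [v -> O (conj v)]: an involutive isometry
    whose fixed planes are the quaternionic lines. *)
Definition quat_conj X := O *m map_mx conjc X *m O^t*.
Local Notation th := quat_conj.
Local Notation cj := (map_mx conjc).

Let cjM X Y : cj (X *m Y) = cj X *m cj Y.
Proof. by apply/matrixP => i j; rewrite !mxE rmorph_sum; apply: eq_bigr => l _; rewrite rmorphM !mxE. Qed.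
Let cjT X : cj X = (X^t*)^T. Proof. by apply/matrixP => i j; rewrite !mxE. Qed.
Let OO' : O^t* *m O = 1%:M. Proof. exact: mulmx1C. Qed.

Lemma thM X Y : th (X *m Y) = th X *m th Y.
Proof.
rewrite /th cjM; move: (cj X) (cj Y) (O^t*) OO' => x y o oo.
by rewrite !mulmxA -(mulmxA _ o O) oo mulmx1.
Qed.

Lemma thD X Y : th (X + Y) = th X + th Y.
Proof.
have -> : th (X + Y) = O *m (cj X + cj Y) *m O^t* by congr (_ *m _ *m _); apply/matrixP => i j; rewrite !mxE rmorphD.
by rewrite mulmxDr mulmxDl.
Qed.

Lemma thZ (a : R) X : th (a%:C *: X) = a%:C *: th X.
Proof.
have -> : th (a%:C *: X) = O *m (a%:C *: cj X) *m O^t*.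
  by congr (_ *m _ *m _); apply/matrixP => i j; rewrite !mxE; exact: conjcZ_real.
by rewrite -scalemxAr -scalemxAl.
Qed.

Lemma thN X : th (- X) = - th X.
Proof. by have := thZ (-1) X; rewrite !(rmorphN1 (real_complex R)) !scaleN1r. Qed.

Lemma thK X : th (th X) = X.
Proof.
have cO : O *m cj O = - 1%:M by rewrite cjT; exact: conjX_mul.
have cO' : cj (O^t*) *m O^t* = - 1%:M.
  have -> : cj (O^t*) = O^T by apply/matrixP => i j; rewrite !mxE; exact: conjcK.
  by move: (O^t*) OO => o oo; rewrite OT mulNmx oo.
rewrite /th !cjM; have -> : cj (cj X) = X by apply/matrixP => i j; rewrite !mxE; exact: conjcK.
move: (cj O) (O^t*) (cj (O^t*)) cO cO' => o1 o3 o2 e1 e2.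
by rewrite !mulmxA e1 -(mulmxA _ o2) e2 mulmxN mulmx1 mulNmx mul1mx opprK.
Qed.

Lemma th_adj X : th (X^t*) = (th X)^t*.
Proof.
have e : cj (X^t*) = (cj X)^t* by apply/matrixP => i j; rewrite !mxE.
by rewrite /th e; move: (cj X) => Y; rewrite adjM adjM adjK mulmxA.
Qed.

Lemma th_tr X : \tr (th X) = (\tr X)^*%C.
Proof.
by rewrite /th mxtrace_mulC mulmxA OO' mul1mx cjT mxtrace_tr tr_adj.
Qed.

Lemma gmet_th X Y : gmet (th X) (th Y) = gmet X Y.
Proof. by rewrite /gmet -thM th_tr ReJ. Qed.

Lemma th_fixedP P : th P = P <-> P *m O = O *m cj P.
Proof.
split=> [e|e]; last by rewrite /th -e -mulmxA OO mulmx1.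
by rewrite -{1}e /th -mulmxA OO' mulmx1.
Qed.

(** A self-adjoint quaternion-linear endomorphism of a quaternionic line is a real scalar. In terms
    of matrices, [G] fixes the alternating form [P O] up to its trace by [alt_form_trace], and [O]
    is invertible. *)
Lemma th_fixed_scalar P G : G2 R m P -> th P = P -> th G = G -> G^t* = G -> P *m G = G -> G *m P = G ->
  G = (\tr G / 2) *: P.
Proof.
move=> gP tP tG hG PG GP; have [hP PP _] := gP.
have cj_herm (H : cmat R m) : H^t* = H -> cj H = H^T by move=> h; rewrite cjT h.
have /th_fixedP := tP; rewrite (cj_herm _ hP) => PO.
have /th_fixedP := tG; rewrite (cj_herm _ hG) => GO.
have ao : alt_form P (P *m O).
  split; last by rewrite mulmxA PP.
  by rewrite trmx_mul OT mulNmx PO.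
have := alt_form_trace gP ao PG GP.
rewrite mulmxA GP -mulmxA -GO mulmxA PG -mulr2n -scaler_nat => E.
have E2 : G *m O = (\tr G / 2) *: (P *m O).
  apply: (@scalerI _ _ 2%:R); first by rewrite pnatr_eq0.
  by rewrite E scalerA mulrCA mulfV ?mulr1// pnatr_eq0.
have := congr1 (fun H => H *m O^t*) E2; move: (O^t*) OO => o oo.
by rewrite -scalemxAl -!mulmxA oo !mulmx1.
Qed.

(** Whether the structure fixes or reverses [V], it fixes [V^2], which is therefore scalar on the
    quaternionic line. *)
Lemma th_tangent_sq P V (e : R) : G2 R m P -> th P = P -> G2_tangent P V -> th V = e%:C *: V -> e * e = 1 ->
  V *m V *m P = (gmet V V)%:C *: P.
Proof.
move=> gP tP [hV eV] tV ee; have [hP PP _] := gP; have tr2 := G2_trace gP.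
have PV : P *m V = V - V *m P by rewrite -{2}eV addrK.
have PVV : P *m (V *m V) = V *m V *m P.
  by rewrite mulmxA PV mulmxBl -(mulmxA V P) PV mulmxBr !mulmxA opprB addrC subrK.
pose G := V *m V *m P.
have GP : G *m P = G by rewrite /G -mulmxA PP.
have PG : P *m G = G by rewrite /G mulmxA PVV GP.
have hG : G^t* = G by rewrite /G !adjM hV hP PVV.
have tG : th G = G by rewrite /G !thM tV tP -scalemxAl -scalemxAr !scalerA -rmorphM ee scale1r.
have t2 : \tr (V *m V) = \tr G + \tr G.
  have -> : \tr (V *m V) = \tr (V *m (P *m V)) + \tr (V *m (V *m P)) by rewrite -linearD/= -mulmxDr eV.
  by rewrite mxtrace_mulC -(mulmxA P) PVV -/G /G mulmxA.
have := th_fixed_scalar gP tP tG hG PG GP; rewrite -/G => ->; congr (_ *: _).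
have rG : (\tr G)^*%C = \tr G by rewrite -tr_adj hG.
rewrite /gmet t2; move: (\tr G) rG => [x y]/= /eqP; rewrite eq_complex/= => /andP[_ /eqP yy].
have y0 : y = 0 by lra.
by apply/eqP; rewrite eq_complex y0/=; apply/andP; split; apply/eqP; field.
Qed.

Definition quat_fixed : set (cmat R m) := [set P | G2 R m P /\ th P = P].

Lemma quat_fixed_velocity (b : R^o -> cmat R m) t : smooth_mx setT b -> (forall t, quat_fixed (b t)) ->
  th (velocity b t) = velocity b t.
Proof.
move=> sb fb; have oT : open (setT : set R^o) := openT.
have db : diff_mx b t by exact: smooth_mx_diff sb _.
have dc (H : cmat R m) : diff_mx (fun _ : R^o => H) t by exact: diff_mx_cst.
have e : b = (fun x => O *m cj (b x) *m O^t*) by apply/funext => x; have [_ h] := fb x; exact: esym h.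
rewrite {2}/velocity {2}e (derive_mxM _ (diff_mxM (dc O) (diff_mxJ db)) (dc (O^t*))).
by rewrite (derive_mxM _ (dc O) (diff_mxJ db)) !derive_mx_cst mul0mx add0r mulmx0 addr0 derive_mxJ.
Qed.

Lemma arc_th Z A B (e : R) t : th Z = Z -> th A = A -> th B = e%:C *: B ->
  th (arc Z A B t) = arc Z A (e%:C *: B) t.
Proof.
move=> tZ tA tB; have half H : (2^-1 : R[i]) *: H = (2^-1)%:C *: H by rewrite fmorphV rmorph_nat.
by rewrite !arcE !half thZ !thD !thZ tZ tA tB.
Qed.

(** [Q (th Q) Q] is the alternating form [Q O Q^T] times its adjoint, hence scalar: [Q] and [th Q]
    are isoclinic and the level fixes their angle. The midpoint of the arc between them is fixed by
    [th] and its velocity is reversed, which makes it orthogonal to all velocities inside the fixed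
    set. *)
Lemma level_tube Q (r : R) : G2 R m Q -> \tr (Q *m th Q) = 2 * (cos (2 * r))%:C ^+ 2 ->
  cos (2 * r) != 0 -> sin (2 * r) != 0 -> tube r quat_fixed Q.
Proof.
move=> gQ trQ c0 s0; have [hQ QQ _] := gQ; set c := cos _ in trQ c0; set s := sin _ in s0.
have cs : c ^+ 2 + s ^+ 2 = 1 by exact: cos2Dsin2.
pose S := th Q.
have SS : S *m S = S by rewrite -thM QQ.
have hS : S^t* = S by rewrite -th_adj hQ.
have tS : \tr S = 2 by rewrite th_tr (G2_trace gQ) conjc_nat.
have QSQ : Q *m S *m Q = (c ^+ 2)%:C *: Q.
  have cjQ : cj Q = Q^T by rewrite cjT hQ.
  have aT : (Q *m O *m Q^T)^T = - (Q *m O *m Q^T) by rewrite trmx_mul trmxK trmx_mul OT mulNmx mulmxN mulmxA.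
  have ao : alt_form Q (Q *m O *m Q^T) by split=> //; rewrite !mulmxA QQ.
  have QTa : (Q^T)^t* = Q^T by rewrite -{2}hQ; apply/matrixP => i j; rewrite !mxE.
  have e : (Q *m O *m Q^T) *m (Q *m O *m Q^T)^t* = Q *m S *m Q.
    rewrite adjM (adjM Q) QTa hQ /S /th cjQ; move: (O^t*) => o.
    by rewrite !mulmxA -(mulmxA _ Q^T Q^T) -trmx_mul QQ.
  have := alt_form_norm gQ ao; rewrite e => ->; congr (_%:C *: _).
  rewrite /gmet e mxtrace_mulC mulmxA QQ trQ -rmorphXn.
  have two (x : R) : complex.Re (2 * x%:C) = 2 * x by rewrite mulrDl mul1r /=; ring.
  by rewrite two; field.
have SQS : S *m Q *m S = (c ^+ 2)%:C *: S.
  by have := congr1 th QSQ; rewrite (thM (Q *m S)) (thM Q) thZ (thK Q : th S = Q).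
pose Z := ((s ^+ 2)^-1)%:C *: (Q + S - Q *m S - S *m Q).
pose A := (c^-1)%:C *: (Q + S - Z); pose B := (s^-1)%:C *: (Q - S).
have cl : clifford Z A B := pair_clifford gQ hS SS tS cs c0 s0 QSQ SQS.
have [[hZ hA hB tZ] [ZZ ZA AZ ZB BZ] [AA BB AB]] := cl.
have tS' : th S = Q by exact: thK.
have tZ' : th Z = Z.
  rewrite /Z thZ !(thD, thN) (thM Q) (thM S) tS' -/S; congr (_ *: _).
  by rewrite -!addrA addrCA; congr (_ + (_ + _)); rewrite addrC.
have tA' : th A = A by rewrite /A thZ !(thD, thN) tZ' tS' -/S (addrC S).
have tB' : th B = (-1)%:C *: B.
  by rewrite /B thZ thD thN tS' -/S (rmorphN1 (real_complex R)) scaleN1r -scalerN opprB.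
have eQ : Z + (c%:C *: A + s%:C *: B) = Q + Q.
  rewrite /A /B !scalerA -!rmorphM !mulfV// !rmorph1 !scale1r.
  by have ok : nc_ok [:: Z; Q; S] [::] by []; move: (Z) ok => Z' ok; nc ok; ring.
clearbody B; clearbody A; clearbody Z.
exists (arc Z A B); have [a0 v0] := arc0 Z A B; split.
- exact: arc_geodesic.
- split; first exact: arc_G2.
  have half H : (2^-1 : R[i]) *: H = (2^-1)%:C *: H by rewrite fmorphV rmorph_nat.
  by rewrite a0 half thZ thD tZ' tA'.
- rewrite v0; split.
  + split=> //; rewrite a0 -scalemxAl -scalemxAr -scalerDr mulmxDl mulmxDr ZB BZ addrACA AB addr0.
    by rewrite halfD.
  + by rewrite /gmet BB tZ /= -[4]/(4%:R) ; field.
  + move=> b sb fb b0; have := gmet_th B (velocity b 0); rewrite (quat_fixed_velocity 0 sb fb) tB' gmetZl mulN1r.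
    by move/eqP; rewrite eq_sym -subr_eq0 opprK -mulr2n mulrn_eq0 => /eqP.
by rewrite arcE -/c -/s eQ halfD.
Qed.

(** Normalized, [V] generates a Clifford arc all of whose points are fixed. Arcs have unit speed, so
    the velocity is only proportional to [V]. *)
Lemma quat_fixed_curve P V : quat_fixed P -> G2_tangent P V -> th V = V -> gmet V V != 0 ->
  exists b : R^o -> cmat R m, [/\ smooth_mx setT b, forall t, quat_fixed (b t), b 0 = P &
    exists2 l : R, l != 0 & velocity b 0 = l%:C *: V].
Proof.
move=> [gP tP] gV tV V0; have [hV eV] := gV.
have V1 : 0 < gmet V V by rewrite lt_neqAle eq_sym V0 gmet_ge0.
pose l := (Num.sqrt (gmet V V))^-1; pose B := l%:C *: V.
have l0 : l != 0 by rewrite invr_neq0// gt_eqF// sqrtr_gt0.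
have l2 : l * l * gmet V V = 1 by rewrite -invfM -expr2 sqr_sqrtr ?ltW// mulVf.
have tB : th B = B by rewrite thZ tV.
have gB : G2_tangent P B.
  by split; [rewrite adjZ conjc_real hV|rewrite -scalemxAr -scalemxAl -scalerDr eV].
have BB : B *m B *m P = P.
  have tV1 : th V = (1 : R)%:C *: V by rewrite scale1r.
  rewrite /B -!scalemxAl -!scalemxAr -!scalemxAl (th_tangent_sq gP tP gV tV1) ?mulr1//.
  by rewrite !scalerA -!rmorphM l2 scale1r.
have cl := tangent_clifford gP gB BB.
have [[hZ hA hB tZ] [ZZ ZA AZ ZB BZ] [AA BB' AB]] := cl.
have tZ' : th (B *m B) = B *m B by rewrite thM tB.
have tA' : th (P + P - B *m B) = P + P - B *m B by rewrite !(thD, thN) tP tZ'.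
exists (arc (B *m B) (P + P - B *m B) B).
have [a0 v0] := arc0 (B *m B) (P + P - B *m B) B; split.
- exact: circ_smooth.
- move=> t; split; first exact: arc_G2.
  have tB1 : th B = (1 : R)%:C *: B by rewrite scale1r.
  by rewrite (arc_th t tZ' tA' tB1) scale1r.
- by rewrite a0 (addrC (_ *m _)) subrK halfD.
- by exists l.
Qed.

(** The fixed vector [v + th v] is the velocity of a curve of quaternionic lines up to scale, so a
    normal [v] must be reversed by [th]. Then [v^2] is scalar on the line, the geodesic is a
    Clifford arc, and [th] reverses its parameter. *)
Lemma tube_level Q (r : R) : tube r quat_fixed Q -> G2 R m Q /\ \tr (Q *m th Q) = 2 * (cos (2 * r))%:C ^+ 2.
Proof.
move=> [g [geo [gP tP] [gv nv perp] ->]]; have [gc _ _] := geo; split; first exact: gc.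
have [hv ev] := gv; set P := g 0 in gP tP gv nv perp ev; set v := velocity g 0 in gv nv perp hv ev.
have gtv : G2_tangent P (th v).
  split; first by rewrite -th_adj hv.
  by have := congr1 th ev; rewrite thD !thM tP.
pose u := v + th v.
have tu : th u = u by rewrite /u thD thK addrC.
have gu : G2_tangent P u.
  by case: gtv => h1 h2; split; [rewrite adjD hv h1|rewrite mulmxDr mulmxDl addrACA ev h2].
have uu : gmet u u = 2 * gmet v u.
  have e1 : gmet (th v) u = gmet v u by rewrite -{1}tu gmet_th.
  by rewrite {1}/u gmetDl e1; ring.
have u0 : gmet u u = 0.
  apply/eqP; apply: contraT => h; have [b [sb fb b0 [l l0 vb]]] := quat_fixed_curve (conj gP tP) gu tu h.
  have := perp b sb fb b0; rewrite vb gmetZr => /eqP; rewrite mulf_eq0 (negPf l0)/= => /eqP e.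
  by move: h; rewrite uu e mulr0 eqxx.
have tv : th v = (-1)%:C *: v.
  have : u = 0.
    have hu : u^t* = u by case: gu.
    move: u0; rewrite /gmet => /eqP; rewrite mulf_eq0 invr_eq0 pnatr_eq0 orbF -{2}hu => /eqP h.
    exact: Re_tr_adj_eq0.
  by rewrite (rmorphN1 (real_complex R)) scaleN1r /u => /eqP; rewrite addrC addr_eq0 => /eqP.
have vv : v *m v *m P = P.
  by rewrite (th_tangent_sq gP tP gv tv) ?mulrNN ?mulr1// nv scale1r.
have cl := tangent_clifford gP gv vv.
have [[hZ hA hB tZ] [ZZ ZA AZ ZB BZ] [AA BB AB]] := cl.
have [a0 v0] := arc0 (v *m v) (P + P - v *m v) v.
have aP : arc (v *m v) (P + P - v *m v) v 0 = P.
  by rewrite a0 (addrC (_ *m _)) subrK halfD.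
have geoA : G2_geodesic (arc (v *m v) (P + P - v *m v) v) by exact: arc_geodesic.
rewrite (geodesic_unique geo geoA (esym aP) (esym v0)).
have tZ' : th (v *m v) = v *m v.
  by rewrite thM tv -scalemxAl -scalemxAr scalerA -rmorphM mulrNN mulr1 scale1r.
have tA' : th (P + P - v *m v) = P + P - v *m v by rewrite !(thD, thN) tP tZ'.
rewrite (arc_th r tZ' tA' tv) !arcE.
exact: clifford_pair_trace cl (cos2Dsin2 (2 * r)).
Qed.

End Tube.

(** * A level set near the hypersurface *)

Section Level_gap.
Context {R : realType} {m : nat}.
Implicit Types (P Q X Y N B : cmat R m).

Lemma Re_mul_le (z w : R[i]) :
  (complex.Re (z * w) ^+ 2 + complex.Im (z * w) ^+ 2) * 4 <=
  ((complex.Re z ^+ 2 + complex.Im z ^+ 2) + (complex.Re w ^+ 2 + complex.Im w ^+ 2)) ^+ 2.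
Proof.
case: z w => [a b] [c d] /=; set u := a ^+ 2 + b ^+ 2; set v := c ^+ 2 + d ^+ 2.
have -> : (a * c - b * d) ^+ 2 + (a * d + b * c) ^+ 2 = u * v by rewrite /u /v; ring.
by have := sqr_ge0 (u - v); nra.
Qed.

(** A crude entrywise estimate; any constant depending on [m] alone would serve. *)
Lemma herm_sq_bound X : X^t* = X ->
  complex.Re (\tr (X *m X *m (X *m X))) <= (2 * m.+2%:R ^+ 2) * complex.Re (\tr (X *m X)) ^+ 2.
Proof.
move=> hX; set y := complex.Re (\tr (X *m X)).
have hXX : (X *m X)^t* = X *m X by rewrite adjM hX.
pose q (z : R[i]) := complex.Re z ^+ 2 + complex.Im z ^+ 2.
have q0 z : 0 <= q z by rewrite addr_ge0// sqr_ge0.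
have Ey : y = \sum_i \sum_j q (X i j) by rewrite /y -{2}hX Re_tr_adj.
have row i : \sum_j q (X i j) <= y.
  by rewrite Ey (bigD1 i (P := xpredT) (F := fun i => \sum_j q (X i j)))//= lerDl sumr_ge0// => l _; exact: sumr_ge0.
have col j : \sum_i q (X i j) <= y.
  by rewrite Ey exchange_big/= (bigD1 j (P := xpredT) (F := fun j => \sum_i q (X i j)))//= lerDl sumr_ge0// => l _; exact: sumr_ge0.
have y0 : 0 <= y by exact: le_trans (sumr_ge0 _ (fun j _ => q0 (X ord0 j))) (row ord0).
have ab (z w : R[i]) : `|complex.Re (z * w)| <= (q z + q w) / 2 /\ `|complex.Im (z * w)| <= (q z + q w) / 2.
  have h := Re_mul_le z w; rewrite -/(q z) -/(q w) in h.
  have p0 : 0 <= (q z + q w) / 2 by rewrite divr_ge0// addr_ge0.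
  split; rewrite -(ler_pXn2r (n := 2))// ?nnegrE// -normrX ger0_norm ?sqr_ge0//.
    by have := sqr_ge0 (complex.Im (z * w)); nra.
  by have := sqr_ge0 (complex.Re (z * w)); nra.
have ent i j : q ((X *m X) i j) <= 2 * y ^+ 2.
  have b (f : R[i] -> R) : (forall a b, f (a + b) = f a + f b) -> f 0 = 0 ->
      (forall z w, `|f (z * w)| <= (q z + q w) / 2) -> f ((X *m X) i j) ^+ 2 <= y ^+ 2.
    move=> fD f0 fb; rewrite mxE.
    have -> : f (\sum_l X i l * X l j) = \sum_l f (X i l * X l j).
      by elim/big_rec2: _ => // l u v _ <-.
    rewrite -(ger0_norm (sqr_ge0 _)) normrX ler_pXn2r// ?nnegrE//.
    apply: (le_trans (ler_norm_sum _ _ _)); apply: (le_trans (ler_sum _ (fun l _ => fb _ _))).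
    rewrite -mulr_suml big_split/=; have := row i; have := col j; lra.
  have b1 := b _ (@ReD R) erefl (fun z w => (ab z w).1).
  have b2 := b (@complex.Im R) (fun u v => (raddfD (@complex.Im R) u v)) erefl (fun z w => (ab z w).2).
  by rewrite /q; lra.
rewrite -{2}hXX Re_tr_adj.
apply: (@le_trans _ _ (\sum_(i < m.+2) \sum_(j < m.+2) 2 * y ^+ 2)).
  by apply: ler_sum => i _; apply: ler_sum => j _; exact: ent.
rewrite !sumr_const !card_ord -!mulrnA -[leLHS]mulr_natr natrM.
by rewrite le_eqVlt; apply/orP; left; apply/eqP; ring.
Qed.

Lemma idem_norm F X : F^t* = F -> F *m F = F -> X^t* = X ->
  complex.Re (\tr (F *m X *m X)) = complex.Re (\tr (F *m X *m (F *m X)^t*)).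
Proof.
move=> hF FF hX; have e : F *m X *m (F *m X)^t* = F *m X *m (X *m F) by rewrite adjM hF hX.
by rewrite e -[in LHS]FF -!mulmxA [in LHS]mxtrace_mulC -!mulmxA.
Qed.

Lemma idem_norm_le F X : F^t* = F -> F *m F = F -> X^t* = X ->
  complex.Re (\tr (F *m X *m (F *m X)^t*)) <= complex.Re (\tr (X *m X)).
Proof.
move=> hF FF hX.
have hF1 : (1%:M - F)^t* = 1%:M - F by rewrite adjB adj1 hF.
have FF1 : (1%:M - F) *m (1%:M - F) = 1%:M - F.
  by rewrite mulmxBl mul1mx mulmxBr mulmx1 FF subrr subr0.
have d : X *m X = F *m X *m X + (1%:M - F) *m X *m X.
  by rewrite -!mulmxDl addrC subrK mul1mx.
rewrite [in leRHS]d mxtraceD ReD (idem_norm hF FF hX) (idem_norm hF1 FF1 hX) lerDl.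
exact: Re_tr_adj_ge0.
Qed.

Context (O : cmat R m) (OO : O *m O^t* = 1%:M) (OT : O^T = - O).
Local Notation th := (quat_conj O).

Lemma tr_sandwich X P B : \tr (X *m (P *m B *m P)) = \tr (P *m X *m P *m B).
Proof. by rewrite !mulmxA [LHS]mxtrace_mulC !mulmxA. Qed.

Lemma tr_mixed_ge0 P Q Y : P^t* = P -> P *m P = P -> Q^t* = Q -> Q *m Q = Q -> Y^t* = Y ->
  0 <= complex.Re (\tr (P *m Y *m Q *m Y)).
Proof.
move=> hP PP hQ QQ hY.
have e : P *m Y *m Q *m (P *m Y *m Q)^t* = P *m Y *m (Q *m Q) *m Y *m P.
  by rewrite !adjM hY hP hQ !mulmxA.
have <- : \tr (P *m Y *m Q *m (P *m Y *m Q)^t*) = \tr (P *m Y *m Q *m Y).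
  by rewrite e QQ [LHS]mxtrace_mulC !mulmxA PP.
exact: Re_tr_adj_ge0.
Qed.

(** The off-diagonal blocks that are dropped contribute nonnegative terms. *)
Lemma tr_pinching P Q Y : P^t* = P -> P *m P = P -> Q^t* = Q -> Q *m Q = Q -> P + Q = 1%:M -> Y^t* = Y ->
  complex.Re (\tr (P *m Y *m P *m Y)) + complex.Re (\tr (Q *m Y *m Q *m Y)) <= complex.Re (\tr (Y *m Y)).
Proof.
move=> hP PP hQ QQ PQ1 hY.
have e : Y *m Y = P *m Y *m P *m Y + Q *m Y *m Q *m Y + P *m Y *m Q *m Y + Q *m Y *m P *m Y.
  have d : Y *m Y = P *m Y *m Y + Q *m Y *m Y by rewrite -!mulmxDl PQ1 mul1mx.
  have d' (A : cmat R m) : A *m Y = A *m P *m Y + A *m Q *m Y by rewrite -!mulmxDl -mulmxDr PQ1 mulmx1.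
  apply: etrans d (etrans (congr2 +%R (d' (P *m Y)) (d' (Q *m Y))) _).
  move: (P *m Y *m P *m Y) (P *m Y *m Q *m Y) (Q *m Y *m P *m Y) (Q *m Y *m Q *m Y) => a b c f.
  by rewrite (addrC c f) addrACA addrA.
rewrite e !mxtraceD !ReD -addrA lerDl addr_ge0//; exact: tr_mixed_ge0.
Qed.

(** The two weighted terms are nonnegative and at most [2x], and they are subtracted from each
    other; [d] adds one more [x]. *)
Lemma convex_gap (t u a b d x : R) : 0 <= t -> 0 <= u -> t + u = 1 -> 0 <= a -> a <= 4 * x -> 0 <= b -> b <= 4 * x ->
  `|d| <= x -> `|2 * t * (a / 4) - 2 * u * (b / 4) - d| <= 3 * x.
Proof.
move=> t0 u0 tu a0 a4 b0 b4; rewrite !ler_norml => /andP[d1 d2].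
have x0 : 0 <= x by lra.
have h1 : 0 <= t * (4 * x - a) by rewrite mulr_ge0// subr_ge0.
have h2 := mulr_ge0 t0 a0.
have h3 : 0 <= u * (4 * x - b) by rewrite mulr_ge0// subr_ge0.
have h4 := mulr_ge0 u0 b0.
have h5 := mulr_ge0 t0 x0; have h6 := mulr_ge0 u0 x0.
have h7 : t * x + u * x = x by rewrite -mulrDl tu mul1r.
by apply/andP; split; lra.
Qed.

Lemma quadratic_gap (x l T K D : R) : 0 < D -> x = l + T / 4 -> T <= K * (4 * x) ^+ 2 -> l * D <= 9 * x ^+ 2 ->
  x <= x * (x * (9 / D + 4 * K)).
Proof.
move=> D0 e hT hl; have l2 : l <= 9 * x ^+ 2 / D by rewrite ler_pdivlMr.
have -> : x * (x * (9 / D + 4 * K)) = 9 * x ^+ 2 / D + K * (4 * x) ^+ 2 / 4 by field; rewrite gt_eqF.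
by rewrite [leLHS]e lerD// ler_pM2r// invr_gt0.
Qed.

(** Let [X = P' - P], [x = |X|^2], [lam = <N, X>]. Idempotence makes the diagonal blocks of [X]
    quadratic in [X], so [x = lam^2 + O(x^2)]. Equality of levels reads
    [2 <X, th P> + <X, th X> = 0], where [th P] has normal component [c s], so [lam = O(x)]. Hence
    [x = O(x^2)], which for small [x] leaves only [x = 0]. *)
Lemma level_gap P P' N (c s : R) : G2 R m P -> G2 R m P' -> G2_tangent P N -> gmet N N = 1 -> P *m N *m N = P ->
  G2_proj P (P' - P) = (gmet N (P' - P))%:C *: N ->
  th P = (c%:C ^+ 2 - s%:C ^+ 2) *: P + (c%:C * s%:C) *: N + s%:C ^+ 2 *: (N *m N) ->
  \tr (P' *m th P') = \tr (P *m th P) -> c ^+ 2 + s ^+ 2 = 1 -> c != 0 -> s != 0 ->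
  gmet (P' - P) (P' - P) * (9 / (4 * (c * s) ^+ 2) + 8 * m.+2%:R ^+ 2) < 1 -> P' = P.
Proof.
move=> gP gP' gN N1 PNN hpr thP lev cs c0 s0.
have [hP PP _] := gP; have [hP' PP' _] := gP'; have [hN eN] := gN.
set X := P' - P; have hX : X^t* = X by rewrite adjB hP hP'.
have eX : X *m X = X - P *m X - X *m P.
  have ok : nc_ok [:: P; P'] [:: (0, 0, NRlet 0); (1, 1, NRlet 1)]%N.
    by split; [exact: PP | split; [exact: PP' | exact: I]].
  by rewrite /X; nc ok; ring.
have hprX : G2_proj P X = (gmet N X)%:C *: N := hpr.
have e3 : P' = P + X by rewrite addrC subrK.
clearbody X.
pose Qm : cmat R m := 1%:M - P.
have hQ : Qm^t* = Qm by rewrite adjB adj1 hP.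
have ok1 : nc_ok [:: P; X] [:: (0, 0, NRlet 0)]%N by split; [exact: PP | exact: I].
have PXP : P *m X *m P = - (P *m (X *m X) *m P) by rewrite eX; nc ok1; ring.
have QXQ : Qm *m X *m Qm = Qm *m (X *m X) *m Qm by rewrite eX /Qm; nc ok1; ring.
have dX : X = G2_proj P X + P *m X *m P + Qm *m X *m Qm by rewrite /G2_proj /Qm; nc ok1; ring.
set lam := gmet N X; set x := gmet X X.
have x0 : 0 <= x by exact: gmet_ge0.
pose nrm (A : cmat R m) := complex.Re (\tr (A *m A^t*)).
have nrm0 A : 0 <= nrm A := Re_tr_adj_ge0 A.
have eyx : complex.Re (\tr (X *m X)) = 4 * x by rewrite /x /gmet; field.
have xE : gmet X X = x by [].
have lE : gmet N X = lam by [].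
clearbody x lam.
have QQ : Qm *m Qm = Qm by rewrite /Qm; nc ok1; ring.
have PXXP : complex.Re (\tr (P *m X *m X)) = nrm (P *m X) := idem_norm hP PP hX.
have b1 : nrm (P *m X) <= 4 * x by rewrite -eyx; exact: idem_norm_le.
have gXP : gmet X P = - (nrm (P *m X) / 4).
  have : complex.Re (\tr (X *m P)) = - nrm (P *m X).
    have e : \tr (X *m P) = \tr (P *m X *m P) by rewrite -{1}PP mulmxA [LHS]mxtrace_mulC mulmxA.
    by rewrite e PXP linearN/= -PXXP raddfN/= mxtrace_mulC !mulmxA PP.
  by rewrite /gmet => ->; rewrite mulNr.
pose F := N *m P *m N.
have PNP := G2_tangent_PXP gP gN.
have FF : F *m F = F.
  have e : F *m F = N *m P *m (N *m N) *m P *m N by rewrite /F !mulmxA.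
  by rewrite e -(mulmxA N P (N *m N)) (mulmxA P N N) PNN -(mulmxA N P P) PP.
have hF : F^t* = F by rewrite /F !adjM hN hP !mulmxA.
have QF : Qm *m F = F by rewrite /Qm /F mulmxBl mul1mx !mulmxA PNP mul0mx subr0.
have FQ : F *m Qm = F by rewrite /Qm /F mulmxBr mulmx1 -!mulmxA (mulmxA P N) PNP !mulmx0 subr0.
have NN : N *m N = P + F.
  have NP : N *m P = N - P *m N by rewrite -{2}eN addrC addKr.
  by rewrite /F NP mulmxBl PNN addrC subrK.
have trF : complex.Re (\tr (F *m X *m X)) = nrm (F *m X) := idem_norm hF FF hX.
have b2 : nrm (F *m X) <= 4 * x by rewrite -eyx; exact: idem_norm_le.
have FN : gmet X (N *m N) = gmet X P + gmet X F by rewrite NN gmetDr.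
clearbody F.
have gXF : gmet X F = nrm (F *m X) / 4.
  rewrite /gmet -trF; congr (complex.Re _ / _).
  have -> : \tr (X *m F) = \tr (Qm *m X *m Qm *m F).
    by rewrite -!mulmxA QF [RHS]mxtrace_mulC -!mulmxA FQ.
  by rewrite QXQ -!mulmxA QF mxtrace_mulC -!mulmxA FQ mulmxA mxtrace_mulC.
have w1 : `|gmet X (th X)| <= x.
  have hth : (th X)^t* = th X by rewrite -th_adj hX.
  have e1 := gmet_th OO X X.
  have p1 : 0 <= gmet (X + th X) (X + th X) by apply: gmet_ge0; rewrite adjD hX hth.
  have p2 : 0 <= gmet (X - th X) (X - th X) by apply: gmet_ge0; rewrite adjB hX hth.
  rewrite gmetDl !gmetDr e1 (gmetC (th X) X) xE in p1.
  rewrite gmetBl !gmetBr e1 (gmetC (th X) X) xE in p2.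
  have abs_le (a b : R) : 0 <= b + a + (a + b) -> 0 <= b - a - (a - b) -> `|a| <= b.
    by clear; move=> p1 p2; rewrite ler_norml; apply/andP; split; lra.
  exact: abs_le p1 p2.
have lev0 : 2 * gmet X (th P) + gmet X (th X) = 0.
  have e : gmet P' (th P') = gmet P (th P) by rewrite /gmet lev.
  have e2 : gmet P (th X) = gmet X (th P).
    by rewrite -(gmet_th OO) (thK OO OT) gmetC.
  move: e; rewrite e3 thD gmetDl !gmetDr e2.
  move: (gmet P (th P)) (gmet X (th P)) (gmet X (th X)) => a b d; clear.
  by move=> h; lra.
have lamE : 2 * (c * s) * lam = 2 * c ^+ 2 * (nrm (P *m X) / 4) - 2 * s ^+ 2 * (nrm (F *m X) / 4) - gmet X (th X).
  have e : gmet X (th P) = (c ^+ 2 - s ^+ 2) * gmet X P + (c * s) * gmet X N + s ^+ 2 * (gmet X P + gmet X F).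
    by rewrite thP -!rmorphXn -rmorphM -rmorphB !gmetDr !gmetZr FN; ring.
  move: lev0; rewrite e gXP gXF (gmetC X N) lE.
  have aux (t u v l a b d : R) : 2 * ((t - u) * - (a / 4) + v * l + u * (- (a / 4) + b / 4)) + d = 0 ->
      2 * v * l = 2 * t * (a / 4) - 2 * u * (b / 4) - d.
    by clear; move=> h; apply/eqP; rewrite -subr_eq0; apply/eqP; rewrite -[RHS]h; field.
  exact: aux.
have lam2 : lam ^+ 2 * (4 * (c * s) ^+ 2) <= 9 * x ^+ 2.
  have le3 : `|2 * (c * s) * lam| <= 3 * x.
    by rewrite lamE; exact: convex_gap (sqr_ge0 c) (sqr_ge0 s) cs (nrm0 _) b1 (nrm0 _) b2 w1.
  have : `|2 * (c * s) * lam| ^+ 2 <= (3 * x) ^+ 2.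
    apply: lerXn2r; [rewrite nnegrE; exact: normr_ge0 | rewrite nnegrE | exact: le3].
    exact: mulr_ge0 (ler0n _ 3) x0.
  have -> : lam ^+ 2 * (4 * (c * s) ^+ 2) = (2 * (c * s) * lam) ^+ 2 by rewrite !exprMn; ring.
  have -> : 9 * x ^+ 2 = (3 * x) ^+ 2 by rewrite exprMn; ring.
  by rewrite real_normK ?num_real.
have quarter (z : R) : z = 4 * (z / 4) by rewrite mulrC divfK ?pnatr_eq0.
have quad : x = lam ^+ 2 + (complex.Re (\tr (P *m (X *m X) *m P *m (X *m X))) +
     complex.Re (\tr (Qm *m (X *m X) *m Qm *m (X *m X)))) / 4.
  have -> : x = gmet X (G2_proj P X) + gmet X (P *m X *m P) + gmet X (Qm *m X *m Qm).
    by rewrite -xE {2}dX !gmetDr.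
  rewrite hprX gmetZr (gmetC X N) lE.
  have e1 : complex.Re (\tr (P *m (X *m X) *m P *m (X *m X))) = 4 * gmet X (P *m X *m P).
    have e : \tr (X *m (P *m X *m P)) = \tr (P *m (X *m X) *m P *m (X *m X)).
      rewrite PXP mulmxN linearN/=.
      have -> : \tr (X *m (P *m (X *m X) *m P)) = \tr (P *m X *m P *m (X *m X)).
        exact: tr_sandwich.
      by rewrite PXP mulNmx linearN/= opprK.
    by rewrite /gmet e; exact: quarter.
  have e2 : complex.Re (\tr (Qm *m (X *m X) *m Qm *m (X *m X))) = 4 * gmet X (Qm *m X *m Qm).
    have e : \tr (X *m (Qm *m X *m Qm)) = \tr (Qm *m (X *m X) *m Qm *m (X *m X)).
      rewrite QXQ.
      have -> : \tr (X *m (Qm *m (X *m X) *m Qm)) = \tr (Qm *m X *m Qm *m (X *m X)).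
        exact: tr_sandwich.
      by rewrite QXQ.
    by rewrite /gmet e; exact: quarter.
  have aux (l a b : R) : l * l + a + b = l ^+ 2 + (4 * a + 4 * b) / 4.
    by rewrite -mulrDr [4 * _]mulrC mulfK ?pnatr_eq0// expr2 addrA.
  by rewrite e1 e2; exact: aux.
have sq4 : complex.Re (\tr (P *m (X *m X) *m P *m (X *m X))) +
     complex.Re (\tr (Qm *m (X *m X) *m Qm *m (X *m X))) <= complex.Re (\tr (X *m X *m (X *m X))).
  have PQ1 : P + Qm = 1%:M by rewrite addrC subrK.
  have hXX : (X *m X)^t* = X *m X by rewrite adjM hX.
  exact: tr_pinching hP PP hQ QQ PQ1 hXX.
move=> small; have hb := herm_sq_bound hX; rewrite eyx in hb.
have main : x <= x * (x * (9 / (4 * (c * s) ^+ 2) + 8 * m.+2%:R ^+ 2)).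
  have cs0 : 0 < 4 * (c * s) ^+ 2 by rewrite mulr_gt0// lt_neqAle sqr_ge0 eq_sym sqrf_eq0 mulf_neq0.
  have -> : 8 * m.+2%:R ^+ 2 = 4 * (2 * m.+2%:R ^+ 2) :> R by ring.
  exact: quadratic_gap cs0 quad (le_trans sq4 hb) lam2.
have x00 : x = 0.
  apply/eqP; rewrite eq_le x0 andbT; apply: contraLR small; rewrite -ltNge -leNgt => xp.
  by rewrite -(ler_pM2l xp) mulr1.
have : X = 0.
  move: x00; rewrite -xE /gmet => /eqP; rewrite mulf_eq0 invr_eq0 pnatr_eq0 orbF -{2}hX => /eqP h.
  exact: Re_tr_adj_eq0.
by rewrite e3 => ->; rewrite addr0.
Qed.

End Level_gap.

(** * Nearest points on the hypersurface *)

Section Nearest_point.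
Context {R : realType} {m : nat}.
Implicit Types (X Y : cmat R m).

Lemma gmet_adj X Y : Y^t* = Y -> gmet (X^t*) Y = gmet X Y.
Proof.
move=> hY; rewrite /gmet; congr (_ / _).
have -> : X^t* *m Y = (Y *m X)^t* by rewrite adjM hY.
have -> (Z : cmat R m) : \tr (Z^t*) = (\tr Z)^*%C by rewrite trace_map_mx mxtrace_tr.
by rewrite mxtrace_mulC; case: (\tr (X *m Y)).
Qed.

Lemma gmet_CS X Y : X^t* = X -> Y^t* = Y -> gmet X Y ^+ 2 <= gmet X X * gmet Y Y.
Proof.
move=> hX hY; have y0 := gmet_ge0 hY; have [/eqP/(gmet_eq0 hY) ->|yn] := boolP (gmet Y Y == 0).
  have z Z : gmet Z (0 : cmat R m) = 0 by rewrite /gmet mulmx0 linear0 mul0r.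
  by rewrite !z expr0n mulr0.
have yp : 0 < gmet Y Y by rewrite lt_neqAle eq_sym yn.
pose a := gmet Y Y; pose b := gmet X Y.
have : 0 <= gmet (a%:C *: X - b%:C *: Y) (a%:C *: X - b%:C *: Y).
  by apply: gmet_ge0; rewrite adjB !adjZ !conjc_real hX hY.
rewrite gmetBl !gmetBr !gmetZl !gmetZr (gmetC Y X) -/a -/b => h.
have e : a * (a * gmet X X) - b * (a * b) - (b * (a * b) - b * (b * a)) = a * (gmet X X * a - b ^+ 2) by ring.
have : 0 <= a * (gmet X X * a - b ^+ 2) by rewrite -e; apply: le_trans h _; rewrite le_eqVlt; apply/orP; left; apply/eqP; ring.
by rewrite pmulr_rge0// subr_ge0.
Qed.

Lemma gmet_parallelogram X Y : X^t* = X -> Y^t* = Y ->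
  gmet (X - Y) (X - Y) <= 2 * (gmet Y Y + gmet X X).
Proof.
move=> hX hY; have pos : 0 <= gmet (X + Y) (X + Y) by apply: gmet_ge0; rewrite adjD hX hY.
rewrite gmetDl !gmetDr (gmetC Y X) in pos; rewrite gmetBl !gmetBr (gmetC Y X).
by move: pos; move: (gmet X X) (gmet X Y) (gmet Y Y) => a b c; lra.
Qed.

Lemma first_order_bound {V : normedModType R} (h : V -> R^o) (L : V -> R) : differentiable h 0 ->
  (forall w, 'D_w h 0 = L w) -> \forall u \near 0, `|h u - h 0 - L u| <= 2^-1 * `|u|.
Proof.
move=> dh hL; have /eqaddoP H := diff_locally dh.
have := H 2^-1 ltac:(by rewrite invr_gt0); apply: filterS => u /=.
by rewrite !fctE /= addr0 opprD addrA -hL deriveE.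
Qed.

Context {M : hypersurface R m} {N : M -> cmat R m}.
Hypotheses (hN : unit_normal N) (m_gt0 : (0 < m)%N).
Local Notation V := 'rV[R]_((4 * m).-1).

Lemma chart_orthogonal q x X : dom q x -> X^t* = X ->
  (forall v, gmet X (derive_mx (imm \o chart q) x v) = 0) -> tproj N (chart q x) X = 0.
Proof.
move=> dx hX h; set p := chart q x; have [_ pN] := hN; have [gNp Np1 nT] := pN p.
have tT := tproj_tangent hN m_gt0 p hX.
have [[hT eT] nTp] := (tangentP hN m_gt0 p _).1 tT.
have [||v Ev] := @hyperplane_surj _ _ (imm p) (N p) _ (fun v => derive_mx (imm \o chart q) x v)
  (imm_G2 p) gNp Np1 m_gt0 erefl (Phi_linear dx) _ _ (tproj N p X) (conj hT eT) nTp.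
- by move=> v; exact: imm_immersion.
- move=> v; split; first exact: Phi_G2_tangent.
  by apply: nT; exact: tangent_chart.
have g0 : gmet (tproj N p X) (tproj N p X) = 0 by rewrite (gmet_tproj hN m_gt0 X tT) Ev.
exact: gmet_eq0 hT g0.
Qed.

(** The dual frame recovers [u] from [imm (chart q u)] to first order; Cauchy-Schwarz then bounds
    [|u|] by the ambient distance. *)
Lemma immersion_expansive q (W : set M) : open W -> W q -> exists rho K : R, [/\ 0 < rho, 0 < K,
  forall u : V, `|u| <= rho -> dom q u /\ W (chart q u) &
  forall u : V, `|u| <= rho -> `|u| ^+ 2 <= K * gmet (imm (chart q u) - imm q) (imm (chart q u) - imm q)].
Proof.
move=> oW Wq; have [d0 c0] := dom_center q.
have [C CD] := @dual_frame _ m _ (fun v => derive_mx (imm \o chart q) 0 v) (Phi_linear d0)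
  (fun v h => imm_immersion d0 h) (fun v => Phi_herm v d0).
(* Passing to the Hermitian part does not change pairings with Hermitian matrices and makes
   Cauchy-Schwarz applicable. *)
pose C' j := (2^-1 : R)%:C *: (C j + (C j)^t*).
have hC' j : (C' j)^t* = C' j by rewrite adjZ conjc_real adjD adjK addrC.
have CD' j (Y : cmat R m) : Y^t* = Y -> gmet (C' j) Y = gmet (C j) Y.
  by move=> hY; rewrite gmetZl gmetDl gmet_adj//; field.
have hP p : (imm p)^t* = imm p by case: (imm_G2 p).
pose h j (u : V) : R^o := gmet (C j) (imm (chart q u)).
have hh : \forall u \near (0 : V), forall j, `|h j u - h j 0 - u 0 j| <= 2^-1 * `|u|.
  apply: (@near_forall_ord _ (nbhs (0 : V)) _ _ (fun j u => `|h j u - h j 0 - u 0 j| <= 2^-1 * `|u|)) => j.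
  apply: (@first_order_bound _ (h j) (fun w => w 0 j)).
    exact: (diff_gmet (diff_mx_cst (C j) 0) (Phi_diff d0)).
  move=> w; rewrite (derive_gmet w (diff_mx_cst (C j) 0) (Phi_diff d0)) derive_mx_cst.
  by rewrite CD /gmet mul0mx linear0 mul0r add0r.
have hd : \forall u \near (0 : V), dom q u /\ W (chart q u).
  by apply: open_nbhs_nbhs; split; [exact: open_dom_chart | split; rewrite ?c0].
have hhd := @filterI _ (nbhs (0 : V)) (nbhs_filter (0 : V)) _ _ hh hd.
have [d /= dp Hd] := (nbhs_ballP (0 : V) _).1 hhd.
exists (d / 2), (4 * (1 + \sum_j gmet (C' j) (C' j))).
have S0 j : 0 <= gmet (C' j) (C' j) by exact: gmet_ge0.
have dom_d (u : V) : `|u| <= d / 2 -> ball 0 d u.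
  by rewrite -ball_normE /ball_/= sub0r normrN => /le_lt_trans -> //; rewrite ltr_pdivrMr// ltr_pMr// ltr1n.
split.
- by rewrite divr_gt0.
- by rewrite mulr_gt0// ltr_wpDr// sumr_ge0.
- by move=> u /dom_d/Hd[_].
move=> u /dom_d/Hd[bu _].
set D := imm (chart q u) - imm q; have hD : D^t* = D by rewrite adjB !hP.
have [->|un0] := eqVneq u 0.
  rewrite normr0 expr0n mulr_ge0 ?gmet_ge0// ?mulr_ge0// addr_ge0// sumr_ge0//.
have [j uj] := rV_norm_attained un0; have := bu j.
have -> : h j u - h j 0 = gmet (C' j) D by rewrite /h c0 -gmetBr CD'.
rewrite uj => b1.
have b2 : 2^-1 * `|u 0 j| <= `|gmet (C' j) D|.
  have := ler_normD (gmet (C' j) D) (u 0 j - gmet (C' j) D); rewrite addrC subrK distrC.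
  by move: b1; move: (`|_ - _|) (`|u 0 j|) (`|gmet _ _|) => a b c; lra.
have b3 : (2^-1 * `|u 0 j|) ^+ 2 <= gmet (C' j) D ^+ 2.
  by rewrite -[leRHS]real_normK ?num_real// ler_pXn2r// ?nnegrE// mulr_ge0.
have b4 := gmet_CS (hC' j) hD.
have b5 : gmet (C' j) (C' j) <= 1 + \sum_j gmet (C' j) (C' j).
  rewrite (bigD1 j (P := xpredT) (F := fun j => gmet (C' j) (C' j)))//= addrCA lerDl addr_ge0// sumr_ge0//.
have b6 := ler_wpM2r (gmet_ge0 hD) b5.
have -> : `|u 0 j| ^+ 2 = 4 * (2^-1 * `|u 0 j|) ^+ 2 by move: (`|_|) => y; field.
by rewrite -mulrA ler_pM2l//; exact: le_trans b3 (le_trans b4 b6).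
Qed.

(** The distance to [B] is minimized over a closed ball of the chart. For [B] close to [imm q] the
    minimum is interior, and there the difference is orthogonal to M. *)
Lemma near_point_foot q (W : set M) : open W -> W q -> exists2 e : R, 0 < e &
  forall B : cmat R m, B^t* = B -> gmet (B - imm q) (B - imm q) < e ->
  exists q', [/\ W q', tproj N q' (B - imm q') = 0 &
    gmet (B - imm q') (B - imm q') <= gmet (B - imm q) (B - imm q)].
Proof.
move=> oW Wq; have [rho [K [r0 K0 Hd HK]]] := immersion_expansive oW Wq.
have [d0 c0] := dom_center q; have hP p : (imm p)^t* = imm p by case: (imm_G2 p).
(* A minimum on the boundary would give [rho^2 <= K * 4 |B - imm q|^2], by expansiveness and the
   parallelogram law. *)
exists (rho ^+ 2 / (4 * K)); first by rewrite divr_gt0 ?exprn_gt0// mulr_gt0.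
move=> B hB Be.
pose g (u : V) : R^o := gmet (B - imm (chart q u)) (B - imm (chart q u)).
have dF u : `|u| <= rho -> diff_mx (fun u => B - imm (chart q u)) u.
  by move=> /Hd[du _]; apply: diff_mxB; [exact: diff_mx_cst | exact: Phi_diff].
have dg u : `|u| <= rho -> differentiable g u by move=> /dF du; exact: diff_gmet.
pose A := closed_ball (0 : V) rho.
have AE u : A u <-> `|u| <= rho by rewrite /A closed_ballE// /closed_ball_/= sub0r normrN.
have cA : compact A.
  apply: bounded_closed_compact; last exact: closed_ball_closed.
  exists rho; split; first exact: num_real.
  by move=> x rx u /AE hu /=; apply: (le_trans hu); exact: ltW.
have A0 : A !=set0 by exists 0; apply/AE; rewrite normr0 ltW.
have [x xA xmin] : exists2 c, c \in A & forall t, t \in A -> g c <= g t.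
  apply: EVT_min_rV => //; apply: continuous_in_subspaceT => u /set_mem/AE/dg.
  exact: differentiable_continuous.
have {}xmin u : `|u| <= rho -> g x <= g u by move=> /AE/mem_set/xmin.
have xr : `|x| <= rho by apply/AE/set_mem.
have g0 : g 0 = gmet (B - imm q) (B - imm q) by rewrite /g c0.
have gx0 : g x <= g 0 by apply: xmin; rewrite normr0 ltW.
have xlt : `|x| < rho.
  rewrite lt_neqAle xr andbT; apply/negP => /eqP xE.
  have := HK x xr; rewrite xE => h.
  have par : gmet (imm (chart q x) - imm q) (imm (chart q x) - imm q) <= 2 * (g x + g 0).
    have -> : imm (chart q x) - imm q = (B - imm q) - (B - imm (chart q x)).
      by rewrite opprB [RHS]addrC addrA subrK.
    by rewrite g0; apply: gmet_parallelogram; rewrite adjB hB hP.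
  have h2 : rho ^+ 2 <= K * (4 * g 0).
    apply: (le_trans h); rewrite ler_pM2l//; apply: (le_trans par).
    by rewrite (_ : 4 * g 0 = 2 * (g 0 + g 0)) ?ler_pM2l ?lerD2r//; ring.
  move: Be; rewrite -g0 ltr_pdivlMr ?mulr_gt0// ltNge => /negP; apply.
  by apply: (le_trans h2); rewrite le_eqVlt; apply/orP; left; apply/eqP; ring.
have [dx Wx] := Hd x xr.
exists (chart q x); split; [exact: Wx | | by rewrite -g0].
apply: (chart_orthogonal dx); first by rewrite adjB hB hP.
move=> v; pose a := (rho - `|x|) / (1 + `|v|).
have v0 : 0 < 1 + `|v| by rewrite ltr_wpDr.
have a0 : 0 < a by rewrite divr_gt0// subr_gt0.
have seg t : t \in `]-a, a[%R -> `|x + t *: v| <= rho.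
  rewrite in_itv/= -ltr_norml => ta; apply: (le_trans (ler_normD _ _)); rewrite normrZ -lerBrDl.
  have := ltW ta; rewrite ler_pdivlMr// => /(le_trans _); apply.
  by rewrite ler_wpM2l// lerDr.
have itv0 : (0 : R) \in `]-a, a[%R by rewrite in_itv/= oppr_lt0 a0.
have d1 t : t \in `]-a, a[%R -> is_derive t (1 : R) (fun s : R => g (x + s *: v)) ('D_v g (x + t *: v)).
  by move=> /seg/dg; exact: is_derive_segment.
have d2 : is_derive (0 : R) (1 : R) (fun s : R => g (x + s *: v) : R) 0.
  have leab : - a <= a by apply: (@le_trans _ _ 0); rewrite ?oppr_le0 ltW.
  apply: (derive1_at_min leab _ itv0).
    by move=> t /d1[].
  by move=> t /seg; rewrite scale0r addr0; exact: xmin.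
have e0 : 'D_v g x = 0.
  have [_ e1] := d1 0 itv0; have [_ e2] := d2.
  by move: e1; rewrite scale0r addr0 => <-; exact: e2.
have dPhi := Phi_diff dx.
have := derive_gmet v (dF x xr) (dF x xr); rewrite e0.
have -> : derive_mx (fun u => B - imm (chart q u)) x v = - derive_mx (imm \o chart q) x v.
  by rewrite (derive_mxB v (diff_mx_cst B x) dPhi) derive_mx_cst sub0r.
by move=> /esym/eqP; rewrite gmetNl (gmetC _ (- _)) gmetNl -opprD oppr_eq0 -mulr2n mulrn_eq0 /= gmetC => /eqP.
Qed.

End Nearest_point.

(** * Transport by unitary matrices and the local congruence *)

Section Transport.
Context {R : realType} {m : nat}.
Implicit Types A B O P Y : cmat R m.

Lemma map_conjcE P : map_mx conjc P = (P^t*)^T.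
Proof. by apply/matrixP => i j; rewrite !mxE. Qed.

Lemma map_conjcM A B : map_mx conjc (A *m B) = map_mx conjc A *m map_mx conjc B.
Proof. by rewrite (map_conjcE (A *m B)) (conjM A B) -(map_conjcE A) -(map_conjcE B). Qed.

Lemma map_conjc_adj P : map_mx conjc (P^t*) = P^T.
Proof. by rewrite map_conjcE conj_adj. Qed.

Lemma adj_trmx P : (P^T)^t* = map_mx conjc P.
Proof. by apply/matrixP => i j; rewrite !mxE. Qed.

Lemma adj_map_conjc P : (map_mx conjc P)^t* = P^T.
Proof. by rewrite map_conjcE -[LHS]conj_T trmxK conj_adj. Qed.

Context Y (YY : Y *m Y^t* = 1%:M).

Let YY' : Y^t* *m Y = 1%:M. Proof. exact: mulmx1C. Qed.

Lemma quat_conj_unitary O P :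
  quat_conj O (Y^t* *m P *m Y) = Y^t* *m quat_conj (Y *m O *m Y^T) P *m Y.
Proof.
have e1 : map_mx conjc (Y^t* *m P *m Y) = Y^T *m map_mx conjc P *m map_mx conjc Y.
  by rewrite (map_conjcM (_ *m P)) (map_conjcM (Y^t*)) map_conjc_adj.
have e2 : (Y *m O *m Y^T)^t* = map_mx conjc Y *m O^t* *m Y^t*.
  by rewrite !adjM mulmxA adj_trmx.
rewrite /quat_conj e1 e2; move: (Y^T) (map_mx conjc P) (map_mx conjc Y) (O^t*) (Y^t*) YY'.
by move=> Yt Pc Yc Oa Ya Y1; rewrite !mulmxA Y1 mul1mx -!mulmxA Y1 mulmx1.
Qed.

Lemma tr_unitary A B : \tr (Y^t* *m A *m Y *m (Y^t* *m B *m Y)) = \tr (A *m B).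
Proof.
have -> : Y^t* *m A *m Y *m (Y^t* *m B *m Y) = Y^t* *m (A *m (Y *m Y^t*) *m B) *m Y.
  by rewrite !mulmxA.
by rewrite YY mulmx1 -mulmxA mxtrace_mulC -mulmxA YY mulmx1.
Qed.

Lemma tr_quat_conj_unitary O P :
  \tr (Y^t* *m P *m Y *m quat_conj O (Y^t* *m P *m Y)) = \tr (P *m quat_conj (Y *m O *m Y^T) P).
Proof. by rewrite quat_conj_unitary tr_unitary. Qed.

Lemma gmet_unitary A B : gmet (Y^t* *m A *m Y) (Y^t* *m B *m Y) = gmet A B.
Proof. by rewrite /gmet tr_unitary. Qed.

End Transport.

Section Local_congruence.
Context {R : realType} {m : nat} {M : hypersurface R m} {N : M -> cmat R m}.
Hypotheses (hN : unit_normal N) (m_gt0 : (0 < m)%N).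
Hypothesis hQ : forall p : M, distQ N p (reeb N p).
Context (O : cmat R m) (OO : O *m O^t* = 1%:M) (OT : O^T = - O) (W : set M) (c s : R).
Hypotheses (oW : open W) (cs1 : c ^+ 2 + s ^+ 2 = 1) (c0 : c != 0) (s0 : s != 0).
Hypothesis focalW : forall q, W q -> quat_conj O (imm q) = focal N c s q.

Lemma level_open q : W q -> exists2 e : R, 0 < e & forall B, G2 R m B ->
  \tr (B *m quat_conj O B) = 2 * c%:C ^+ 2 -> gmet (B - imm q) (B - imm q) < e ->
  exists2 q', W q' & B = imm q'.
Proof.
move=> Wq; have [e e0 He] := near_point_foot hN m_gt0 oW Wq.
pose K : R := 9 / (4 * (c * s) ^+ 2) + 8 * m.+2%:R ^+ 2.
have K0 : 0 < K by rewrite ltr_wpDl ?mulr_gt0 ?exprn_gt0// divr_ge0// mulr_ge0// sqr_ge0.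
(* The bound [e] provides a foot point inside [W]; the bound [K^-1] makes [level_gap] identify [B]
   with it. *)
exists (Num.min e K^-1); first by rewrite lt_min e0 invr_gt0.
move=> B gB lev; rewrite lt_min => /andP[Be BK]; have hB : B^t* = B by case: gB.
have [q' [Wq' foot le_q']] := He B hB Be; exists q' => //.
have [_ /(_ q')[gN N1 _]] := hN.
apply: (level_gap OO OT (imm_G2 q') gB gN N1 (normal_sq hN hQ q') _ (focalW Wq') _ cs1 c0 s0).
- by apply/eqP; rewrite -subr_eq0 -tprojE foot.
- by rewrite lev (focalW Wq') (focal_trace hN hQ).
rewrite -ltr_pdivlMr// mul1r; exact: le_lt_trans le_q' BK.
Qed.

End Local_congruence.

Theorem corollary1 (R : realType) (m : nat) (k : R) (M : hypersurface R m)
    (N : M -> cmat R m)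
    (nabla : (M -> cmat R m) -> (M -> cmat R m) -> M -> cmat R m)
    (S : M -> cmat R m -> cmat R m)
    (hm : (3 <= m)%N) (hk : k != 0)
    (hN : unit_normal N)
    (hnabla : levi_civita nabla)
    (hS : ricci_tensor nabla S)
    (hHopf : hopf N)
    (halpha : forall p : M, alpha N p = 2 * k)
    (hpar : gtw_reeb_parallel nabla N k S)
    (hQ : forall p : M, distQ N p (reeb N p)) :
  exists2 n : nat, m = (2 * n)%N &
    locally_congruent_to_open_part M
      (tube (atan (Num.sqrt (2 * n%:R - 1)) / 2) (HPn R m)).
Proof.
have m_gt0 : (0 < m)%N by exact: leq_trans hm.
have Areeb q : shape_op N q (reeb N q) = (2 * k)%:C *: reeb N q by rewrite hHopf halpha.
have a0 : 2 * k != 0 by rewrite mulf_neq0// pnatr_eq0.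
have [p0 _] := hs_nonempty M.
have k2 : k ^+ 2 = m%:R - 1 := hopf_constant hN m_gt0 hnabla hQ a0 Areeb hS erefl hpar hk p0.
pose t : R := Num.sqrt (m%:R - 1).
have t2 : t ^+ 2 = m%:R - 1 by rewrite sqr_sqrtr// -k2 sqr_ge0.
(* Since [k] is [t] up to sign, [s] is [sin 2r] up to the sign left open by the choice of the
   normal. *)
pose c := cos (atan t); pose s := - k * c.
have mp : 0 < m%:R :> R by rewrite ltr0n.
have cE : c = (Num.sqrt m%:R)^-1 by rewrite /c cos_atan t2 addrCA subrr addr0.
have c0 : c != 0 by rewrite cE invr_neq0// gt_eqF// sqrtr_gt0.
have s0 : s != 0 by rewrite mulf_neq0// oppr_eq0.
have c2 : c ^+ 2 * m%:R = 1 by rewrite cE exprVn sqr_sqrtr ?ltW// mulVf// gt_eqF.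
have cs1 : c ^+ 2 + s ^+ 2 = 1.
  have -> : c ^+ 2 + s ^+ 2 = c ^+ 2 * (1 + k ^+ 2) by rewrite /s; ring.
  by rewrite k2 addrCA subrr addr0.
have sin0 : sin (atan t) != 0.
  have tE : tan (atan t) = t by exact: atanK.
  have t0 : t != 0 by rewrite -sqrf_eq0 t2 -k2 sqrf_eq0.
  by apply: contra_neq t0 => sin0; rewrite -tE /tan sin0 mul0r.
have foc := local_focal hN m_gt0 hnabla hQ hk Areeb cs1 erefl.
have even_m : ~~ odd m.
  have [X [W [_ _ XX XT _]]] := foc p0.
  by have := skew_unitary_even XX XT; rewrite /= negbK.
have mE : m = (2 * m./2)%N by rewrite mul2n even_halfK.
exists m./2 => //; have -> : 2 * (m./2)%:R = m%:R :> R by rewrite -natrM -mE.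
rewrite -/t; set r := atan t / 2.
have r2 : 2 * r = atan t by rewrite /r mulrC divfK ?pnatr_eq0.
move=> p; have [X [W [oW Wp XX XT Xfoc]]] := foc p.
have [Y [YY XE]] := quat_Omega_normal_form XX XT.
have YY' : Y^t* *m Y = 1%:M by exact: mulmx1C.
pose Om := quat_Omega R m.
have YT : Y^T *m map_mx conjc Y = 1%:M.
  by rewrite -(map_conjc_adj Y) -(map_conjcM (Y^t*) Y) YY' map_conjcE adj1 trmx1.
have YT' := mulmx1C YT.
have OmE : Om = Y^t* *m X *m map_mx conjc Y.
  by rewrite XE !mulmxA YY' mul1mx -mulmxA YT mulmx1.
have OO : Om *m Om^t* = 1%:M.
  have e : Om^t* = Y^T *m X^t* *m Y.
    by rewrite OmE !adjM adjK mulmxA adj_map_conjc.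
  rewrite e {1}OmE !mulmxA -(mulmxA _ (map_mx conjc Y)) YT' mulmx1 -(mulmxA _ X) XX mulmx1.
  exact: YY'.
have OT : Om^T = - Om.
  have YadjT : (Y^t*)^T = map_mx conjc Y by rewrite map_conjcE.
  have YcT : (map_mx conjc Y)^T = Y^t* by rewrite map_conjcE trmxK.
  by rewrite OmE !trmx_mul YadjT YcT XT mulNmx mulmxN mulmxA.
have focW q : W q -> quat_conj X (imm q) = focal N c s q.
  move=> Wq; rewrite (Xfoc q Wq) /quat_conj; congr (_ *m _ *m _).
  exact: map_conjcE.
(* As [X = Y Om Y^T], this congruence carries the structure of [X] to the one defining [HPn]. *)
pose F (P : cmat R m) := Y^t* *m P *m Y.
have isoF : G2_isometry F := unitary_G2_isometry YY.
have levF P : \tr (F P *m quat_conj Om (F P)) = \tr (P *m quat_conj X P).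
  by rewrite [in RHS]XE; exact: tr_quat_conj_unitary.
have tubeE : tube r (HPn R m) = tube r (quat_fixed Om).
  by congr (tube r _); apply/seteqP; split=> P [gP eP]; split=> //; apply/(th_fixedP OO).
have gF P : G2 R m P -> G2 R m (F P) by have [[h _ _] _] := isoF; exact: h.
have YY'' : Y^t* *m (Y^t*)^t* = 1%:M by rewrite adjK.
have gF' P : G2 R m P -> G2 R m (Y *m P *m Y^t*).
  have [[h _ _] _] := unitary_G2_isometry YY''; move=> gP.
  by have := h P gP; rewrite /= adjK.
have FK P : F (Y *m P *m Y^t*) = P by rewrite /F !mulmxA YY' mul1mx -mulmxA YY' mulmx1.
exists W, F; split=> //; rewrite tubeE; split.
  move=> _ [q Wq <-] /=; apply: (level_tube OO OT (gF _ (imm_G2 q))); rewrite ?r2//.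
  by rewrite levF focW// (focal_trace hN hQ).
move=> _ [q Wq <-] /=.
(* Openness is proved before the congruence, for the level set of [X], and pulled back by the
   isometry. *)
have [e e0 He] := level_open hN m_gt0 hQ XX XT oW cs1 c0 s0 focW Wq; exists e => // Q' tQ' lt_e.
have [gQ' lev] := tube_level OO OT tQ'; rewrite r2 in lev.
have [q' Wq' BE] : exists2 q', W q' & Y *m Q' *m Y^t* = imm q'.
  apply: He (gF' _ gQ') _ _; first by rewrite -levF FK lev.
  rewrite -(gmet_unitary YY) !mulmxBr !mulmxBl -/(F _) -/(F (imm q)).
  by rewrite -!/(F _) FK.
by exists q' => //=; rewrite -BE FK.
Qed.
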